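(* Let $\Delta$ be a locally finite building of type $(W,S)$, where $(W,S)$ is a Coxeter system with $S$ finite and $W$ infinite. Let $G$ be a closed, not necessarily discrete, subgroup of $\mathrm{Aut}(\Delta)$ consisting of type-preserving automorphisms and acting co-compactly on $\Delta$. Let $d$ be the dimension of a maximal flat of $\Delta$. Then $G$ contains a compact-by-$\mathbf{Z}^{d}$ subgroup.
   Context: The building $\Delta$ is regarded as a proper $\mathrm{CAT}(0)$ space via its Davis realization, on which $\mathrm{Aut}(\Delta)$ acts by isometries. $\mathrm{Aut}(\Delta)$ carries its usual locally compact topology (pointwise convergence on the set of chambers); ''closed'' refers to this topology. An action on a space $Y$ is co-compact if there is a compact subset of $Y$ whose translates cover $Y$; for $\Delta$ this is equivalent to having finitely many orbits of chambers. A flat of dimension $d$ in a $\mathrm{CAT}(0)$ space $X$ is a closed convex subset of $X$ isometric to Euclidean $d$-space, where $d\ge 2$. It is maximal if it is not properly contained in another flat. A compact-by-$\mathbf{Z}^d$ subgroup of $G$ is a subgroup $H\le G$ having a compact normal subgroup $K$ such that $H/K\cong \mathbf{Z}^d$. *)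

(* Defs.v *)
From HB Require Import structures.
From mathcomp Require Import all_boot all_order all_algebra all_fingroup.
From mathcomp Require Import all_classical all_reals all_analysis.

Set Implicit Arguments.
Unset Strict Implicit.
Unset Printing Implicit Defensive.

Import Order.TTheory GRing.Theory Num.Theory.
Local Open Scope classical_set_scope.
Local Open Scope ring_scope.

(** * Coxeter systems *)

(* [m s t = 0] encodes an infinite entry of the Coxeter matrix: the relator
   [(s t)^0] is then empty, so it imposes no relation. *)
Definition coxeter_matrix (S : finType) (m : S -> S -> nat) : Prop :=
  [/\ forall s, m s s = 1%N,
      forall s t, m s t = m t s &
      forall s t, s != t -> m s t != 1%N].

(* Words in [S] modulo the relators [(s t)^(m s t)].  Since [m s s = 1], every
   generator is its own inverse, so this monoid congruence presents the group
   <S | (s t)^(m s t)>. *)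
Inductive coxeter_cong (S : finType) (m : S -> S -> nat) :
    seq S -> seq S -> Prop :=
| cong_refl u : coxeter_cong m u u
| cong_sym u v : coxeter_cong m u v -> coxeter_cong m v u
| cong_trans u v w :
    coxeter_cong m u v -> coxeter_cong m v w -> coxeter_cong m u w
| cong_relator u v s t :
    coxeter_cong m (u ++ flatten (nseq (m s t) [:: s; t]) ++ v) (u ++ v).

Definition word_val (W : groupType) (S : finType) (gen : S -> W) (u : seq S) :
  W := foldr (fun s w => (gen s * w)%g) 1%g u.

Record coxeterSystem := CoxeterSystem {
  cox_group : groupType;
  cox_gens : finType;
  cox_mx : cox_gens -> cox_gens -> nat;
  cox_gen : cox_gens -> cox_group;
  cox_mxP : coxeter_matrix cox_mx;
  cox_generated : forall w, exists u, word_val cox_gen u = w;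
  cox_presented : forall u v,
    word_val cox_gen u = word_val cox_gen v <-> coxeter_cong cox_mx u v }.

Section CoxeterSystem.
Variable W : coxeterSystem.
Implicit Types (w : cox_group W) (s t : cox_gens W) (J : {set cox_gens W}).

Lemma cox_length_ex w :
  exists n, `[< exists2 u, size u = n & word_val (@cox_gen W) u = w >].
Proof.
have [u uw] := cox_generated w.
by exists (size u); apply/asboolP; exists u.
Qed.

Definition cox_length w : nat := ex_minn (cox_length_ex w).

(* The standard parabolic subgroup W_J. *)
Definition parabolic J : set (cox_group W) :=
  [set w | exists2 u, all (mem J) u & word_val (@cox_gen W) u = w].

Definition spherical J : Prop := finite_set (parabolic J).

Section CoxeterForm.
Variable R : realType.
Implicit Types x y : {ffun cox_gens W -> R}.

(* The canonical bilinear form, in the basis (e_s) of unit simple roots: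
   B(e_s, e_t) = - cos (pi / m s t).  When [m s t = 0] this reads - cos 0 = -1,
   the usual value for m = oo. *)
Definition cox_form x y : R :=
  \sum_s \sum_t - cos (pi / (cox_mx s t)%:R) * x s * y t.

(* For J spherical, the unique x_J in the span of (e_s), s in J, with
   B(e_s, x_J) = 1 for all s in J: the point of the fundamental chamber of W_J
   at distance 1 from each of its walls.  The Coxeter cell of type J is the
   convex hull of the W_J-orbit of x_J. *)
Definition cell_vertex J : {ffun cox_gens W -> R} :=
  xget 0 [set x : {ffun cox_gens W -> R} |
    (forall s, s \notin J -> x s = 0) /\
    (forall s, s \in J -> cox_form [ffun t => (t == s)%:R] x = 1)].

End CoxeterForm.
End CoxeterSystem.

(** * Buildings, as chamber sets with a W-valued distance *)

Record building (W : coxeterSystem) := Building {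
  chamber :> choiceType;
  wdist : chamber -> chamber -> cox_group W;
  chamber_inhabited : inhabited chamber;
  wdist1 : forall c d, wdist c d = 1%g <-> c = d;
  wdist_adj : forall c c' d s, wdist c' c = cox_gen s ->
    wdist c' d = wdist c d \/ wdist c' d = (cox_gen s * wdist c d)%g;
  wdist_adj_length : forall c c' d s, wdist c' c = cox_gen s ->
    cox_length (cox_gen s * wdist c d)%g = (cox_length (wdist c d)).+1 ->
    wdist c' d = (cox_gen s * wdist c d)%g;
  wdist_ex : forall c d s, exists2 c',
    wdist c' c = cox_gen s & wdist c' d = (cox_gen s * wdist c d)%g }.

Definition locally_finite (W : coxeterSystem) (X : building W) : Prop :=
  forall (c : X) (s : cox_gens W), finite_set [set d | wdist c d = cox_gen s].

Section Residues.
Variables (W : coxeterSystem) (X : building W).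

Definition residue (J : {set cox_gens W}) (c : X) : set X :=
  [set d | parabolic J (wdist c d)].

Definition spherical_residue (A : set X) : Prop :=
  exists J c, spherical J /\ A = residue J c.

(* If A is a residue of type J, this is J. *)
Definition residue_type (A : set X) : {set cox_gens W} :=
  [set s | `[< exists c d, [/\ A c, A d & wdist c d = cox_gen s] >]]%SET.

End Residues.

(** * The automorphism group *)

Section Automorphisms.
Variables (W : coxeterSystem) (X : building W).

(* Automorphisms may permute the types, through an automorphism of (W, S). *)
Definition is_automorphism (f : X -> X) : Prop :=
  bijective f /\
  exists (sigma : cox_group W -> cox_group W) (p : {perm cox_gens W}),
    [/\ bijective sigma,
        forall v w, sigma (v * w)%g = (sigma v * sigma w)%g,
        forall s, sigma (cox_gen s) = cox_gen (p s) &
        forall c d, wdist (f c) (f d) = sigma (wdist c d)].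

Record building_aut := BuildingAut {
  aut_fun :> X -> X;
  aut_funP : is_automorphism aut_fun }.

Lemma aut_eq (f g : building_aut) : aut_fun f = aut_fun g -> f = g.
Proof.
by case: f g => [f fP] [g gP] /= fg; subst g; congr BuildingAut.
Qed.

Lemma aut_one_subproof : is_automorphism (@id X).
Proof.
split; first by exists id.
by exists id, 1%g; split=> // [|s]; [exists id | rewrite perm1].
Qed.

Lemma aut_mul_subproof (f g : building_aut) : is_automorphism (f \o g).
Proof.
case: f g => [f [fb [sf [pf [sfb sfM sfg fE]]]]].
case=> [g [gb [sg [pg [sgb sgM sgg gE]]]]] /=.
split; first exact: bij_comp.
exists (sf \o sg), (pg * pf)%g; split=> [||s|c d] /=.
- exact: bij_comp.
- by move=> v w; rewrite sgM sfM.
- by rewrite sgg sfg permM.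
- by rewrite fE gE.
Qed.

Lemma aut_inv_exists (f : building_aut) :
  exists g : building_aut, cancel (aut_fun f) g /\ cancel (aut_fun g) f.
Proof.
case: f => [f [[g fK gK] [sf [pf [[sg sfK sgK] sfM sfg fE]]]]] /=.
have gP : is_automorphism g.
  split; first by exists f.
  exists sg, (pf^-1)%g; split=> [|v w|s|c d].
  - by exists sf.
  - by apply: (can_inj sfK); rewrite sfM !sgK.
  - by apply: (can_inj sfK); rewrite sgK sfg permKV.
  - by apply: (can_inj sfK); rewrite sgK -fE !gK.
by exists (BuildingAut gP).
Qed.

Definition aut_one := BuildingAut aut_one_subproof.
Definition aut_mul f g := BuildingAut (aut_mul_subproof f g).
Definition aut_inv f := projT1 (cid (aut_inv_exists f)).

Lemma aut_invP f :
  cancel (aut_fun f) (aut_inv f) /\ cancel (aut_fun (aut_inv f)) f.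
Proof. by rewrite /aut_inv; case: cid. Qed.

Lemma aut_mulA : associative aut_mul.
Proof. by move=> f g h; apply: aut_eq. Qed.
Lemma aut_mul1g : left_id aut_one aut_mul.
Proof. by move=> f; apply: aut_eq. Qed.
Lemma aut_mulg1 : right_id aut_one aut_mul.
Proof. by move=> f; apply: aut_eq. Qed.
Lemma aut_mulVg : left_inverse aut_one aut_inv aut_mul.
Proof.
move=> f; apply: aut_eq; apply/funext => c /=.
by have [fK _] := aut_invP f; exact: fK.
Qed.
Lemma aut_mulgV : right_inverse aut_one aut_inv aut_mul.
Proof.
move=> f; apply: aut_eq; apply/funext => c /=.
by have [_ fK] := aut_invP f; exact: fK.
Qed.

HB.instance Definition _ := gen_eqMixin building_aut.
HB.instance Definition _ := gen_choiceMixin building_aut.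
HB.instance Definition _ := isGroup.Build building_aut
  aut_mulA aut_mul1g aut_mulg1 aut_mulVg aut_mulgV.

(* Pointwise convergence, the set of chambers being discrete. *)
Definition aut_ptws (f : building_aut) : {ptws X -> discrete_topology X} := f.

HB.instance Definition _ := Topological.copy building_aut
  (initial_topology aut_ptws).

Definition type_preserving (f : building_aut) : Prop :=
  forall c d, wdist (f c) (f d) = wdist c d.

End Automorphisms.

(** * Subgroups of possibly infinite groups *)

Definition is_subgroup (gT : groupType) (G : set gT) : Prop :=
  G 1%g /\ forall x y, G x -> G y -> G (x * y^-1)%g.

(* The last clause spells out the isomorphism H / K -> Z^d as a surjective morphism
   on H whose fibres are the cosets of K. *)
Definition compact_by_Zd (W : coxeterSystem) (X : building W) (d : nat)
    (H : set (building_aut X)) : Prop :=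
  is_subgroup H /\
  exists K : set (building_aut X),
    [/\ is_subgroup K, K `<=` H,
        forall h k, H h -> K k -> K (h * k * h^-1)%g,
        compact K &
        exists phi : building_aut X -> 'rV[int]_d,
          [/\ forall x y, H x -> H y -> phi (x * y)%g = phi x + phi y,
              forall z, exists2 x, H x & phi x = z &
              forall x y, H x -> H y -> (phi x = phi y <-> K (x^-1 * y)%g)]].

(** * The Davis realization *)

Section Davis.
Variables (R : realType) (W : coxeterSystem) (X : building W).

(* The geometric realization of the poset of spherical residues, in barycentric
   coordinates. *)
Definition is_davis_point (p : set X -> R) : Prop :=
  [/\ forall A, 0 <= p A,
      finite_set [set A | p A != 0],
      forall A, p A != 0 -> spherical_residue A,
      forall A B, p A != 0 -> p B != 0 -> A `<=` B \/ B `<=` A &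
      \sum_(A \in [set: set X]) p A = 1].

Record davis := DavisPoint {
  davis_coord :> set X -> R;
  davis_coordP : is_davis_point davis_coord }.

Definition same_simplex (p q : davis) : Prop :=
  forall A B, p A != 0 \/ q A != 0 -> p B != 0 \/ q B != 0 ->
    A `<=` B \/ B `<=` A.

(* In the Coxeter cell of type J, the face of type K through x_J (K included in
   J) has barycenter x_J - x_K.  Up to the isometry v |-> x_J - v, a simplex is
   thus the Euclidean simplex spanned by the x_K, for K ranging over the types
   of its vertices. *)
Definition davis_pos (p : davis) : {ffun cox_gens W -> R} :=
  [ffun s => \sum_(A \in [set: set X]) p A * cell_vertex R (residue_type A) s].

Definition simplex_dist (p q : davis) : R :=
  let v := davis_pos p - davis_pos q in Num.sqrt (cox_form v v).

Definition davis_string (p q : davis) (n : nat) (c : nat -> davis) : Prop :=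
  [/\ c 0%N = p, c n = q &
      forall i, (i < n)%N -> same_simplex (c i) (c i.+1)].

Definition string_length (n : nat) (c : nat -> davis) : R :=
  \sum_(0 <= i < n) simplex_dist (c i) (c i.+1).

(* The length metric of the piecewise Euclidean structure, a priori valued in
   the extended reals. *)
Definition davis_dist (p q : davis) : \bar R :=
  ereal_inf [set l | exists n c,
    davis_string p q n c /\ l = (string_length n c)%:E].

Definition davis_ball (p : davis) (e : R) : set davis :=
  [set q | (davis_dist p q < e%:E)%E].

Lemma simplex_dist_sym p q : simplex_dist p q = simplex_dist q p.
Proof.
rewrite /simplex_dist -opprB; congr Num.sqrt.
apply: eq_bigr => s _; apply: eq_bigr => t _.
by rewrite !ffunE -!mulrA mulrNN.
Qed.

Lemma davis_string0 p : davis_string p p 0 (fun=> p).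
Proof. by []. Qed.

Lemma davis_string_rev p q n c : davis_string p q n c ->
  davis_string q p n (fun i => c (n - i)%N).
Proof.
case=> c0 cn cs; split; rewrite ?subn0 ?subnn // => i ltin A B AP BP.
apply: (cs (n - i.+1)%N); first by rewrite ltn_subrL; case: n ltin {c0 cn cs AP BP}.
  by rewrite subnSK //; case: AP; [right|left].
by rewrite subnSK //; case: BP; [right|left].
Qed.

Lemma string_length_rev n c :
  string_length n (fun i => c (n - i)%N) = string_length n c.
Proof.
rewrite /string_length big_nat_rev /=; apply: eq_big_nat => i /andP[_ ltin].
by rewrite add0n subKn // simplex_dist_sym subnSK // subKn // ltnW.
Qed.

Lemma davis_ball_center p (e : R) : 0 < e -> davis_ball p e p.
Proof.
move=> e0; rewrite /davis_ball /=; apply: (@le_lt_trans _ _ 0%E); last first.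
  by rewrite lte_fin.
apply: ereal_inf_lbound; exists 0%N, (fun=> p); split=> //.
by rewrite /string_length big_geq.
Qed.

Lemma davis_ballP p q (e : R) : davis_ball p e q <->
  exists n c, davis_string p q n c /\ string_length n c < e.
Proof.
split=> [|[n [c [cs le]]]]; last first.
  rewrite /davis_ball /=; apply: (@le_lt_trans _ _ (string_length n c)%:E).
    by apply: ereal_inf_lbound; exists n, c.
  by rewrite lte_fin.
move=> /ereal_inf_lt[_ [n [c [cs ->]]]]; rewrite lte_fin => le.
by exists n, c.
Qed.

Lemma davis_ball_sym p q (e : R) : davis_ball p e q -> davis_ball q e p.
Proof.
move=> /davis_ballP[n [c [/davis_string_rev cs le]]].
by apply/davis_ballP; exists n, (fun i => c (n - i)%N); rewrite string_length_rev.
Qed.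

Lemma davis_ball_triangle p q r (e1 e2 : R) :
  davis_ball p e1 q -> davis_ball q e2 r -> davis_ball p (e1 + e2) r.
Proof.
move=> /davis_ballP[n [c [[c0 cn cs] cl]]] /davis_ballP[k [d [[d0 dk ds] dl]]].
pose b i := if (i <= n)%N then c i else d (i - n)%N.
have bl i : (i <= n)%N -> b i = c i by rewrite /b => ->.
have br i : b (n + i)%N = d i.
  rewrite /b; case: i => [|i]; first by rewrite addn0 leqnn cn d0.
  by rewrite addnS leqNgt ltnS leq_addr /= -addnS addKn.
apply/davis_ballP; exists (n + k)%N, b; split; first split.
- by rewrite bl.
- by rewrite br.
- move=> i lti; case: (ltnP i n) => [ltin|lein].
    by rewrite !bl ?(ltnW ltin) //; exact: cs.
  rewrite -(subnKC lein) -addnS !br; apply: ds.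
  by rewrite ltn_subLR.
rewrite /string_length (big_cat_nat _ (leq_addr k n)) //=; apply: ltrD.
  rewrite (eq_big_nat _ _ (F2 := fun i => simplex_dist (c i) (c i.+1))) //.
  by move=> i /andP[_ ltin]; rewrite !bl // ltnW.
rewrite -{1}(add0n n) (addnC n) big_addn addnK.
rewrite (eq_big_nat _ _ (F2 := fun i => simplex_dist (d i) (d i.+1))) //.
by move=> i _; rewrite addnC -addnS !br.
Qed.

HB.instance Definition _ := gen_eqMixin davis.
HB.instance Definition _ := gen_choiceMixin davis.
HB.instance Definition _ := hasNbhs.Build davis (nbhs_ (entourage_ davis_ball)).
HB.instance Definition _ := Nbhs_isPseudoMetric.Build R davis erefl
  davis_ball_center davis_ball_sym davis_ball_triangle erefl.

(* [davis_translate g p q] : q = g p. *)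
Definition davis_translate (g : building_aut X) (p q : davis) : Prop :=
  forall A, q A = p (g @^-1` A).

Definition cocompact (G : set (building_aut X)) : Prop :=
  exists2 K : set davis, compact K &
    forall q, exists g p, [/\ G g, K p & davis_translate g p q].

(* [c] restricted to [0, l] is a geodesic from p to q. *)
Definition davis_geodesic (p q : davis) (l : R) (c : R -> davis) : Prop :=
  [/\ 0 <= l, c 0 = p, c l = q &
      forall s t, 0 <= s <= l -> 0 <= t <= l ->
        davis_dist (c s) (c t) = `|s - t|%:E].

Definition davis_convex (F : set davis) : Prop :=
  forall p q l c, F p -> F q -> davis_geodesic p q l c ->
    forall t, 0 <= t <= l -> F (c t).

(* The library norm on ['rV[R]_d] is the supremum norm. *)
Definition euclidean_dist (d : nat) (x y : 'rV[R]_d) : R :=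
  Num.sqrt (\sum_i (x ord0 i - y ord0 i) ^+ 2).

Definition flat (d : nat) (F : set davis) : Prop :=
  [/\ (2 <= d)%N, closed F, davis_convex F &
      exists f : 'rV[R]_d -> davis, range f = F /\
        forall x y, davis_dist (f x) (f y) = (euclidean_dist x y)%:E].

Definition maximal_flat (d : nat) (F : set davis) : Prop :=
  flat d F /\
  forall (d' : nat) (F' : set davis), flat d' F' -> F `<=` F' -> F = F'.

End Davis.

(* Main.v *)
(* Retracting the building onto a chamber [c] turns a chamber [a] into the element
   [wdist c a] of [W].  A point of the Davis realization is a chamber together with
   a coordinate in the fundamental chamber [inQ], so a flat becomes a map
   [x |-> (w_x, z_x)] which does not increase distances and, from a small ball
   around a suitable base point, preserves them.  The height over the wall of a
   root is affine along such a map wherever it vanishes, so the walls crossed by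
   the flat cut it along hyperplanes.  This yields, for d independent directions,
   infinite families of parallel walls such that two walls of different families
   intersect, i.e. [|B(a, b)| < 1].  As [B] takes finitely many values in ]-1, 1[
   on pairs of roots, a pigeonhole argument extracts one pair of roots from each
   family so that the d products of two reflections commute and are independent:
   [W] contains Z^d.

   After conjugation and restriction to a finite index subgroup, Z^d contains [m]
   such that [k |-> t (k m)] is geodesic and every [t n] lies on a geodesic from
   [t (- k m)] to [t (k m)] for large [k].  Since [G] has finitely many orbits of
   chambers, some [g] in [G] translates a chamber [c] by [t m] (up to a multiple of
   [m]), and the chambers [a n] between [g^-k c] and [g^k c] form a copy of Z^d
   determined by [g] and [c].  For a fixed direction [i] the axes
   [(g, a (l e_i))], [l] a natural number, accumulate by compactness; axes that agree
   along a long enough segment are conjugate in [G], so two of them are, and the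
   conjugating element translates all the [a n] by a positive multiple of [e_i].
   The elements of [G] acting on the [a n] as translations of the resulting lattice
   form the required subgroup. *)

Require Import Defs.
From HB Require Import structures.
From mathcomp Require Import all_boot all_order all_algebra all_fingroup.
From mathcomp Require Import all_classical all_reals all_analysis.
From mathcomp Require Import ring lra zify.

Set Implicit Arguments.
Unset Strict Implicit.
Unset Printing Implicit Defensive.

Import Order.TTheory GRing.Theory Num.Theory.
Import numFieldNormedType.Exports.
Local Open Scope classical_set_scope.
Local Open Scope ring_scope.

(** * The geometric representation of a Coxeter system *)

(** Three obstacles shape the proof. The retracted flat need not be a flat, and distances are exact
    only as seen from a small ball: heights are first shown to be affine in directions that point
    back to the ball, other directions follow from a parallelogram identity, and a ray cannot cross
    a wall twice because folding it between the two crossings would give a geodesic with a corner.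
    Two parallel walls give roots with B >= 1. If B > 1, orthogonality to the pairs of the other
    families can be forced. If B = 1, only the difference a - b becomes orthogonal to all the roots
    chosen; commutation then rests on the fact that no root has coordinates of both signs, so that a
    two-parameter lattice of roots degenerates. Finally [G] need not be discrete, so its elements
    cannot be counted. What is finite are the spheres around a chamber, and closedness of [G] turns
    agreement on longer and longer segments into agreement on a whole axis. *)

Section GeometricRepresentation.
Variables (R : realType) (W : coxeterSystem).
Local Notation S := (cox_gens W).
Local Notation V := {ffun S -> R}.
Local Notation B := (@cox_form W R).
Local Notation gen := (@cox_gen W).
Local Notation len := (@cox_length W).
Implicit Types (x y z v : V) (s t : S) (u w : cox_group W).

Definition bas s : V := [ffun t => (t == s)%:R].
Definition cosmx s t : R := - cos (pi / (cox_mx s t)%:R).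

Lemma cosmxC s t : cosmx s t = cosmx t s.
Proof. by have [_ mC _] := cox_mxP W; rewrite /cosmx mC. Qed.

Lemma cosmx1 s : cosmx s s = 1.
Proof. by have [m1 _ _] := cox_mxP W; rewrite /cosmx m1 divr1 cospi opprK. Qed.

Lemma cosmx_le0 s t : s != t -> cosmx s t <= 0.
Proof.
move=> st; have [_ _ /(_ _ _ st)] := cox_mxP W; rewrite /cosmx oppr_le0.
case: (cox_mx s t) => [|[|m]] // _; first by rewrite invr0 mulr0 cos0 ler01.
have pi0 := pi_ge0 R.
apply: cos_ge0_pihalf; rewrite ler_wpM2l // ?lef_pV2 ?posrE ?ltr0n // ?ler_nat //.
by rewrite andbT (@le_trans _ _ 0) // ?oppr_le0 ?divr_ge0.
Qed.

Lemma formC x y : B x y = B y x.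
Proof.
rewrite /cox_form exchange_big; apply: eq_bigr => s _; apply: eq_bigr => t _.
by rewrite -!/(cosmx _ _) cosmxC mulrAC.
Qed.

Lemma formDl x y z : B (x + y) z = B x z + B y z.
Proof.
rewrite /cox_form -big_split; apply: eq_bigr => s _; rewrite -big_split.
by apply: eq_bigr => t _ /=; rewrite ffunE; ring.
Qed.

Lemma formZl a x y : B (a *: x) y = a * B x y.
Proof.
rewrite /cox_form mulr_sumr; apply: eq_bigr => s _; rewrite mulr_sumr.
by apply: eq_bigr => t _ /=; rewrite ffunE /GRing.scale /=; ring.
Qed.

Lemma formDr x y z : B z (x + y) = B z x + B z y.
Proof. by rewrite formC formDl !(formC z). Qed.
Lemma formZr a x y : B y (a *: x) = a * B y x.
Proof. by rewrite formC formZl (formC x). Qed.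
Lemma formNl x y : B (- x) y = - B x y.
Proof. by rewrite -scaleN1r formZl mulN1r. Qed.
Lemma formNr x y : B y (- x) = - B y x.
Proof. by rewrite formC formNl (formC x). Qed.
Lemma form0l y : B 0 y = 0.
Proof. by rewrite -(scale0r 0) formZl mul0r. Qed.
Lemma form0r y : B y 0 = 0. Proof. by rewrite formC form0l. Qed.
Definition formE := (formDl, formDr, formZl, formZr, formNl, formNr, form0l, form0r).

Lemma form_suml I (r : seq I) (P : pred I) (F : I -> V) y :
  B (\sum_(i <- r | P i) F i) y = \sum_(i <- r | P i) B (F i) y.
Proof.
exact: (big_morph (fun x => B x y) (fun a b => formDl a b y) (form0l y)).
Qed.

Lemma form_sumr I (r : seq I) (P : pred I) (F : I -> V) y :
  B y (\sum_(i <- r | P i) F i) = \sum_(i <- r | P i) B y (F i).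
Proof. by rewrite formC form_suml; apply: eq_bigr => i _; rewrite formC. Qed.

Lemma bas_sum x : x = \sum_s x s *: bas s.
Proof.
apply/ffunP => t; rewrite sum_ffunE (bigD1 t) //= big1 ?addr0.
  by rewrite !ffunE eqxx /GRing.scale /= mulr1.
by move=> s st; rewrite !ffunE eq_sym (negbTE st) scaler0.
Qed.

Lemma form_bas s t : B (bas s) (bas t) = cosmx s t.
Proof.
rewrite /cox_form (bigD1 s) //= [X in _ + X]big1 ?addr0; last first.
  by move=> i si; apply: big1 => j _; rewrite ffunE (negbTE si) mulr0 mul0r.
rewrite (bigD1 t) //= big1 ?addr0; last first.
  by move=> j tj; rewrite [bas t j]ffunE (negbTE tj) mulr0.
by rewrite !ffunE !eqxx !mulr1.
Qed.

Lemma form_basl s x : B (bas s) x = \sum_t cosmx s t * x t.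
Proof.
rewrite {1}[x]bas_sum form_sumr; apply: eq_bigr => t _.
by rewrite formZr form_bas mulrC.
Qed.

Lemma form_sum x y : B x y = \sum_s x s * B (bas s) y.
Proof. by rewrite {1}[x]bas_sum form_suml; apply: eq_bigr => s _; rewrite formZl. Qed.

Lemma bas_form1 s : B (bas s) (bas s) = 1. Proof. by rewrite form_bas cosmx1. Qed.

Definition refl a x : V := x - (2 * B a x) *: a.

Lemma reflD a x y : refl a (x + y) = refl a x + refl a y.
Proof. by rewrite /refl formDr mulrDr scalerDl opprD addrACA. Qed.
Lemma reflZ a c x : refl a (c *: x) = c *: refl a x.
Proof. by rewrite /refl formZr scalerBr scalerA mulrCA. Qed.
Lemma reflK a : B a a = 1 -> involutive (refl a).
Proof.
move=> a1 x; rewrite /refl !formE a1; apply/ffunP => s.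
by rewrite !ffunE /GRing.scale /=; ring.
Qed.
Lemma refl_form a x y : B a a = 1 -> B (refl a x) (refl a y) = B x y.
Proof. by move=> a1; rewrite /refl !formE a1 (formC x a); ring. Qed.
Lemma refl_id a x : B a x = 0 -> refl a x = x.
Proof. by rewrite /refl => ->; rewrite mulr0 scale0r subr0. Qed.
Lemma refl_self a : B a a = 1 -> refl a a = - a.
Proof.
move=> a1; rewrite /refl a1; apply/ffunP => s.
by rewrite !ffunE /GRing.scale /=; ring.
Qed.

Definition wordact (r : seq S) x : V := foldr (fun s => refl (bas s)) x r.

Lemma wordact_cat r1 r2 x : wordact (r1 ++ r2) x = wordact r1 (wordact r2 x).
Proof. by rewrite /wordact foldr_cat. Qed.

Lemma wordact_cons s r x : wordact (s :: r) x = refl (bas s) (wordact r x).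
Proof. by []. Qed.

Lemma sin_rec (th x : R) : sin (x + th) = 2 * cos th * sin x - sin (x - th).
Proof. by rewrite sinD sinB; ring. Qed.

(* In the plane of [bas s] and [bas t] the product of the two reflections is
   the rotation of angle [2 th]. *)
Lemma iter_rot s t (th : R) k v (a b : R) :
  cosmx s t = - cos th -> sin th != 0 ->
  B (bas s) v = 0 -> B (bas t) v = 0 ->
  iter k (fun x => refl (bas s) (refl (bas t) x)) (v + a *: bas s + b *: bas t) =
  v + ((a * sin ((2 * k)%:R * th + th) - b * sin ((2 * k)%:R * th)) / sin th) *: bas s
    + ((a * sin ((2 * k)%:R * th) - b * sin ((2 * k)%:R * th - th)) / sin th) *: bas t.
Proof.
move=> cst sth sv tv; elim: k => [|k IH].
  rewrite /= muln0 mul0r add0r sub0r sin0 sinN !mulr0 subr0 sub0r mulrN opprK.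
  by rewrite !mulfK.
rewrite iterS IH; set A := (2 * k)%:R * th.
have -> : (2 * k.+1)%:R * th = A + th + th by rewrite /A mulnS natrD; ring.
rewrite addrK; set S1 := sin (A + th + th).
have -> : sin (A + th + th + th) = 2 * cos th * S1 - sin (A + th).
  by rewrite (sin_rec th) addrK.
have S1E : S1 = 2 * cos th * sin (A + th) - sin A by rewrite /S1 (sin_rec th) addrK.
rewrite /refl !formE !form_bas !cosmx1 (cosmxC t s) cst sv tv.
have Am : sin (A - th) = 2 * cos th * sin A - sin (A + th).
  by rewrite (sin_rec th); ring.
apply/ffunP => r; rewrite !ffunE /GRing.scale /= S1E Am.
move: (sin th) (sin A) (sin (A + th)) (cos th) sth => s1 s2 s3 c s10.
by field.
Qed.

(** The Gram determinant of the plane of [bas s] and [bas t] is sin^2 (pi / m), nonzero for finite m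
    >= 2, so [x] splits into a vector fixed by both reflections and a vector of the plane, which m
    rotations of angle 2 pi / m restore. *)
Lemma relator_act s t x :
  wordact (flatten (nseq (cox_mx s t) [:: s; t])) x = x.
Proof.
have itE k : wordact (flatten (nseq k [:: s; t])) x =
    iter k (fun x => refl (bas s) (refl (bas t) x)) x.
  elim: k => [//|k IH]; rewrite iterS -IH.
  by rewrite -[nseq k.+1 _]/([:: s; t] :: nseq k [:: s; t]) -cat1s flatten_cat wordact_cat.
rewrite itE; have [m1 _ mn1] := cox_mxP W.
have [<-|st] := eqVneq s t; first by rewrite m1 /= reflK ?bas_form1.
have := mn1 _ _ st; case mE: (cox_mx s t) => [|[|m]] // _.
set th : R := pi / (m.+2)%:R.
have cst : cosmx s t = - cos th by rewrite /cosmx mE.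
have pi0 := pi_gt0 R.
have sth : sin th != 0.
  rewrite gt_eqF // sin_gt0_pi // /th divr_gt0 ?ltr0n //=.
  by rewrite ltr_pdivrMr ?ltr0n // ltr_pMr // ltr1n.
pose p := B (bas s) x; pose q := B (bas t) x; pose D := sin th ^+ 2.
have D0 : D != 0 by rewrite expf_neq0.
have DE : D = 1 - cos th ^+ 2 by rewrite /D -(cos2Dsin2 th); ring.
pose a := (p + cos th * q) / D; pose b := (q + cos th * p) / D.
pose v := x - b *: bas t - a *: bas s.
have xE : x = v + a *: bas s + b *: bas t by rewrite /v subrK subrK.
have sv : B (bas s) v = 0.
  rewrite /v !formE !form_bas cosmx1 cst -/p /a /b.
  rewrite DE in D0 *; move: (p) (q) (cos th) D0 => p' q' C D0.
  by field.
have tv : B (bas t) v = 0.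
  rewrite /v !formE !form_bas cosmx1 (cosmxC t s) cst -/q /a /b.
  rewrite DE in D0 *; move: (p) (q) (cos th) D0 => p' q' C D0.
  by field.
rewrite [in LHS]xE (@iter_rot s t th) // [RHS]xE.
have -> : (2 * m.+2)%:R * th = pi *+ 2.
  by rewrite natrM -mulrA (mulrC m.+2%:R) divfK ?pnatr_eq0 // mulr_natl.
have s2 : sin (pi *+ 2) = 0 :> R by rewrite -[_ *+ 2]add0r sinD2pi sin0.
rewrite [pi *+ 2 + th]addrC sinD2pi.
have -> : sin (pi *+ 2 - th) = - sin th by rewrite addrC sinD2pi sinN.
rewrite s2; congr (_ + _ *: _ + _ *: _).
  by rewrite mulr0 subr0 mulfK.
by rewrite mulr0 sub0r mulrN opprK mulfK.
Qed.

Lemma wordact_cong r1 r2 : coxeter_cong (@cox_mx W) r1 r2 ->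
  forall x, wordact r1 x = wordact r2 x.
Proof.
elim=> [//|u v _ IH|u v w _ IH1 _ IH2|u v s t] x; first by rewrite IH.
- by rewrite IH1 IH2.
- by rewrite !wordact_cat relator_act.
Qed.

Definition word_of w : seq S := projT1 (cid (cox_generated w)).
Lemma word_ofP w : word_val gen (word_of w) = w.
Proof. by rewrite /word_of; case: cid. Qed.

(** The word is an arbitrary choice; [act_word] shows it to be immaterial, since every relator acts
    trivially. *)
Definition act w x : V := wordact (word_of w) x.

Lemma act_word r x : act (word_val gen r) x = wordact r x.
Proof. by apply: wordact_cong; apply/cox_presented; rewrite word_ofP. Qed.

Lemma word_val_cat r1 r2 :
  word_val gen (r1 ++ r2) = (word_val gen r1 * word_val gen r2)%g.
Proof. by elim: r1 => [|s r IH] /=; rewrite ?mul1g // IH mulgA. Qed.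

Lemma actM u w x : act (u * w)%g x = act u (act w x).
Proof.
by rewrite -{1}(word_ofP u) -{1}(word_ofP w) -word_val_cat act_word wordact_cat.
Qed.
Lemma act1 x : act 1%g x = x.
Proof. by rewrite -[1%g]/(word_val gen [::]) act_word. Qed.
Lemma act_gen s x : act (gen s) x = refl (bas s) x.
Proof. by have := act_word [:: s] x; rewrite /= mulg1. Qed.
Lemma actK w : cancel (act w) (act w^-1%g).
Proof. by move=> x; rewrite -actM mulVg act1. Qed.
Lemma actVK w : cancel (act w^-1%g) (act w).
Proof. by move=> x; rewrite -actM mulgV act1. Qed.
Lemma actD w x y : act w (x + y) = act w x + act w y.
Proof.
rewrite /act; elim: (word_of w) => [//|s r IH].
by rewrite !wordact_cons IH reflD.
Qed.
Lemma actZ w c x : act w (c *: x) = c *: act w x.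
Proof.
rewrite /act; elim: (word_of w) => [//|s r IH].
by rewrite !wordact_cons IH reflZ.
Qed.
Lemma actN w x : act w (- x) = - act w x.
Proof. by rewrite -[in LHS]scaleN1r actZ scaleN1r. Qed.
Lemma act0 w : act w 0 = 0. Proof. by rewrite -[X in act w X](scale0r 0) actZ scale0r. Qed.
Lemma act_form w x y : B (act w x) (act w y) = B x y.
Proof.
rewrite /act; elim: (word_of w) => [//|s r IH].
by rewrite !wordact_cons refl_form ?bas_form1.
Qed.
Lemma act_formr w x y : B x (act w y) = B (act w^-1%g x) y.
Proof. by rewrite -(act_form w^-1%g) actK. Qed.
Lemma act_sum w I (r : seq I) (P : pred I) (F : I -> V) :
  act w (\sum_(i <- r | P i) F i) = \sum_(i <- r | P i) act w (F i).
Proof. exact: (big_morph (act w) (actD w) (act0 w)). Qed.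

Lemma cgenK s : (gen s * gen s)%g = 1%g.
Proof.
have [m1 _ _] := cox_mxP W.
have := cong_relator (@cox_mx W) [::] [::] s s; rewrite m1 /=.
by move/(cox_presented _ _) => /=; rewrite !mulg1.
Qed.
Lemma cgenV s : (gen s)^-1%g = gen s.
Proof. by apply: (mulIg (gen s)); rewrite mulVg cgenK. Qed.

End GeometricRepresentation.

(** * The length function and alternating words *)

Section Length.
Variables (W : coxeterSystem).
Local Notation S := (cox_gens W).
Local Notation gen := (@cox_gen W).
Local Notation len := (@cox_length W).
Local Notation val := (word_val gen).
Implicit Types (s t : S) (u v w : cox_group W) (r : seq S).

Lemma len_word w : exists2 r, size r = len w & val r = w.
Proof.
by rewrite /cox_length; case: ex_minnP => n /asboolP[r rn rw] _; exists r.
Qed.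

Lemma len_le r : (len (val r) <= size r)%N.
Proof.
rewrite /cox_length; case: ex_minnP => n _; apply; apply/asboolP.
by exists r.
Qed.

Lemma len1 : len 1%g = 0%N.
Proof. by apply/eqP; rewrite -leqn0 -[1%g]/(val [::]) len_le. Qed.

Lemma word_valV r : (val r)^-1%g = val (rev r).
Proof.
elim: r => [|s r IH] /=; first by rewrite invg1.
by rewrite invMg IH cgenV rev_cons -cats1 word_val_cat /= mulg1.
Qed.

Lemma lenV w : len w^-1%g = len w.
Proof.
suff h v : (len v^-1%g <= len v)%N.
  by apply/eqP; rewrite eqn_leq h -{1}(invgK w) h.
have [r <- <-] := len_word v.
by rewrite word_valV -(size_rev r) len_le.
Qed.

Lemma lenM u v : (len (u * v)%g <= len u + len v)%N.
Proof.
have [r <- <-] := len_word u; have [r' <- <-] := len_word v.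
by rewrite -word_val_cat -size_cat len_le.
Qed.

Lemma len_gen s : (len (gen s) <= 1)%N.
Proof. by have := len_le [:: s]; rewrite /= mulg1. Qed.

(** Relators have even length, so parity is an invariant of the group element; hence multiplication
    by a generator changes the length by exactly one. *)
Lemma size_cong_odd r r' : coxeter_cong (@cox_mx W) r r' ->
  odd (size r) = odd (size r').
Proof.
elim=> [//|u v _ <- //|u v w _ -> _ -> //|u v s t].
rewrite !size_cat !oddD size_flatten /shape map_nseq sumn_nseq /=.
by rewrite oddM.
Qed.

Lemma odd_len r : odd (len (val r)) = odd (size r).
Proof.
have [r' <- rr'] := len_word (val r).
by apply: size_cong_odd; apply/cox_presented.
Qed.

Lemma len_genM s w :
  len (gen s * w)%g = (len w).+1 \/ (len (gen s * w)%g).+1 = len w.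
Proof.
have [r rw <-] := len_word w; rewrite -[(gen s * _)%g]/(val (s :: r)).
have h1 := lenM (gen s) (val r).
have h2 := lenM (gen s) (val (s :: r)).
have h3 := len_gen s; have h4 := odd_len (s :: r); have h5 := odd_len r.
have ne : len (val (s :: r)) <> len (val r).
  by move=> e; move: h4; rewrite e h5 /=; case: (odd _).
rewrite [val (s :: r)]/= mulgA cgenK mul1g in h2; rewrite -[(gen s * _)%g]/(val (s :: r)) in h1 h2.
move: h1 h2 h3 ne; clear; lia.
Qed.

Lemma len_Mgen s w :
  len (w * gen s)%g = (len w).+1 \/ (len (w * gen s)%g).+1 = len w.
Proof.
by rewrite -(lenV (w * gen s)%g) -(lenV w) invMg cgenV; exact: len_genM.
Qed.

Lemma len_first w : w != 1%g -> exists s, (len (gen s * w)%g < len w)%N.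
Proof.
have [[|s r] rw wE] := len_word w; first by rewrite -wE eqxx.
by move=> _; exists s; rewrite -rw -wE /= mulgA cgenK mul1g ltnS len_le.
Qed.

Fixpoint alt n s t : seq S := if n is n'.+1 then s :: alt n' t s else [::].

Lemma size_alt n s t : size (alt n s t) = n.
Proof. by elim: n s t => //= n IH s t; rewrite IH. Qed.

Lemma alt_rcons n s t :
  alt n.+1 s t = rcons (alt n s t) (if odd n then t else s).
Proof.
elim: n s t => [//|n IH] s t.
change (s :: alt n.+1 t s = rcons (s :: alt n t s) (if ~~ odd n then t else s)).
by rewrite IH rcons_cons; case: (odd n).
Qed.

Lemma rev_alt n s t : rev (alt n s t) = if odd n then alt n s t else alt n t s.
Proof.
elim: n s t => // n IH s t; rewrite [in LHS]alt_rcons rev_rcons IH /=.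
by case: (odd n).
Qed.

Lemma alt_cat a b s t :
  alt (a + b) s t = alt a s t ++ (if odd a then alt b t s else alt b s t).
Proof.
elim: a s t => //= a IH s t; rewrite IH; by case: (odd a).
Qed.

Lemma alt_double n s t : flatten (nseq n [:: s; t]) = alt (n + n) s t.
Proof. by elim: n => //= n ->; rewrite addnS. Qed.

Lemma alt_braid s t : val (alt (cox_mx s t) s t) = val (alt (cox_mx s t) t s).
Proof.
have := cong_relator (@cox_mx W) [::] [::] s t; rewrite /= cats0.
move/(cox_presented _ _); rewrite alt_double alt_cat word_val_cat /= => h.
set m := cox_mx s t in h *.
apply: (mulIg (val (if odd m then alt m t s else alt m s t))); rewrite h.
rewrite -[X in (X * _)%g]invgK word_valV rev_alt.
by case: (odd m); rewrite mulVg.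
Qed.

End Length.

(** * Positivity of roots and length *)

Section Roots.
Variables (R : realType) (W : coxeterSystem).
Local Notation S := (cox_gens W).
Local Notation V := {ffun S -> R}.
Local Notation B := (@cox_form W R).
Local Notation gen := (@cox_gen W).
Local Notation len := (@cox_length W).
Local Notation val := (word_val gen).
Local Notation bas := (@bas R W).
Local Notation act := (@act R W).
Implicit Types (x y z a b c : V) (s t : S) (u v w : cox_group W).

Definition nneg x := forall s, 0 <= x s.

Lemma nnegD x y : nneg x -> nneg y -> nneg (x + y).
Proof. by move=> x0 y0 s; rewrite ffunE addr_ge0. Qed.
Lemma nnegZ (k : R) x : 0 <= k -> nneg x -> nneg (k *: x).
Proof. by move=> k0 x0 s; rewrite ffunE mulr_ge0. Qed.

(* [sig c k] is [sin (k th) / sin th] for [c = cos th]. *)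
Fixpoint sig (c : R) k : R :=
  if k is k'.+1 then (if k' is k''.+1 then 2 * c * sig c k' - sig c k'' else 1)
  else 0.

Lemma sigSS (c : R) k : sig c k.+2 = 2 * c * sig c k.+1 - sig c k.
Proof. by []. Qed.

Lemma sig_sin (th : R) k : sig (cos th) k * sin th = sin (k%:R * th).
Proof.
suff : sig (cos th) k * sin th = sin (k%:R * th) /\
       sig (cos th) k.+1 * sin th = sin (k.+1%:R * th) by case.
elim: k => [|k [IH1 IH2]]; first by rewrite /= !mul0r sin0 !mul1r.
split=> //; rewrite sigSS mulrBl -(mulrA (2 * cos th)) IH2 IH1.
have -> : k.+2%:R * th = k.+1%:R * th + th by rewrite -natr1; ring.
rewrite (sin_rec th); congr (_ - sin _); rewrite -natr1; ring.
Qed.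

Lemma sig1 k : sig 1 k = k%:R.
Proof.
suff : sig 1 k = k%:R /\ sig 1 k.+1 = k.+1%:R by case.
elim: k => [//|k [IH1 IH2]]; split => //; rewrite sigSS IH1 IH2.
by rewrite -!natr1; ring.
Qed.

Lemma sig_ge0 s t k : s != t -> (cox_mx s t = 0 \/ k <= cox_mx s t)%N ->
  0 <= sig (- cosmx R s t) k.
Proof.
move=> st; have [_ _ /(_ _ _ st)] := cox_mxP W.
rewrite /cosmx opprK; case mE: (cox_mx s t) => [|[|m]] // _ [//|km].
- by rewrite invr0 mulr0 cos0 sig1.
- by move: km; rewrite leqn0 => /eqP ->.
have pi0 := pi_gt0 R; have m0 : (0 : R) < m.+2%:R by rewrite ltr0n.
have sth : 0 < sin (pi / m.+2%:R : R).
  by rewrite sin_gt0_pi // divr_gt0 //= ltr_pdivrMr // ltr_pMr // ltr1n.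
rewrite -(pmulr_lge0 _ sth) sig_sin.
have [->|k0] := eqVneq k 0%N; first by rewrite mul0r sin0.
move: km; rewrite leq_eqVlt => /orP[/eqP->|km].
  by rewrite mulrC divfK ?gt_eqF // sinpi.
apply: ltW; apply: sin_gt0_pi; rewrite mulr_gt0 ?divr_gt0 ?ltr0n ?lt0n //=.
by rewrite mulrCA gtr_pMr // ltr_pdivrMr // mul1r ltr_nat.
Qed.

(** Both orders of the letters are treated at once because removing the first letter exchanges them;
    each further letter raises one of the two indices of [sig] by two. *)
Lemma act_alt n s t : s != t ->
  act (val (alt n t s))^-1%g (bas s) =
  let c := - cosmx R s t in
  if odd n then sig c n *: bas s + sig c n.+1 *: bas t
  else sig c n.+1 *: bas s + sig c n *: bas t.
Proof.
move=> st; set c := - cosmx R s t.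
pose P k (a b : S) := act (val (alt k b a))^-1%g (bas a) =
  if odd k then sig c k *: bas a + sig c k.+1 *: bas b
  else sig c k.+1 *: bas a + sig c k *: bas b.
suff : (P n s t /\ P n t s) /\ (P n.+1 s t /\ P n.+1 t s) by case=> -[].
have step (a b : S) k : act (val (alt k.+1 b a))^-1%g (bas a) =
    act (val (alt k a b))^-1%g (bas a) -
      (2 * cosmx R a b) *: act (val (alt k a b))^-1%g (bas b).
  rewrite /= invMg actM cgenV act_gen /refl form_bas cosmxC.
  by rewrite -scaleNr actD actZ scaleNr.
have step' (a b : S) k : act (val (alt k.+1 a b))^-1%g (bas a) =
    - act (val (alt k b a))^-1%g (bas a).
  by rewrite /= invMg actM cgenV act_gen refl_self ?bas_form1 // actN.
have cC : cosmx R t s = - c by rewrite /c opprK cosmxC.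
have cC' : cosmx R s t = - c by rewrite /c opprK.
elim: n => [|k [[IH1 IH2] [IH3 IH4]]].
  rewrite /P /= !invg1 !act1 !mulg1 !cgenV !act_gen /refl !form_bas cC cC'.
  by split; split; apply/ffunP => r; rewrite !ffunE /GRing.scale /=; ring.
rewrite /P in IH1 IH2 IH3 IH4; split=> //.
rewrite /P (step s t k.+1) (step t s k.+1) !step' IH1 IH2 IH3 IH4 cC cC'.
rewrite [odd k.+2]/= negbK [odd k.+1]/= (sigSS c k.+1) (sigSS c k).
case: (odd k) => /=; split; apply/ffunP => r;
 rewrite !ffunE /GRing.scale /=; ring.
Qed.

(** Strip from [w] its longest alternating prefix in [t], [s] with additive lengths. Neither [s] nor
    [t] shortens the remainder [v], so by induction v^-1 maps both simple roots to nonnegative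
    vectors, and the dihedral prefix combines these with nonnegative coefficients. *)
Theorem act_nneg w s : (len w < len (gen s * w)%g)%N -> nneg (act w^-1%g (bas s)).
Proof.
have [n] := ubnP (len w); elim: n w s => // n IH w s wn sw.
have [w1|wn1] := eqVneq w 1%g.
  by rewrite w1 invg1 act1 => t; rewrite ffunE ler0n.
have [t tw] := len_first wn1.
have st : s != t by apply: contraTneq sw => ->; rewrite -leqNgt ltnW.
pose P k := `[< exists2 v, w = (val (alt k t s) * v)%g & (len v + k = len w)%N >].
have P1 : P 1%N.
  apply/asboolP; exists (gen t * w)%g.
    by rewrite /= mulg1 mulgA cgenK mul1g.
  by have := len_genM t w; lia.
have Pb k : P k -> (k <= len w)%N by move=> /asboolP[v _ <-]; rewrite leq_addl.
case: (ex_maxnP (ex_intro P 1%N P1) Pb) => k /asboolP[v wE vk] kmax.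
have k1 := kmax _ P1.
(* [g] would prolong the alternating prefix, and [f] is its last letter. *)
pose g := if odd k then s else t.
pose f := if odd k then t else s.
have gv : (len v < len (gen g * v)%g)%N.
  have [->//|gv] := len_genM g v.
  suff /kmax : P k.+1 by rewrite ltnn.
  apply/asboolP; exists (gen g * v)%g; last by rewrite -vk -gv addSnnS.
  rewrite alt_rcons -cats1 word_val_cat /= mulg1 -/g.
  by rewrite -mulgA (mulgA (gen g)) cgenK mul1g.
have fv : (len v < len (gen f * v)%g)%N.
  have [->//|fv] := len_genM f v.
  suff : (len w <= k.-1 + len (gen f * v)%g)%N by move: fv vk k1; lia.
  rewrite wE {fv gv}; case: (k) k1 @g @f => // j _ _.
  rewrite alt_rcons -cats1 word_val_cat -mulgA /= mulg1.
  have -> : (if ~~ odd j then t else s) = (if odd j then s else t).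
    by case: (odd j).
  apply: (leq_trans (lenM _ _)).
  by rewrite leq_add2r -{2}(size_alt j t s) len_le.
have vn : (len v < n)%N by move: wn vk k1; rewrite ltnS; lia.
have [vs vt] : nneg (act v^-1%g (bas s)) /\ nneg (act v^-1%g (bas t)).
  by move: (IH _ _ vn gv) (IH _ _ vn fv); rewrite /g /f; case: (odd k).
(* If the prefix had length at least m, the braid relation would let it begin with [s], and [s]
   would shorten [w]. *)
have km : (cox_mx s t = 0 \/ k.+1 <= cox_mx s t)%N.
  case mE: (cox_mx s t) => [|m]; first by left.
  right; rewrite ltnS leqNgt; apply/negP => mk.
  suff : (len (gen s * w) <= k.-1 + len v)%N by move: sw vk k1; lia.
  rewrite wE -(subnKC mk) alt_cat !word_val_cat.
  have [_ mC _] := cox_mxP W.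
  have -> : val (alt m.+1 t s) = val (alt m.+1 s t).
    by have := alt_braid t s; rewrite mC mE.
  rewrite [alt m.+1 s t]/= [val (s :: _)]/= !mulgA cgenK mul1g -!mulgA.
  apply: (leq_trans (lenM _ _)); apply: (leq_trans (leq_add (len_le _) (lenM _ _))).
  rewrite size_alt; case: (odd _); move: (len_le (alt (k - m.+1) s t)) (len_le (alt (k - m.+1) t s));
    rewrite !size_alt; lia.
rewrite wE invMg actM act_alt //; lazy zeta.
have km' : (cox_mx s t = 0 \/ k <= cox_mx s t)%N by case: km; [left|right; lia].
by case: (odd k); rewrite actD !actZ; apply: nnegD; apply: nnegZ => //; exact: sig_ge0.
Qed.

End Roots.

(** * Half-spaces and galleries *)

Section RootSides.
Variables (R : realType) (W : coxeterSystem).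
Local Notation S := (cox_gens W).
Local Notation V := {ffun S -> R}.
Local Notation B := (@cox_form W R).
Local Notation gen := (@cox_gen W).
Local Notation len := (@cox_length W).
Local Notation val := (word_val gen).
Local Notation bas := (@bas R W).
Local Notation act := (@act R W).
Implicit Types (x y z a b c : V) (s t : S) (u v w : cox_group W).

Definition root c := exists w s, c = act w (bas s).
Definition rho x : R := \sum_s x s.
(* The chamber [w] lies in the half-space of the root [c] iff [side c w]. *)
Definition side c w : bool := 0 < rho (act w^-1%g c).

Lemma rhoD x y : rho (x + y) = rho x + rho y.
Proof. by rewrite /rho -big_split; apply: eq_bigr => s _; rewrite ffunE. Qed.
Lemma rhoZ (k : R) x : rho (k *: x) = k * rho x.
Proof. by rewrite /rho mulr_sumr; apply: eq_bigr => s _; rewrite ffunE. Qed.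
Lemma rhoN x : rho (- x) = - rho x.
Proof. by rewrite -[in LHS]scaleN1r rhoZ mulN1r. Qed.
Lemma rho0 : rho 0 = 0.
Proof. by rewrite -[0 in LHS](scale0r 0) rhoZ mul0r. Qed.
Lemma rho_sum I (r : seq I) (P : pred I) (F : I -> V) :
  rho (\sum_(i <- r | P i) F i) = \sum_(i <- r | P i) rho (F i).
Proof. exact: (big_morph rho rhoD rho0). Qed.

Lemma root_form c : root c -> B c c = 1.
Proof. by case=> w [s ->]; rewrite act_form bas_form1. Qed.
Lemma root_act w c : root c -> root (act w c).
Proof. by case=> v [s ->]; exists (w * v)%g, s; rewrite actM. Qed.
Lemma root_bas s : root (bas s). Proof. by exists 1%g, s; rewrite act1. Qed.
Lemma act_bas_gen w s : act (w * gen s)%g (bas s) = - act w (bas s).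
Proof. by rewrite actM act_gen refl_self ?bas_form1 // actN. Qed.
Lemma rootN c : root c -> root (- c).
Proof. by case=> w [s ->]; exists (w * gen s)%g, s; rewrite act_bas_gen. Qed.
Lemma root_neq0 c : root c -> c != 0.
Proof.
move=> /root_form; apply: contra_eq_neq => ->.
by rewrite form0l eq_sym oner_neq0.
Qed.

Lemma root_refl c : root c -> exists r, forall x, act r x = refl c x.
Proof.
case=> w [s ->]; exists (w * gen s * w^-1)%g => x.
rewrite !actM act_gen /refl actD actN actZ actVK.
by rewrite [in RHS]formC [in RHS]act_formr (formC _ (bas s)).
Qed.

Lemma nneg_len w s : (len w < len (w * gen s)%g)%N -> nneg (act w (bas s)).
Proof.
move=> h; rewrite -[w]invgK; apply: act_nneg.
by rewrite lenV -(lenV (_ * _)%g) invMg invgK cgenV.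
Qed.

Lemma nneg_lenN w s : (len (w * gen s)%g < len w)%N -> nneg (- act w (bas s)).
Proof.
move=> h; rewrite -act_bas_gen; apply: nneg_len.
by rewrite -mulgA cgenK mulg1.
Qed.

Lemma root_sign c : root c -> nneg c \/ nneg (- c).
Proof.
case=> w [s ->]; have [h|h] := len_Mgen s w; [left|right].
  by apply: nneg_len; rewrite h.
by apply: nneg_lenN; rewrite -h.
Qed.

(** The Gram matrix has diagonal entries 1 and nonpositive entries elsewhere. This gives the uniform
    gap |[rho] c| >= 1 on roots, on which the later finiteness arguments rest. *)
Lemma nneg_form_le x : nneg x -> B x x <= rho x ^+ 2.
Proof.
move=> x0; rewrite expr2 {1}/rho mulr_suml form_sum; apply: ler_sum => s _.
rewrite ler_wpM2l // form_basl; apply: ler_sum => t _.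
have [->|st] := eqVneq s t; first by rewrite cosmx1 mul1r.
by rewrite (@le_trans _ _ 0) // mulr_le0_ge0 // cosmx_le0.
Qed.

Lemma rho_nneg x : nneg x -> 0 <= rho x.
Proof. by move=> x0; apply: sumr_ge0. Qed.

Lemma rho_root_ge1 c : root c -> nneg c -> 1 <= rho c.
Proof.
move=> rc c0; have := nneg_form_le c0; rewrite root_form // => h.
by rewrite -(@ler_pXn2r _ 2) ?nnegrE ?rho_nneg // expr1n.
Qed.

Lemma rho_root_abs c : root c -> 1 <= `|rho c|.
Proof.
move=> rc; have [h|h] := root_sign rc.
  exact: le_trans (rho_root_ge1 rc h) (ler_norm _).
by rewrite -normrN -rhoN; exact: le_trans (rho_root_ge1 (rootN rc) h) (ler_norm _).
Qed.

Lemma sideP c w : root c -> side c w -> nneg (act w^-1%g c).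
Proof.
move=> rc sc; have [//|h] := root_sign (root_act w^-1%g rc).
by move: sc; rewrite /side ltNge -oppr_ge0 -rhoN rho_nneg.
Qed.

Lemma sideNP c w : root c -> ~~ side c w -> nneg (- act w^-1%g c).
Proof.
move=> rc sc; have [h|//] := root_sign (root_act w^-1%g rc).
case/negP: sc; apply: lt_le_trans (rho_root_ge1 (root_act _ rc) h).
exact: ltr01.
Qed.

Lemma side_ge1 c w : root c -> side c w -> 1 <= rho (act w^-1%g c).
Proof. by move=> rc sc; apply: rho_root_ge1 (root_act _ rc) (sideP rc sc). Qed.

Lemma side_leN1 c w : root c -> ~~ side c w -> rho (act w^-1%g c) <= -1.
Proof.
move=> rc sc; rewrite lerNr -rhoN.
by apply: rho_root_ge1 (rootN (root_act _ rc)) (sideNP rc sc).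
Qed.

Lemma nneg_side c w : root c -> nneg (act w^-1%g c) -> side c w.
Proof.
move=> rc h; apply: lt_le_trans (rho_root_ge1 (root_act _ rc) h).
exact: ltr01.
Qed.

Lemma sideN c w : root c -> side (- c) w = ~~ side c w.
Proof.
move=> rc; rewrite {1}/side actN rhoN; case: (boolP (side c w)) => h /=.
  by have := side_ge1 rc h; lra.
by have := side_leN1 rc h; lra.
Qed.

Lemma side_act u c w : side (act u c) w = side c (u^-1 * w)%g.
Proof. by rewrite /side invMg invgK actM. Qed.

(** The reflection in [bas s] changes the coordinate at [s] only. A nonnegative vector with
    nonpositive image is therefore a multiple of [bas s], so adjacent chambers are separated by
    their common wall alone. *)
Lemma side_gen c w s : root c -> side c (w * gen s)%g != side c w ->
  c = act w (bas s) \/ c = - act w (bas s).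
Proof.
have key d v : root d -> side d v -> ~~ side d (v * gen s)%g -> d = act v (bas s).
  move=> rd dv dvs; have h1 := sideP rd dv; have := sideNP rd dvs.
  rewrite invMg cgenV actM act_gen; set y := act v^-1%g d in h1 * => h2.
  have yt t : t != s -> y t = 0.
    move=> ts; have := h2 t; rewrite !ffunE (negbTE ts) /GRing.scale /= mulr0 subr0.
    by move: (h1 t); lra.
  have ys : y = y s *: bas s.
    apply/ffunP => t; rewrite !ffunE; have [->|ts] := eqVneq t s.
      by rewrite /GRing.scale /= mulr1.
    by rewrite yt // scaler0.
  have : B y y = 1 by rewrite act_form root_form.
  rewrite ys !formE bas_form1 mulr1 => /eqP; rewrite -expr2 sqrf_eq1.
  case/orP => /eqP e; last by have := h1 s; rewrite e oppr_ge0 ler10.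
  by rewrite -[d](actVK v) -/y ys e scale1r.
move=> rc; case: (boolP (side c w)) => cw; case: (boolP (side c _)) => cws // _.
  by left; apply: key.
right; apply: oppr_inj; rewrite opprK; apply: key; rewrite ?sideN //.
  exact: rootN.
by rewrite cws.
Qed.

(** A gallery from [u] to [w] crosses one wall per letter, and a wall carries two opposite roots:
    hence the factor 2. *)
Lemma sep_list u w : exists l : seq V, (size l <= 2 * len (u^-1 * w)%g)%N /\
  forall c, root c -> side c u != side c w -> c \in l.
Proof.
have [r <-] := len_word (u^-1 * w)%g => rE.
have -> : w = (u * val r)%g by rewrite rE mulgA mulgV mul1g.
elim: r u {rE} => [|s r IH] u; first by exists [::]; split=> // c _; rewrite /= mulg1 eqxx.
have [l [sl lP]] := IH (u * gen s)%g.
exists [:: act u (bas s), - act u (bas s) & l]; split; first by rewrite /= mulnS ltnS.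
move=> c rc; rewrite /= mulgA => cs; rewrite !inE.
have [e|/(side_gen rc) [->|->]] := eqVneq (side c (u * gen s)%g) (side c u).
- by rewrite (lP c) ?orbT // e.
- by rewrite eqxx.
- by rewrite eqxx orbT.
Qed.

Lemma sep_ex u w : (forall c, root c -> side c u = side c w) -> u = w.
Proof.
move=> h; apply/eqP; rewrite eq_sym -(inj_eq (mulgI u^-1%g)) mulVg; apply/eqP.
have [r] := len_word (u^-1 * w)%g; case/lastP: r => [|r s] rs rE; first by rewrite -rE.
have rc : root (act w (bas s)) by exists w, s.
have := h _ rc; rewrite [RHS]nneg_side //; last first.
  by rewrite actK => t; rewrite ffunE ler0n.
have {2}-> : w = (u * (u^-1 * w))%g by rewrite mulgA mulgV mul1g.
move/(sideP rc); rewrite -[in act w]( mulg1 w).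
rewrite mulg1; set x := act _ _ => x0.
have /nneg_lenN : (len (u^-1 * w * gen s)%g < len (u^-1 * w)%g)%N.
  rewrite -{1}rE -cats1 word_val_cat /= mulg1 -mulgA cgenK mulg1.
  by rewrite -rs size_rcons ltnS len_le.
rewrite actM -/x => xn; suff : x = 0.
  by move/eqP; rewrite (negbTE (root_neq0 (root_act _ rc))).
by apply/ffunP => t; have := x0 t; have := xn t; rewrite !ffunE; lra.
Qed.

Lemma act_faithful u w : (forall x, act u x = act w x) -> u = w.
Proof.
move=> h; apply: sep_ex => c rc; rewrite /side; congr (0 < rho _).
by rewrite -{1}(actVK w c) -h actK.
Qed.

Lemma reduced_cat r r' : size (r ++ r') = len (val (r ++ r')) ->
  len (val r) = size r /\ len (val r') = size r'.
Proof.
rewrite size_cat word_val_cat => h.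
have := lenM (val r) (val r'); have := len_le r; have := len_le r'.
by move: h; lia.
Qed.

(** Otherwise some prefix p of a reduced word of [w], followed by s, has u p s shorter than u p. The
    root (u p) e_s then separates 1 from [u], and the reduced word recrosses its wall between [u]
    and u w. *)
Lemma len_add u w :
  (forall c, root c -> side c 1%g != side c u -> side c u = side c (u * w)%g) ->
  len (u * w)%g = (len u + len w)%N.
Proof.
have [r rw wE] := len_word w; rewrite -{}wE in rw *; move=> H; rewrite -rw.
suff: forall p q, r = p ++ q -> len (u * val p)%g = (len u + size p)%N.
  by move/(_ r [::]); apply; rewrite cats0.
elim/last_ind => [|p s IH] q rE; first by rewrite mulg1 addn0.
rewrite -cats1 word_val_cat size_cat /= mulg1 mulgA addnA -(IH (s :: q)) -?cat_rcons //.
have [-> //|dec] := len_Mgen s (u * val p)%g; first by rewrite addn1.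
have rc : root (act (u * val p)%g (bas s)) by exists (u * val p)%g, s.
have red : size ((rcons p s) ++ q) = len (val ((rcons p s) ++ q)) by rewrite -rE.
have [red1 _] := reduced_cat red.
rewrite cat_rcons in red; have [redp redq] := reduced_cat red.
have s1 : ~~ side (act (u * val p)%g (bas s)) 1%g.
  rewrite -sideN // nneg_side //; first exact: rootN.
  by rewrite invg1 act1; apply: nneg_lenN; rewrite -dec.
have su : side (act (u * val p)%g (bas s)) u.
  rewrite nneg_side // actM actK; apply: nneg_len.
  have -> : (val p * gen s)%g = val (rcons p s) by rewrite -cats1 word_val_cat /= mulg1.
  by rewrite red1 redp size_rcons.
have := H _ rc; rewrite (negbTE s1) su => /(_ isT) /esym.
rewrite rE cat_rcons word_val_cat /= => suw.
have : nneg (act (val q)^-1%g (bas s)).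
  apply: act_nneg; have [_ ->] := reduced_cat (r := [:: s]) (esym redq).
  by rewrite -[(gen s * _)%g]/(val (s :: q)) redq.
have := sideP rc suw; rewrite !invMg !actM !actK cgenV act_gen.
rewrite refl_self ?bas_form1 // actN => h1 h2.
have /negP[] := root_neq0 (root_act (val q)^-1%g (root_bas s)).
apply/eqP/ffunP => t; have := h1 t; have := h2 t; rewrite !ffunE => h3 h4.
by apply/eqP; rewrite eq_le h3 -oppr_ge0 h4.
Qed.

End RootSides.

(** * Roots with common sides, and dominating functionals *)

Section CrossingRoots.
Variables (R : realType) (W : coxeterSystem).
Local Notation S := (cox_gens W).
Local Notation V := {ffun S -> R}.
Local Notation B := (@cox_form W R).
Local Notation gen := (@cox_gen W).
Local Notation len := (@cox_length W).
Local Notation val := (word_val gen).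
Local Notation bas := (@bas R W).
Local Notation act := (@act R W).
Implicit Types (x y z a b c : V) (s t : S) (u v w : cox_group W).

Lemma act_lin w x y (k : R) : act w (x + k *: y) = act w x + k *: act w y.
Proof. by rewrite actD actZ. Qed.

Lemma sig_incr (k : R) n : 1 <= k -> 0 <= sig k n /\ sig k n + 1 <= sig k n.+1.
Proof.
move=> k1; elim: n => [|n [IH1 IH2]]; first by rewrite /=; split; lra.
by split; first lra; rewrite sigSS; nra.
Qed.

Lemma sep_uniq_bound u w (f : nat -> V) : injective f ->
  ~ (forall n, root (f n) /\ side (f n) u != side (f n) w).
Proof.
move=> finj h; have [l [_ lP]] := sep_list R u w.
have us : uniq [seq f n | n <- iota 0 (size l).+1].
  by rewrite map_inj_uniq // iota_uniq.
have sub : {subset [seq f n | n <- iota 0 (size l).+1] <= l}.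
  by move=> c /mapP[n _ ->]; have [? ?] := h n; apply: lP.
by have := uniq_leq_size us sub; rewrite size_map size_iota ltnn.
Qed.

(** If B a b <= -1, alternating the two reflections produces infinitely many roots that are
    nonnegative combinations of [a] and [b]; all of them would separate [u] from [w]. *)
Lemma cross_gtN1 a b u w : root a -> root b -> side a u -> side b u ->
  ~~ side a w -> ~~ side b w -> -1 < B a b.
Proof.
move=> ra rb au bu aw bw; rewrite ltNge; apply/negP => le1.
pose k := - B a b; have k1 : 1 <= k by rewrite /k; lra.
pose d n x y : V := sig k n.+1 *: x + sig k n *: y.
have dS n x y : B x x = 1 -> B x y = - k -> refl x (d n y x) = d n.+1 x y.
  move=> x1 xy; rewrite /d /refl !formE x1 xy sigSS; apply/ffunP => s.
  by rewrite !ffunE /GRing.scale /=; ring.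
have rd n : root (d n a b) /\ root (d n b a).
  elim: n => [|n [IH1 IH2]].
    by rewrite /d /= !scale0r !addr0 !scale1r.
  have ab : B a b = - k by rewrite /k opprK.
  have ba : B b a = - k by rewrite formC.
  have [r rE] := root_refl ra; have [r' rE'] := root_refl rb.
  by rewrite -(dS n a b) -?(dS n b a) ?root_form // -rE -rE'; split; apply: root_act.
have rhod n v : rho (act v^-1%g (d n a b)) =
    sig k n.+1 * rho (act v^-1%g a) + sig k n * rho (act v^-1%g b).
  by rewrite /d actD !actZ rhoD !rhoZ.
have sg n := sig_incr n k1.
have := @sep_uniq_bound u w (fun n => d n a b); apply.
  have incr n : rho (act u^-1%g (d n a b)) < rho (act u^-1%g (d n.+1 a b)).
    rewrite !rhod; have := side_ge1 ra au; have := side_ge1 rb bu.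
    have [s1 s2] := sg n; have [s3 s4] := sg n.+1; nra.
  apply: (@inj_compr _ _ _ (fun x => rho (act u^-1%g x))).
  have mono := homo_ltn lt_trans incr.
  by move=> m n /= e; case: (ltngtP m n) => // /mono; rewrite e ltxx.
move=> n; split; first by case: (rd n).
have [s1 s2] := sg n.
have -> : side (d n a b) u.
  by rewrite /side rhod; have := side_ge1 ra au; have := side_ge1 rb bu; nra.
suff -> : side (d n a b) w = false by [].
apply/negbTE; rewrite /side rhod -leNgt.
by have := side_leN1 ra aw; have := side_leN1 rb bw; nra.
Qed.

Lemma nneg_refl_bas c s : root c -> nneg c -> c <> bas s -> nneg (act (gen s) c).
Proof.
move=> rc c0 cs; have s1 : side c 1%g by rewrite nneg_side // invg1 act1.
have [e|/(side_gen rc)] := eqVneq (side c (1%g * gen s)%g) (side c 1%g).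
  by have := sideP rc (etrans e s1); rewrite mul1g cgenV.
rewrite act1; case=> [/cs//|cE]; by have := c0 s; rewrite cE !ffunE eqxx oppr_ge0 ler10.
Qed.

(* An instance of the description of the Tits cone: [xi] is negative on finitely
   many positive roots only. *)
Lemma dominate (xi : V -> R) (l : seq V) :
  (forall x y k, xi (x + k *: y) = xi x + k * xi y) ->
  (forall c, root c -> nneg c -> xi c < 0 -> c \in l) ->
  exists w, forall s, 0 <= xi (act w (bas s)).
Proof.
have [n] := ubnP (size l); elim: n xi l => // n IH xi l ln lin lP.
have [h|/existsNP[s sN]] := pselect (forall s, 0 <= xi (bas s)).
  by exists 1%g => s; rewrite act1.
have xs : xi (bas s) < 0 by rewrite ltNge; apply/negP.
have sl : bas s \in l by apply: lP xs; [exact: root_bas|move=> t; rewrite ffunE ler0n].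
have xi0 : xi 0 = 0 by have := lin 0 0 1; rewrite scaler0 addr0; lra.
(* The reflection [gen s] permutes the positive roots other than [bas s], so composing [xi] with it
   removes one root from the list. *)
pose l' := [seq act (gen s) c | c <- l & c != bas s].
have [|x y k|c rc c0 cn|w wP] := IH (fun x => xi (act (gen s) x)) l'.
- rewrite size_map size_filter.
  have : (count (pred1 (bas s)) l + count (fun c => c != bas s) l = size l)%N.
    by rewrite -(count_predC (pred1 (bas s))).
  have : (0 < count (pred1 (bas s)) l)%N by rewrite -has_count has_pred1.
  by move: ln; lia.
- by rewrite actD actZ lin.
- have cs : c <> bas s.
    move=> e; move: cn; rewrite e act_gen refl_self ?bas_form1 //.
    have := lin 0 (bas s) (-1); rewrite add0r scaleN1r xi0; lra.
  apply/mapP; exists (act (gen s) c); last by rewrite -actM cgenK act1.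
  rewrite mem_filter lP ?andbT //; [|exact: root_act|exact: nneg_refl_bas].
  apply/eqP => e; have := c0 s; rewrite -[c](actK (gen s)) e cgenV act_gen.
  by rewrite refl_self ?bas_form1 // !ffunE eqxx oppr_ge0 ler10.
by exists (gen s * w)%g => t; rewrite actM.
Qed.

(** As long as r >= 1, each difference of consecutive terms drops by at least 2 - 2 t > 0, so the
    sequence would tend to minus infinity. *)
Lemma concave_eventually_neg (r : nat -> R) (t : R) : t < 1 ->
  (forall k, r k.+2 = 2 * t * r k.+1 - r k) -> ~ (forall k, 1 <= r k).
Proof.
move=> t1 rec r1.
pose e := 2 - 2 * t; have e0 : 0 < e by rewrite /e; lra.
have d k : r k.+1 - r k <= r 1%N - r 0%N - e * k%:R.
  elim: k => [|k IH]; first by rewrite mulr0 subr0.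
  by rewrite rec -natr1 /e; have := r1 k.+1; rewrite /e in e0 IH *; nra.
pose A := r 1%N - r 0%N.
have [n nP] : exists n : nat, forall k, (n <= k)%N -> A - e * k%:R <= -1.
  exists (Num.truncn ((A + 1) / e)).+1 => k nk.
  have := truncnS_gt ((A + 1) / e); rewrite ltr_pdivrMr // => h.
  have : (Num.truncn ((A + 1) / e)).+1%:R <= k%:R :> R by rewrite ler_nat.
  by nra.
have lin k : r (n + k)%N <= r n - k%:R.
  elim: k => [|k IH]; first by rewrite addn0 subr0.
  rewrite addnS -natr1; have := d (n + k)%N; have := nP (n + k)%N (leq_addr _ _).
  by rewrite /A; lra.
have := lin (Num.truncn (r n)).+1; have := r1 (n + (Num.truncn (r n)).+1)%N.
by have := truncnS_gt (r n); lra.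
Qed.

End CrossingRoots.

(** * Crossing roots lie in a finite parabolic subsystem *)

Section FiniteValues.
Variables (R : realType) (W : coxeterSystem).
Local Notation S := (cox_gens W).
Local Notation V := {ffun S -> R}.
Local Notation B := (@cox_form W R).
Local Notation gen := (@cox_gen W).
Local Notation len := (@cox_length W).
Local Notation val := (word_val gen).
Local Notation bas := (@bas R W).
Local Notation act := (@act R W).
Implicit Types (x y z a b c : V) (s t : S) (u v w : cox_group W).

Definition supp_in (J : {set S}) x := forall s, s \notin J -> x s = 0.

Lemma iter_period (T : Type) (f : T -> T) (x : T) m n :
  iter m f x = x -> iter (n * m) f x = x.
Proof. by move=> h; elim: n => // n IH; rewrite mulSn iterD IH. Qed.

Section Rotation.
Variables (a b : V).
Hypotheses (ra : root a) (rb : root b) (ab1 : `|B a b| < 1).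
Let f x := refl a (refl b x).
Let beta := B a b.
Let a1 : B a a = 1. Proof. exact: root_form. Qed.
Let b1 : B b b = 1. Proof. exact: root_form. Qed.
Let betalt : -1 < beta < 1. Proof. by rewrite -ltr_norml. Qed.
Let tau := 2 * beta ^+ 2 - 1.
Let tau1 : tau < 1. Proof. by rewrite /tau; case/andP: betalt => ? ?; nra. Qed.

Let f_lin x y k : f (x + k *: y) = f x + k *: f y.
Proof. by rewrite /f !(reflD, reflZ). Qed.

Let f_rec p q : let x := p *: a + q *: b in f (f x) = (2 * tau) *: f x - x.
Proof.
have ba : B b a = beta by rewrite formC.
lazy zeta; rewrite /f /refl !formE a1 b1 ba -/beta /tau.
by apply/ffunP => s; rewrite !ffunE /GRing.scale /=; ring.
Qed.

Let iter_plane k (p q : R) : exists p' q', iter k f (p *: a + q *: b) = p' *: a + q' *: b.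
Proof.
elim: k => [|k [p' [q' IH]]]; first by exists p, q.
rewrite iterS IH /f /refl; set P := B b _; set Q := B a _.
exists (p' - 2 * Q), (q' - 2 * P); apply/ffunP => s.
by rewrite !ffunE /GRing.scale /=; ring.
Qed.

(* The height of the orbit of a root under the rotation cannot keep a constant
   sign, and each change of sign happens at one of finitely many roots. *)
Let orbit_period c p q : root c -> c = p *: a + q *: b ->
  exists m, (0 < m)%N /\ iter m f c = c.
Proof.
move=> rc cE; have [r rE] : exists r, forall x, f x = act r x.
  have [u uE] := root_refl ra; have [w wE] := root_refl rb.
  by exists (u * w)%g => x; rewrite actM wE uE.
have rk k : root (iter k f c) by elim: k => // k IH; rewrite iterS rE; apply: root_act.
have rec k : rho (iter k.+2 f c) = 2 * tau * rho (iter k.+1 f c) - rho (iter k f c).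
  rewrite !iterS cE; have [p' [q' ->]] := iter_plane k p q.
  by rewrite f_rec rhoD rhoN rhoZ.
have abs k : rho (iter k f c) <= -1 \/ 1 <= rho (iter k f c).
  by have := rho_root_abs (rk k); rewrite ler_normr => /orP[]; lra.
have recs (e : R) K k : e * rho (iter (K + k.+2) f c) =
    2 * tau * (e * rho (iter (K + k.+1) f c)) - e * rho (iter (K + k) f c).
  by rewrite !addnS rec; ring.
have pos K : exists2 k, (K <= k)%N & 1 <= rho (iter k f c).
  apply: contrapT => h; apply: (concave_eventually_neg tau1 (recs (-1) K)) => k.
  have [|h1] := abs (K + k)%N; first by rewrite mulN1r; lra.
  by exfalso; apply: h; exists (K + k)%N; rewrite ?leq_addr.
have neg K : exists2 k, (K <= k)%N & rho (iter k f c) <= -1.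
  apply: contrapT => h; apply: (concave_eventually_neg tau1 (recs 1 K)) => k.
  have [h1|] := abs (K + k)%N; last by rewrite mul1r.
  by exfalso; apply: h; exists (K + k)%N; rewrite ?leq_addr.
have chg K : exists2 k, (K <= k)%N & 1 <= rho (iter k f c) /\ rho (iter k.+1 f c) <= -1.
  have [k Kk k1] := pos K; have [j kj j1] := neg k.
  apply: contrapT => h.
  suff /(_ (j - k)%N) : forall i, 1 <= rho (iter (k + i) f c) by rewrite subnKC //; lra.
  elim=> [|i IH]; rewrite ?addn0 // addnS; have [h1|//] := abs (k + i).+1.
  by exfalso; apply: h; exists (k + i)%N => //; apply: leq_trans (leq_addr _ _).
have [l [_ lP]] := sep_list R 1%g r^-1%g.
have inl k : 1 <= rho (iter k f c) -> rho (iter k.+1 f c) <= -1 -> iter k f c \in l.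
  move=> h1 h2; apply: lP => //; rewrite /side invg1 act1 invgK -rE -iterS.
  have -> : 0 < rho (iter k f c) by apply: lt_le_trans ltr01 h1.
  suff -> : (0 < rho (iter k.+1 f c)) = false by [].
  by apply/negbTE; rewrite -leNgt (le_trans h2) // lerN10.
pose nx K := projT1 (cid2 (chg K)).
have nxP K : [/\ (K <= nx K)%N, 1 <= rho (iter (nx K) f c) & rho (iter (nx K).+1 f c) <= -1].
  by rewrite /nx; case: cid2 => k /= ? [].
pose g n := iter n (fun K => nx K.+1) (nx 0%N).
have gP n : iter (g n) f c \in l.
  case: n => [|n]; [have [_] := nxP 0%N|have [_] := nxP (g n).+1]; exact: inl.
have gincr n : (g n < g n.+1)%N by have [] := nxP (g n).+1.
have gmono := homo_ltn ltn_trans gincr.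
have : ~~ uniq [seq iter (g n) f c | n <- iota 0 (size l).+1].
  apply/negP => us; have : {subset [seq iter (g n) f c | n <- iota 0 (size l).+1] <= l}.
    by move=> x /mapP[n _ ->].
  by move/(uniq_leq_size us); rewrite size_map size_iota ltnn.
move=> nu; have [i [j [ij e]]] : exists i j, (i < j)%N /\ iter (g i) f c = iter (g j) f c.
  apply: contrapT => h; case/negP: nu; rewrite map_inj_uniq ?iota_uniq // => i j e.
  case: (ltngtP i j) => // ij; exfalso; apply: h.
    by exists i, j.
  by exists j, i.
exists (g j - g i)%N; have gij := gmono _ _ ij; split; first by rewrite subn_gt0.
have rinj n x y : iter n f x = iter n f y -> x = y.
  by elim: n => [//|n IH]; rewrite !iterS !rE => /(can_inj (actK r)).
apply: (rinj (g i)); rewrite -iterD subnKC ?e //; exact: ltnW.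
Qed.

Lemma rotation_period : exists n, (0 < n)%N /\ forall x, iter n f x = x.
Proof.
have [m [m0 mE]] := @orbit_period a 1 0 ra ltac:(by rewrite scale1r scale0r addr0).
have [k [k0 kE]] := @orbit_period b 0 1 rb ltac:(by rewrite scale1r scale0r add0r).
exists (k * m)%N; split=> [|x]; first by rewrite muln_gt0 k0.
have D0 : 1 - beta ^+ 2 != 0 by rewrite gt_eqF //; case/andP: betalt => ? ?; nra.
pose p := (B a x - beta * B b x) / (1 - beta ^+ 2).
pose q := (B b x - beta * B a x) / (1 - beta ^+ 2).
pose y := x - q *: b - p *: a.
have xE : x = (y + p *: a) + q *: b by rewrite /y !subrK.
have ba : B b a = beta by rewrite formC.
have ya : B a y = 0 by rewrite /y !formE a1 -/beta /p /q; field.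
have yb : B b y = 0 by rewrite /y !formE b1 ba /p /q; field.
have fy : f y = y by rewrite /f !refl_id.
have itl n z1 z2 (t : R) : iter n f (z1 + t *: z2) = iter n f z1 + t *: iter n f z2.
  by elim: n => [//|n IH]; rewrite !iterS IH f_lin.
have fyn n : iter n f y = y by elim: n => [//|n IH]; rewrite iterS IH.
by rewrite xE !itl fyn (iter_period k mE) mulnC (iter_period m kE).
Qed.

(** [xi] sums [rho] over the powers of the finite-order rotation: it vanishes on the plane of [a]
    and [b] and is nonpositive on finitely many positive roots only. After conjugation by the [w] of
    [dominate] it is nonnegative on the simple roots, and its zeros among them form [J]. *)
Lemma crossing_spherical : exists w (J : {set S}) (l : seq V),
  [/\ supp_in J (act w^-1%g a), supp_in J (act w^-1%g b) &
      forall c, root c -> supp_in J c -> c \in l].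
Proof.
have [n [n0 nP]] := rotation_period.
have [r rE] : exists r, forall x, f x = act r x.
  have [u uE] := root_refl ra; have [w wE] := root_refl rb.
  by exists (u * w)%g => x; rewrite actM wE uE.
have rkE k x : iter k f x = act (r ^+ k)%g x.
  by elim: k => [|k IH]; rewrite ?expg0 ?act1 // iterS IH rE expgS actM.
pose xi x := \sum_(j < n) rho (iter j f x).
have xi_lin x y (k : R) : xi (x + k *: y) = xi x + k * xi y.
  rewrite /xi mulr_sumr -big_split; apply: eq_bigr => j _.
  by rewrite !rkE act_lin rhoD rhoZ.
have xiN x : xi (- x) = - xi x.
  have xi0 : xi 0 = 0 by rewrite /xi big1 // => j _; rewrite rkE act0 rho0.
  by have := xi_lin 0 x (-1); rewrite scaleN1r add0r xi0; lra.
(* The orbit sum [u] is fixed by the rotation, whose trace on the plane is 2 tau < 2, so [u]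
   vanishes. *)
have xiP p q : xi (p *: a + q *: b) = 0.
  pose u := \sum_(j < n) iter j f (p *: a + q *: b).
  suff u0 : u = 0 by rewrite /xi -rho_sum -/u u0 rho0.
  have fu : f u = u.
    rewrite /u rE act_sum; under eq_bigr do rewrite -rE -iterS.
    case: (n) n0 nP => // m _ mP.
    by rewrite big_ord_recr [RHS]big_ord_recl /= -iterS mP addrC.
  have [p' [q' uE]] : exists p' q', u = p' *: a + q' *: b.
    rewrite /u; apply: (big_ind (fun z => exists p' q', z = p' *: a + q' *: b)) => [|x y|j _].
    - by exists 0, 0; rewrite !scale0r addr0.
    - move=> [p1 [q1 ->]] [p2 [q2 ->]]; exists (p1 + p2), (q1 + q2).
      by rewrite !scalerDl addrACA.
    - exact: iter_plane.
  have := f_rec p' q'; rewrite /= -uE !fu => h.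
  have : (2 - 2 * tau) *: u = 0.
    apply/ffunP => s; have /ffunP/(_ s) := h.
    rewrite !ffunE /GRing.scale /= => e; move: (u s) tau e => us t e; lra.
  move/eqP; rewrite scaler_eq0 => /orP[|/eqP //].
  by move: tau1; move: tau => t t1; rewrite gt_eqF //; lra.
(* A positive root with xi <= 0 has a nonpositive [rho] at some rotate f^j, so it separates 1 from
   r^-j; there are only n values of j. *)
have [L LP] : exists L : seq V, forall c, root c -> nneg c -> xi c <= 0 -> c \in L.
  have sl j := projT1 (cid (sep_list R 1%g (r ^- j)%g)).
  pose L := flatten [seq projT1 (cid (sep_list R 1%g (r ^- j)%g)) | j <- iota 0 n].
  exists L => c rc c0 xc; have rc1 := rho_root_ge1 rc c0.
  have [j jn jP] : exists2 j, (j < n)%N & rho (iter j f c) <= 0.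
    apply: contrapT => h; suff : 0 < xi c by rewrite ltNge xc.
    rewrite /xi; case: (n) n0 h => // m _ h; rewrite big_ord_recl /=.
    rewrite ltr_wpDr ?(lt_le_trans ltr01) // sumr_ge0 // => i _.
    by rewrite leNgt; apply/negP => /ltW ?; apply: h; exists (lift ord0 i).
  apply/flatten_mapP; exists j; first by rewrite mem_iota.
  case: cid => l /= [_]; apply=> //.
  rewrite nneg_side ?invg1 ?act1 // /side invgK -rkE.
  by rewrite ltNge jP.
have [w wP] : exists w, forall s, 0 <= xi (act w (bas s)).
  by apply: (@dominate R W xi L) => // c rc c0 /ltW; apply: LP.
pose J := [set s | xi (act w (bas s)) == 0]%SET.
have xiw x : xi (act w x) = \sum_s x s * xi (act w (bas s)).
  rewrite {1}[x]bas_sum act_sum; elim/big_rec2: _ => [|s y z _ IH].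
    by have := xi_lin 0 0 (-1); rewrite scaler0 addr0; lra.
  by rewrite actZ addrC xi_lin IH addrC.
have xiJ c : nneg c -> xi (act w c) = 0 -> supp_in J c.
  move=> c0; rewrite xiw => /eqP; rewrite psumr_eq0; last by move=> s _; rewrite mulr_ge0.
  move=> /allP h s; rewrite inE => sJ; have := h s; rewrite mem_index_enum => /(_ isT).
  by rewrite mulf_eq0 (negbTE sJ) orbF => /eqP.
have suppN c : supp_in J (- c) -> supp_in J c.
  by move=> h s sJ; have := h s sJ; rewrite ffunE => /eqP; rewrite oppr_eq0 => /eqP.
have inJ c : root c -> xi c = 0 -> supp_in J (act w^-1%g c).
  move=> rc xc; have [h|h] := root_sign (root_act w^-1%g rc).
    by apply: xiJ; rewrite ?actVK.
  by apply: suppN; apply: xiJ; rewrite // actN actVK xiN xc oppr0.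
exists w, J, ([seq act w^-1%g c | c <- L] ++ [seq - act w^-1%g c | c <- L]); split.
- by apply: inJ; rewrite // -(xiP 1 0) scale1r scale0r addr0.
- by apply: inJ; rewrite // -(xiP 0 1) scale1r scale0r add0r.
move=> c rc cJ.
have xc : xi (act w c) = 0.
  rewrite xiw big1 // => s _; have [sJ|sJ] := boolP (s \in J).
    by move: sJ; rewrite inE => /eqP ->; rewrite mulr0.
  by rewrite cJ // mul0r.
rewrite mem_cat; have [h|h] := root_sign (root_act w rc).
  apply/orP; left; apply/mapP; exists (act w c); last by rewrite actK.
  by apply: LP; rewrite ?xc //; apply: root_act.
apply/orP; right; apply/mapP; exists (- act w c); last by rewrite actN actK opprK.
by apply: LP; rewrite ?xiN ?xc ?oppr0 //; apply/rootN/root_act.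
Qed.

End Rotation.
End FiniteValues.

(** * No infinite sequence of pairwise crossing walls *)

Section NoCrossingSequence.
Variables (R : realType) (W : coxeterSystem).
Local Notation S := (cox_gens W).
Local Notation V := {ffun S -> R}.
Local Notation B := (@cox_form W R).
Local Notation gen := (@cox_gen W).
Local Notation len := (@cox_length W).
Local Notation val := (word_val gen).
Local Notation bas := (@bas R W).
Local Notation act := (@act R W).
Implicit Types (x y z a b c : V) (s t : S) (u v w : cox_group W).

(** Conjugation moves a crossing pair into the span of one of finitely many [J], each of which
    supports finitely many roots. *)
Lemma crossing_values : exists vals : seq R, forall a b, root a -> root b ->
  `|B a b| < 1 -> B a b \in vals.
Proof.
have [L LP] : exists L : {set S} -> seq V, forall J (l : seq V),
    (forall c, root c -> supp_in J c -> c \in l) ->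
    (forall c, root c -> supp_in J c -> c \in L J).
  have [L LP] := @choice _ _ (fun J l' => forall l : seq V,
    (forall c, root c -> supp_in J c -> c \in l) ->
    (forall c, root c -> supp_in J c -> c \in l'))
    (fun J => match pselect (exists l : seq V,
       (forall c, root c -> supp_in J c -> c \in l)) with
       | left h => let: ex_intro l lP := h in ex_intro _ l (fun _ _ => lP)
       | right h => ex_intro _ [::] (fun l lP => False_ind _ (h (ex_intro _ l lP)))
       end).
  by exists L => J l; apply: LP.
exists (flatten [seq [seq B x y | x <- L J, y <- L J] | J <- enum {set S}]).
move=> a b ra rb ab; have [w [J [l [aJ bJ lP]]]] := crossing_spherical ra rb ab.
apply/flatten_mapP; exists J; first by rewrite mem_enum.
apply/allpairsP; exists (act w^-1%g a, act w^-1%g b) => /=; split.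
- by apply: LP lP _ _ aJ; apply: root_act.
- by apply: LP lP _ _ bJ; apply: root_act.
- by rewrite act_form.
Qed.

Lemma lin_dep k (y : 'I_k -> V) : (#|S| < k)%N ->
  exists c : 'I_k -> R, (exists i, c i != 0) /\ \sum_i c i *: y i = 0.
Proof.
move=> Sk; pose A : 'M[R]_(k, #|S|) := \matrix_(i, j) y i (enum_val j).
have /rowV0Pn[v /sub_kermxP vA v0] : kermx A != 0.
  rewrite kermx_eq0 /row_free neq_ltn; apply/orP; left.
  exact: leq_ltn_trans (rank_leq_col A) Sk.
exists (v ord0); split.
  by have /rV0Pn[i vi] := v0; exists i.
apply/ffunP => s; rewrite sum_ffunE !ffunE.
move/matrixP/(_ ord0 (enum_rank s)) : vA; rewrite !mxE => e; rewrite -[RHS]e.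
by apply: eq_bigr => i _; rewrite ffunE mxE enum_rankK.
Qed.

(** The differences with the last vector have Gram matrix (1 - t) times identity plus all-ones
    matrix. It is positive definite, so there are at most #|S| of them. *)
Lemma no_simplex k (x : 'I_k -> V) (t : R) : (#|S|.+1 < k)%N -> `|t| < 1 ->
  (forall i, B (x i) (x i) = 1) -> (forall i j : 'I_k, (i < j)%N -> B (x i) (x j) = t) ->
  False.
Proof.
case: k x => // k x Sk t1 xx xt.
have xt' i j : i != j -> B (x i) (x j) = t.
  by rewrite neq_ltn => /orP[|] h; [exact: xt|rewrite formC; exact: xt].
pose y i := x (widen_ord (leqnSn k) i) - x ord_max.
have [c [[i0 ci0] c0]] := lin_dep y Sk.
move: t1; rewrite ltr_norml => /andP[t1 t2].
have : B (\sum_i c i *: y i) (\sum_i c i *: y i) = 0 by rewrite c0 form0l.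
rewrite form_suml.
have yy i j : B (y i) (y j) = (1 - t) * (i == j)%:R + (1 - t).
  have nmax (l : 'I_k) : widen_ord (leqnSn k) l != ord_max.
    by rewrite -val_eqE /= neq_ltn ltn_ord.
  rewrite /y !formE xx (xt' _ _ (nmax i)) (formC (x ord_max)) (xt' _ _ (nmax j)).
  have [->|ij] := eqVneq i j; first by rewrite xx /= mulr1; ring.
  by rewrite xt' ?(inj_eq (@widen_ord_inj _ _ _)) //= mulr0; ring.
have -> : \sum_i B (c i *: y i) (\sum_j c j *: y j) =
    (1 - t) * \sum_i c i ^+ 2 + (1 - t) * (\sum_i c i) ^+ 2.
  rewrite [in X in _ + X]expr2 mulr_suml !mulr_sumr -big_split.
  apply: eq_bigr => i _ /=; rewrite formZl form_sumr.
  have -> : \sum_j B (y i) (c j *: y j) =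
      \sum_j ((1 - t) * (c j * (i == j)%:R) + (1 - t) * c j).
    by apply: eq_bigr => j _; rewrite formZr yy; ring.
  rewrite big_split -!mulr_sumr /= (bigD1 i) //= eqxx big1 ?addr0.
    by rewrite mulr1; ring.
  by move=> j; rewrite eq_sym => /negbTE ->; rewrite mulr0.
move=> h; suff : \sum_i c i ^+ 2 = 0.
  move/eqP; rewrite psumr_eq0; last by move=> i _; rewrite sqr_ge0.
  by move/allP/(_ i0); rewrite mem_index_enum sqrf_eq0 (negbTE ci0) => /(_ isT).
have := sqr_ge0 (\sum_i c i); have : 0 <= \sum_i c i ^+ 2.
  by apply: sumr_ge0 => i _; rewrite sqr_ge0.
by move: h; nra.
Qed.

Lemma infinite_color (T C : choiceType) (A : set T) (f : T -> C) (vals : seq C) :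
  infinite_set A -> (forall p, A p -> f p \in vals) ->
  exists2 q, q \in vals & infinite_set (A `&` [set p | f p = q]).
Proof.
move=> Ai Af; apply: contrapT => h; apply: Ai.
apply: (@sub_finite_set _ _ (\bigcup_(q in [set` vals]) (A `&` [set p | f p = q]))).
  by move=> p Ap; exists (f p) => //=; exact: Af.
apply: bigcup_finite; first exact: finite_seq.
by move=> q vq; apply: contrapT => vi; apply: h; exists q.
Qed.

(** The infinite Ramsey argument: an entry (i, v) records that [f i j] equals v for every later
    index j of the sequence. *)
Lemma monochromatic_seq (C : choiceType) (f : nat -> nat -> C) (vals : seq C) n
    (A : set nat) : infinite_set A -> (forall i j, (i < j)%N -> f i j \in vals) ->
  exists s : seq (nat * C), [/\ size s = n,
    pairwise (fun p q => (p.1 < q.1)%N && (f p.1 q.1 == p.2)) s,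
    forall p, p \in s -> A p.1 & forall p, p \in s -> p.2 \in vals].
Proof.
move=> Ai fv; elim: n A Ai => [|n IH] A Ai; first by exists [::].
have [i Ai'] : exists i, A i.
  by apply: contrapT => h; apply: Ai; rewrite (_ : A = set0) // -subset0 => i Ai; apply: h; exists i.
pose A1 := A `&` [set j | (i < j)%N].
have A1i : infinite_set A1.
  move=> fin; apply: Ai; apply: (@sub_finite_set _ _ (A1 `|` `I_i.+1)).
    by move=> j Aj; have [ij|ij] := ltnP i j; [left|right].
  by rewrite finite_setU; split => //; exact: finite_II.
have [v vv A2i] : exists2 v, v \in vals & infinite_set (A1 `&` [set j | f i j = v]).
  by apply: infinite_color => // j [_ ij]; exact: fv.
have [s [sn sp sA sv]] := IH _ A2i.
exists ((i, v) :: s); split => //=; first by rewrite sn.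
- rewrite sp andbT; apply/allP => p /sA[[_ /= ->] ->] /=; exact: eqxx.
- by move=> p; rewrite inE => /orP[/eqP-> //|/sA[[]]].
- by move=> p; rewrite inE => /orP[/eqP-> //|/sv].
Qed.

Lemma no_crossing_seq (a : nat -> V) : (forall n, root (a n)) ->
  ~ (forall i j, (i < j)%N -> `|B (a i) (a j)| < 1).
Proof.
move=> ra ab; have [vals vP] := crossing_values.
pose M := #|S|.+2; pose f i j := B (a i) (a j).
have [s [ss sp _ sv]] := @monochromatic_seq _ f vals
  (size vals * M).+1 setT infinite_nat (fun i j ij => vP _ _ (ra i) (ra j) (ab i j ij)).
(* With more than [size vals * M] entries, some value is carried by M of them, and these form a set
   forbidden by [no_simplex]. *)
have [q Mq] : exists q, (M <= size [seq p <- s | p.2 == q])%N.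
  apply: contrapT => h; suff : (size s <= size vals * M)%N by rewrite ss ltnn.
  elim: (vals) s sv h {ss sp} => [|q l IH] s sv h.
    by case: s sv {h} => // p s /(_ p); rewrite inE eqxx => /(_ isT).
  rewrite -(count_predC (fun p => p.2 == q)) mulSn leq_add //.
    by rewrite -size_filter leqNgt; apply/negP => /ltnW Mq; apply: h; exists q.
  rewrite -size_filter; apply: IH => [p|[z Mu]].
    by rewrite mem_filter /= => /andP[pv /sv]; rewrite inE (negbTE pv).
  apply: h; exists z; apply: (leq_trans Mu); rewrite -filter_predI !size_filter.
  by apply: sub_count => p /= /andP[].
set s' := [seq p <- s | p.2 == q] in Mq.
have sp' : pairwise (fun p q => (p.1 < q.1)%N && (f p.1 q.1 == p.2)) s'.
  exact: (subseq_pairwise (filter_subseq _ _) sp).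
pose d : nat * R := (0%N, 0); pose x (i : 'I_M) := a (nth d s' i).1.
have xx (i j : 'I_M) : (i < j)%N -> B (x i) (x j) = q.
  move=> ij; have := pairwiseP d sp' i j; rewrite !inE.
  rewrite !(leq_trans (ltn_ord _) Mq) => /(_ isT isT ij) /andP[_ /eqP fe].
  rewrite -[LHS]/(f (nth d s' i).1 (nth d s' j).1) fe.
  have : nth d s' i \in s' by rewrite mem_nth // (leq_trans (ltn_ord i) Mq).
  by rewrite mem_filter => /andP[/eqP].
apply: (@no_simplex M x q); [by []| |by move=> i; apply/root_form/ra|exact: xx].
rewrite -(xx ord0 ord_max) //; apply: ab.
have M0 : (0 < size s')%N by apply: leq_trans Mq.
have M1 : (M.-1 < size s')%N by apply: leq_trans Mq.
by have := pairwiseP d sp' 0%N M.-1; rewrite !inE M0 M1 => /(_ isT isT isT) /andP[].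
Qed.

End NoCrossingSequence.

(** * Cells of the Davis complex *)

Section Spherical.
Variables (R : realType) (W : coxeterSystem).
Local Notation S := (cox_gens W).
Local Notation V := {ffun S -> R}.
Local Notation B := (@cox_form W R).
Local Notation gen := (@cox_gen W).
Local Notation len := (@cox_length W).
Local Notation val := (word_val gen).
Local Notation bas := (@bas R W).
Local Notation act := (@act R W).
Implicit Types (x y z a b c : V) (s t : S) (u v w : cox_group W).

Implicit Types J K L : {set S}.

Lemma par1 J : parabolic J 1%g. Proof. by exists [::]. Qed.
Lemma parM J u w : parabolic J u -> parabolic J w -> parabolic J (u * w)%g.
Proof.
move=> [p pJ <-] [q qJ <-]; exists (p ++ q); last by rewrite word_val_cat.
by rewrite all_cat pJ.
Qed.
Lemma parV J u : parabolic J u -> parabolic J u^-1%g.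
Proof. by move=> [p pJ <-]; exists (rev p); rewrite ?all_rev // word_valV. Qed.
Lemma par_gen J s : s \in J -> parabolic J (gen s).
Proof. by move=> sJ; exists [:: s]; rewrite /= ?mulg1 // andbT. Qed.
Lemma par_sub J K w : J \subset K -> parabolic J w -> parabolic K w.
Proof.
move=> /fintype.subsetP JK [p pJ <-]; exists p => //; apply/allP => s sp.
exact/JK/(allP pJ).
Qed.

Lemma par_ind J (P : cox_group W -> Prop) : P 1%g ->
  (forall s w, s \in J -> parabolic J w -> P w -> P (gen s * w)%g) ->
  forall w, parabolic J w -> P w.
Proof.
move=> P1 Ps w [p pJ <-]; elim: p pJ => //= s p IH /andP[sJ pJ].
by apply: Ps => //; [exists p|exact: IH].
Qed.

Lemma supp_inD J x y : supp_in J x -> supp_in J y -> supp_in J (x + y).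
Proof. by move=> xJ yJ s sJ; rewrite ffunE xJ // yJ // addr0. Qed.
Lemma supp_inZ J (k : R) x : supp_in J x -> supp_in J (k *: x).
Proof. by move=> xJ s sJ; rewrite ffunE xJ // scaler0. Qed.
Lemma supp_inN J x : supp_in J x -> supp_in J (- x).
Proof. by move=> xJ s sJ; rewrite ffunE xJ // oppr0. Qed.
Lemma supp_inB J x y : supp_in J x -> supp_in J y -> supp_in J (x - y).
Proof. by move=> xJ yJ; apply: supp_inD xJ (supp_inN yJ). Qed.
Lemma supp_in_bas J s : s \in J -> supp_in J (bas s).
Proof. by move=> sJ t tJ; rewrite ffunE; case: eqP tJ => // ->; rewrite sJ. Qed.
Lemma supp_in_sub J K x : J \subset K -> supp_in J x -> supp_in K x.
Proof.
by move=> /fintype.subsetP JK xJ s sK; apply: xJ; apply: contraNN sK; exact: JK.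
Qed.

Lemma act_par_out J v x t : parabolic J v -> t \notin J -> act v x t = x t.
Proof.
move=> vJ tJ; move: v vJ.
apply: (@par_ind J (fun v => act v x t = x t)) => [|s w sJ _ <-]; first by rewrite act1.
rewrite actM act_gen !ffunE; have -> : (t == s) = false.
  by apply/negbTE; apply: contraNneq tJ => ->.
by rewrite scaler0 subr0.
Qed.

Lemma act_par_supp J v x : parabolic J v -> supp_in J x -> supp_in J (act v x).
Proof. by move=> vJ xJ t tJ; rewrite (act_par_out _ vJ) // xJ. Qed.

Lemma par_gen_mem J s : parabolic J (gen s) -> s \in J.
Proof.
move=> sJ; apply: contrapT => /negP snJ.
have := act_par_out (bas s) sJ snJ.
by rewrite act_gen refl_self ?bas_form1 // !ffunE eqxx /=; lra.
Qed.

Lemma spherical_sub J K : J \subset K -> spherical K -> spherical J.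
Proof. by move=> JK; apply: sub_finite_set => w; apply: par_sub. Qed.

Definition coord_dot x y : R := \sum_s x s * y s.

(** The coordinate scalar product averaged over the finite group W_J is an invariant positive
    definite [b0]. Invariance under a reflection gives b0 (y, e_s) = B (y, e_s) k_s, so the two
    forms agree up to scaling the simple roots. *)
Lemma spherical_posdef J x : spherical J -> supp_in J x -> x != 0 -> 0 < B x x.
Proof.
move=> /finite_seqP[l0 l0E] xJ x0.
pose l := undup l0; have lP w : (w \in l) = `[< parabolic J w >].
  by rewrite mem_undup; apply/idP/asboolP => [h|]; rewrite l0E.
pose b0 y z := \sum_(w <- l) coord_dot (act w y) (act w z).
have dotD y1 y2 z : coord_dot (y1 + y2) z = coord_dot y1 z + coord_dot y2 z.
  by rewrite -big_split; apply: eq_bigr => s _; rewrite ffunE mulrDl.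
have dotZ (k : R) y z : coord_dot (k *: y) z = k * coord_dot y z.
  by rewrite /coord_dot mulr_sumr; apply: eq_bigr => s _; rewrite ffunE -mulrA.
have dotC y z : coord_dot y z = coord_dot z y by apply: eq_bigr => s _; rewrite mulrC.
have b0D y1 y2 z : b0 (y1 + y2) z = b0 y1 z + b0 y2 z.
  by rewrite -big_split; apply: eq_bigr => w _; rewrite actD dotD.
have b0Z (k : R) y z : b0 (k *: y) z = k * b0 y z.
  by rewrite /b0 mulr_sumr; apply: eq_bigr => w _; rewrite actZ dotZ.
have b0C y z : b0 y z = b0 z y by apply: eq_bigr => w _; rewrite dotC.
have b0N y z : b0 y (- z) = - b0 y z.
  by rewrite -scaleN1r b0C b0Z mulN1r b0C.
have b00 z : b0 0 z = 0 by rewrite -(scale0r 0) b0Z mul0r.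
have b0pos y : y != 0 -> 0 < b0 y y.
  move=> y0; have dge z : 0 <= coord_dot z z by apply: sumr_ge0 => s _; rewrite -expr2 sqr_ge0.
  have l1 : 1%g \in l by rewrite lP; apply/asboolP; exact: par1.
  rewrite /b0 (perm_big _ (perm_to_rem l1)) big_cons ltr_wpDr ?sumr_ge0 //.
  rewrite act1 lt_def dge andbT; apply/eqP => /eqP.
  rewrite psumr_eq0; last by move=> s _; rewrite -expr2 sqr_ge0.
  move=> /allP h; case/eqP: y0; apply/ffunP => s; have := h s.
  by rewrite mem_index_enum => /(_ isT); rewrite mulf_eq0 orbb ffunE => /eqP.
have b0s s y z : s \in J -> b0 (act (gen s) y) (act (gen s) z) = b0 y z.
  move=> sJ; have pe : perm_eq [seq (w * gen s)%g | w <- l] l.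
    apply: uniq_perm; rewrite ?undup_uniq ?map_inj_uniq ?undup_uniq //.
      exact: mulIg.
    move=> w; rewrite lP; apply/mapP/asboolP => [[v]|wJ].
      by rewrite lP => /asboolP vJ ->; apply: parM => //; apply: par_gen.
    exists (w * gen s)%g; last by rewrite -mulgA cgenK mulg1.
    by rewrite lP; apply/asboolP; apply: parM => //; apply: par_gen.
  rewrite /b0 -[RHS](perm_big _ pe) big_map; apply: eq_bigr => w _.
  by rewrite !actM.
pose k s := b0 (bas s) (bas s).
have k0 s : 0 < k s by apply/b0pos/root_neq0/root_bas.
have kE s y : s \in J -> B y (bas s) * k s = b0 y (bas s).
  move=> sJ; have := b0s s y (bas s) sJ.
  rewrite !act_gen refl_self ?bas_form1 // /refl b0N b0D -scaleNr b0Z (formC _ y) -/(k s).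
  by lra.
have kst s t : s \in J -> t \in J -> b0 (bas s) (bas t) != 0 -> k s = k t.
  move=> sJ tJ; rewrite -kE // => h; have := kE s (bas t) sJ.
  rewrite b0C -kE // formC => /mulfI -> //.
  by apply: contraNneq h => ->; rewrite mul0r.
have sq s : 0 < Num.sqrt (k s) by rewrite sqrtr_gt0.
(* [k] takes equal values at two simple roots with nonzero product, so dividing each coordinate by
   its square root turns [b0] into the form B. *)
pose y := \sum_(s in J) (x s / Num.sqrt (k s)) *: bas s.
have yE s : y s = x s / Num.sqrt (k s).
  rewrite sum_ffunE; have [sJ|sJ] := boolP (s \in J); last first.
    rewrite xJ // mul0r big1 // => t tJ; rewrite !ffunE.
    by case: eqP sJ => [->|_]; rewrite ?tJ // scaler0.
  rewrite (bigD1 s) //= !ffunE eqxx big1 ?addr0; first by rewrite /GRing.scale /= mulr1.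
  by move=> t /andP[_ ts]; rewrite !ffunE eq_sym (negbTE ts) scaler0.
suff -> : B x x = b0 y y.
  apply: b0pos; apply: contra_neq x0 => y0; apply/ffunP => s.
  have := yE s; rewrite y0 !ffunE => /eqP; rewrite eq_sym mulf_eq0 invr_eq0.
  by rewrite (gt_eqF (sq s)) orbF => /eqP.
have xE : x = \sum_(s in J) x s *: bas s.
  rewrite {1}[x]bas_sum [RHS]big_mkcond; apply: eq_bigr => s _.
  by case: ifPn => // sJ; rewrite xJ // scale0r.
have b0_suml (F : S -> V) z : b0 (\sum_(s in J) F s) z = \sum_(s in J) b0 (F s) z.
  exact: (big_morph (fun x => b0 x z) (fun a b => b0D a b z) (b00 z)).
rewrite {1}xE form_suml [in RHS]/y b0_suml; apply: eq_bigr => s sJ.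
have -> : B (x s *: bas s) x = x s * \sum_(t in J) x t * B (bas s) (bas t).
  by rewrite formZl {2}xE form_sumr; congr (_ * _); apply: eq_bigr => t _; rewrite formZr.
rewrite b0Z b0C b0_suml !mulr_sumr; apply: eq_bigr => t tJ; rewrite b0Z.
have -> : B (bas s) (bas t) = b0 (bas s) (bas t) / k t by rewrite -kE // mulfK // gt_eqF.
rewrite (b0C (bas t)); have [->|nz] := eqVneq (b0 (bas s) (bas t)) 0.
  by rewrite mul0r !mulr0.
have kk := kst _ _ sJ tJ nz; rewrite kk.
have e : Num.sqrt (k t) * Num.sqrt (k t) = k t by rewrite -expr2 sqr_sqrtr // ltW.
rewrite -[in LHS]e; move: (sq t) => sqt; move: (b0 _ _) (x s) (x t) (Num.sqrt (k t)) sqt => ? ? ? c c0.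
by field; rewrite gt_eqF.
Qed.

Lemma spherical_form_ge0 J x : spherical J -> supp_in J x -> 0 <= B x x.
Proof.
move=> Js xJ; have [->|x0] := eqVneq x 0; first by rewrite form0l.
exact/ltW/(spherical_posdef Js).
Qed.

Definition nrm x : R := Num.sqrt (B x x).

Lemma nrm_ge0 x : 0 <= nrm x. Proof. exact: sqrtr_ge0. Qed.
Lemma nrmN x : nrm (- x) = nrm x. Proof. by rewrite /nrm !formE opprK. Qed.
Lemma nrmB x y : nrm (x - y) = nrm (y - x). Proof. by rewrite -nrmN opprB. Qed.
Lemma nrm0 : nrm 0 = 0. Proof. by rewrite /nrm form0l sqrtr0. Qed.
Lemma nrm_act w x : nrm (act w x) = nrm x. Proof. by rewrite /nrm act_form. Qed.
Lemma nrmZ (k : R) x : nrm (k *: x) = `|k| * nrm x.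
Proof. by rewrite /nrm !formE mulrA -expr2 sqrtrM ?sqr_ge0 // sqrtr_sqr. Qed.

Section PositivePart.
Variables (L : {set S}) (Ls : spherical L).

Lemma nrm_sq x : supp_in L x -> nrm x ^+ 2 = B x x.
Proof. by move=> xL; rewrite sqr_sqrtr // (spherical_form_ge0 Ls). Qed.

Lemma form_CS x y : supp_in L x -> supp_in L y -> `|B x y| <= nrm x * nrm y.
Proof.
move=> xL yL; rewrite -(@ler_pXn2r _ 2) ?nnegrE ?mulr_ge0 ?nrm_ge0 //.
rewrite real_normK ?num_real // exprMn !nrm_sq //.
have [->|y0] := eqVneq y 0; first by rewrite !form0r expr0n mulr0.
have yy := spherical_posdef Ls yL y0.
have := @spherical_form_ge0 L (B y y *: x - B x y *: y) Ls.
move=> /(_ (supp_inB (supp_inZ _ xL) (supp_inZ _ yL))); rewrite !formE (formC y x).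
by move=> h; rewrite -(ler_pM2l yy); move: h; lra.
Qed.

Lemma nrm_tri x y : supp_in L x -> supp_in L y -> nrm (x + y) <= nrm x + nrm y.
Proof.
move=> xL yL; rewrite -(@ler_pXn2r _ 2) ?nnegrE ?addr_ge0 ?nrm_ge0 //.
rewrite sqrrD !nrm_sq //; last exact: supp_inD.
rewrite !formE (formC y x); have := le_trans (ler_norm _) (form_CS xL yL); lra.
Qed.

Lemma form_bas_nrm s x : s \in L -> supp_in L x -> `|B (bas s) x| <= nrm x.
Proof.
move=> sL xL; apply: le_trans (form_CS (supp_in_bas sL) xL) _.
by rewrite {1}/nrm bas_form1 sqrtr1 mul1r.
Qed.

End PositivePart.

Definition solve J (d : S -> R) : V := xget 0 [set x : V |
  (forall s, s \notin J -> x s = 0) /\ (forall s, s \in J -> B (bas s) x = d s)].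

Lemma solve_uniq J x y : spherical J -> supp_in J x -> supp_in J y ->
  (forall s, s \in J -> B (bas s) x = B (bas s) y) -> x = y.
Proof.
move=> Js xJ yJ xy; apply/eqP; rewrite -subr_eq0; apply: contraT => n0.
have dJ := supp_inB xJ yJ; have := spherical_posdef Js dJ n0.
rewrite form_sum big1 ?ltxx // => s _; have [sJ|sJ] := boolP (s \in J).
  by rewrite formDr formNr xy // subrr mulr0.
by rewrite dJ // mul0r.
Qed.

Lemma solveP J d : spherical J ->
  supp_in J (solve J d) /\ (forall s, s \in J -> B (bas s) (solve J d) = d s).
Proof.
move=> Js; suff [x xP] : exists x, supp_in J x /\ (forall s, s \in J -> B (bas s) x = d s).
  exact: (@xgetPex _ 0 [set x : V | supp_in J x /\ (forall s, s \in J -> B (bas s) x = d s)] (ex_intro _ x xP)).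
pose n := #|S|.
(* The Gram matrix of [J], completed by the identity outside [J] to make it square over all
   generators and invertible. *)
pose G : 'M[R]_n := \matrix_(i, j) if (enum_val i \in J) && (enum_val j \in J)
  then B (bas (enum_val i)) (bas (enum_val j)) else (i == j)%:R.
have Gu : G \in unitmx.
  rewrite -row_free_unit -kermx_eq0; apply/negPn/negP => /rowV0Pn[v /sub_kermxP vG v0].
  pose x : V := [ffun s => if s \in J then v ord0 (enum_rank s) else 0].
  have xJ : supp_in J x by move=> s /negbTE sJ; rewrite ffunE sJ.
  have vn j : enum_val j \notin J -> v ord0 j = 0.
    move=> jJ; move/matrixP/(_ ord0 j): vG; rewrite !mxE (bigD1 j) //= mxE.
    rewrite (negbTE jJ) andbF eqxx mulr1 big1 ?addr0 // => i ij.
    by rewrite mxE (negbTE jJ) andbF (negbTE ij) mulr0.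
  have xB t : t \in J -> B x (bas t) = 0.
    move=> tJ; rewrite form_sum.
    move/matrixP/(_ ord0 (enum_rank t)): vG; rewrite !mxE => e; rewrite -[RHS]e.
    rewrite (reindex (@enum_val S S)) /=; last exact: (onW_bij _ (@enum_val_bij S)).
    apply: eq_bigr => i _; rewrite ffunE !mxE enum_rankK tJ andbT enum_valK.
    by case: ifPn => // iJ; rewrite mul0r vn // mul0r.
  have x0 : x != 0.
    apply: contra_neq v0 => x0; apply/rowP => j; rewrite mxE.
    have [jJ|/vn //] := boolP (enum_val j \in J).
    by have := congr1 (fun y : V => y (enum_val j)) x0; rewrite !ffunE jJ enum_valK.
  have := spherical_posdef Js xJ x0; rewrite form_sum big1 ?ltxx // => s _.
  have [sJ|sJ] := boolP (s \in J); first by rewrite formC xB // mulr0.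
  by rewrite xJ // mul0r.
pose dv : 'rV[R]_n := \row_j (if enum_val j \in J then d (enum_val j) else 0).
have [v vG] : exists v : 'rV[R]_n, v *m G = dv by exists (dv *m invmx G); rewrite mulmxKV.
pose x : V := [ffun s => if s \in J then v ord0 (enum_rank s) else 0].
exists x; split=> [s /negbTE sJ|t tJ]; first by rewrite ffunE sJ.
rewrite formC form_sum.
have vn j : enum_val j \notin J -> v ord0 j = 0.
  move=> jJ; move/matrixP/(_ ord0 j): vG; rewrite !mxE (negbTE jJ) (bigD1 j) //= mxE.
  rewrite (negbTE jJ) andbF eqxx mulr1 big1 ?addr0 // => i ij.
  by rewrite mxE (negbTE jJ) andbF (negbTE ij) mulr0.
move/matrixP/(_ ord0 (enum_rank t)): vG; rewrite !mxE enum_rankK tJ => <-.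
rewrite (reindex (@enum_val S S)) /=; last exact: (onW_bij _ (@enum_val_bij S)).
apply: eq_bigr => i _; rewrite ffunE !mxE enum_rankK tJ andbT enum_valK.
by case: ifPn => // iJ; rewrite mul0r vn // mul0r.
Qed.

Definition supp x : {set S} := [set s | x s != 0]%SET.
(** In the coordinates x_J - v, the distance of a point to the wall of s is 1 - B (e_s, x); these
    are the walls through the point. *)
Definition wall_type x : {set S} := [set s | B (bas s) x == 1]%SET.
(* [Q] is the fundamental chamber of the Davis complex, the union over the
   spherical [J] of the convex hulls of the [x_K], [K] included in [J]. *)
Definition inQ x := [/\ nneg x, spherical (supp x) & forall s, B (bas s) x <= 1].

Lemma supp_in_supp x J : supp x \subset J -> supp_in J x.
Proof.
move=> /fintype.subsetP h s sJ; apply/eqP; apply: contraNT sJ => xs.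
by apply: h; rewrite inE.
Qed.

Lemma form_disjoint_le0 x y : nneg x -> nneg y -> (forall s, x s * y s = 0) -> B x y <= 0.
Proof.
move=> x0 y0 xy; rewrite form_sum; apply: sumr_le0 => s _.
rewrite form_basl mulr_sumr; apply: sumr_le0 => t _.
have [->|st] := eqVneq s t; first by rewrite cosmx1 mul1r xy.
by rewrite mulr_ge0_le0 // mulr_le0_ge0 // cosmx_le0.
Qed.

Lemma form_off_le0 x s : nneg x -> x s = 0 -> B (bas s) x <= 0.
Proof.
move=> x0 xs; apply: form_disjoint_le0 => // [t|t]; first by rewrite ffunE ler0n.
by rewrite ffunE; case: eqP => [->|]; rewrite ?xs ?mulr0 ?mul0r.
Qed.

Lemma form_gt0_supp x s : nneg x -> 0 < B (bas s) x -> s \in supp x.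
Proof.
move=> x0 h; rewrite inE; apply: contraTneq h => xs.
by rewrite -leNgt form_off_le0.
Qed.

Lemma wall_type_supp x : nneg x -> wall_type x \subset supp x.
Proof.
move=> x0; apply/fintype.subsetP => s; rewrite inE => /eqP h.
by apply: form_gt0_supp; rewrite // h ltr01.
Qed.

(* The Gram matrix of [J] is positive definite with nonpositive off-diagonal
   entries, so its inverse is nonnegative. *)
Lemma nneg_inverse J x : spherical J -> (forall t, t \notin J -> 0 <= x t) ->
  (forall t, t \in J -> 0 <= B (bas t) x) -> nneg x.
Proof.
move=> Js xo xi.
pose n : V := [ffun s => Num.max 0 (- x s)]; pose p := x + n.
have n0 : nneg n by move=> s; rewrite ffunE le_max lexx.
have p0 : nneg p.
  move=> s; rewrite !ffunE; have [|] := lerP 0 (- x s); lra.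
have np s : n s * p s = 0.
  rewrite !ffunE; have [h|h] := lerP 0 (- x s); first by rewrite subrr mulr0.
  by rewrite mul0r.
have nJ : supp_in J n.
  by move=> s sJ; rewrite ffunE; have := xo s sJ; have [|] := lerP 0 (- x s); lra.
have h1 : 0 <= B n x.
  rewrite form_sum sumr_ge0 // => s _; have [sJ|sJ] := boolP (s \in J).
    by rewrite mulr_ge0 // xi.
  by rewrite nJ // mul0r.
have h2 := form_disjoint_le0 n0 p0 np.
have nz : n = 0.
  apply/eqP; apply: contraT => nn; have := spherical_posdef Js nJ nn.
  by rewrite -/p {1}/p formDr in h2; lra.
by move=> s; have := p0 s; rewrite /p nz addr0.
Qed.

End Spherical.

(** * Paths in the Davis complex of the Coxeter group *)

Section Chart.
Variables (R : realType) (W : coxeterSystem).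
Local Notation S := (cox_gens W).
Local Notation V := {ffun S -> R}.
Local Notation B := (@cox_form W R).
Local Notation gen := (@cox_gen W).
Local Notation len := (@cox_length W).
Local Notation val := (word_val gen).
Local Notation bas := (@bas R W).
Local Notation act := (@act R W).
Implicit Types (x y z a b c : V) (s t : S) (u v w : cox_group W).

Implicit Types J K L : {set S}.

(* [(w, z)] encodes the point of the Davis complex with coordinate [z] in the
   chamber [w]; [reach] describes piecewise straight paths and their length. *)
Inductive reach : cox_group W -> V -> cox_group W -> V -> R -> Prop :=
| reach_refl w z : inQ z -> reach w z w z 0
| reach_turn w z w' z' v l : reach w z w' z' l ->
    parabolic (wall_type z') v -> reach w z (w' * v)%g z' l
| reach_move w z w' z' z'' l : reach w z w' z' l -> inQ z'' ->
    spherical (supp z' :|: supp z'')%SET -> reach w z w' z'' (l + nrm (z' - z'')).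

Lemma reach_inQ w z w' z' l : reach w z w' z' l -> inQ z /\ inQ z'.
Proof. by elim=> // {}w {}z {}w' {}z' z'' {}l _ []. Qed.

Lemma reach_ge0 w z w' z' l : reach w z w' z' l -> 0 <= l.
Proof. by elim=> // *; rewrite addr_ge0 ?nrm_ge0. Qed.

Lemma reach_trans w1 z1 w2 z2 w3 z3 l l' : reach w1 z1 w2 z2 l ->
  reach w2 z2 w3 z3 l' -> reach w1 z1 w3 z3 (l + l').
Proof.
move=> h1 h2; elim: h2 h1 => [*|w z w' z' v l0 _ IH vz h1|w z w' z' z'' l0 _ IH q s h1].
- by rewrite addr0.
- by apply: reach_turn vz; apply: IH.
- by rewrite addrA; apply: reach_move => //; apply: IH.
Qed.

Lemma reach_turn1 w z v : inQ z -> parabolic (wall_type z) v -> reach w z (w * v)%g z 0.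
Proof. by move=> qz; apply: reach_turn; apply: reach_refl. Qed.
Lemma reach_move1 w z z' : inQ z -> inQ z' -> spherical (supp z :|: supp z')%SET ->
  reach w z w z' (nrm (z - z')).
Proof.
move=> qz qz' s; rewrite -[nrm _]add0r; apply: reach_move => //; exact: reach_refl.
Qed.

Lemma reach_sym w z w' z' l : reach w z w' z' l -> reach w' z' w z l.
Proof.
elim=> [*|{}w {}z {}w' {}z' v {}l h IH vz|{}w {}z {}w' {}z' z'' {}l h IH q s].
- exact: reach_refl.
- rewrite -[l]add0r; apply: reach_trans IH.
  have {2}-> : w' = (w' * v * v^-1)%g by rewrite -mulgA mulgV mulg1.
  by apply: reach_turn1 (parV vz); case: (reach_inQ h).
rewrite addrC nrmB; apply: reach_trans IH; apply: reach_move1 => //.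
  by case: (reach_inQ h).
by rewrite finset.setUC.
Qed.

(** A relation that can be concatenated need only be checked on intervals where finitely many affine
    functions keep their sign; the pair (a, b) stands for the function a + b s. *)
Lemma subdivide (P : R -> R -> Prop) (l : seq (R * R)) :
  (forall s r t : R, 0 <= s <= r -> r <= t <= 1 -> P s r -> P r t -> P s t) ->
  (forall s t : R, 0 <= s -> s <= t -> t <= 1 ->
    (forall g, g \in l -> 0 <= (g.1 + g.2 * s) * (g.1 + g.2 * t)) -> P s t) ->
  forall s t : R, 0 <= s -> s <= t -> t <= 1 -> P s t.
Proof.
move=> tr; elim: l => [|[a b] l IH] base; first by move=> s t s0 st t1; apply: base.
apply: IH => s t s0 st t1 lP.
have [ab|ab] := lerP 0 ((a + b * s) * (a + b * t)).
  by apply: base => // g; rewrite inE => /orP[/eqP-> //|/lP].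
have b0 : b != 0.
  by apply: contraTneq ab => ->; rewrite -leNgt !mul0r addr0 -expr2 sqr_ge0.
pose r := - a / b; have abr : a + b * r = 0 by rewrite /r; field.
have bE : a = - (b * r) by lra.
have [sr rt] : s <= r /\ r <= t.
  have : (s - r) * (t - r) < 0.
    rewrite -(pmulr_rlt0 _ (_ : 0 < b ^+ 2)) ?exprn_even_gt0 //.
    by move: ab; rewrite bE; lra.
  by move=> h; split; rewrite leNgt; apply/negP => h'; nra.
have conv g (u1 u2 : R) : g \in l -> s <= u1 -> u1 <= u2 -> u2 <= t -> (u1 = s \/ u2 = t) ->
    0 <= (g.1 + g.2 * u1) * (g.1 + g.2 * u2).
  move=> /lP; move: g => [p q] /= h su uu ut.
  have [ts|ts] := eqVneq t s => e.
    have -> : u1 = u2 by apply/eqP; rewrite eq_le uu /= (le_trans ut) // ts.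
    by rewrite -expr2 sqr_ge0.
  have ts0 : 0 < t - s by rewrite subr_gt0 lt_neqAle eq_sym ts.
  have key (u : R) : s <= u -> u <= t -> 0 <= (p + q * s) * (p + q * u) /\ 0 <= (p + q * u) * (p + q * t).
    move=> su' ut'.
    have e1 : (t - s) * (p + q * u) = (t - u) * (p + q * s) + (u - s) * (p + q * t) by ring.
    split; rewrite -(pmulr_rge0 _ ts0).
      have -> : (t - s) * ((p + q * s) * (p + q * u)) =
        (t - u) * (p + q * s) ^+ 2 + (u - s) * ((p + q * s) * (p + q * t)) by ring.
      by rewrite addr_ge0 // mulr_ge0 ?sqr_ge0 // subr_ge0.
    have -> : (t - s) * ((p + q * u) * (p + q * t)) =
      (t - u) * ((p + q * s) * (p + q * t)) + (u - s) * (p + q * t) ^+ 2 by ring.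
    by rewrite addr_ge0 // mulr_ge0 ?sqr_ge0 // subr_ge0.
  case: e => e; rewrite e.
    by have [] := key u2 (le_trans su uu) ut.
  by have [] := key u1 su (le_trans uu ut).
apply: (tr s r t); rewrite ?s0 ?sr ?rt ?t1 //; apply: base; try lra.
  move=> g; rewrite inE => /orP[/eqP->|gl]; first by rewrite /= abr mulr0.
  by apply: conv => //; left.
move=> g; rewrite inE => /orP[/eqP->|gl]; first by rewrite /= abr mul0r.
by apply: conv => //; right.
Qed.

Lemma seq_max (T : eqType) (f : T -> R) (l : seq T) (p0 : T) : p0 \in l ->
  exists2 m, m \in l & forall q, q \in l -> f q <= f m.
Proof.
elim: l p0 => // p l IH p0 _; case: l IH => [|q l] IH.
  by exists p; rewrite ?inE // => r; rewrite inE => /eqP ->.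
have [m ml mP] := IH q (mem_head _ _).
have [pm|mp] := lerP (f p) (f m).
  by exists m => [|r]; rewrite inE ?ml ?orbT // => /orP[/eqP-> //|/mP].
exists p; first exact: mem_head.
by move=> r; rewrite inE => /orP[/eqP-> //|/mP h]; apply: le_trans h (ltW mp).
Qed.

Section Local.
Variables (J : {set S}) (Js : spherical J) (kap : R) (kap0 : 0 < kap) (kap1 : kap <= 1).

Definition dom v x := parabolic J v /\
  forall s, s \in J -> 0 <= B (bas s) (act v^-1%g x).

(** An element of W_J maximizing the product of v^-1 x with x_J works: x_J has product 1 with each
    e_s, so reflecting a negative coordinate would increase the value. *)
Lemma dom_ex x : exists v, dom v x.
Proof.
have [l lE] := (finite_seqP _).1 Js.
have lP w : (w \in l) <-> parabolic J w by rewrite -[parabolic J w]/((parabolic J) w) lE.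
pose xJ := @solve R W J (fun=> 1); have [_ xJP] := solveP (fun=> 1 : R) Js.
have [v /lP vJ vP] := seq_max (fun v => B (act v^-1%g x) xJ) ((lP 1%g).2 (par1 J)).
exists v; split=> // s sJ; set y := act _ x.
have /lP/vP := parM vJ (par_gen sJ).
rewrite invMg cgenV actM act_gen -/y /refl !formE xJP //; lra.
Qed.

(** The dominant cone is a strict fundamental domain of W_J. A last letter s of [g] sends e_s to a
    negative root, which forces B (e_s, x) = 0; so s fixes [x] and can be removed from [g]. *)
Lemma dominant_uniq g x y : parabolic J g -> act g x = y ->
  (forall s, s \in J -> 0 <= B (bas s) x) -> (forall s, s \in J -> 0 <= B (bas s) y) ->
  x = y /\ parabolic [set s in J | B (bas s) x == 0]%SET g.
Proof.
have [n] := ubnP (len g); elim: n g => // n IH g gn gJ gxy xd yd.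
have [g1|gn1] := eqVneq g 1%g.
  by rewrite -gxy g1 act1; split => //; exact: par1.
have gn1' : g^-1%g != 1%g by rewrite invg_eq1.
have [s] := len_first gn1'.
rewrite -[X in (X < _)%N]lenV invMg invgK cgenV lenV => lgs.
have gs0 := nneg_lenN R lgs; have sJ : s \in J.
  apply: contrapT => /negP sJ; have := gs0 s.
  by rewrite ffunE (act_par_out _ gJ sJ) ffunE eqxx /=; lra.
have h1 : B (act g (bas s)) y <= 0.
  rewrite form_sum; apply: sumr_le0 => t _; have [tJ|tJ] := boolP (t \in J).
    by rewrite mulr_le0_ge0 ?yd // -oppr_ge0; have := gs0 t; rewrite ffunE.
  by rewrite (act_par_supp gJ (supp_in_bas _ sJ)) // mul0r.
rewrite -gxy act_form in h1; have xs : B (bas s) x = 0.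
  by apply/eqP; rewrite eq_le h1 xd.
have [||xy gK] := IH (g * gen s)%g _ (parM gJ (par_gen sJ)) _ xd yd.
- by apply: leq_trans lgs _; rewrite -ltnS.
- by rewrite actM act_gen refl_id.
split=> //; rewrite -[g]mulg1 -(cgenK s) mulgA; apply: parM gK _.
by apply: par_gen; rewrite inE sJ xs eqxx.
Qed.

Lemma dom_turn v v' x : dom v x -> dom v' x -> act v^-1%g x = act v'^-1%g x /\
  parabolic [set s in J | B (bas s) (act v^-1%g x) == 0]%SET (v^-1 * v')%g.
Proof.
move=> [vJ vd] [v'J vd'].
have e0 : act (v'^-1 * v)%g (act v^-1%g x) = act v'^-1%g x by rewrite actM actVK.
have [e p] := dominant_uniq (parM (parV v'J) vJ) e0 vd vd'.
split=> //; have := parV p; by rewrite invMg invgK.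
Qed.

(** Near a point of wall type [J] the complex is an orthogonal product. [xi x] is the component in
    V_J, with products the heights of [x] over the walls of [J]; [eta x] is the component on which
    all those heights are 0. [form_split] is the theorem of Pythagoras for x = eta x - xi x. *)
Definition xi x : V := @solve R W J (fun s => 1 - B (bas s) x).
Definition eta x : V := x + xi x.

Lemma xi_supp x : supp_in J (xi x).
Proof. by case: (solveP (fun s => 1 - B (bas s) x) Js). Qed.
Lemma xi_form s x : s \in J -> B (bas s) (xi x) = 1 - B (bas s) x.
Proof. by case: (solveP (fun s => 1 - B (bas s) x) Js) => _; apply. Qed.
Lemma eta_form s x : s \in J -> B (bas s) (eta x) = 1.
Proof. by move=> sJ; rewrite formDr xi_form //; lra. Qed.
Lemma form_supp_in x y z : supp_in J x ->
  (forall s, s \in J -> B (bas s) y = B (bas s) z) -> B x y = B x z.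
Proof.
move=> xJ yz; rewrite !(form_sum x); apply: eq_bigr => s _.
by have [sJ|sJ] := boolP (s \in J); [rewrite yz|rewrite xJ // !mul0r].
Qed.
Lemma eta_orth x y z : supp_in J x -> B x (eta y) = B x (eta z).
Proof. by move=> xJ; apply: form_supp_in => // s sJ; rewrite !eta_form. Qed.

Lemma eta_xi x : eta x - xi x = x. Proof. by rewrite /eta addrK. Qed.

Lemma form_split x y : B (x - y) (x - y) =
  B (xi x - xi y) (xi x - xi y) + B (eta x - eta y) (eta x - eta y).
Proof.
have e : x - y = (eta x - eta y) - (xi x - xi y).
  by rewrite /eta; move: (xi x) (xi y) => p q; apply/ffunP => s; rewrite !ffunE; ring.
have o : B (xi x - xi y) (eta x - eta y) = 0.
  rewrite formDr formNr (eta_orth _ y) ?subrr //.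
  exact: supp_inB (xi_supp _) (xi_supp _).
rewrite {1 2}e; move: (eta x - eta y) (xi x - xi y) o => p q o.
by rewrite !formDl !formDr !formNl !formNr (formC p q) o; ring.
Qed.

(** [x] is within [r] of the stratum of type [J] in the direction V_J, and its height over every
    other wall is at least kap - r. *)
Definition near (r : R) x := nrm (xi x) <= r /\
  forall s, s \notin J -> B (bas s) x <= 1 - kap + r.

Lemma near_supp r x : r < 1 -> inQ x -> near r x -> J \subset supp x.
Proof.
move=> r1 [x0 _ _] [xr _]; apply/fintype.subsetP => s sJ; apply: form_gt0_supp => //.
have := form_bas_nrm Js sJ (xi_supp x); rewrite xi_form // ler_norml => /andP[_]; lra.
Qed.

Lemma near_wall r x : r < kap -> near r x -> wall_type x \subset J.
Proof.
move=> rk [_ h]; apply/fintype.subsetP => s; rewrite inE => /eqP e.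
by apply: contrapT => /negP /h; rewrite e; lra.
Qed.

Lemma near_step r x y : r < 1 -> inQ x -> inQ y -> spherical (supp x :|: supp y)%SET ->
  near r x -> near (r + nrm (x - y)) y.
Proof.
move=> r1 qx qy Ls nx; have JL := fintype.subset_trans (near_supp r1 qx nx) (finset.subsetUl _ (supp y)).
set L := (supp x :|: supp y)%SET in Ls JL.
have xL : supp_in L x by apply: supp_in_supp; exact: finset.subsetUl.
have yL : supp_in L y by apply: supp_in_supp; exact: finset.subsetUr.
have xiL z := supp_in_sub JL (xi_supp z).
have d : nrm (xi y - xi x) <= nrm (x - y).
  rewrite (nrmB x) -(@ler_pXn2r _ 2) ?nnegrE ?nrm_ge0 //.
  rewrite (nrm_sq Js (supp_inB (xi_supp y) (xi_supp x))).
  rewrite (nrm_sq Ls (supp_inB yL xL)) (form_split y x).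
  rewrite lerDl (spherical_form_ge0 Ls) //.
  by apply: supp_inB; apply: supp_inD.
case: nx => [n1 n2]; split.
  have -> : xi y = xi x + (xi y - xi x) by rewrite addrC subrK.
  by apply: le_trans (nrm_tri Js (xi_supp _) (supp_inB (xi_supp _) (xi_supp _))) _; lra.
move=> s sJ; have [sL|sL] := boolP (s \in L); last first.
  have ys : y s = 0 by apply: yL.
  have [y0 _ _] := qy; have := form_off_le0 y0 ys; have := nrm_ge0 (x - y).
  by have r0 : 0 <= r := le_trans (nrm_ge0 _) n1; have := kap1; lra.
have := form_bas_nrm Ls sL (supp_inB xL yL); rewrite ler_norml formDr formNr => /andP[h _].
by have := n2 s sJ; lra.
Qed.

Lemma near_le r r' x : r <= r' -> near r x -> near r' x.
Proof.
by move=> rr [h1 h2]; split=> [|s /h2]; [exact: le_trans rr|move=> ?; lra].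
Qed.

(** A path too short to reach a wall outside [J] turns only inside W_J, so it stays in the chart. *)
Lemma near_reach w z w' z' l r : reach w z w' z' l -> near r z -> r + l < kap ->
  near (r + l) z' /\ parabolic J (w^-1 * w')%g.
Proof.
move=> h0 + + ; have k1 := kap1.
elim: h0 => [{}w {}z _|{}w {}z {}w' {}z' v {}l h IH vz|{}w {}z {}w' {}z' z'' {}l h IH q s] nz rl.
- by rewrite addr0 mulVg; split => //; exact: par1.
- have [n1 p1] := IH nz rl; split=> //; rewrite mulgA; apply: parM => //.
  exact: par_sub (near_wall rl n1) vz.
have n0 := nrm_ge0 (z' - z''); have [|n1 p1] := IH nz; first lra.
split=> //; rewrite addrA; apply: near_step => //; first lra.
by case: (reach_inQ h).
Qed.

(** The component in V_J may be replaced by any small dominant vector. For a wall outside [J] the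
    bounds 1 - kap + r for [x], r for [xi x] and r for [y] must add up to at most 1, whence the
    condition 3 r <= kap. *)
Lemma shift_inQ (r : R) x y : 3 * r <= kap -> r < 1 -> inQ x -> near r x ->
  supp_in J y -> (forall s, s \in J -> 0 <= B (bas s) y) -> nrm y <= r ->
  inQ (eta x - y) /\ supp (eta x - y) \subset supp x.
Proof.
move=> rk r1 qx nx yJ yd yr; have JL := near_supp r1 qx nx; case: qx => x0 Ls x1; have k1 := kap1.
have out s : s \notin J -> (eta x - y) s = x s.
  by move=> sJ; rewrite !ffunE yJ // xi_supp // addr0 subr0.
have jn s : s \in J -> B (bas s) (eta x - y) = 1 - B (bas s) y.
  by move=> sJ; rewrite formDr formNr eta_form.
have ss : supp (eta x - y) \subset supp x.
  apply/fintype.subsetP => s; have [sJ _|sJ] := boolP (s \in J).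
    exact: (fintype.subsetP JL).
  by rewrite !inE out.
have e0 : nneg (eta x - y).
  apply: (nneg_inverse Js) => s sJ; first by rewrite out.
  by rewrite jn //; have := form_bas_nrm Js sJ yJ; rewrite ler_norml => /andP[_]; lra.
split=> //; split=> //; first exact: spherical_sub ss Ls.
move=> s; have [sJ|sJ] := boolP (s \in J).
  by rewrite jn //; have := yd s sJ; lra.
have [sL|sL] := boolP (s \in supp x); last first.
  apply: le_trans (form_off_le0 e0 _) _ => //; rewrite out //.
  by move: sL; rewrite inE negbK => /eqP.
have h1 := form_bas_nrm Ls sL (supp_in_sub JL (xi_supp x)).
have h2 := form_bas_nrm Ls sL (supp_in_sub JL yJ).
case: nx => n1 /(_ s sJ) n2.
rewrite /eta !formDr formNr; move: h1 h2; rewrite !ler_norml => /andP[? ?] /andP[? ?]; lra.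
Qed.

End Local.
End Chart.

(** * Straight segments in a product chart *)

Section ChartGeodesics.
Variables (R : realType) (W : coxeterSystem).
Local Notation S := (cox_gens W).
Local Notation V := {ffun S -> R}.
Local Notation B := (@cox_form W R).
Local Notation gen := (@cox_gen W).
Local Notation len := (@cox_length W).
Local Notation val := (word_val gen).
Local Notation bas := (@bas R W).
Local Notation act := (@act R W).
Implicit Types (x y z a b c : V) (u v w : cox_group W).

Implicit Types J K L : {set S}.
Variables (J : {set S}) (Js : spherical J) (kap : R) (kap0 : 0 < kap) (kap1 : kap <= 1).
Local Notation xi := (@xi R W J).
Local Notation eta := (@eta R W J).
Local Notation dom := (@dom R W J).
Local Notation near := (@near R W J kap).

Definition seg x y (t : R) : V := x + t *: (y - x).

Lemma seg_form z x y t : B z (seg x y t) = B z x + B z (y - x) * t.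
Proof. by rewrite /seg !formE mulrC. Qed.
Lemma seg0 x y : seg x y 0 = x. Proof. by rewrite /seg scale0r addr0. Qed.
Lemma seg1 x y : seg x y 1 = y. Proof. by rewrite /seg scale1r addrC subrK. Qed.
Lemma segB x y s t : seg x y s - seg x y t = (t - s) *: (x - y).
Proof. by apply/ffunP => i; rewrite !ffunE /GRing.scale /=; ring. Qed.
Lemma act_seg v x y t : act v (seg x y t) = seg (act v x) (act v y) t.
Proof. by rewrite /seg actD actZ actD actN. Qed.
Lemma seg_supp K x y t : supp_in K x -> supp_in K y -> supp_in K (seg x y t).
Proof. by move=> xK yK; apply: supp_inD xK (supp_inZ _ (supp_inB yK xK)). Qed.

Lemma seg_conv x y (t : R) : seg x y t = (1 - t) *: x + t *: y.
Proof. by apply/ffunP => i; rewrite !ffunE /GRing.scale /=; ring. Qed.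

Lemma nrm_seg K x y (t r : R) : spherical K -> supp_in K x -> supp_in K y ->
  0 <= t <= 1 -> nrm x <= r -> nrm y <= r -> nrm (seg x y t) <= r.
Proof.
move=> Ks xK yK /andP[t0 t1] xr yr; rewrite seg_conv.
apply: le_trans (nrm_tri Ks (supp_inZ _ xK) (supp_inZ _ yK)) _.
by rewrite !nrmZ !ger0_norm ?subr_ge0 //; nra.
Qed.

Lemma xi_seg x y t : xi (seg x y t) = seg (xi x) (xi y) t.
Proof.
apply: (solve_uniq Js); first exact: xi_supp.
  by apply: seg_supp; apply: xi_supp.
move=> s sJ; rewrite xi_form // !seg_form xi_form // !formDr !formNr !xi_form //; ring.
Qed.

Lemma eta_seg x y t : eta (seg x y t) = seg (eta x) (eta y) t.
Proof.
rewrite /eta xi_seg /seg; move: (xi x) (xi y) => p q.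
by apply/ffunP => i; rewrite !ffunE /GRing.scale /=; ring.
Qed.

Lemma near_seg r x y t : 0 <= t <= 1 -> near r x -> near r y -> near r (seg x y t).
Proof.
move=> /andP[t0 t1] [x1 x2] [y1 y2]; split.
  by rewrite xi_seg; apply: (nrm_seg Js (xi_supp Js x) (xi_supp Js y)); rewrite ?t0.
move=> s sJ; rewrite seg_conv !formE; have := x2 s sJ; have := y2 s sJ; nra.
Qed.

Lemma supp_seg x y t : supp (seg x y t) \subset supp x :|: supp y.
Proof.
apply/fintype.subsetP => s; apply: contraTT; rewrite !inE negb_or !negbK.
by move=> /andP[/eqP xs /eqP ys]; rewrite seg_conv !ffunE xs ys !scaler0 addr0.
Qed.

Lemma inQ_seg x y t : 0 <= t <= 1 -> inQ x -> inQ y ->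
  spherical (supp x :|: supp y)%SET -> inQ (seg x y t).
Proof.
move=> /andP[t0 t1] [x0 _ x1] [y0 _ y1] Ls; split.
- by move=> s; rewrite seg_conv !ffunE addr_ge0 ?mulr_ge0 ?subr_ge0.
- exact: spherical_sub (supp_seg _ _ _) Ls.
- by move=> s; rewrite seg_conv !formE; have := x1 s; have := y1 s; nra.
Qed.

Lemma dom_inQ (r : R) v x y : 3 * r <= kap -> r < 1 -> inQ x -> near r x ->
  supp_in J y -> nrm y <= r -> dom v y ->
  inQ (eta x - act v^-1%g y) /\ supp (eta x - act v^-1%g y) \subset supp x.
Proof.
move=> rk r1 qx nx yJ yr [vJ vd]; apply: (shift_inQ Js kap1 rk) => //.
  by apply: act_par_supp => //; apply: parV.
by rewrite nrm_act.
Qed.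

Lemma dom_turn_reach (r : R) w v v' x y : 3 * r <= kap -> r < 1 -> inQ x -> near r x ->
  supp_in J y -> nrm y <= r -> dom v y -> dom v' y ->
  act v^-1%g y = act v'^-1%g y /\
  reach (w * v)%g (eta x - act v^-1%g y) (w * v')%g (eta x - act v'^-1%g y) 0.
Proof.
move=> rk r1 qx nx yJ yr vd v'd.
have [e p] := dom_turn vd v'd; rewrite -e; split=> //.
have -> : (w * v' = w * v * (v^-1 * v'))%g by rewrite mulgA mulgK.
apply: reach_turn1; first by case: (dom_inQ rk r1 qx nx yJ yr vd).
apply: par_sub p; apply/fintype.subsetP => s; rewrite !inE => /andP[sJ /eqP h].
by rewrite formDr formNr h (eta_form Js) // subr0.
Qed.

Definition chartD x y x' y' : R :=
  Num.sqrt (B (y - y') (y - y') + B (eta x - eta x') (eta x - eta x')).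

(** A segment of the product of V_J and the orthogonal factor is realized as a path: the component
    in V_J is brought into the dominant cone by elements [v], which change only where it meets a
    wall of W_J. *)
Lemma chart_segment (r : R) w x x' y y' v v' : 3 * r <= kap -> r < 1 ->
  inQ x -> inQ x' -> spherical (supp x :|: supp x')%SET -> near r x -> near r x' ->
  supp_in J y -> supp_in J y' -> nrm y <= r -> nrm y' <= r -> dom v y -> dom v' y' ->
  exists2 l, l <= chartD x y x' y' &
    reach (w * v)%g (eta x - act v^-1%g y) (w * v')%g (eta x' - act v'^-1%g y') l.
Proof.
move=> rk r1 qx qx' Ls nx nx' yJ yJ' yr yr' dv dv'.
set D := chartD x y x' y'.
pose X t := seg x x' t; pose Y t := seg y y' t.
have XQ t : 0 <= t <= 1 -> inQ (X t) by move=> t01; apply: inQ_seg.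
have Xn t : 0 <= t <= 1 -> near r (X t) by move=> t01; apply: near_seg.
have YJ t : supp_in J (Y t) by apply: seg_supp.
have Yr t : 0 <= t <= 1 -> nrm (Y t) <= r.
  by move=> t01; apply: (nrm_seg Js).
pose P s t := forall v v', dom v (Y s) -> dom v' (Y t) -> exists2 l, l <= (t - s) * D &
  reach (w * v)%g (eta (X s) - act v^-1%g (Y s)) (w * v')%g (eta (X t) - act v'^-1%g (Y t)) l.
have [l0 l0E] := (finite_seqP _).1 Js.
have l0P u : (u \in l0) <-> parabolic J u by rewrite -[parabolic J u]/((parabolic J) u) l0E.
(* The sign changes of these functions are the crossings of the walls of W_J by the segment from [y]
   to [y']. *)
pose cs := [seq (B (act u (bas s)) y, B (act u (bas s)) (y' - y)) | u <- l0, s <- enum J].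
suff : P 0 1 by rewrite /P /X /Y !seg0 !seg1 subr0 mul1r => /(_ v v' dv dv').
apply: (@subdivide R P cs) => //.
  move=> s t u /andP[s0 st] /andP[tu u1] h1 h2 v1 v2 d1 d2.
  have [v3 d3] := dom_ex Js (Y t).
  have [l1 l1D r1'] := h1 _ _ d1 d3; have [l2 l2D r2] := h2 _ _ d3 d2.
  exists (l1 + l2); last exact: reach_trans r1' r2.
  by move: l1D l2D; rewrite !mulrBl; lra.
move=> s t s0 st t1 hs v1 v2 d1 d2.
(* No wall is crossed between s and t, so an element dominating the midpoint dominates both ends. *)
have [v3 [v3J v3d]] := dom_ex Js (Y ((s + t) / 2)).
have key e : e \in J -> 0 <= B (bas e) (act v3^-1%g (Y s)) /\ 0 <= B (bas e) (act v3^-1%g (Y t)).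
  move=> eJ; have := v3d e eJ; rewrite !act_formr invgK !seg_form.
  have := hs (B (act v3 (bas e)) y, B (act v3 (bas e)) (y' - y)).
  have -> : (B (act v3 (bas e)) y, B (act v3 (bas e)) (y' - y)) \in cs.
    by apply/allpairsP; exists (v3, e); split=> //=; [exact/l0P|rewrite mem_enum].
  move=> /(_ isT) /=; set a := B _ y; set b := B _ (y' - y) => h1 h2.
  by split; rewrite leNgt; apply/negP => h; nra.
have [ds dt] : dom v3 (Y s) /\ dom v3 (Y t) by split; split=> // e /key[].
have s01 : 0 <= s <= 1 by rewrite s0 (le_trans st).
have t01 : 0 <= t <= 1 by rewrite t1 (le_trans s0).
have [_ e1] := dom_turn_reach w rk r1 (XQ s s01) (Xn s s01) (YJ s) (Yr s s01) d1 ds.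
have [_ e2] := dom_turn_reach w rk r1 (XQ t t01) (Xn t t01) (YJ t) (Yr t t01) dt d2.
have [q1 ss1] := dom_inQ rk r1 (XQ s s01) (Xn s s01) (YJ s) (Yr s s01) ds.
have [q2 ss2] := dom_inQ rk r1 (XQ t t01) (Xn t t01) (YJ t) (Yr t t01) dt.
have sph : spherical (supp (eta (X s) - act v3^-1%g (Y s)) :|:
                      supp (eta (X t) - act v3^-1%g (Y t)))%SET.
  apply: spherical_sub Ls; rewrite finset.subUset.
  by rewrite (fintype.subset_trans ss1 (supp_seg _ _ _)) (fintype.subset_trans ss2 (supp_seg _ _ _)).
have mv := reach_move1 (w * v3)%g q1 q2 sph.
exists (0 + (nrm (eta (X s) - act v3^-1%g (Y s) - (eta (X t) - act v3^-1%g (Y t))) + 0)).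
  rewrite add0r addr0 /nrm.
  have -> : eta (X s) - act v3^-1%g (Y s) - (eta (X t) - act v3^-1%g (Y t)) =
     (t - s) *: ((eta x - eta x') - act v3^-1%g (y - y')).
    rewrite /X /Y !eta_seg !act_seg actD actN /seg.
    move: (eta x) (eta x') (act _ y) (act _ y') => ? ? ? ?.
    by apply/ffunP => i; rewrite !ffunE /GRing.scale /=; ring.
  have o : B (eta x - eta x') (act v3^-1%g (y - y')) = 0.
    rewrite formC formDr formNr (eta_orth Js _ x') ?subrr //.
    by apply: act_par_supp (parV v3J) (supp_inB yJ yJ').
  rewrite !formZl !formZr mulrA -expr2 sqrtrM ?sqr_ge0 // sqrtr_sqr ger0_norm ?subr_ge0 //.
  rewrite ler_wpM2l ?subr_ge0 // /D /chartD ler_sqrt.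
  - rewrite -(act_form v3^-1%g (y - y')).
    move: (eta x - eta x') (act v3^-1%g (y - y')) o => p q o.
    by rewrite !formDl !formDr !formNl !formNr o (formC q p) o; lra.
  - apply: addr_ge0; first exact: (spherical_form_ge0 Js (supp_inB yJ yJ')).
    apply: (spherical_form_ge0 Ls).
    have JL := fintype.subset_trans (near_supp Js r1 qx nx) (finset.subsetUl _ (supp x')).
    by apply: supp_inB; apply: supp_inD; do ?[apply: (supp_in_sub JL); exact: xi_supp];
      apply: supp_in_supp; rewrite ?finset.subsetUl ?finset.subsetUr.
exact: reach_trans e1 (reach_trans mv e2).
Qed.

End ChartGeodesics.

(** * Geodesics project to straight lines of V_J *)

Section LocalGeodesics.
Variables (R : realType) (W : coxeterSystem).
Local Notation S := (cox_gens W).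
Local Notation V := {ffun S -> R}.
Local Notation B := (@cox_form W R).
Local Notation gen := (@cox_gen W).
Local Notation len := (@cox_length W).
Local Notation val := (word_val gen).
Local Notation bas := (@bas R W).
Local Notation act := (@act R W).
Implicit Types (x y z a b c : V) (u v w : cox_group W).

Implicit Types J K L : {set S}.
Variables (J : {set S}) (Js : spherical J) (kap : R) (kap0 : 0 < kap) (kap1 : kap <= 1).
Local Notation xi := (@xi R W J).
Local Notation eta := (@eta R W J).
Local Notation dom := (@dom R W J).
Local Notation near := (@near R W J kap).

Lemma act_fix K v x : parabolic K v -> (forall s, s \in K -> B (bas s) x = 0) ->
  act v x = x.
Proof.
move=> vK xK; move: v vK; apply: (@par_ind W K (fun v => act v x = x)) => [|s v sK _ IH].
  by rewrite act1.
by rewrite actM IH act_gen refl_id ?xK.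
Qed.

Lemma minkowski (a b p q l e : R) : 0 <= a -> 0 <= b -> 0 <= p -> 0 <= q -> 0 <= l -> 0 <= e ->
  a ^+ 2 + p ^+ 2 <= l ^+ 2 -> b ^+ 2 + q ^+ 2 <= e ^+ 2 ->
  (a + b) ^+ 2 + (p + q) ^+ 2 <= (l + e) ^+ 2.
Proof.
move=> a0 b0 p0 q0 l0 e0 h1 h2.
have cs : a * b + p * q <= l * e.
  rewrite -(@ler_pXn2r _ 2) ?nnegrE ?addr_ge0 ?mulr_ge0 //.
  apply: (@le_trans _ _ ((a ^+ 2 + p ^+ 2) * (b ^+ 2 + q ^+ 2))).
    have := sqr_ge0 (a * q - p * b); lra.
  by rewrite exprMn ler_pM // addr_ge0 ?sqr_ge0.
by lra.
Qed.

(* [shiftable rho w x y p]: there is a path along the factor of the chart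
   orthogonal to [V_J], of length [p], from the component of [x] to that of
   [y], and it can be combined with any straight motion in [V_J]. *)
Definition shiftable (rho : R) w x y (p : R) := forall U U' v v',
  supp_in J U -> supp_in J U' -> nrm U <= rho -> nrm U' <= rho -> dom v U -> dom v' U' ->
  exists2 l, l <= Num.sqrt (B (U - U') (U - U') + p ^+ 2) &
    reach (w * v)%g (eta x - act v^-1%g U) (w * v')%g (eta y - act v'^-1%g U') l.

(** The motion in V_J is cut in the ratio p : q, so that both halves have the slope of the whole
    segment and their lengths add without loss. *)
Lemma shiftable_cat rho w x y z p q : 0 <= p -> 0 <= q ->
  shiftable rho w x y p -> shiftable rho w y z q -> shiftable rho w x z (p + q).
Proof.
move=> p0 q0 h1 h2 U U' v v' UJ UJ' Ur Ur' dv dv'.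
have [th [th0 th1 pE qE]] : exists th : R, [/\ 0 <= th, th <= 1, p = th * (p + q) &
    q = (1 - th) * (p + q)].
  have [e|pq] := eqVneq (p + q) 0.
    by exists 1; rewrite e; split; lra.
  have pq0 : 0 < p + q by rewrite lt_def pq addr_ge0.
  exists (p / (p + q)); split; rewrite ?divr_ge0 ?addr_ge0 //.
  - by rewrite ler_pdivrMr // mul1r lerDl.
  - by rewrite divfK.
  - by rewrite mulrBl mul1r divfK //; lra.
have th01 : 0 <= th <= 1 by rewrite th0.
have UmJ := seg_supp th UJ UJ'.
have Umr := nrm_seg Js UJ UJ' th01 Ur Ur'.
have [vm dm] := dom_ex Js (seg U U' th).
have [l1 l1b r1] := h1 _ _ _ _ UJ UmJ Ur Umr dv dm.
have [l2 l2b r2] := h2 _ _ _ _ UmJ UJ' Umr Ur' dm dv'.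
exists (l1 + l2); last exact: reach_trans r1 r2.
have e1 : U - seg U U' th = th *: (U - U').
  by rewrite -{1}(seg0 U U') segB subr0.
have e2 : seg U U' th - U' = (1 - th) *: (U - U').
  by rewrite -{2}(seg1 U U') segB.
have s1 : B (U - seg U U' th) (U - seg U U' th) + p ^+ 2 =
    th ^+ 2 * (B (U - U') (U - U') + (p + q) ^+ 2).
  by rewrite e1 formZl formZr {1}pE; ring.
have s2 : B (seg U U' th - U') (seg U U' th - U') + q ^+ 2 =
    (1 - th) ^+ 2 * (B (U - U') (U - U') + (p + q) ^+ 2).
  by rewrite e2 formZl formZr {1}qE; ring.
rewrite s1 in l1b; rewrite s2 in l2b; move: l1b l2b.
rewrite !(sqrtrM _ (sqr_ge0 _)) !sqrtr_sqr !ger0_norm ?subr_ge0 //.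
by rewrite mulrBl mul1r; lra.
Qed.

(** Each move splits by Pythagoras into a part in V_J and an orthogonal part; [minkowski]
    accumulates the two totals separately. A turn inside W_J that fixes the point leaves the
    component in V_J unchanged. *)
Lemma path_shift (rho : R) w (a : cox_group W) x (b : cox_group W) y l : 3 * rho <= kap -> rho < 1 ->
  reach a x b y l -> forall v1 r, a = (w * v1)%g -> parabolic J v1 -> near r x ->
  r + l <= rho -> exists v2 p, [/\ b = (w * v2)%g, parabolic J v2, near (r + l) y,
   0 <= p /\ nrm (act v1 (xi x) - act v2 (xi y)) ^+ 2 + p ^+ 2 <= l ^+ 2 &
   shiftable rho w x y p].
Proof.
move=> rk r1; elim=> [{}a {}x qx|{}a {}x {}b {}y v {}l h IH vy|{}a {}x {}b {}y z {}l h IH qz s].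
- move=> v1 r aE v1J nx rl; exists v1, 0; split=> //; first by rewrite addr0.
    by rewrite subrr nrm0 expr0n addr0 lexx.
  move=> U U' v v' UJ UJ' Ur Ur' dv dv'.
  rewrite addr0 in rl; have nr := near_le rl nx.
  have sx : spherical (supp x :|: supp x)%SET by rewrite finset.setUid; case: qx.
  have [m mb mr] := chart_segment Js kap1 w rk r1 qx qx sx nr nr UJ UJ' Ur Ur' dv dv'.
  by exists m => //; move: mb; rewrite /chartD subrr form0l expr0n.
- move=> v1 r aE v1J nx rl; have [v2 [p [bE v2J ny [p0 pb] sh]]] := IH v1 r aE v1J nx rl.
  have yJ : wall_type y \subset J by apply: near_wall ny; have := kap0; lra.
  exists (v2 * v)%g, p; split=> //; first by rewrite bE mulgA.
    by apply: parM => //; apply: par_sub yJ vy.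
  rewrite actM (act_fix vy) // => s sy; rewrite xi_form //; last exact: (fintype.subsetP yJ).
  by move: sy; rewrite inE => /eqP ->; rewrite subrr.
move=> v1 r aE v1J nx rl.
have e0 := nrm_ge0 (y - z); have rl' : r + l <= rho by lra.
have [v2 [p [bE v2J ny [p0 pb] sh]]] := IH v1 r aE v1J nx rl'.
have [qx qy] := reach_inQ h; have l0 := reach_ge0 h.
have nz := near_step Js kap1 (le_lt_trans rl' r1) qy qz s ny.
have JL := fintype.subset_trans (near_supp Js (le_lt_trans rl' r1) qy ny) (finset.subsetUl _ (supp z)).
have xiJ t : supp_in J (xi t) by apply: xi_supp.
have ezL : supp_in (supp y :|: supp z)%SET (eta y - eta z).
  by apply: supp_inB; apply: supp_inD; do ?[exact: supp_in_sub JL (xiJ _)];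
    apply: supp_in_supp; rewrite ?finset.subsetUl ?finset.subsetUr.
have yzL : supp_in (supp y :|: supp z)%SET (y - z).
  by apply: supp_inB; apply: supp_in_supp; rewrite ?finset.subsetUl ?finset.subsetUr.
pose q := nrm (eta y - eta z); have q0 : 0 <= q by exact: nrm_ge0.
exists v2, (p + q); split=> //; first by rewrite addrA.
  split; first exact: addr_ge0.
  set u1 := act v1 (xi x); set u2 := act v2 (xi y); set u3 := act v2 (xi z).
  have u1J : supp_in J u1 by apply: act_par_supp.
  have u2J : supp_in J u2 by apply: act_par_supp.
  have u3J : supp_in J u3 by apply: act_par_supp.
  have b0 : nrm (u2 - u3) ^+ 2 + q ^+ 2 <= nrm (y - z) ^+ 2.
    rewrite /u2 /u3 -actN -actD nrm_act (nrm_sq Js (supp_inB (xiJ y) (xiJ z))).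
    by rewrite (nrm_sq s ezL) (nrm_sq s yzL) (form_split Js y z).
  apply: le_trans (minkowski (nrm_ge0 _) (nrm_ge0 _) p0 q0 l0 e0 pb b0).
  rewrite lerD2r ler_pXn2r ?nnegrE ?addr_ge0 ?nrm_ge0 //.
  have -> : u1 - u3 = (u1 - u2) + (u2 - u3) by rewrite addrA subrK.
  by apply: (nrm_tri Js); apply: supp_inB.
apply: (shiftable_cat p0 q0 sh) => U U' v v' UJ UJ' Ur Ur' dv dv'.
have rl2 : r + l + nrm (y - z) <= rho by lra.
have [m mb mr] := chart_segment Js kap1 w rk r1 qy qz s (near_le rl' ny)
  (near_le rl2 nz) UJ UJ' Ur Ur' dv dv'.
by exists m => //; move: mb; rewrite /chartD -(nrm_sq s ezL).
Qed.

Lemma dom_self w v x : inQ x -> parabolic J v ->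
  dom v (act v (xi x)) /\ eta x - act v^-1%g (act v (xi x)) = x.
Proof.
move=> [_ _ x1] vJ; rewrite actK eta_xi; split=> //; split=> // s sJ.
by rewrite actK xi_form // subr_ge0.
Qed.

(* The chart is a metric product, so three points in geodesic position project to
   aligned points of [V_J]. *)
Lemma geodesic_affine w v1 v2 v3 x1 x2 x3 (r D1 D2 : R) :
  0 <= D1 -> 0 <= D2 -> parabolic J v1 -> near r x1 -> 0 <= r ->
  3 * (r + D1 + D2) < kap -> r + D1 + D2 < 1 ->
  (forall e, 0 < e -> exists2 l, l < D1 + e & reach (w * v1)%g x1 (w * v2)%g x2 l) ->
  (forall e, 0 < e -> exists2 l, l < D2 + e & reach (w * v2)%g x2 (w * v3)%g x3 l) ->
  (forall l, reach (w * v1)%g x1 (w * v3)%g x3 l -> D1 + D2 <= l) ->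
  D2 *: (act v2 (xi x2) - act v1 (xi x1)) = D1 *: (act v3 (xi x3) - act v2 (xi x2)).
Proof.
move=> D10 D20 v1J n1 r0 k3 rr h12 h23 low.
set u1 := act v1 _; set u2 := act v2 _; set u3 := act v3 _.
(* [N] vanishes exactly when the three projections are aligned in the ratio D1 : D2. When the two
   half paths are within e of D1 and D2, its square is at most K e. *)
pose N := D2 *: (u2 - u1) - D1 *: (u3 - u2).
pose K := (D1 + D2) * (D2 * (2 * D1 + 1) + D1 * (2 * D2 + 1)).
have K0 : 0 <= K by rewrite /K; nra.
(* Keeps the enlarged radius r + D1 + D2 + 2 e below kap / 3 and below 1. *)
pose e0 := Num.min 1 (Num.min ((kap - 3 * (r + D1 + D2)) / 6) ((1 - (r + D1 + D2)) / 3)).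
have e00 : 0 < e0 by rewrite !lt_min ltr01 !divr_gt0 ?subr_gt0.
have main e : 0 < e -> e <= e0 ->
    [/\ parabolic J v2, parabolic J v3 & B N N <= K * e].
  move=> ep; rewrite !le_min => /and3P[e1 e2 e3].
  pose rho := r + D1 + D2 + 2 * e.
  have rk : 3 * rho <= kap by move: e2; rewrite /rho ler_pdivlMr //; lra.
  have rho1 : rho < 1 by move: e3; rewrite /rho ler_pdivlMr //; lra.
  have [l1 l1e r1] := h12 e ep; have [l2 l2e r2] := h23 e ep.
  have l10 := reach_ge0 r1; have l20 := reach_ge0 r2.
  have [q1 q2] := reach_inQ r1; have [_ q3] := reach_inQ r2.
  have rl1 : r + l1 <= rho by rewrite /rho; lra.
  have [v2' [p [/mulgI <- v2J n2 [p0 pb] sh1]]] := path_shift (w := w) rk rho1 r1 erefl v1J n1 rl1.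
  have rl2 : r + l1 + l2 <= rho by rewrite /rho; lra.
  have [v3' [q [/mulgI <- v3J n3 [q0 qb] sh2]]] := path_shift (w := w) rk rho1 r2 erefl v2J n2 rl2.
  rewrite -/u1 -/u2 in pb; rewrite -/u2 -/u3 in qb; split=> //.
  have u1J : supp_in J u1 by apply: act_par_supp => //; apply: xi_supp.
  have u2J : supp_in J u2 by apply: act_par_supp => //; apply: xi_supp.
  have u3J : supp_in J u3 by apply: act_par_supp => //; apply: xi_supp.
  have [d1 E1] := dom_self w q1 v1J; have [d3 E3] := dom_self w q3 v3J.
  have nr1 : nrm u1 <= rho by rewrite nrm_act; case: n1 => h _; apply: le_trans h _; rewrite /rho; lra.
  have nr3 : nrm u3 <= rho by rewrite nrm_act; case: n3 => h _; apply: le_trans h _.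
  have [l lb lr] := shiftable_cat p0 q0 sh1 sh2 u1J u3J nr1 nr3 d1 d3.
  rewrite E1 E3 in lr; have Dl := le_trans (low _ lr) lb.
  have DD : (D1 + D2) ^+ 2 <= B (u1 - u3) (u1 - u3) + (p + q) ^+ 2.
    have S0 : 0 <= B (u1 - u3) (u1 - u3) + (p + q) ^+ 2.
      by rewrite addr_ge0 ?sqr_ge0 // (spherical_form_ge0 Js) //; apply: supp_inB.
    by rewrite -(sqr_sqrtr S0) ler_pXn2r ?nnegrE ?addr_ge0 ?sqrtr_ge0.
  rewrite (nrm_sq Js (supp_inB u1J u2J)) in pb.
  rewrite (nrm_sq Js (supp_inB u2J u3J)) in qb.
  pose a2 := B (u1 - u2) (u1 - u2); pose b2 := B (u2 - u3) (u2 - u3).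
  pose c2 := B (u1 - u2) (u2 - u3).
  have sum : B (u1 - u3) (u1 - u3) = a2 + b2 + 2 * c2.
    have -> : u1 - u3 = (u1 - u2) + (u2 - u3) by rewrite addrA subrK.
    rewrite /a2 /b2 /c2; move: (u1 - u2) (u2 - u3) => m n.
    by rewrite !formDl !formDr (formC n m); ring.
  have NE : B N N = D2 ^+ 2 * a2 + D1 ^+ 2 * b2 - 2 * D1 * D2 * c2.
    rewrite /N -(opprB u1) -(opprB u2 u3) /a2 /b2 /c2; move: (u1 - u2) (u2 - u3) => m n.
    by rewrite !scalerN !formDl !formDr !formNl !formNr !formZl !formZr (formC n m); ring.
  have pb' : a2 + p ^+ 2 <= D1 ^+ 2 + e * (2 * D1 + 1).
    apply: le_trans pb _; apply: (@le_trans _ _ ((D1 + e) ^+ 2)).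
      by rewrite ler_pXn2r ?nnegrE //; lra.
    by nra.
  have qb' : b2 + q ^+ 2 <= D2 ^+ 2 + e * (2 * D2 + 1).
    apply: le_trans qb _; apply: (@le_trans _ _ ((D2 + e) ^+ 2)).
      by rewrite ler_pXn2r ?nnegrE //; lra.
    by nra.
  rewrite NE; rewrite sum in DD; clear NE sum pb qb.
  have t1 : (D1 + D2) * D2 * (a2 + p ^+ 2) <= (D1 + D2) * D2 * (D1 ^+ 2 + e * (2 * D1 + 1)).
    by rewrite ler_wpM2l // mulr_ge0 // addr_ge0.
  have t2 : (D1 + D2) * D1 * (b2 + q ^+ 2) <= (D1 + D2) * D1 * (D2 ^+ 2 + e * (2 * D2 + 1)).
    by rewrite ler_wpM2l // mulr_ge0 // addr_ge0.
  have t3 : D1 * D2 * (D1 + D2) ^+ 2 <= D1 * D2 * (a2 + b2 + 2 * c2 + (p + q) ^+ 2).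
    by rewrite ler_wpM2l // mulr_ge0.
  have t4 := sqr_ge0 (D2 * p - D1 * q).
  rewrite /K; lra.
have [v2J v3J _] := main e0 e00 (lexx _).
have NJ : supp_in J N.
  by apply: supp_inB; apply: supp_inZ; apply: supp_inB; apply: act_par_supp => //; apply: xi_supp.
suff NN : B N N <= 0.
  apply/eqP; rewrite -subr_eq0 -/N; apply: contraT => n0.
  by have := spherical_posdef Js NJ n0; lra.
rewrite leNgt; apply/negP => NN; pose e := Num.min e0 (B N N / (2 * (K + 1))).
have K1 : 0 < 2 * (K + 1) by lra.
have ep : 0 < e by rewrite lt_min e00 divr_gt0.
have [|_ _ h] := main e ep; first by rewrite ge_min lexx.
have : e * (2 * (K + 1)) <= B N N by rewrite -ler_pdivlMr // ge_min lexx orbT.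
by nra.
Qed.

End LocalGeodesics.

(** * Heights over walls, folding, and comparison with word length *)

Section Walls.
Variables (R : realType) (W : coxeterSystem).
Local Notation S := (cox_gens W).
Local Notation V := {ffun S -> R}.
Local Notation B := (@cox_form W R).
Local Notation gen := (@cox_gen W).
Local Notation len := (@cox_length W).
Local Notation val := (word_val gen).
Local Notation bas := (@bas R W).
Local Notation act := (@act R W).
Implicit Types (x y z a b c : V) (s t : S) (u v w : cox_group W).

Implicit Types J K L : {set S}.

(* On each cell this is an affine function, with unit gradient along the walls
   of its type, vanishing on the wall of [c] and positive on the side of [c]. *)
Definition hgt c w x : R := rho (act w^-1%g c) - B x (act w^-1%g c).

Lemma hgt_sum c w x : hgt c w x = \sum_s act w^-1%g c s * (1 - B (bas s) x).
Proof.
rewrite /hgt /rho formC form_sum -sumrB; apply: eq_bigr => s _.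
by rewrite mulrBr mulr1.
Qed.

Lemma hgt_lin a c w x (k : R) : hgt (a + k *: c) w x = hgt a w x + k * hgt c w x.
Proof. by rewrite /hgt actD actZ rhoD rhoZ !formE; ring. Qed.

Lemma hgt_suml I (r : seq I) (k : I -> R) (F : I -> V) w x :
  hgt (\sum_(i <- r) k i *: F i) w x = \sum_(i <- r) k i * hgt (F i) w x.
Proof.
elim: r => [|i r IH]; first by rewrite !big_nil /hgt act0 rho0 form0r subrr.
by rewrite !big_cons addrC hgt_lin IH addrC.
Qed.

Lemma hgt_side c w x : root c -> inQ x -> side c w -> 0 <= hgt c w x.
Proof.
move=> rc [_ _ x1] sc; rewrite hgt_sum sumr_ge0 // => s _.
by rewrite mulr_ge0 ?subr_ge0 //; apply: sideP.
Qed.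

Lemma hgt_sideN c w x : root c -> inQ x -> ~~ side c w -> hgt c w x <= 0.
Proof.
move=> rc [_ _ x1] sc; rewrite hgt_sum sumr_le0 // => s _.
by rewrite mulr_le0_ge0 ?subr_ge0 // -oppr_ge0; have := sideNP rc sc s; rewrite ffunE.
Qed.

Lemma hgt_eq0 c w x : root c -> inQ x ->
  hgt c w x = 0 <-> supp_in (wall_type x) (act w^-1%g c).
Proof.
move=> rc qx; have [_ _ x1] := qx; split=> [|h]; last first.
  rewrite hgt_sum big1 // => s _; have [|sx] := boolP (s \in wall_type x).
    by rewrite inE => /eqP ->; rewrite subrr mulr0.
  by rewrite h // mul0r.
have gen d : nneg d -> \sum_s d s * (1 - B (bas s) x) = 0 -> supp_in (wall_type x) d.
  move=> d0 /eqP; rewrite psumr_eq0; last by move=> s _; rewrite mulr_ge0 ?subr_ge0.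
  move=> /allP h s; rewrite inE => sx; have := h s; rewrite mem_index_enum => /(_ isT) /implyP/(_ isT).
  by rewrite mulf_eq0 subr_eq0 [1 == _]eq_sym (negbTE sx) orbF => /eqP.
rewrite hgt_sum => h0; have [h|h] := root_sign (root_act w^-1%g rc); first exact: gen.
have := gen _ h; under eq_bigr do rewrite ffunE mulNr.
rewrite sumrN h0 oppr0 => /(_ erefl) hs s /hs.
by rewrite ffunE => /eqP; rewrite oppr_eq0 => /eqP.
Qed.

Lemma hgt_chart J c w v x : spherical J -> parabolic J v -> supp_in J (act w^-1%g c) ->
  hgt c (w * v)%g x = B (act w^-1%g c) (act v (xi J x)).
Proof.
move=> Js vJ cJ; rewrite hgt_sum invMg actM act_formr -/act.
set y := act v^-1%g _; rewrite form_sum; apply: eq_bigr => s _.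
have yJ : supp_in J y by apply: act_par_supp => //; apply: parV.
by have [sJ|sJ] := boolP (s \in J); [rewrite xi_form|rewrite yJ // !mul0r].
Qed.

(** A turn in W_J does not change the coordinates outside [J], and one nonzero coordinate decides
    the sign of a root. *)
Lemma side_par J c w v : root c -> parabolic J v -> ~ supp_in J (act w^-1%g c) ->
  side c (w * v)%g = side c w.
Proof.
move=> rc vJ; set y := act w^-1%g c => nJ.
have out t : t \notin J -> act (w * v)^-1%g c t = y t.
  by move=> tJ; rewrite invMg actM (act_par_out _ (parV vJ)).
case: (boolP (side c w)) => cw; case: (boolP (side c (w * v)%g)) => cwv //; exfalso; apply: nJ => t tJ.
  have := sideP rc cw t; have := sideNP rc cwv t.
  by rewrite !ffunE out // -/y; lra.
have := sideP rc cwv t; have := sideNP rc cw t.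
by rewrite !ffunE out // -/y; lra.
Qed.

(** Among the positive images of [c] under W_J, one with smallest [rho] is simple: otherwise a
    reflection with positive product would keep it positive and lower [rho]. *)
Lemma root_spherical J c : spherical J -> root c -> supp_in J c ->
  exists v s, [/\ parabolic J v, s \in J & c = act v (bas s)].
Proof.
move=> Js; have pos d : root d -> supp_in J d -> nneg d ->
    exists v s, [/\ parabolic J v, s \in J & d = act v (bas s)].
  move=> rd dJ d0; have [l lE] := (finite_seqP _).1 Js.
  have lP w : (w \in l) <-> parabolic J w by rewrite -[parabolic J w]/((parabolic J) w) lE.
  have l1 : 1%g \in [seq u <- l | 0 < rho (act u d)].
    rewrite mem_filter act1 (lt_le_trans ltr01 (rho_root_ge1 rd d0)).
    by apply/lP; exact: par1.
  have [u] := seq_max (fun u => - rho (act u d)) l1.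
  rewrite mem_filter => /andP[u0 /lP uJ] umin.
  have ru := root_act u rd; set y := act u d in u0 umin ru.
  have y0 : nneg y.
    by have [//|h] := root_sign ru; have := rho_nneg h; rewrite rhoN; lra.
  have yJ : supp_in J y by apply: act_par_supp.
  have [s sJ ys] : exists2 s, s \in J & 0 < B (bas s) y.
    apply: contrapT => h; have := root_form ru; rewrite form_sum => e.
    suff : \sum_s y s * B (bas s) y <= 0 by rewrite e; lra.
    apply: sumr_le0 => s _; have [sJ|sJ] := boolP (s \in J); last by rewrite yJ // mul0r.
    by rewrite mulr_ge0_le0 // leNgt; apply/negP => ?; apply: h; exists s.
  exists u^-1%g, s; split=> //; first exact: parV.
  have [ys1|ys1] := pselect (y = bas s); first by rewrite -ys1 actK.
  have n1 := nneg_refl_bas ru y0 ys1.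
  have := umin (gen s * u)%g; rewrite mem_filter actM -/y => h.
  suff : - rho (act (gen s) y) <= - rho y.
    rewrite act_gen /refl -scaleNr rhoD rhoZ.
    have -> : rho (bas s) = 1.
      by rewrite /rho (bigD1 s) //= big1 ?ffunE ?eqxx ?addr0 // => t ts; rewrite ffunE (negbTE ts).
    by move=> e; exfalso; clear -e ys; lra.
  apply: h; rewrite (lt_le_trans ltr01 (rho_root_ge1 (root_act _ ru) n1)).
  by apply/lP; apply: parM uJ; apply: par_gen.
move=> rc cJ; have [h|h] := root_sign rc; first exact: pos.
have [v [s [vJ sJ e]]] := pos _ (rootN rc) (supp_inN cJ) h.
exists (v * gen s)%g, s; split=> //; first by apply: parM => //; apply: par_gen.
by rewrite act_bas_gen -e opprK.
Qed.

Lemma refl_spherical J c : spherical J -> root c -> supp_in J c ->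
  exists2 v, parabolic J v & forall x, act v x = refl c x.
Proof.
move=> Js rc cJ; have [v [s [vJ sJ cE]]] := root_spherical Js rc cJ.
exists (v * gen s * v^-1)%g; first by apply: parM (parM vJ (par_gen sJ)) (parV vJ).
move=> x; rewrite cE !actM act_gen /refl actD actN actZ actVK.
by rewrite [in RHS]formC [in RHS]act_formr (formC _ (bas s)).
Qed.

Lemma spherical_roots_finite J : spherical J ->
  exists l : seq V, forall c, root c -> supp_in J c -> c \in l.
Proof.
move=> Js; have [l lE] := (finite_seqP _).1 Js.
exists [seq act u (bas s) | u <- l, s <- enum J] => c rc cJ.
have [v [s [vJ sJ ->]]] := root_spherical Js rc cJ.
apply/allpairsP; exists (v, s); split=> //=; last by rewrite mem_enum.
by have : (parabolic J) v by []; rewrite lE.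
Qed.

Definition fold_wall c r w : cox_group W := if side c w then w else (r * w)%g.

(** A turn crossing the wall of [c] takes place at a point of that wall, where the reflection is
    itself a turn. Every other step keeps the side, and there folding is the identity or left
    multiplication by [r]. *)
Lemma reach_fold c r w x w' x' l : root c -> (forall y, act r y = refl c y) ->
  reach w x w' x' l -> reach (fold_wall c r w) x (fold_wall c r w') x' l.
Proof.
move=> rc rE; have rr : (r * r = 1)%g.
  by apply: (@act_faithful R) => y; rewrite actM !rE reflK ?root_form // act1.
elim=> [{}w {}x qx|{}w {}x {}w' {}x' v {}l h IH vx|*]; [exact: reach_refl| |exact: reach_move].
have same : side c (w' * v)%g = side c w' -> reach (fold_wall c r w) x (fold_wall c r (w' * v)) x' l.
  move=> e; have -> : fold_wall c r (w' * v)%g = (fold_wall c r w' * v)%g.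
    by rewrite /fold_wall e; case: ifP => // _; rewrite mulgA.
  exact: reach_turn IH vx.
have [cJ|nJ] := pselect (supp_in (wall_type x') (act w'^-1%g c)); last first.
  by apply: same; apply: side_par vx nJ.
have [/same //|ne] := eqVneq (side c (w' * v)%g) (side c w').
have [_ [x0 Lx _]] := reach_inQ h.
have Js := spherical_sub (wall_type_supp x0) Lx.
have [v0 v0J v0E] := refl_spherical Js (root_act _ rc) cJ.
have v0r : (w' * v0 = r * w')%g.
  apply: (@act_faithful R) => y; rewrite !actM v0E rE /refl actD actN actZ actVK.
  by rewrite act_formr.
move: IH ne; rewrite /fold_wall; case: (side c w'); case: (side c (w' * v)%g) => // IH _.
  by rewrite mulgA -v0r -mulgA; apply: reach_turn IH _; apply: parM.
have -> : (w' * v = r * w' * (v0 * v))%g by rewrite mulgA -(mulgA r) v0r mulgA rr mul1g.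
by apply: reach_turn IH _; apply: parM.
Qed.

Lemma par_len_bound : exists N, forall J v, spherical J -> parabolic J v -> (len v <= N)%N.
Proof.
have [N NP] : exists N : {set S} -> nat, forall J v, spherical J -> parabolic J v -> (len v <= N J)%N.
  have h J : exists n, spherical J -> forall v, parabolic J v -> (len v <= n)%N.
    have [Js|?] := pselect (spherical J); last by exists 0%N.
    have [l lE] := (finite_seqP _).1 Js; exists (\max_(v <- l) len v)%N => _ v vJ.
    have vl : v \in l by have : (parabolic J) v by []; rewrite lE.
    by rewrite (big_rem v) //= leq_maxl.
  have [N NP] := choice h; exists N => J v Js; exact: NP.
exists (\sum_J N J)%N => J v Js vJ; apply: leq_trans (NP _ _ Js vJ) _.
by rewrite (bigD1 J) //= leq_addr.
Qed.

Lemma form_bas_step s x y : inQ x -> inQ y -> spherical (supp x :|: supp y)%SET ->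
  Num.max 0 (B (bas s) y) <= Num.max 0 (B (bas s) x) + nrm (x - y).
Proof.
move=> [x0 _ _] [y0 _ _]; set L := (_ :|: _)%SET => Ls.
have xL : supp_in L x by apply: supp_in_supp; exact: finset.subsetUl.
have yL : supp_in L y by apply: supp_in_supp; exact: finset.subsetUr.
have n0 := nrm_ge0 (x - y); have m0 : 0 <= Num.max 0 (B (bas s) x) by rewrite le_max lexx.
have [sL|sL] := boolP (s \in L); last first.
  by have /max_idPl-> := form_off_le0 y0 (yL _ sL); rewrite addr_ge0.
have := form_bas_nrm Ls sL (supp_inB xL yL); rewrite ler_norml formDr formNr => /andP[h _].
rewrite ge_max addr_ge0 //=.
have : B (bas s) x <= Num.max 0 (B (bas s) x) by rewrite le_max lexx orbT.
by lra.
Qed.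

(* The turns of a path of length less than [1/2] all belong to one finite
   standard parabolic subgroup. *)
Lemma reach_len_bound : exists N : nat, forall w x w' x' l, reach w x w' x' l ->
  (len (w^-1 * w')%g)%:R <= N%:R * (2 * l + 1) :> R.
Proof.
have [N NP] := par_len_bound; exists N => w x w' x' l h.
(* [w1] and [x1] mark the last restart, [d] the length since then. While d < 1/2, all turns belong
   to letters with B (e_s, x1) > 1/2, a spherical set; each of the k restarts consumes a length of
   at least 1/2. *)
suff [k [w1 [x1 [d [h1 h2 h3 [h4 h5 h6]]]]]] : exists (k : nat) w1 x1 (d : R), [/\
    (len (w^-1 * w1)%g <= N * k)%N, inQ x1,
    parabolic [set s | 1 / 2 < B (bas s) x1]%SET (w1^-1 * w')%g &
    [/\ 0 <= d < 1 / 2, k%:R <= 2 * (l - d) &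
        forall s, Num.max 0 (B (bas s) x') <= Num.max 0 (B (bas s) x1) + d]].
  have Js : spherical [set s | 1 / 2 < B (bas s) x1]%SET.
    case: h2 => x0 Lx _; apply: spherical_sub Lx; apply/fintype.subsetP => s.
    by rewrite inE => hs; apply: form_gt0_supp => //; lra.
  have : (len (w^-1 * w')%g <= N * k.+1)%N.
    have -> : (w^-1 * w' = w^-1 * w1 * (w1^-1 * w'))%g by rewrite mulgA mulgK.
    by apply: leq_trans (lenM _ _) _; rewrite mulnS addnC leq_add // (NP _ _ Js).
  rewrite -(ler_nat R) => /le_trans; apply; rewrite natrM ler_wpM2l ?ler0n //.
  by rewrite -natr1; lra.
elim: h => [{}w {}x qx|{}w {}x {}w' {}x' v {}l h [k [w1 [x1 [d [h1 h2 h3 [h4 h5 h6]]]]]] vx|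
  {}w {}x {}w' {}x' x'' {}l h [k [w1 [x1 [d [h1 h2 h3 [h4 h5 h6]]]]]] qx s].
- exists 0%N, w, x, 0; rewrite !mulVg len1 muln0; split=> //; first exact: par1.
  by split=> //; [lra|rewrite subrr mulr0|move=> s; rewrite addr0].
- exists k, w1, x1, d; split=> //; rewrite mulgA; apply: parM => //.
  apply: par_sub vx; apply/fintype.subsetP => s; rewrite !inE => /eqP sx.
  have := h6 s; rewrite sx; have -> : Num.max 0 1 = 1 :> R by apply/max_idPr; exact: ler01.
  by move: h4; have [|] := lerP 0 (B (bas s) x1); lra.
have qx' : inQ x' by case: (reach_inQ h).
have e0 := nrm_ge0 (x' - x'').
have [de|de] := ltrP (d + nrm (x' - x'')) (1 / 2).
  exists k, w1, x1, (d + nrm (x' - x'')); split=> //; split; [lra|lra|move=> t].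
  by have := form_bas_step t qx' qx s; have := h6 t; lra.
exists k.+1, w', x'', 0; rewrite mulVg; split=> //; last first.
- by split=> [||t]; [lra|rewrite -natr1; lra|rewrite addr0].
- exact: par1.
have Js : spherical [set s | 1 / 2 < B (bas s) x1]%SET.
  case: h2 => x0 Lx _; apply: spherical_sub Lx; apply/fintype.subsetP => t.
  by rewrite inE => hs; apply: form_gt0_supp => //; lra.
have -> : (w^-1 * w' = w^-1 * w1 * (w1^-1 * w'))%g by rewrite mulgA mulgK.
by apply: leq_trans (lenM _ _) _; rewrite mulnS addnC leq_add // (NP _ _ Js).
Qed.

Lemma spherical0 : spherical (finset.set0 : {set S}).
Proof.
apply: (@sub_finite_set _ _ [set 1%g]); last exact: finite_set1.
by move=> w [[|s p]]; [move=> _ <-|rewrite /= finset.in_set0].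
Qed.

Lemma par_set0 w : parabolic (finset.set0 : {set S}) w -> w = 1%g.
Proof. by move=> [[|s p]]; [move=> _ <-|rewrite /= finset.in_set0]. Qed.

Lemma spherical1 s : spherical (finset.set1 s).
Proof.
apply: (@sub_finite_set _ _ [set 1%g; gen s]); last exact: finite_set2.
apply: par_ind => [|t w ts _]; first by left.
by move: ts; rewrite finset.in_set1 => /eqP -> [->|->]; [right|left]; rewrite ?mulg1 ?cgenK.
Qed.

Lemma inQ0 : inQ (0 : V).
Proof.
split=> [s||s]; rewrite ?ffunE ?form0r ?ler01 //.
have -> : supp (0 : V) = finset.set0 by apply/finset.setP => s; rewrite !inE ffunE eqxx.
exact: spherical0.
Qed.

Lemma supp_bas s : supp (bas s) = finset.set1 s.
Proof.
by apply/finset.setP => t; rewrite !inE ffunE; case: (t == s); rewrite ?oner_neq0 ?eqxx.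
Qed.

Lemma inQ_bas s : inQ (bas s).
Proof.
split=> [t||t]; first by rewrite ffunE ler0n.
  by rewrite supp_bas; exact: spherical1.
rewrite form_bas; have [->|/cosmx_le0 h] := eqVneq t s; first by rewrite cosmx1.
exact: le_trans (h R) ler01.
Qed.

(** Cauchy-Schwarz against x_J with J the support of x: B (x, x) <= B (x, x_J), because all products
    B (e_s, x) are at most 1. *)
Lemma inQ_nrm_bound : exists C : R, forall x, inQ x -> nrm x <= C.
Proof.
pose C := \sum_(J : {set S}) nrm (@solve R W J (fun=> 1)).
exists C => x [x0 Lx x1]; pose J := supp x.
apply: (@le_trans _ _ (nrm (@solve R W J (fun=> 1)))); last first.
  by rewrite /C (bigD1 J) //= lerDl sumr_ge0 // => K _; exact: nrm_ge0.
have xJ : supp_in J x by apply: supp_in_supp; exact: fintype.subxx.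
have [sJ sE] := solveP (fun=> 1 : R) Lx.
have [n0|n0] := eqVneq (nrm x) 0; first by rewrite n0 nrm_ge0.
have np : 0 < nrm x by rewrite lt_def n0 nrm_ge0.
rewrite -(ler_pM2l np) -expr2 (nrm_sq Lx xJ).
apply: le_trans (le_trans (ler_norm _) (form_CS Lx xJ sJ)).
rewrite !(form_sum x); apply: ler_sum => s _; have [h|h] := boolP (s \in J).
  by rewrite sE // ler_wpM2l.
by rewrite xJ // !mul0r.
Qed.

(** The path visits the centres 0 of the chambers of a gallery and crosses the panel of s at e_s, at
    distance 1 from both centres. *)
Lemma reach_upper w x w' x' : inQ x -> inQ x' ->
  reach w x w' x' (nrm x + (len (w^-1 * w')%g)%:R * 2 + nrm x').
Proof.
move=> qx qx'.
have to0 u y : inQ y -> reach u y u 0 (nrm y).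
  move=> qy; rewrite -[in nrm _](subr0 y); apply: reach_move1 => //; first exact: inQ0.
  case: qy => _ h _; apply: spherical_sub h; rewrite finset.subUset fintype.subxx /=.
  by apply/fintype.subsetP => s; rewrite inE ffunE eqxx.
have from0 u y : inQ y -> reach u 0 u y (nrm y) by move=> qy; apply/reach_sym/to0.
apply: reach_trans (from0 w' x' qx'); apply: reach_trans (to0 w x qx) _.
have [r <- rE] := len_word (w^-1 * w')%g.
have {rE} -> : w' = (w * val r)%g by rewrite rE mulgA mulgV mul1g.
elim: r w => [|s r IH] u; first by rewrite /= mulg1 mul0r; apply: reach_refl; exact: inQ0.
rewrite [size _]/= -addn1 natrD mulrDl mul1r addrC /= mulgA; apply: reach_trans (IH _).
have b1 : nrm (bas s) = 1 by rewrite /nrm bas_form1 sqrtr1.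
have -> : 2 = nrm (bas s) + (0 + nrm (bas s)) by rewrite b1; lra.
apply: reach_trans (from0 u _ (inQ_bas s)) _.
apply: reach_trans (reach_turn1 u (inQ_bas s) (par_gen _)) (to0 _ _ (inQ_bas s)).
by rewrite inE bas_form1 eqxx.
Qed.

Lemma xi_wall_type x : inQ x -> xi (wall_type x) x = 0.
Proof.
move=> [x0 Lx _]; have Js := spherical_sub (wall_type_supp x0) Lx.
apply: (solve_uniq Js) => [||s sx]; first exact: xi_supp.
  by move=> s _; rewrite ffunE.
by rewrite xi_form // form0r; move: sx; rewrite inE => /eqP ->; rewrite subrr.
Qed.

Lemma near_self x : inQ x -> exists kap : R,
  [/\ 0 < kap, kap <= 1 & near (wall_type x) kap 0 x].
Proof.
move=> qx; have [_ _ x1] := qx; pose J := wall_type x.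
have [s0|sN] := pselect (exists s, s \notin J); last first.
  exists 1; split=> //; split; first by rewrite xi_wall_type // nrm0.
  by move=> s sJ; exfalso; apply: sN; exists s.
have [s0' s0J] := s0; have s0l : s0' \in [seq s <- enum S | s \notin J].
  by rewrite mem_filter s0J mem_enum.
have [m] := seq_max (fun s => B (bas s) x) s0l; rewrite mem_filter => /andP[mJ _] mm.
have mlt : B (bas m) x < 1 by rewrite lt_neqAle x1 andbT; move: mJ; rewrite inE.
exists (Num.min 1 (1 - B (bas m) x)); split; first by rewrite lt_min ltr01 subr_gt0.
  by rewrite ge_min lexx.
split; first by rewrite xi_wall_type // nrm0.
move=> s sJ; rewrite addr0; have := mm s; rewrite mem_filter sJ mem_enum => /(_ isT) h.
by have [|] := lerP 1 (1 - B (bas m) x); lra.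
Qed.

End Walls.

(** * Walls crossed by a flat *)

Section Euclid.
Variables (R : realType) (d : nat).
Implicit Types (x y z h : 'rV[R]_d) (k : R).

Definition dot x y : R := \sum_i x ord0 i * y ord0 i.
Definition en x : R := Num.sqrt (dot x x).

Lemma dotC x y : dot x y = dot y x.
Proof. by apply: eq_bigr => i _; rewrite mulrC. Qed.
Lemma dotDl x y z : dot (x + y) z = dot x z + dot y z.
Proof. by rewrite -big_split; apply: eq_bigr => i _; rewrite mxE mulrDl. Qed.
Lemma dotZl k x y : dot (k *: x) y = k * dot x y.
Proof. by rewrite /dot mulr_sumr; apply: eq_bigr => i _; rewrite mxE mulrA. Qed.
Lemma dotDr x y z : dot z (x + y) = dot z x + dot z y.
Proof. by rewrite dotC dotDl !(dotC z). Qed.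
Lemma dotZr k x y : dot x (k *: y) = k * dot x y.
Proof. by rewrite dotC dotZl dotC. Qed.
Lemma dotNl x y : dot (- x) y = - dot x y.
Proof. by rewrite -scaleN1r dotZl mulN1r. Qed.
Lemma dotNr x y : dot x (- y) = - dot x y.
Proof. by rewrite dotC dotNl dotC. Qed.
Lemma dot0l x : dot 0 x = 0. Proof. by rewrite -(scale0r x) dotZl mul0r. Qed.
Lemma dot0r x : dot x 0 = 0. Proof. by rewrite dotC dot0l. Qed.
Definition dotE := (dotDl, dotDr, dotZl, dotZr, dotNl, dotNr, dot0l, dot0r).

Lemma dot_suml I (r : seq I) (F : I -> 'rV[R]_d) y :
  dot (\sum_(i <- r) F i) y = \sum_(i <- r) dot (F i) y.
Proof.
by elim: r => [|i r IH]; rewrite ?big_nil ?dot0l // !big_cons dotDl IH.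
Qed.

Lemma dot_ge0 x : 0 <= dot x x.
Proof. by apply: sumr_ge0 => i _; rewrite -expr2 sqr_ge0. Qed.

Lemma dot_eq0 x : dot x x = 0 -> x = 0.
Proof.
move=> /eqP; rewrite psumr_eq0 => [/allP h|i _]; last by rewrite -expr2 sqr_ge0.
apply/rowP => i; rewrite mxE; have := h i; rewrite mem_index_enum => /(_ isT) /implyP/(_ isT).
by rewrite mulf_eq0 orbb => /eqP.
Qed.

Lemma en_ge0 x : 0 <= en x. Proof. exact: sqrtr_ge0. Qed.
Lemma en_sq x : en x ^+ 2 = dot x x. Proof. by rewrite sqr_sqrtr // dot_ge0. Qed.
Lemma en0 : en 0 = 0. Proof. by rewrite /en dot0l sqrtr0. Qed.
Lemma enZ k x : en (k *: x) = `|k| * en x.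
Proof. by rewrite /en dotZl dotZr mulrA -expr2 sqrtrM ?sqr_ge0 // sqrtr_sqr. Qed.
Lemma enN x : en (- x) = en x. Proof. by rewrite /en dotNl dotNr opprK. Qed.
Lemma enB x y : en (x - y) = en (y - x). Proof. by rewrite -enN opprB. Qed.
Lemma en_gt0 x : x <> 0 -> 0 < en x.
Proof.
move=> x0; rewrite lt_def en_ge0 andbT; apply/eqP => e; apply: x0; apply: dot_eq0.
by rewrite -en_sq e expr0n.
Qed.

Lemma dot_CS x y : dot x y <= en x * en y.
Proof.
have [->|/eqP/en_gt0 x0] := eqVneq x 0; first by rewrite dot0l en0 mul0r.
have := dot_ge0 (en x ^+ 2 *: y - dot x y *: x).
have -> : dot (en x ^+ 2 *: y - dot x y *: x) (en x ^+ 2 *: y - dot x y *: x) =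
    en x ^+ 2 * ((en x * en y) ^+ 2 - dot x y ^+ 2).
  rewrite !dotE (dotC y x) -!en_sq; ring.
rewrite pmulr_rge0 ?exprn_gt0 // subr_ge0 => h; apply: le_trans (ler_norm _) _.
by rewrite -(@ler_pXn2r _ 2) ?nnegrE ?mulr_ge0 ?en_ge0 // real_normK ?num_real.
Qed.

Lemma en_tri x y : en (x + y) <= en x + en y.
Proof.
rewrite -(@ler_pXn2r _ 2) ?nnegrE ?addr_ge0 ?en_ge0 // en_sq !dotE (dotC y x) -!en_sq.
by have := dot_CS x y; nra.
Qed.

Lemma en_triB x y : en (x - y) <= en x + en y.
Proof. by rewrite -(enN y); exact: en_tri. Qed.

Lemma en_coord x i : `|x ord0 i| <= en x.
Proof.
rewrite -(@ler_pXn2r _ 2) ?nnegrE ?en_ge0 // en_sq real_normK ?num_real //.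
rewrite /dot (bigD1 i) //= expr2 lerDl sumr_ge0 // => j _.
by rewrite -expr2 sqr_ge0.
Qed.

Lemma en_delta i : en (delta_mx 0 i) = 1.
Proof.
rewrite /en /dot (bigD1 i) //= big1 ?mxE ?eqxx ?mulr1 ?addr0 ?sqrtr1 // => j ji.
by rewrite mxE (negbTE ji) andbF mul0r.
Qed.

Lemma euclidean_distE x y : euclidean_dist x y = en (x - y).
Proof.
by congr Num.sqrt; apply: eq_bigr => i _; rewrite !mxE expr2.
Qed.

Lemma nonparallel x y : (forall k, y <> k *: x) -> exists h, dot x h = 0 /\ dot y h = 1.
Proof.
move=> np; have [->|/eqP x0] := eqVneq x 0.
  have y0 : dot y y != 0 by apply/eqP => /dot_eq0 e; apply: (np 0); rewrite e scale0r.
  by exists ((dot y y)^-1 *: y); rewrite dot0l dotZr mulVf.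
have xx : dot x x != 0 by apply/eqP => /dot_eq0.
pose h := y - (dot x y / dot x x) *: x.
have xh : dot x h = 0 by rewrite /h !dotE mulfVK // subrr.
have yh : dot y h = dot h h by rewrite {2}/h dotDl dotNl dotZl xh mulr0 subr0.
have hh : dot h h != 0.
  by apply/eqP => /dot_eq0 /eqP; rewrite /h subr_eq0 => /eqP; exact: np.
by exists ((dot h h)^-1 *: h); rewrite !dotZr xh mulr0 yh mulVf.
Qed.

Definition indep n (L : nat -> 'rV[R]_d) := forall c : nat -> R,
  \sum_(i < n) c i *: L i = 0 -> forall i, (i < n)%N -> c i = 0.

Lemma orthogonal_ex n (L : nat -> 'rV[R]_d) : (n < d)%N ->
  exists2 v, v <> 0 & forall i, (i < n)%N -> dot (L i) v = 0.
Proof.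
move=> nd; pose M : 'M[R]_(d, n) := \matrix_(j, i) L i ord0 j.
have /rowV0Pn[v /sub_kermxP vM v0] : kermx M != 0.
  by rewrite -mxrank_eq0 mxrank_ker subn_eq0 -ltnNge (leq_ltn_trans (rank_leq_col M)).
exists v => [|i lti]; first exact/eqP.
move: vM => /rowP/(_ (Ordinal lti)); rewrite !mxE => e; rewrite -[RHS]e dotC.
by apply: eq_bigr => j _; rewrite !mxE.
Qed.

Lemma indep_solve (L : nat -> 'rV[R]_d) (t : nat -> R) : indep d L ->
  exists x, forall i, (i < d)%N -> dot (L i) x = t i.
Proof.
move=> Li; pose M : 'M[R]_d := \matrix_(i, j) L i ord0 j.
have Mu : M \in unitmx.
  rewrite -row_free_unit -kermx_eq0; apply/eqP/row_matrixP => k; rewrite row0.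
  set v := row k _; have vM : v *m M = 0.
    by apply/sub_kermxP; exact: row_sub.
  move: v vM => v vM.
  pose c i := if insub i is Some j then v ord0 j else 0.
  have cE (j : 'I_d) : c j = v ord0 j by rewrite /c valK.
  apply/rowP => j; rewrite [RHS]mxE -[LHS]cE; apply: (Li c) => //; apply/rowP => m.
  move: vM => /rowP/(_ m); rewrite !mxE => e; rewrite -[RHS]e summxE.
  by apply: eq_bigr => l _; rewrite !mxE cE.
exists (invmx M *m \col_i t i)^T => i lti.
have := mulKVmx Mu (\col_(i < d) t i) => /matrixP/(_ (Ordinal lti) ord0); rewrite !mxE /= => <-.
by apply: eq_bigr => j _; rewrite !mxE.
Qed.

End Euclid.

(** * Locally constant predicates and greedy sequences *)

Section Sequences.

Lemma interval_connected (R : realType) (P : R -> Prop) :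
  (forall t, 0 <= t <= 1 -> exists2 e, 0 < e &
    forall s, 0 <= s <= 1 -> `|s - t| < e -> (P s <-> P t)) -> P 0 -> P 1.
Proof.
move=> loc P0; pose A := [set t | 0 <= t <= 1 /\ forall s, 0 <= s <= t -> P s].
have A0 : A 0.
  split=> [|s]; first by rewrite lexx ler01.
  by move=> h; have -> : s = 0 by apply/eqP; rewrite eq_le andbC.
have A1 t : A t -> t <= 1 by case=> /andP[].
have sA : has_sup A by split; [exists 0|exists 1].
have m0 : 0 <= sup A by apply: ub_le_sup A0; exists 1.
have m1 : sup A <= 1 by apply: ge_sup => //; exists 0.
have [|e e0 eP] := loc (sup A); first by rewrite m0.
have [t At tlt] := sup_adherent e0 sA; have [t01 tP] := At.
have tm : t <= sup A by apply: ub_le_sup At; exists 1.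
have t0 : 0 <= t by case/andP: t01.
have Pm : P (sup A).
  apply/(eP t) => //; last by apply: tP; rewrite t0 lexx.
  by rewrite distrC ger0_norm ?subr_ge0 //; lra.
pose m' := Num.min 1 (sup A + e / 2).
have m'e : m' <= sup A + e / 2 by rewrite ge_min lexx orbT.
have m'1 : m' <= 1 by rewrite ge_min lexx.
have m'P s : 0 <= s <= m' -> P s.
  move=> /andP[s0 sm]; have [st|st] := lerP s t; first by apply: tP; rewrite s0.
  apply/eP => //; first by rewrite s0 (le_trans sm).
  by rewrite ltr_norml; apply/andP; split; lra.
have : m' <= sup A.
  apply: ub_le_sup; first by exists 1.
  by split=> //; rewrite m'1 andbT le_min ler01 /=; lra.
rewrite /m' ge_min => /orP[h|]; last by lra.
by have -> : 1 = sup A by apply/eqP; rewrite eq_le h.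
Qed.

Lemma related_seq (T : eqType) (P : T -> Prop) (Q : T -> T -> Prop) :
  (forall l : seq T, (forall b, b \in l -> P b) ->
    exists2 c, P c & forall b, b \in l -> Q b c) ->
  exists2 f : nat -> T, forall n, P (f n) & forall i j, (i < j)%N -> Q (f i) (f j).
Proof.
move=> h; have h' : forall l : seq T, exists c, (forall b, b \in l -> P b) ->
    P c /\ forall b, b \in l -> Q b c.
  move=> l; have [/h[c ? ?]|n] := pselect (forall b, b \in l -> P b); first by exists c.
  by have [c] := h [::] (fun b => ltac:(done)); exists c.
have [g gP] := choice h'.
pose l := fix l n := if n is n.+1 then g (l n) :: l n else [::].
have lP n b : b \in l n -> P b.
  elim: n b => [//|n IH] b /=; rewrite inE => /orP[/eqP ->|]; last exact: IH.
  by have [] := gP _ IH.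
exists (fun n => g (l n)) => [n|i j ij]; first by have [] := gP _ (@lP n).
have [_] := gP _ (@lP j); apply; elim: j ij => [//|j IH].
rewrite ltnS leq_eqVlt => /orP[/eqP ->|/IH h2] /=; rewrite inE ?eqxx //.
by rewrite h2 orbT.
Qed.

Lemma injective_seq (T : eqType) (P : T -> Prop) :
  (forall l : seq T, exists2 c, P c & c \notin l) ->
  exists2 f : nat -> T, injective f & forall n, P (f n).
Proof.
move=> h; have [|f fP fn] := @related_seq T P (fun b c => b <> c).
  by move=> l _; have [c Pc cl] := h l; exists c => // b bl bc; rewrite -bc bl in cl.
exists f => // i j e; by case: (ltngtP i j) => // ij; case: (fn _ _ ij).
Qed.

End Sequences.

(** * Sides, folding and quadrants *)

Section Crossing.
Variables (R : realType) (W : coxeterSystem).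
Local Notation S := (cox_gens W).
Local Notation V := {ffun S -> R}.
Local Notation B := (@cox_form W R).
Local Notation len := (@cox_length W).
Local Notation act := (@act R W).
Implicit Types (x y z a b c : V) (s t : S) (u v w : cox_group W).

Lemma hgtN c w x : hgt (- c) w x = - hgt c w x.
Proof. by rewrite /hgt actN rhoN formNr; ring. Qed.

Lemma hgt_gt0_side c w x : root c -> inQ x -> 0 < hgt c w x -> side c w.
Proof.
move=> rc qx h; apply: contraT => /(hgt_sideN rc qx).
by rewrite leNgt h.
Qed.

Lemma hgt_lt0_side c w x : root c -> inQ x -> hgt c w x < 0 -> ~~ side c w.
Proof. by move=> rc qx h; apply/negP => /(hgt_side rc qx); rewrite leNgt h. Qed.

Lemma side_refl c r w : root c -> (forall y, act r y = refl c y) ->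
  side c (r * w)%g = ~~ side c w.
Proof.
move=> rc rE; rewrite -sideN // /side invMg actM.
have e : act r (- c) = c by rewrite actN rE refl_self ?root_form // opprK.
by rewrite -{1}e actK.
Qed.

Lemma side_fold c r w : root c -> (forall y, act r y = refl c y) ->
  side c (fold_wall c r w).
Proof.
by move=> rc rE; rewrite /fold_wall; case: ifP => // /negbT; rewrite side_refl.
Qed.

Lemma fold_zero c r w x : root c -> (forall y, act r y = refl c y) -> inQ x ->
  hgt c w x = 0 -> parabolic (wall_type x) (w^-1 * (r * w))%g.
Proof.
move=> rc rE qx /(hgt_eq0 w rc qx) cJ; have [x0 Lx _] := qx.
have Js := spherical_sub (wall_type_supp x0) Lx.
have [v vJ vE] := refl_spherical Js (root_act _ rc) cJ.
suff <- : v = (w^-1 * (r * w))%g by [].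
apply: (@act_faithful R) => y; rewrite vE !actM rE /refl actD actN actZ actK.
by rewrite act_formr.
Qed.

(** Opposite quadrants exclude B <= -1 by [cross_gtN1]; the other two quadrants do the same for [a]
    and [- b]. *)
Lemma quadrants a b u1 u2 w1 w2 : root a -> root b -> side a u1 -> side a u2 ->
  ~~ side a w1 -> ~~ side a w2 -> side b u1 != side b u2 -> side b w1 != side b w2 ->
  `|B a b| < 1.
Proof.
move=> ra rb + + + + bu bw.
wlog : u1 u2 bu / side b u1.
  move=> h; case b1: (side b u1); first by apply: h.
  by move=> a1 a2; apply: (h u2 u1) => //; move: bu; rewrite b1; case: (side b u2).
move=> b1; wlog : w1 w2 bw / side b w1.
  move=> h; case b3: (side b w1); first by apply: h.
  by move=> a1 a2 a3 a4; apply: (h w2 w1) => //; move: bw; rewrite b3; case: (side b w2).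
move=> b3 a1 a2 a3 a4; have b2 : ~~ side b u2 by move: bu; rewrite b1; case: (side b u2).
have b4 : ~~ side b w2 by move: bw; rewrite b3; case: (side b w2).
have h1 := cross_gtN1 ra rb a1 b1 a4 b4.
have := @cross_gtN1 R W a (- b) u2 w1 ra (rootN rb) a2.
by rewrite !sideN // formNr b3 => /(_ b2 a3 isT); rewrite ltr_norml; lra.
Qed.

(** Such a chamber is determined by its sides of the finitely many roots in [l], so there are
    finitely many of them. *)
Lemma sep_finite (l : seq V) : exists M, forall w,
  (forall c, root c -> side c 1%g -> ~~ side c w -> c \in l) -> (len w <= M)%N.
Proof.
pose Wl := [set w | forall c, root c -> side c 1%g -> ~~ side c w -> c \in l].
pose mask w : (size l).-tuple bool := [tuple side (tnth (in_tuple l) i) w | i < size l].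
have mask_inj w w' : Wl w -> Wl w' -> mask w = mask w' -> w = w'.
  move=> h h' mw; have pos c : root c -> side c 1%g -> side c w = side c w'.
    move=> rc c1; have [cl|cl] := boolP (c \in l).
      have ci : (index c l < size l)%N by rewrite index_mem.
      have := congr1 (fun m => tnth m (Ordinal ci)) mw; rewrite !tnth_mktuple.
      by rewrite (tnth_nth 0) /= nth_index.
    have -> : side c w by apply: contraT => /(h _ rc c1); rewrite (negbTE cl).
    by apply/esym; apply: contraT => /(h' _ rc c1); rewrite (negbTE cl).
  apply: (@sep_ex R) => c rc; have [/pos->//|c1] := boolP (side c 1%g).
  have := pos (- c) (rootN rc); rewrite !sideN // c1 => /(_ isT) e.
  by apply: negb_inj.
have ex (m : (size l).-tuple bool) : exists u, (exists2 w, Wl w & mask w = m) -> Wl u /\ mask u = m.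
  by have [[w h e]|n] := pselect (exists2 w, Wl w & mask w = m); [exists w|exists 1%g].
have [g gP] := choice ex.
exists (\max_m len (g m))%N => w wl.
have [g1 g2] := gP _ (ex_intro2 _ _ w wl erefl).
by rewrite -(mask_inj _ _ g1 wl g2); apply: (@leq_bigmax _ (fun m => len (g m))).
Qed.

End Crossing.

(** * Traces of walls on a flat *)

Section Flat.
Variables (R : realType) (W : coxeterSystem) (d : nat).
Local Notation S := (cox_gens W).
Local Notation V := {ffun S -> R}.
Local Notation B := (@cox_form W R).
Local Notation len := (@cox_length W).
Local Notation act := (@act R W).
Local Notation E := 'rV[R]_d.
Implicit Types (a b c : V) (x y h k e L v : E).

Variables (wx : E -> cox_group W) (zx : E -> V) (r0 : R).
Hypotheses (r0_gt0 : 0 < r0) (zxQ : forall x, inQ (zx x)) (wx0 : wx 0 = 1%g).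
Hypothesis reach_flat : forall x y r, en (x - y) < r ->
  exists2 l, l < r & reach (wx x) (zx x) (wx y) (zx y) l.
Hypothesis reach_ball : forall x y l, en x < r0 ->
  reach (wx x) (zx x) (wx y) (zx y) l -> en (x - y) <= l.

Local Notation hg c x := (hgt c (wx x) (zx x)).
Local Notation wt x := (wall_type (zx x)).

Lemma wt_spherical x : spherical (wt x).
Proof. by have [x0 Lx _] := zxQ x; apply: spherical_sub Lx; apply: wall_type_supp. Qed.

Lemma chart_near y kap r x : 0 < kap -> kap <= 1 -> near (wt y) kap 0 (zx y) ->
  en (x - y) < r -> r < kap ->
  near (wt y) kap r (zx x) /\ parabolic (wt y) ((wx y)^-1 * wx x)%g.
Proof.
move=> k0 k1 ny xr rk; have xr' := xr; rewrite enB in xr'; have [l lr h] := reach_flat xr'.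
have [|n p] := near_reach (wt_spherical y) k1 h ny; first by lra.
by split=> //; apply: near_le n; lra.
Qed.

Lemma local_pos c y : root c -> 0 < hg c y ->
  exists2 rho : R, 0 < rho & forall x, en (x - y) < rho -> 0 < hg c x.
Proof.
move=> rc hy; have [kap [k0 k1 ny]] := near_self (zxQ y).
exists (kap / 2) => [|x xy]; first by rewrite divr_gt0.
have [|nx px] := chart_near k0 k1 ny xy; first by rewrite ltr_pdivrMr // ltr_pMr // ltr1n.
have nJ : ~ supp_in (wt y) (act (wx y)^-1%g c).
  by move=> /(hgt_eq0 _ rc (zxQ y)) e; rewrite e ltxx in hy.
(* Turns near [y] do not change this coordinate of [c], and nearby points keep away from the wall of
   [s]: its term alone keeps the height positive. *)
have [s sJ s0] : exists2 s, s \notin wt y & act (wx y)^-1%g c s != 0.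
  by apply: contrapT => h; apply: nJ => s sJ; apply: contrapT => /eqP ?; apply: h; exists s.
have wE : wx x = (wx y * ((wx y)^-1 * wx x))%g by rewrite mulKVg.
have sx : side c (wx x) by rewrite wE (side_par rc px nJ) (hgt_gt0_side rc (zxQ y)).
have cx := sideP rc sx; have [_ _ x1] := zxQ x.
have cs : act (wx x)^-1%g c s = act (wx y)^-1%g c s.
  by rewrite wE invMg actM (act_par_out _ (parV px)).
rewrite hgt_sum (bigD1 s) //= ltr_pwDl //; last first.
  by apply: sumr_ge0 => t _; rewrite mulr_ge0 ?subr_ge0.
rewrite mulr_gt0 //; first by rewrite lt_def cs s0 -cs cx.
by have := nx.2 s sJ; lra.
Qed.

Lemma local_neq0 c y : root c -> hg c y <> 0 ->
  exists2 rho : R, 0 < rho & forall x, en (x - y) < rho -> hg c x <> 0.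
Proof.
move=> rc hy; have [h|h|//] := ltrgtP (hg c y) 0; last first.
  by have [rho ? hr] := local_pos rc h; exists rho => // x /hr; lra.
have [|rho ? hr] := @local_pos (- c) y (rootN rc); first by rewrite hgtN; lra.
by exists rho => // x /hr; rewrite hgtN; lra.
Qed.

(** The segment is prolonged backwards to a point of the ball of radius [r0], from which distances
    are exact; so its part near [y] is geodesic. In the chart at [y] the height is a linear function
    of the component in V_J, to which [geodesic_affine] applies. *)
Lemma affine_dir c y : root c -> hg c y = 0 ->
  exists2 rho : R, 0 < rho & forall x e D1 D2 s, 0 <= D1 -> 0 <= D2 -> D1 <= s ->
    en (x - D1 *: e - y) < rho -> en (x - y) < rho -> en (x + D2 *: e - y) < rho ->
    en (x - s *: e) < r0 ->
    D2 * (hg c x - hg c (x - D1 *: e)) = D1 * (hg c (x + D2 *: e) - hg c x).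
Proof.
move=> rc hy; have [kap [k0 k1 ny]] := near_self (zxQ y).
exists (kap / 16); first by rewrite divr_gt0.
move=> x e D1 D2 s D10 D20 D1s q1y q2y q3y bb.
have [->|/eqP/en_gt0 e0] := eqVneq e 0; first by rewrite !scaler0 subr0 addr0 !subrr !mulr0.
set q1 := x - D1 *: e in q1y *; set q3 := x + D2 *: e in q3y *.
have k16 : kap / 16 < kap by lra.
have [n1 p1] := chart_near k0 k1 ny q1y k16.
have [n2 p2] := chart_near k0 k1 ny q2y k16.
have [n3 p3] := chart_near k0 k1 ny q3y k16.
have cJ : supp_in (wt y) (act (wx y)^-1%g c) by apply/(hgt_eq0 _ rc (zxQ y)).
have hE q : parabolic (wt y) ((wx y)^-1 * wx q)%g ->
    hg c q = B (act (wx y)^-1%g c) (act ((wx y)^-1 * wx q)%g (xi (wt y) (zx q))).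
  by move=> pq; rewrite -(@hgt_chart R W _ c (wx y) _ (zx q) (wt_spherical y) pq cJ) mulKVg.
have d12 : en (q1 - x) = D1 * en e.
  by rewrite /q1 addrAC subrr add0r enN enZ ger0_norm.
have d23 : en (x - q3) = D2 * en e.
  by rewrite /q3 opprD addNKr enN enZ ger0_norm.
have t12 := en_triB (q1 - y) (x - y); rewrite opprB addrA subrK d12 in t12.
have t23 := en_triB (x - y) (q3 - y); rewrite opprB addrA subrK d23 in t23.
have G := @geodesic_affine R W _ (wt_spherical y) kap k0 k1 (wx y) _ _ _ (zx q1) (zx x) (zx q3)
  (kap / 16) (D1 * en e) (D2 * en e) (mulr_ge0 D10 (ltW e0)) (mulr_ge0 D20 (ltW e0)) p1 n1 _.
have {G} := G ((wx y)^-1 * wx x)%g ((wx y)^-1 * wx q3)%g; rewrite !mulKVg => G.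
have G1 : D2 * en e *: (act ((wx y)^-1 * wx x)%g (xi (wt y) (zx x)) -
    act ((wx y)^-1 * wx q1)%g (xi (wt y) (zx q1))) =
    D1 * en e *: (act ((wx y)^-1 * wx q3)%g (xi (wt y) (zx q3)) -
    act ((wx y)^-1 * wx x)%g (xi (wt y) (zx x))).
  apply: G; [lra|lra|lra|move=> t t0..|].
  - by apply: reach_flat; rewrite d12 ltrDl.
  - by apply: reach_flat; rewrite d23 ltrDl.
  move=> l h; rewrite leNgt; apply/negP => lt.
  have [|l' lt' h'] := @reach_flat (x - s *: e) q1 ((s - D1) * en e + (D1 * en e + D2 * en e - l)).
    have -> : x - s *: e - q1 = - ((s - D1) *: e).
      by rewrite /q1; apply/rowP => i; rewrite !mxE; ring.
    by rewrite enN enZ ger0_norm ?subr_ge0 // ltrDl subr_gt0.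
  have := reach_ball bb (reach_trans h' h).
  have -> : x - s *: e - q3 = - ((s + D2) *: e).
    by rewrite /q3; apply/rowP => i; rewrite !mxE; ring.
  rewrite enN enZ ger0_norm; last by lra.
  by lra.
have := congr1 (fun u => B (act (wx y)^-1%g c) u) G1.
rewrite !formZr !formDr !formNr -!hE // mulrAC (mulrAC D1) => /(mulIf _); apply.
by rewrite gt_eqF.
Qed.

Definition locaff c y L := exists2 rho : R, 0 < rho &
  forall x, en (x - y) < rho -> hg c x = dot L (x - y).

Lemma locaff_eq0 c y L : locaff c y L -> hg c y = 0.
Proof. by case=> rho r1 /(_ y) ->; rewrite subrr ?dot0r ?en0. Qed.

(** With t = tau y rho, the vector e = t y is short, while going back from y by t^-1 e leads to the
    centre of the ball. This makes e, and its small perturbations, directions allowed in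
    [affine_dir]. *)
Let tau y (rho : R) := Num.min 1 (rho / (8 * (en y + 1))).

Lemma tauP y (rho : R) : 0 < rho ->
  [/\ 0 < tau y rho, tau y rho <= 1 & en (tau y rho *: y) < rho / 8].
Proof.
move=> r1; have y0 := en_ge0 y; have y1 : 0 < en y + 1 by lra.
have t0 : 0 < tau y rho by rewrite /tau lt_min ltr01 /= divr_gt0 // mulr_gt0.
split=> //; first by rewrite /tau ge_min lexx.
rewrite enZ gtr0_norm //; apply: (@le_lt_trans _ _ (rho / (8 * (en y + 1)) * en y)).
  by rewrite ler_wpM2r // /tau ge_min lexx orbT.
by rewrite invfM mulrA -mulrA gtr_pMr ?divr_gt0 // mulrC ltr_pdivrMr // mul1r; lra.
Qed.

(** [affine_dir] gives the midpoint identity at x in the nearly radial directions e + h and e - h,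
    and at x + h and x - h in the direction e. The four corners x +- e +- h occur once on each side,
    which leaves the identity for an arbitrary small h. *)
Lemma jensen c y : root c -> hg c y = 0 ->
  exists2 rho : R, 0 < rho & forall x h, en (x - y) < rho -> en h < rho ->
    hg c (x + h) + hg c (x - h) = 2 * hg c x.
Proof.
move=> rc hy; have [rho r1 aff] := affine_dir rc hy.
have [t0 t1 te] := tauP y r1; set t := tau y rho in t0 t1 te *; set e := t *: y in te.
have yE : y = t^-1 *: e by rewrite /e scalerA mulVf ?scale1r // gt_eqF.
exists (Num.min (rho / 8) (t * r0 / 8)).
  by rewrite lt_min !divr_gt0 ?mulr_gt0.
move=> x h; rewrite !lt_min => /andP[x1 x2] /andP[h1 h2].
have tr : t * r0 / 8 <= r0 / 8 by rewrite -mulrA ler_piMl // divr_ge0 // ltW.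
have ht : en (t^-1 *: h) < r0 / 8.
  by rewrite enZ gtr0_norm ?invr_gt0 // mulrC ltr_pdivrMr // mulrC mulrA.
have s1 : 1 <= t^-1 by rewrite -invr1 lef_pV2 // ?posrE.
have n3 (p q s : E) : en p < rho / 8 -> en q < rho / 8 -> en s < rho / 8 -> en (p + q + s) < rho.
  by move=> ? ? ?; have := en_tri (p + q) s; have := en_tri p q; lra.
have nn (p : E) : en p < rho / 8 -> en (- p) < rho / 8 by rewrite enN.
have n1 (p : E) : en p < rho / 8 -> en p < rho by lra.
have n2 (p q : E) : en p < rho / 8 -> en q < rho / 8 -> en (p + q) < rho.
  by move=> ? ?; have := en_tri p q; lra.
have b2 (p q : E) : en p < r0 / 8 -> en q < r0 / 8 -> en (p + q) < r0.
  by move=> ? ?; have r00 := r0_gt0; have := en_tri p q; lra.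
have hN : en (- h) < rho / 8 by rewrite enN.
have xr : en (x - y) < r0 / 8 by lra.
have hr : en h < r0 / 8 by lra.
have A (g : E) : en g < rho / 8 -> en (t^-1 *: g) < r0 / 8 ->
    hg c x - hg c (x - (e + g)) = hg c (x + (e + g)) - hg c x.
  move=> g1 g2; have := aff x (e + g) 1 1 t^-1; rewrite !scale1r !mul1r; apply=> //.
  - have -> : x - (e + g) - y = (x - y) + - e + - g by apply/rowP => i; rewrite !mxE; ring.
    by apply: n3 => //; exact: nn.
  - exact: n1.
  - have -> : x + (e + g) - y = (x - y) + e + g by apply/rowP => i; rewrite !mxE; ring.
    exact: n3.
  - rewrite scalerDr -yE opprD addrA; apply: b2 => //; by rewrite enN.
have C (g : E) : en g < rho / 8 -> en g < r0 / 8 ->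
    hg c (x + g) - hg c (x + g - e) = hg c (x + g + e) - hg c (x + g).
  move=> g1 g2; have := aff (x + g) e 1 1 t^-1; rewrite !scale1r !mul1r; apply=> //.
  - have -> : x + g - e - y = (x - y) + g + - e by apply/rowP => i; rewrite !mxE; ring.
    by apply: n3 => //; exact: nn.
  - have -> : x + g - y = (x - y) + g by apply/rowP => i; rewrite !mxE; ring.
    exact: n2.
  - have -> : x + g + e - y = (x - y) + g + e by apply/rowP => i; rewrite !mxE; ring.
    exact: n3.
  - rewrite -yE; have -> : x + g - y = (x - y) + g by apply/rowP => i; rewrite !mxE; ring.
    exact: b2.
have A1 := A h h1 ht; have A2 := A (- h) (nn _ h1); rewrite scalerN enN in A2.
have {A2} A2 := A2 ht.
have C1 := C h h1 hr; have C2 := C (- h) (nn _ h1); rewrite enN in C2; have {C2} C2 := C2 hr.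
have E1 : x - (e - h) = x + h - e by apply/rowP => i; rewrite !mxE; ring.
have E2 : x + (e - h) = x - h + e by apply/rowP => i; rewrite !mxE; ring.
have E3 : x - (e + h) = x - h - e by apply/rowP => i; rewrite !mxE; ring.
have E4 : x + (e + h) = x + h + e by apply/rowP => i; rewrite !mxE; ring.
by rewrite E1 E2 in A2; rewrite E3 E4 in A1; lra.
Qed.

(** Additivity near [y] comes from [jensen]. Homogeneity holds along e and e + g, which are nearly
    radial, hence along g by difference; L is then read off on small multiples of the basis
    vectors. *)
Lemma locaff_ex c y : root c -> hg c y = 0 -> exists L, locaff c y L.
Proof.
move=> rc hy; have [rA rA0 aff] := affine_dir rc hy; have [rJ rJ0 jen] := jensen rc hy.
pose rho := Num.min rA (Num.min rJ r0) / 2.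
have [rho0 rhoA rhoJ rhor] : [/\ 0 < rho, rho < rA, rho < rJ & rho < r0].
  have m0 : 0 < Num.min rA (Num.min rJ r0) by rewrite !lt_min rA0 rJ0.
  have mA : Num.min rA (Num.min rJ r0) <= rA by rewrite ge_min lexx.
  have mJ : Num.min rA (Num.min rJ r0) <= rJ by rewrite ge_min ge_min lexx orbT.
  have mr : Num.min rA (Num.min rJ r0) <= r0 by rewrite !ge_min lexx !orbT.
  by rewrite /rho; split; lra.
pose cc h := hg c (y + h).
have cc0 : cc 0 = 0 by rewrite /cc addr0.
have ccD h k : en h < rho -> en k < rho -> cc (h + k) = cc h + cc k.
  move=> h1 k1; have hk : en ((1 / 2 : R) *: (h + k)) < rJ.
    by rewrite enZ ger0_norm ?divr_ge0 //; have := en_tri h k; lra.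
  have hk' : en ((1 / 2 : R) *: (h - k)) < rJ.
    by rewrite enZ ger0_norm ?divr_ge0 //; have := en_triB h k; lra.
  have yx : y + (1 / 2 : R) *: (h + k) - y = (1 / 2 : R) *: (h + k) by rewrite addrAC subrr add0r.
  have := jen (y + (1 / 2 : R) *: (h + k)) ((1 / 2 : R) *: (h - k)); rewrite yx => /(_ hk hk').
  have := jen (y + (1 / 2 : R) *: (h + k)) ((1 / 2 : R) *: (h + k)); rewrite yx => /(_ hk hk).
  have -> : y + (1 / 2 : R) *: (h + k) + (1 / 2 : R) *: (h + k) = y + (h + k).
    by apply/rowP => i; rewrite !mxE; field.
  have -> : y + (1 / 2 : R) *: (h + k) + (1 / 2 : R) *: (h - k) = y + h.
    by apply/rowP => i; rewrite !mxE; field.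
  have -> : y + (1 / 2 : R) *: (h + k) - (1 / 2 : R) *: (h - k) = y + k.
    by apply/rowP => i; rewrite !mxE; field.
  by rewrite addrK hy /cc; lra.
have ccN h : en h < rho -> cc (- h) = - cc h.
  move=> h1; have := ccD h (- h); rewrite enN subrr cc0 => /(_ h1 h1); lra.
have [t0 t1 te] := tauP y rho0; set t := tau y rho in t0 t1 te *; set e := t *: y in te.
have yE : y = t^-1 *: e by rewrite /e scalerA mulVf ?scale1r // gt_eqF.
have s1 : 1 <= t^-1 by rewrite -invr1 lef_pV2 // ?posrE.
have hom1 g (p : R) : 0 <= p <= 1 -> en (e + g) < rho -> en (t^-1 *: g) < r0 ->
    cc (p *: (e + g)) = p * cc (e + g).
  move=> /andP[p0 p1] g1 g2; have pn : en (p *: (e + g)) < rA.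
    by rewrite enZ ger0_norm //; have := en_ge0 (e + g); nra.
  have := aff (y + p *: (e + g)) (e + g) p (1 - p) (p + t^-1).
  have -> : y + p *: (e + g) - p *: (e + g) = y by rewrite addrK.
  have -> : y + p *: (e + g) + (1 - p) *: (e + g) = y + (e + g).
    by apply/rowP => i; rewrite !mxE; ring.
  have -> : y + p *: (e + g) - (p + t^-1) *: (e + g) = - (t^-1 *: g).
    by rewrite {1}yE; apply/rowP => i; rewrite !mxE; ring.
  have addK (q : E) : y + q - y = q by rewrite addrAC subrr add0r.
  rewrite !addK subrr en0 enN hy => h.
  suff : (1 - p) * (cc (p *: (e + g)) - 0) = p * (cc (e + g) - cc (p *: (e + g))) by lra.
  have ti := invr_gt0 t; rewrite t0 in ti.
  by apply: h => //; lra.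
pose eta := Num.min (rho / 8) (t * r0 / 2).
have eta0 : 0 < eta by have tr := mulr_gt0 t0 r0_gt0; rewrite /eta lt_min; apply/andP; split; lra.
have eta8 : eta <= rho / 8 by rewrite ge_min lexx.
have etar : eta <= t * r0 / 2 by rewrite ge_min lexx orbT.
have hom h (p : R) : `|p| <= 1 -> en h <= eta -> cc (p *: h) = p * cc h.
  have pos g (q : R) : 0 <= q <= 1 -> en g <= eta -> cc (q *: g) = q * cc g.
    move=> q01 g1; have := q01 => /andP[q0 q1].
    have eg := en_tri e g; have eg1 : en (e + g) < rho by lra.
    have g2 : en (t^-1 *: g) < r0.
      rewrite enZ gtr0_norm ?invr_gt0 // mulrC ltr_pdivrMr //; have := mulr_gt0 t0 r0_gt0; lra.
    have h1 := hom1 _ _ q01 eg1 g2.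
    have h2 := hom1 0 q q01; rewrite addr0 scaler0 en0 in h2.
    have {h2} h2 : cc (q *: e) = q * cc e by apply: h2; lra.
    have ge0 := en_ge0 g; have ee0 := en_ge0 e.
    have qe : en (q *: e) < rho by rewrite enZ ger0_norm //; nra.
    have qg : en (q *: g) < rho by rewrite enZ ger0_norm //; nra.
    move: h1; rewrite scalerDr !ccD // ?h2; [lra|lra|lra].
  move=> p1 h1; have [p0|p0] := lerP 0 p.
    by apply: pos => //; rewrite p0 -(ger0_norm p0).
  have := pos h (- p); rewrite scaleNr ccN; last first.
    by rewrite enZ; have := en_ge0 h; nra.
  rewrite ltr0_norm // in p1; move=> /(_ _ h1) h2.
  by have := h2 ltac:(apply/andP; split; lra); lra.
pose L : E := \row_i (cc (eta *: delta_mx 0 i) / eta); exists L.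
have d0 : 0 < d%:R + 1 :> R by rewrite ltr_wpDl.
exists (eta / (d%:R + 1)); first by rewrite divr_gt0.
move=> x; have -> : hg c x = cc (x - y) by rewrite /cc addrC subrK.
move: (x - y) => h xy {x}.
have h1 : (d%:R + 1) * en h < eta by rewrite mulrC -ltr_pdivlMr.
have hc i : cc (h ord0 i *: delta_mx 0 i) = L ord0 i * h ord0 i.
  have hi := en_coord h i; have eh := en_ge0 h; have hd : 0 <= d%:R * en h by rewrite mulr_ge0.
  have -> : h ord0 i *: (delta_mx 0 i : E) = (h ord0 i / eta) *: (eta *: delta_mx 0 i).
    by rewrite scalerA mulfVK // gt_eqF.
  rewrite hom ?mxE; first by field; rewrite gt_eqF.
    by rewrite normrM normfV (gtr0_norm eta0) ler_pdivrMr // mul1r; lra.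
  by rewrite enZ en_delta mulr1 gtr0_norm.
have part (r : seq 'I_d) : (size r)%:R * en h < eta ->
    cc (\sum_(i <- r) h ord0 i *: delta_mx 0 i) = \sum_(i <- r) cc (h ord0 i *: delta_mx 0 i) /\
    en (\sum_(i <- r) h ord0 i *: (delta_mx 0 i : E)) <= (size r)%:R * en h.
  elim: r => [|i r IH]; first by rewrite !big_nil en0 mul0r.
  rewrite [size _]/= -natr1 mulrDl mul1r => hs; have eh := en_ge0 h.
  have [IH1 IH2] := IH ltac:(lra); rewrite !big_cons.
  have hi : en (h ord0 i *: (delta_mx 0 i : E)) <= en h.
    by rewrite enZ en_delta mulr1 en_coord.
  have hd : 0 <= (size r)%:R * en h by rewrite mulr_ge0.
  split; first by rewrite ccD ?IH1 //; lra.
  by have := en_tri (h ord0 i *: (delta_mx 0 i : E)) (\sum_(j <- r) h ord0 j *: delta_mx 0 j); lra.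
have [] := part (enum 'I_d); first by rewrite size_enum_ord; have := en_ge0 h; lra.
rewrite !big_enum /= -row_sum_delta => -> _; apply: eq_bigr => i _; exact: hc.
Qed.

Lemma locaff_near c y L : locaff c y L -> exists2 rho : R, 0 < rho &
  forall y', en (y' - y) < rho -> hg c y' = 0 -> locaff c y' L.
Proof.
case=> rho r1 aff; exists rho => // y' yy' h0.
exists (rho - en (y' - y)) => [|x xy']; first by rewrite subr_gt0.
have := aff _ yy'; rewrite h0 => e0.
rewrite aff; last first.
  by rewrite -(subrK y' x) -addrA; have := en_tri (x - y') (y' - y); lra.
have -> : x - y = (x - y') + (y' - y) by rewrite addrA subrK.
by rewrite dotDr -e0 addr0.
Qed.

Lemma locaff_uniq c y L L' : locaff c y L -> locaff c y L' -> L = L'.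
Proof.
move=> [r1 r10 h1] [r2 r20 h2]; pose D := L - L'; have eD := en_ge0 D.
pose r := Num.min r1 r2; have r_0 : 0 < r by rewrite lt_min r10.
pose k := r / (en D + 1); have k0 : 0 < k by rewrite divr_gt0 //; lra.
have kD : en (k *: D) < r.
  rewrite enZ gtr0_norm // /k mulrAC ltr_pdivrMr; last by lra.
  by rewrite ltr_pM2l //; lra.
have yk : y + k *: D - y = k *: D by rewrite addrAC subrr add0r.
have := h1 (y + k *: D); have := h2 (y + k *: D); rewrite yk.
have [ra rb] : r <= r1 /\ r <= r2 by rewrite !ge_min !lexx orbT.
move=> -> ; last exact: lt_le_trans rb.
move=> /(_ (lt_le_trans kD ra)) e.
have : k * dot D D = 0 by rewrite -dotZr {1}/D dotDl dotNl e subrr.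
move=> /eqP; rewrite mulf_eq0 gt_eqF //= => /eqP /dot_eq0 /eqP.
by rewrite subr_eq0 => /eqP.
Qed.

Lemma locaffN c y L : locaff c y L -> locaff (- c) y (- L).
Proof. by case=> r r_0 h; exists r => // x /h hx; rewrite hgtN hx dotNl. Qed.

Lemma seg_near x k (t rho : R) : 0 < rho -> exists2 e : R, 0 < e &
  forall s, `|s - t| < e -> en (x + s *: k - (x + t *: k)) < rho.
Proof.
move=> r1; have ek := en_ge0 k; exists (rho / (en k + 1)); first by rewrite divr_gt0 //; lra.
move=> s st; have -> : x + s *: k - (x + t *: k) = (s - t) *: k.
  by apply/rowP => i; rewrite !mxE; ring.
rewrite enZ; move: st; rewrite ltr_pdivlMr; last by lra.
by have := normr_ge0 (s - t); nra.
Qed.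

(** Connectedness along the segment: near a zero of the height the linear part is unique, so having
    linear part L is an open condition and so is its negation. *)
Lemma propagate c y L k : root c -> locaff c y L -> dot L k = 0 -> locaff c (y + k) L.
Proof.
move=> rc hy Lk; rewrite -(scale1r k).
apply: (@interval_connected R (fun t => locaff c (y + t *: k) L)); last first.
  by rewrite scale0r addr0.
move=> t _; have [h0|h0] := pselect (hg c (y + t *: k) = 0); last first.
  have [rho r1 hr] := local_neq0 rc h0; have [e e0 he] := seg_near y k t r1.
  exists e => // s _ /he /hr hs; split=> [/locaff_eq0 //|].
  by move=> /locaff_eq0.
have [L' hL'] := locaff_ex rc h0; have [rho r1 hr] := locaff_near hL'.
have [r2 r20 h2] := hL'; pose r := Num.min rho r2.
have [e e0 he] : exists2 e : R, 0 < e & forall s, `|s - t| < e -> en (y + s *: k - (y + t *: k)) < r.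
  by apply: seg_near; rewrite lt_min r1.
exists e => // s _ /he; rewrite lt_min => /andP[s1 s2]; split=> hs.
  by rewrite -(locaff_uniq (hr _ s1 (locaff_eq0 hs)) hs).
rewrite (locaff_uniq hs hL'); apply: hr => //; rewrite h2 // (locaff_uniq hL' hs).
have -> : y + s *: k - (y + t *: k) = (s - t) *: k.
  by apply/rowP => i; rewrite !mxE; ring.
by rewrite dotZr Lk mulr0.
Qed.

Lemma ivt c x k : root c -> 0 < hg c x -> hg c (x + k) <= 0 ->
  exists2 t, 0 <= t <= 1 & hg c (x + t *: k) = 0.
Proof.
move=> rc h0 h1; apply: contrapT => no; suff : 0 < hg c (x + 1 *: k).
  by rewrite scale1r ltNge h1.
apply: (@interval_connected R (fun t => 0 < hg c (x + t *: k))); last first.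
  by rewrite scale0r addr0.
move=> t t01; have [ht|ht|ht] := ltrgtP (hg c (x + t *: k)) 0.
- have [|rho r1 hr] := @local_pos (- c) (x + t *: k) (rootN rc); first by rewrite hgtN; lra.
  have [e e0 he] := seg_near x k t r1; exists e => // s _ /he /hr; rewrite hgtN.
  by split; lra.
- have [rho r1 hr] := local_pos rc ht.
  by have [e e0 he] := seg_near x k t r1; exists e => // s _ /he /hr.
- by exfalso; apply: no; exists t.
Qed.

Lemma fold_par c r y : root c -> (forall a, act r a = refl c a) -> hg c y = 0 ->
  parabolic (wt y) ((wx y)^-1 * fold_wall c r (wx y))%g.
Proof.
move=> rc rE hy; rewrite /fold_wall; case: ifP => _; first by rewrite mulVg; exact: par1.
exact: fold_zero rc rE (zxQ y) hy.
Qed.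

(** Fold the ray between its zeros t1 and t2. The folded path has the same ends and length, so it is
    still geodesic; but its height falls to 0 at t1 and is nonnegative afterwards, a corner excluded
    by [geodesic_affine]. *)
Lemma fold_contra c v (t1 t2 : R) L : root c -> 0 < t1 -> t1 < t2 -> locaff c (t1 *: v) L ->
  dot L v < 0 -> hg c (t2 *: v) = 0 -> False.
Proof.
move=> rc t10 t12 hL Lv h2; have v0 : 0 < en v.
  by apply: en_gt0 => e; rewrite e dot0r ltxx in Lv.
have hy := locaff_eq0 hL; have [rho r1 aff] := hL; set y := t1 *: v in hy hL aff.
have [kap [k0 k1 ny]] := near_self (zxQ y).
pose m := Num.min (Num.min t1 (t2 - t1)) (Num.min rho (kap / 16) / en v).
have m0 : 0 < m by rewrite !lt_min t10 subr_gt0 t12 divr_gt0 // lt_min r1 divr_gt0.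
have m1 : m <= t1 by rewrite /m !ge_min lexx.
have m2 : m <= t2 - t1 by rewrite /m !ge_min lexx orbT.
have m3 : m * en v <= Num.min rho (kap / 16).
  by rewrite -ler_pdivlMr // /m ge_min lexx orbT.
have [m4 m5] : m * en v <= rho /\ m * en v <= kap / 16.
  by split; apply: le_trans m3 _; rewrite ge_min lexx ?orbT.
clearbody m; pose dl := m / 2; pose D := dl * en v.
have [dl0 dl1 dl2 D0'] : [/\ 0 < dl, dl < t1, dl < t2 - t1 & 0 < D /\ D < rho /\ D < kap / 16].
  have mv := mulr_gt0 m0 v0; rewrite /D /dl; split; [lra|lra|lra|].
  by split; [nra|split; nra].
have [D0 [Dr Dk]] := D0'.
pose q1 := (t1 - dl) *: v; pose q3 := (t1 + dl) *: v; pose q4 := t2 *: v.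
have ev (p q : R) : en (p *: v - q *: v) = `|p - q| * en v by rewrite -scalerBl enZ.
have y1 : en (y - q1) = D by rewrite ev (_ : t1 - (t1 - dl) = dl) ?gtr0_norm //; ring.
have y3 : en (y - q3) = D.
  by rewrite enB ev (_ : t1 + dl - t1 = dl) ?gtr0_norm //; ring.
have [r rE] := root_refl rc; pose F x := fold_wall c r (wx x).
have pathF (e : R) : 0 < e -> exists2 l, l < D + e & reach (wx y) (zx y) (F q3) (zx q3) l.
  move=> e0; have [|l lt h] := @reach_flat y q3 (D + e); first by rewrite y3 ltrDl.
  exists l => //; have := reach_turn1 (wx y) (zxQ y) (fold_par rc rE hy); rewrite mulKVg.
  by move=> /reach_trans/(_ (reach_fold rc rE h)); rewrite add0r.
have p3 : parabolic (wt y) ((wx y)^-1 * F q3)%g.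
  have [|l lt h] := pathF (kap - D); first by lra.
  by have [|//] := near_reach (wt_spherical y) k1 h ny; lra.
have [n1 p1] : near (wt y) kap (kap / 16) (zx q1) /\ parabolic (wt y) ((wx y)^-1 * wx q1)%g.
  by apply: chart_near => //; [rewrite enB y1|lra].
have low l : reach (wx q1) (zx q1) (F q3) (zx q3) l -> D + D <= l.
  move=> h; rewrite leNgt; apply/negP => lt; pose g := (D + D - l) / 2.
  have g0 : 0 < g by rewrite /g; lra.
  have [|l0 lt0 hl0] := @reach_flat 0 q1 ((t1 - dl) * en v + g).
    by rewrite sub0r enN enZ ger0_norm ?ltrDl // subr_ge0 ltW.
  have [|l2 lt2 hl2] := @reach_flat q3 q4 ((t2 - t1 - dl) * en v + g).
    rewrite enB ev ger0_norm; last by lra.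
    by rewrite opprD addrA ltrDl.
  have := reach_fold rc rE hl2; rewrite -/(F q3) -/(F q4) => hl3.
  have := parV (fold_par rc rE h2); rewrite invMg invgK => /(reach_turn1 (F q4) (zxQ q4)).
  rewrite mulKVg => hl4.
  have := reach_ball _ (reach_trans (reach_trans (reach_trans hl0 h) hl3) hl4).
  rewrite en0 => /(_ r0_gt0); rewrite sub0r enN enZ gtr0_norm; last by lra.
  by rewrite /g /D in lt0 lt2 *; lra.
have cJ : supp_in (wt y) (act (wx y)^-1%g c) by apply/(hgt_eq0 _ rc (zxQ y)).
have hE (v' : cox_group W) q : parabolic (wt y) ((wx y)^-1 * v')%g ->
    hgt c v' (zx q) = B (act (wx y)^-1%g c) (act ((wx y)^-1 * v')%g (xi (wt y) (zx q))).
  by move=> pq; rewrite -(@hgt_chart R W _ c (wx y) _ (zx q) (wt_spherical y) pq cJ) mulKVg.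
have G := @geodesic_affine R W _ (wt_spherical y) kap k0 k1 (wx y) _ _ _ (zx q1) (zx y) (zx q3)
  (kap / 16) D D (ltW D0) (ltW D0) p1 n1 _.
have {G} := G ((wx y)^-1 * wx y)%g ((wx y)^-1 * F q3)%g; rewrite !mulKVg => G.
have G1 : D *: (act ((wx y)^-1 * wx y)%g (xi (wt y) (zx y)) -
    act ((wx y)^-1 * wx q1)%g (xi (wt y) (zx q1))) =
    D *: (act ((wx y)^-1 * F q3)%g (xi (wt y) (zx q3)) -
    act ((wx y)^-1 * wx y)%g (xi (wt y) (zx y))).
  apply: G => //; [lra|lra|lra|move=> e e0].
  by apply: reach_flat; rewrite enB y1 ltrDl.
have := congr1 (fun u => B (act (wx y)^-1%g c) u) G1.
rewrite !formZr !formDr !formNr -!hE //; last by rewrite mulVg; exact: par1.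
move=> /mulfI; rewrite gt_eqF // => /(_ isT); rewrite hy.
have -> : hg c q1 = - dl * dot L v.
  rewrite aff; last by rewrite enB y1.
  by rewrite /q1 /y -scalerBl dotZr (_ : t1 - dl - t1 = - dl) //; ring.
have := hgt_side rc (zxQ q3) (side_fold (wx q3) rc rE); rewrite -/(F q3).
by have := mulr_gt0 dl0 (ltac:(lra) : 0 < - dot L v); lra.
Qed.

Lemma no_two_zeros c v (t1 t2 : R) : root c -> hg c 0 <> 0 -> 0 < t1 -> t1 < t2 ->
  hg c (t1 *: v) = 0 -> hg c (t2 *: v) = 0 -> False.
Proof.
move=> rc h0 t10 t12 h1 h2; have [L hL] := locaff_ex rc h1.
have [Lv|Lv|Lv] := ltrgtP (dot L v) 0.
- exact: fold_contra hL Lv h2.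
- apply: (fold_contra (rootN rc) t10 t12 (locaffN hL)); first by rewrite dotNl; lra.
  by rewrite hgtN h2 oppr0.
apply: h0; have := @propagate _ _ _ (- (t1 *: v)) rc hL; rewrite subrr => h.
by apply: (locaff_eq0 (h _)); rewrite dotNr dotZr Lv mulr0 oppr0.
Qed.

Lemma ray_neg c v (t : R) L : root c -> 0 < hg c 0 -> locaff c (t *: v) L -> 0 < t ->
  dot L v < 0 /\ forall t', t < t' -> hg c (t' *: v) < 0.
Proof.
move=> rc h0 hL t0; have h0' : hg c 0 <> 0 by move=> e; rewrite e ltxx in h0.
have ht := locaff_eq0 hL; have nz := no_two_zeros rc h0'.
have Lv0 : dot L v <> 0.
  move=> Lv; apply: h0'; have := @propagate _ _ _ (- (t *: v)) rc hL; rewrite subrr => h.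
  by apply: (locaff_eq0 (h _)); rewrite dotNr dotZr Lv mulr0 oppr0.
have near_t (m : R) : 0 < m -> exists2 dl, 0 < dl < m &
    forall s : R, `|s| <= dl -> hg c ((t + s) *: v) = s * dot L v.
  move=> m0; have [rho r1 aff] := hL; have ev := en_ge0 v.
  pose dl := Num.min m (rho / (en v + 1)) / 2.
  have n0 : 0 < rho / (en v + 1) by rewrite divr_gt0 //; lra.
  have [d0 dm dr] : [/\ 0 < dl, dl < m & dl < rho / (en v + 1)].
    have mn : 0 < Num.min m (rho / (en v + 1)) by rewrite lt_min m0.
    have mm : Num.min m (rho / (en v + 1)) <= m by rewrite ge_min lexx.
    have mr : Num.min m (rho / (en v + 1)) <= rho / (en v + 1) by rewrite ge_min lexx orbT.
    by rewrite /dl; split; lra.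
  exists dl; first by rewrite d0.
  move=> s sd; rewrite aff -scalerBl (_ : t + s - t = s) ?dotZr //; try ring.
  rewrite enZ; move: dr; rewrite ltr_pdivlMr; last by lra.
  by have := normr_ge0 s; nra.
have Lv : dot L v < 0.
  rewrite ltNge; apply/negP => Lv; have {}Lv : 0 < dot L v by rewrite lt_def Lv andbT; apply/eqP.
  have [dl /andP[d0 dt] hd] := near_t _ t0; have := hd (- dl); rewrite normrN gtr0_norm // lexx.
  move=> /(_ isT) hn; have neg : hg c (0 + (t - dl) *: v) <= 0.
    by rewrite add0r hn; have := mulr_gt0 d0 Lv; lra.
  have [s /andP[s0 s1]] := ivt rc h0 neg; rewrite add0r scalerA => hs.
  have sp : 0 < s by rewrite lt_def s0 andbT; apply/eqP => e; move: hs; rewrite e mul0r scale0r.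
  by apply: (nz v (s * (t - dl)) t); rewrite ?mulr_gt0 ?subr_gt0 //; nra.
split=> // t' tt'; have [dl /andP[d0 dt] hd] := near_t (t' - t) ltac:(lra).
rewrite ltNge; apply/negP => ge.
have := hd dl; rewrite gtr0_norm // lexx => /(_ isT) hn.
have pos : 0 < hg (- c) ((t + dl) *: v).
  by rewrite hgtN hn; have := mulr_gt0 d0 (ltac:(lra) : 0 < - dot L v); lra.
have [|s /andP[s0 s1]] := @ivt (- c) ((t + dl) *: v) ((t' - t - dl) *: v) (rootN rc) pos.
  by rewrite -scalerDl (_ : t + dl + (t' - t - dl) = t') ?hgtN; [lra|ring].
rewrite scalerA -scalerDl hgtN => /eqP; rewrite oppr_eq0 => /eqP.
apply: (nz v t) => //; have := mulr_ge0 s0 (ltac:(lra) : 0 <= t' - t - dl); lra.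
Qed.

Definition ray_root v c := [/\ root c, 0 < hg c 0 & exists (t : R) L, 0 < t /\ locaff c (t *: v) L].

(** If finitely many walls were crossed, the chambers along the ray would have bounded length, hence
    would stay at bounded distance from the origin. *)
Lemma ray_root_infinite v (l : seq V) : v <> 0 -> exists2 c, ray_root v c & c \notin l.
Proof.
move=> /en_gt0 v0; apply: contrapT => no.
have gl c : ray_root v c -> c \in l by move=> gc; apply: contraT => cl; case: no; exists c.
have [l0 l0P] := spherical_roots_finite R (wt_spherical 0).
have [M MP] := sep_finite (l0 ++ l).
have lenM (T : R) : 0 <= T -> (len (wx (T *: v)) <= M)%N.
  move=> T0; apply: MP => c rc c1 cT; rewrite mem_cat.
  have [h0|h0] := pselect (hg c 0 = 0).
    by rewrite l0P //; move/(hgt_eq0 _ rc (zxQ 0)): h0; rewrite wx0 invg1 act1.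
  have p0 : 0 < hg c 0.
    by rewrite lt_def (introN eqP h0) /=; apply: hgt_side; rewrite ?wx0.
  have n0 : hg c (0 + T *: v) <= 0 by rewrite add0r; exact: hgt_sideN.
  have [s /andP[s0 s1]] := ivt rc p0 n0; rewrite add0r scalerA => hs.
  have sT : 0 < s * T.
    by rewrite lt_def mulr_ge0 // andbT; apply/eqP => e; apply: h0; rewrite -hs e scale0r.
  have [L hL] := locaff_ex rc hs.
  by rewrite gl ?orbT //; split=> //; exists (s * T), L.
have [C CP] := inQ_nrm_bound R W; have C0 := le_trans (nrm_ge0 _) (CP _ (zxQ 0)).
(* The point T v is farther from 0 than [reach_upper] allows for a chamber of length at most M. *)
pose T := (2 * C + 2 * M%:R + 1) / en v.
have T0 : 0 <= T by rewrite divr_ge0 ?en_ge0 // !addr_ge0 ?mulr_ge0.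
have h := reach_upper 1%g (wx (T *: v)) (zxQ 0) (zxQ (T *: v)).
rewrite -{1}wx0 in h; have := reach_ball _ h; rewrite en0 => /(_ r0_gt0).
rewrite sub0r enN enZ ger0_norm // /T mulfVK ?gt_eqF // invg1 mul1g.
have := CP _ (zxQ 0); have := CP _ (zxQ (T *: v)); rewrite -/T.
by have := lenM _ T0; rewrite -(ler_nat R); lra.
Qed.

(** The two traces propagate to a common point, and around it both heights take all four
    combinations of signs. *)
Lemma nonparallel_cross a b ya La yb Lb : root a -> root b -> locaff a ya La ->
  locaff b yb Lb -> La <> 0 -> (forall k : R, Lb <> k *: La) -> `|B a b| < 1.
Proof.
move=> ra rb ha hb La0 np; have [h [ah bh]] := nonparallel np.
have np' (k : R) : La <> k *: Lb.
  move=> e; have k0 : k != 0 by apply/eqP => k0; apply: La0; rewrite e k0 scale0r.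
  by apply: (np k^-1); rewrite e scalerA mulVf // scale1r.
have [g [bg ag]] := nonparallel np'.
pose t := dot Lb (yb - ya); pose y := ya + t *: h.
have hya : locaff a y La by apply: propagate => //; rewrite dotZr ah mulr0.
have hyb : locaff b y Lb.
  rewrite -(subrK yb y) addrC; apply: propagate => //.
  rewrite (_ : y - yb = t *: h - (yb - ya)); last by rewrite /y; apply/rowP => i; rewrite !mxE; ring.
  by rewrite dotDr dotNr dotZr bh mulr1 subrr.
have [r1 r10 h1] := hya; have [r2 r20 h2] := hyb.
pose m := Num.min r1 r2; have m0 : 0 < m by rewrite lt_min r10.
have eh := en_ge0 h; have eg := en_ge0 g.
pose e := m / (2 * (en h + en g + 1)); have e0 : 0 < e by rewrite divr_gt0 //; lra.
have em : e * (en h + en g) < m.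
  by rewrite /e mulrAC ltr_pdivrMr; [nra|lra].
have val (p q : R) : `|p| = e -> `|q| = e ->
    hg a (y + (p *: g + q *: h)) = p /\ hg b (y + (p *: g + q *: h)) = q.
  move=> pe qe; have n : en (y + (p *: g + q *: h) - y) < m.
    rewrite addrAC subrr add0r; have := en_tri (p *: g) (q *: h).
    by rewrite !enZ pe qe; lra.
  rewrite h1 ?h2; [|apply: lt_le_trans n _; rewrite /m ge_min lexx ?orbT //..].
  by rewrite addrAC subrr add0r !dotDr !dotZr ah ag bh bg; split; ring.
have ne : `|- e| = e by rewrite normrN gtr0_norm.
have pe : `|e| = e by rewrite gtr0_norm.
have S (p q : R) : `|p| = e -> `|q| = e -> exists w, side a w = (0 < p) /\ side b w = (0 < q).
  move=> pp qq; have [va vb] := val _ _ pp qq; set x := y + _ in va vb; exists (wx x).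
  have sg c (z : R) : root c -> hg c x = z -> `|z| = e -> side c (wx x) = (0 < z).
    move=> rc cx ze; have [z0|z0] := ltrP 0 z.
      by apply: hgt_gt0_side (zxQ x) _; rewrite ?cx.
    apply/negbTE; apply: hgt_lt0_side (zxQ x) _; rewrite ?cx // lt_neqAle z0 andbT.
    by apply/eqP => z1; move: e0; rewrite -ze z1 normr0 ltxx.
  by rewrite (sg a p) ?(sg b q).
have [u1 [u1a u1b]] := S e e pe pe; have [u2 [u2a u2b]] := S e (- e) pe ne.
have [u3 [u3a u3b]] := S (- e) e ne pe; have [u4 [u4a u4b]] := S (- e) (- e) ne ne.
have ep : 0 < e = true by []; have en : 0 < - e = false by apply/negbTE; rewrite -leNgt; lra.
apply: (quadrants ra rb (u1 := u1) (u2 := u2) (w1 := u3) (w2 := u4));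
  by rewrite ?u1a ?u2a ?u3a ?u4a ?u1b ?u2b ?u3b ?u4b ?ep ?en.
Qed.

(* The wall of [c] meets the flat along a hyperplane orthogonal to [L]. *)
Definition fam L c := [/\ root c, 0 < hg c 0 &
  exists y (mu : R), [/\ 0 < mu, locaff c y (mu *: L) & dot L y < 0]].

(** If every direction occurred for finitely many of the infinitely many walls met by the ray, one
    could choose an infinite sequence with pairwise nonparallel traces, which cross and contradict
    [no_crossing_seq]. *)
Lemma class_ex v : v <> 0 -> exists L, dot L v < 0 /\
  exists2 f : nat -> V, injective f & forall n, fam L (f n).
Proof.
move=> v0; apply: contrapT => no.
have ex c : exists L, ray_root v c -> exists2 t : R, 0 < t & locaff c (t *: v) L.
  by have [[_ _ [t [L [t0 h]]]]|n] := pselect (ray_root v c); [exists L => _; exists t|exists 0].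
have [Lf LfP] := choice ex.
have fin b : ray_root v b -> exists l : seq V, forall c, ray_root v c -> (exists k : R, Lf c = k *: Lf b) -> c \in l.
  move=> gb; apply: contrapT => nf; apply: no; have [rb b0 _] := gb.
  have [tb tb0 hb] := LfP _ gb; have [Lb _] := ray_neg rb b0 hb tb0.
  exists (Lf b); split=> //; apply: injective_seq => l; apply: contrapT => nl; apply: nf.
  exists l => c gc [k kE]; apply: contraT => cl; case: nl; exists c => //.
  have [rc c0 _] := gc; have [t t0 ht] := LfP _ gc; have [Lc _] := ray_neg rc c0 ht t0.
  split=> //; exists (t *: v), k; rewrite -kE; split=> //; last by rewrite dotZr; nra.
  by move: Lc; rewrite kE dotZl nmulr_llt0.
have [|f fP fQ] := @related_seq _ (ray_root v) (fun b c => forall k : R, Lf c <> k *: Lf b).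
  move=> l lg; have [m mP] : exists m : seq V, forall b c, b \in l -> ray_root v c ->
      (exists k : R, Lf c = k *: Lf b) -> c \in m.
    elim: l lg => [|b l IH] lg; first by exists [::].
    have [|m mP] := IH; first by move=> c cl; apply: lg; rewrite inE cl orbT.
    have [|m' m'P] := fin b; first by apply: lg; rewrite inE eqxx.
    exists (m' ++ m) => b' c; rewrite inE mem_cat => /orP[/eqP ->|bl] gc kex.
      by rewrite m'P.
    by rewrite (mP b') ?orbT.
  have [c gc cm] := ray_root_infinite m v0; exists c => // b bl k kE.
  by move/negP: cm; apply; apply: (mP b) => //; exists k.
apply: (@no_crossing_seq R W f) => [n|i j ij]; first by case: (fP n).
have [[ri i0 _] [rj j0 _]] := (fP i, fP j).
have [[ti ti0 hi] [tj tj0 hj]] := (LfP _ (fP i), LfP _ (fP j)).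
apply: (nonparallel_cross ri rj hi hj _ (fQ _ _ ij)) => e.
by have [] := ray_neg ri i0 hi ti0; rewrite e dot0l ltxx.
Qed.

(** The next ray direction [v] is orthogonal to the normals found so far, whereas the new normal has
    a negative product with it: hence independence. *)
Lemma families (k : nat) : (k <= d)%N -> exists (A : nat -> nat -> V) (L : nat -> E),
  indep k L /\ forall i, (i < k)%N -> injective (A i) /\ forall n, fam (L i) (A i n).
Proof.
elim: k => [|k IH] kd; first by exists (fun _ _ => 0), (fun=> 0); split=> // c _ i.
have [A [L [Li AP]]] := IH (ltnW kd).
have [v v0 Lv] := orthogonal_ex L kd; have [L0 [L0v [f fi fP]]] := class_ex v0.
exists (fun i => if i == k then f else A i), (fun i => if i == k then L0 else L i).
split=> [c|i]; last first.
  by rewrite ltnS leq_eqVlt => /orP[/eqP ->|ik]; rewrite ?eqxx // ltn_eqF //; exact: AP.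
rewrite big_ord_recr /= eqxx.
under eq_bigr => i _ do rewrite ltn_eqF //.
move=> e; have ck : c k = 0.
  have := congr1 (fun u => dot u v) e; rewrite dotDl dot_suml big1 => [|i _].
    by rewrite add0r dotZl dot0l => /eqP; rewrite mulf_eq0 (lt_eqF L0v) orbF => /eqP.
  by rewrite dotZl Lv // mulr0.
move: e; rewrite ck scale0r addr0 => /Li cl i.
by rewrite ltnS leq_eqVlt => /orP[/eqP ->|/cl].
Qed.

Lemma fam_neg L c v : fam L c -> dot L v < 0 ->
  exists T0 : R, forall T, T0 < T -> hg c (T *: v) < 0.
Proof.
move=> [rc c0 [y [mu [mu0 h Ly]]]] Lv; pose T0 := dot L y / dot L v.
have T00 : 0 < T0 by rewrite /T0 ltr_ndivlMr // mul0r.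
have hT : locaff c (T0 *: v) (mu *: L).
  rewrite -(subrK y (T0 *: v)) addrC; apply: propagate => //.
  by rewrite dotZl dotDr dotNr dotZr /T0 mulfVK ?lt_eqF // subrr mulr0.
by exists T0; have [_] := ray_neg rc c0 hT T00.
Qed.

Lemma displacement c r y v L : root c -> (forall a, act r a = refl c a) -> locaff c y L ->
  dot L v = 0 -> exists C : nat, forall T : R,
    (len ((wx (T *: v))^-1 * (r * wx (T *: v)))%g <= C)%N.
Proof.
move=> rc rE hy Lv; have [N1 N1P] := par_len_bound W; have [N2 N2P] := reach_len_bound R W.
have ey := en_ge0 y; pose Q : R := N2%:R * (2 * (en y + 1) + 1).
have Q0 : 0 <= Q by rewrite /Q mulr_ge0 //; lra.
pose M := Num.bound Q; exists (M + N1 + M)%N => T.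
set x := T *: v; pose x' := y + T *: v.
have hx' : locaff c x' L by apply: propagate => //; rewrite dotZr Lv mulr0.
have lM : (len ((wx x)^-1 * wx x')%g <= M)%N.
  have [|l lt h] := @reach_flat x x' (en y + 1).
    by rewrite /x' opprD addrCA subrr addr0 enN ltrDl.
  have := N2P _ _ _ _ _ h; rewrite -(ler_nat R) => /le_trans; apply.
  by apply: le_trans (ltW (archi_boundP Q0)); rewrite /Q ler_wpM2l //; lra.
have -> : ((wx x)^-1 * (r * wx x) = (wx x)^-1 * wx x' * ((wx x')^-1 * (r * wx x')) *
    ((wx x)^-1 * wx x')^-1)%g.
  by rewrite invMg invgK !mulgA !mulgK.
apply: leq_trans (lenM _ _) _; rewrite lenV leq_add //.
apply: leq_trans (lenM _ _) _; rewrite leq_add // (N1P _ _ (wt_spherical x')) //.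
exact: fold_zero rc rE (zxQ x') (locaff_eq0 hx').
Qed.

Definition gprod (rr : nat -> cox_group W) (l : seq nat) : cox_group W :=
  foldr (fun n g => (rr n * g)%g) 1%g l.

Lemma displacement_prod (rr : nat -> cox_group W) (l : seq nat) v :
  (forall n, exists C : nat, forall T : R,
    (len ((wx (T *: v))^-1 * (rr n * wx (T *: v)))%g <= C)%N) ->
  exists C : nat, forall T : R,
    (len ((wx (T *: v))^-1 * (gprod rr l * wx (T *: v)))%g <= C)%N.
Proof.
move=> h; elim: l => [|n l [C CP]]; first by exists 0%N => T; rewrite mul1g mulVg len1.
have [C' C'P] := h n; exists (C' + C)%N => T; set w := wx _.
have -> : (w^-1 * (gprod rr (n :: l) * w) = w^-1 * (rr n * w) * (w^-1 * (gprod rr l * w)))%g.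
  by rewrite /= !mulgA mulgK.
by apply: leq_trans (lenM _ _) _; rewrite leq_add ?CP ?C'P.
Qed.

(** In the direction [v], parallel to family [i] and transverse to family [j], both g and g r_n
    displace chambers boundedly. So most walls of family [j] separating 1 from a far chamber w also
    separate g and g r_n from g w and g r_n w. The wall of [b] separates g from g r_n and g w from g
    r_n w: all four quadrants are met. *)
Lemma fam_cross (A : nat -> nat -> V) (L : nat -> E) i j n (rr : nat -> cox_group W) l v :
  (forall m, fam (L i) (A i m)) -> (forall m, fam (L j) (A j m)) -> injective (A j) ->
  (forall m a, act (rr m) a = refl (A i m) a) -> dot (L i) v = 0 -> dot (L j) v < 0 ->
  exists N, forall m, (N <= m)%N -> `|B (A j m) (act (gprod rr l) (A i n))| < 1.
Proof.
move=> Ai Aj Aj_inj rrE Liv Ljv; set g := gprod rr l; set b := act g (A i n).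
have disp m : exists C : nat, forall T : R,
    (len ((wx (T *: v))^-1 * (rr m * wx (T *: v)))%g <= C)%N.
  have [rm _ [y [mu [mu0 hy _]]]] := Ai m.
  by apply: displacement rm (rrE m) hy _; rewrite dotZl Liv mulr0.
have [C1 C1P] := displacement_prod l disp.
have [C2 C2P] := displacement_prod (rcons l n) disp.
have gr : gprod rr (rcons l n) = (g * rr n)%g.
  by rewrite /g; elim: (l) => [|p l' IH] /=; rewrite ?mulg1 ?mul1g // IH mulgA.
rewrite gr in C2P.
apply: contrapT => no; have bad N : exists2 m, (N <= m)%N & ~ `|B (A j m) b| < 1.
  apply: contrapT => h; apply: no; exists N => m Nm; apply: contrapT => h2.
  by apply: h; exists m.
have [|f fP flt] := @related_seq _ (fun m => ~ `|B (A j m) b| < 1) (fun m m' => (m < m')%N).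
  move=> s _; have [m sm hm] := bad (\max_(p <- s) p).+1; exists m => // p ps.
  by apply: leq_ltn_trans sm; rewrite (big_rem p) //= leq_maxl.
have finj : injective f by move=> p q e; case: (ltngtP p q) => // /flt; rewrite e ltnn.
(* The lists [l1] to [l4] below have at most 4 (C1 + C2) elements in all, so one of K walls is in
   none of them. *)
pose K := (4 * (C1 + C2)).+1.
have [T0 T0P] : exists T0 : R, forall p, (p < K)%N -> forall T, T0 < T -> hg (A j (f p)) (T *: v) < 0.
  elim: K => [|K [T0 IH]]; first by exists 0.
  have [T1 h1] := fam_neg (Aj (f K)) Ljv; exists (Num.max T0 T1) => p.
  rewrite ltnS leq_eqVlt => /orP[/eqP ->|pK] T; rewrite gt_max => /andP[t0 t1]; first exact: h1.
  exact: IH.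
pose T := T0 + 1; pose w := wx (T *: v).
have [rb _ _] := Ai n; have rb' : root b by apply: root_act.
have [l1 [s1 h1]] := sep_list R 1%g g; have [l2 [s2 h2]] := sep_list R 1%g (g * rr n)%g.
have [l3 [s3 h3]] := sep_list R w (g * w)%g; have [l4 [s4 h4]] := sep_list R w (g * rr n * w)%g.
have sb u : side b (g * rr n * u)%g = ~~ side b (g * u)%g.
  rewrite /b -mulgA; rewrite /side !invMg !actM !actK -!actM -!invMg.
  exact: (@side_refl R W (A i n) (rr n) u rb (rrE n)).
have sub : {subset [seq A j (f p) | p <- iota 0 K] <= l1 ++ l2 ++ l3 ++ l4}.
  move=> c /mapP[p]; rewrite mem_iota add0n => /andP[_ pK] ->.
  apply: contraT; rewrite !mem_cat !negb_or => /andP[c1 /andP[c2 /andP[c3 c4]]].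
  case: (fP p); have [rc c0 _] := Aj (f p).
  have pos : side (A j (f p)) 1%g.
    by rewrite -wx0; apply: hgt_gt0_side (zxQ 0) _.
  have neg : ~~ side (A j (f p)) w.
    by apply: hgt_lt0_side (zxQ _) _ => //; apply: T0P => //; rewrite /T ltrDl.
  have e1 : side (A j (f p)) g by apply: contraT => /negbTE h; rewrite h1 ?h ?pos in c1.
  have e2 : side (A j (f p)) (g * rr n)%g by apply: contraT => /negbTE h; rewrite h2 ?h ?pos in c2.
  have e3 : ~~ side (A j (f p)) (g * w)%g.
    by apply/negP => h; rewrite h3 ?h ?(negbTE neg) in c3.
  have e4 : ~~ side (A j (f p)) (g * rr n * w)%g.
    by apply/negP => h; rewrite h4 ?h ?(negbTE neg) in c4.
  apply: (quadrants rc rb' e1 e2 e3 e4); last by rewrite sb; case: (side b _).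
  by have := sb 1%g; rewrite !mulg1 => ->; case: (side b _).
have := uniq_leq_size _ sub; rewrite map_inj_uniq ?iota_uniq; last first.
  by move=> p q /Aj_inj /finj.
move=> /(_ isT); rewrite size_map size_iota !size_cat.
have := C1P 0; have := C2P 0; have := C1P T; have := C2P T.
rewrite scale0r wx0 invg1 !mul1g !mulg1 -/w -/g => q1 q2 q3 q4.
rewrite invg1 !mul1g in s1; rewrite invg1 !mul1g in s2; rewrite /K => le.
have := leq_add (leq_add s1 s2) (leq_add s3 s4); rewrite -addnA => h.
move: q1 q2 q3 q4 {s1 s2 s3 s4} h le.
move: (len _) => a1; move: (len _) => a2; move: (len _) => a3; move: (len _) => a4.
by move: (size l1 + _)%N => a5; clear; lia.
Qed.

Theorem flat_families : exists A : 'I_d -> nat -> V, [/\ forall i n, root (A i n),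
  forall i, injective (A i),
  forall i n m, -1 < B (A i n) (A i m),
  forall i j n m, i != j -> `|B (A i n) (A j m)| < 1 &
  (forall i j n (rr : nat -> cox_group W) l, i != j ->
    (forall m a, act (rr m) a = refl (A i m) a) ->
    exists N, forall m, (N <= m)%N -> `|B (A j m) (act (gprod rr l) (A i n))| < 1) /\
  forall (f : 'I_d -> nat) (c : 'I_d -> R), (exists i, c i != 0) ->
    0 < B (\sum_i c i *: A i (f i)) (\sum_i c i *: A i (f i))].
Proof.
have [A [L [Li AP]]] := families (leqnn d); exists (fun i => A i).
have dual (i j : 'I_d) : i != j -> exists v, dot (L i) v = 0 /\ dot (L j) v = - 1.
  move=> ij; have [v vP] := indep_solve (fun m => if m == j :> nat then - 1 else 0) Li.
  by exists v; rewrite !vP // eqxx; split=> //; rewrite ifN.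
have fA (i : 'I_d) n : fam (L i) (A i n) by have [_] := AP _ (ltn_ord i); apply.
split=> [i n|i|i n m|i j n m ij|]; first by case: (fA i n).
- by case: (AP _ (ltn_ord i)).
- have [[rn n0 _] [rm m0 _]] := (fA i n, fA i m).
  have [v Lv] : exists v, dot (L i) v < 0.
    have [_ _ [y [mu [_ _ Ly]]]] := fA i n; by exists y.
  have [[T1 h1] [T2 h2]] := (fam_neg (fA i n) Lv, fam_neg (fA i m) Lv).
  pose T := Num.max T1 T2 + 1; have [t1 t2] : T1 < T /\ T2 < T.
    have : T1 <= Num.max T1 T2 by rewrite le_max lexx.
    have : T2 <= Num.max T1 T2 by rewrite le_max lexx orbT.
    by rewrite /T; lra.
  have s c : root c -> 0 < hg c 0 -> side c 1%g by rewrite -wx0 => ? ?; apply: hgt_gt0_side (zxQ 0) _.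
  apply: (@cross_gtN1 R W _ _ 1%g (wx (T *: v))); rewrite ?s //.
    exact: hgt_lt0_side (zxQ _) (h1 _ t1).
  exact: hgt_lt0_side (zxQ _) (h2 _ t2).
- have [[rn n0 [yn [mun [pn hn _]]]] [rm m0 [ym [mum [pm hm _]]]]] := (fA i n, fA j m).
  apply: (nonparallel_cross rn rm hn hm) => [e|k e].
    have [v [_ vi]] : exists v, dot (L j) v = 0 /\ dot (L i) v = - 1 by apply: dual; rewrite eq_sym.
    by have := congr1 (fun u => dot u v) e; rewrite dotZl vi dot0l; lra.
  have [v [vi vj]] := dual _ _ ij.
  by have := congr1 (fun u => dot u v) e; rewrite !dotZl vi vj; lra.
split=> [i j n rr l ij rrE|f c [i0 ci0]].
  have [v [vi vj]] := dual _ _ ij.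
  apply: (@fam_cross A L i j n rr l v) => //; last by rewrite vj; lra.
  by case: (AP _ (ltn_ord j)).
have ex (i : 'I_d) : exists y mu, 0 < mu /\ locaff (A i (f i)) y (mu *: L i).
  by have [_ _ [y [mu [m0 h _]]]] := fA i (f i); exists y, mu.
have [yi yiP] := choice ex; have [mu muP] := choice yiP.
pose yn (m : nat) : R := if (insub m : option 'I_d) is Some i then dot (L m) (yi i) else 0.
(* The hyperplanes of the chosen roots meet at [y], so these roots all lie in the spherical type of
   [y], where the form is positive definite. *)
have [y yP] := indep_solve yn Li.
have hy (i : 'I_d) : locaff (A i (f i)) y (mu i *: L i).
  have [m0 h] := muP i; rewrite -(subrK (yi i) y) addrC; apply: propagate => //.
    by case: (fA i (f i)).
  by rewrite dotZl dotDr dotNr yP // /yn valK subrr mulr0.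
pose w := wx y; pose b (i : 'I_d) := act w^-1%g (A i (f i)).
set X := \sum_i _; have XE : act w^-1%g X = \sum_i c i *: b i.
  by rewrite /X act_sum; apply: eq_bigr => i _; rewrite actZ.
have bJ (i : 'I_d) : supp_in (wt y) (b i).
  by apply/(hgt_eq0 _ _ (zxQ y)); [case: (fA i (f i))|exact: (locaff_eq0 (hy i))].
have XJ : supp_in (wt y) (act w^-1%g X).
  by move=> s sJ; rewrite XE sum_ffunE big1 // => i _; rewrite ffunE bJ // scaler0.
rewrite -(act_form w^-1%g); apply: (spherical_posdef (wt_spherical y) XJ).
apply/eqP => X0; have {}X0 : X = 0 by rewrite -(actVK w X) X0 act0.
have [eps eps0 epsP] : exists2 rho : R, 0 < rho &
    forall x, en (x - y) < rho -> forall i : 'I_d, hg (A i (f i)) x = dot (mu i *: L i) (x - y).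
  suff [rho r_0 h] : exists2 rho : R, 0 < rho & forall x, en (x - y) < rho ->
      forall i : 'I_d, i \in enum 'I_d -> hg (A i (f i)) x = dot (mu i *: L i) (x - y).
    by exists rho => // x /h + i; apply; rewrite mem_enum.
  elim: (enum 'I_d) => [|i r [rho r_0 IH]]; first by exists 1.
  have [r1 r10 h1] := hy i; exists (Num.min rho r1) => [|x]; first by rewrite lt_min r_0.
  rewrite lt_min => /andP[x1 x2] k; rewrite inE => /orP[/eqP ->|]; first exact: h1.
  exact: IH.
(* The gradient at [y] of the combination of heights with coefficients [c]; it vanishes if the
   combination of roots does. *)
pose u := \sum_i (c i * mu i) *: L i.
have u0 : u = 0.
  have eu := en_ge0 u; pose k := eps / (en u + 1).
  have k0 : 0 < k by rewrite divr_gt0 //; lra.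
  have ku : en (k *: u) < eps.
    rewrite enZ gtr0_norm // /k mulrAC ltr_pdivrMr; last by lra.
    by rewrite ltr_pM2l //; lra.
  have := epsP (y + k *: u); rewrite addrAC subrr add0r => /(_ ku) hi.
  have := hgt_suml (index_enum 'I_d) c (fun i => A i (f i)) (wx (y + k *: u)) (zx (y + k *: u)).
  have -> : hgt X (wx (y + k *: u)) (zx (y + k *: u)) = 0.
    by rewrite X0 /hgt act0 rho0 form0r subrr.
  under eq_bigr => i _ do rewrite hi.
  have -> : \sum_i c i * dot (mu i *: L i) (k *: u) = k * dot u u.
    by rewrite {2}/u dot_suml mulr_sumr; apply: eq_bigr => i _; rewrite !dotZl dotZr; ring.
  move=> /esym/eqP; rewrite mulf_eq0 gt_eqF //= => /eqP; exact: dot_eq0.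
pose cn (m : nat) : R := if (insub m : option 'I_d) is Some i then c i * mu i else 0.
have := Li cn; have -> : \sum_(i < d) cn i *: L i = u.
  by apply: eq_bigr => i _; rewrite /cn valK.
move=> /(_ u0 i0 (ltn_ord i0)); rewrite /cn valK => /eqP; rewrite mulf_eq0 (negbTE ci0) /=.
by have [m0 _] := muP i0; rewrite gt_eqF.
Qed.

End Flat.

(** * Free abelian subgroups *)

Section Pairs.
Variables (R : realType) (W : coxeterSystem).
Local Notation S := (cox_gens W).
Local Notation V := {ffun S -> R}.
Local Notation B := (@cox_form W R).
Local Notation act := (@act R W).
Implicit Types (a b c : V) (s t : S) (u v w : cox_group W).

Lemma list_gap (l : seq R) : exists2 e : R, 0 < e &
  forall x y, x \in l -> y \in l -> `|x - y| < e -> x = y.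
Proof.
suff [e e0 h] : exists2 e : R, 0 < e &
    forall p : R * R, p \in [seq (x, y) | x <- l, y <- l] -> `|p.1 - p.2| < e -> p.1 = p.2.
  by exists e => // x y xl yl; apply: (h (x, y)); apply/allpairsP; exists (x, y).
elim: [seq _ | _ <- _, _ <- _] => [|p r [e e0 IH]]; first by exists 1.
exists (if p.1 == p.2 then e else Num.min e `|p.1 - p.2|).
  case: eqVneq => // ne; by rewrite lt_min e0 normr_gt0 subr_eq0.
move=> q; rewrite inE => /orP[/eqP ->|qr]; case: eqVneq => // ne.
- by rewrite lt_min ltxx andbF.
- exact: IH.
- by rewrite lt_min => /andP[h _]; exact: IH.
Qed.

(** Each term is 1 / C times the sum of its two neighbours, so every step inwards from the ends of
    [-K, K] gains a factor 2 / C. *)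
Lemma damped (x : int -> R) (C M : R) (K : nat) : 2 < C ->
  (forall k, x (k + 1) + x (k - 1) = C * x k) ->
  (forall k : int, (`|k| <= K)%N -> `|x k| <= M) -> `|x 0| <= M * (2 / C) ^+ K.
Proof.
move=> C2 xC xM; have C0 : 0 < C by lra.
suff h j : (j <= K)%N -> forall k : int, (`|k| + j <= K)%N -> `|x k| <= M * (2 / C) ^+ j.
  by apply: h => //; rewrite absz0.
elim: j => [|j IH] jK k kK; first by rewrite mulr1 xM // (leq_trans _ kK) // leq_addr.
rewrite exprS mulrCA; have := IH (ltnW jK) (k + 1); have := IH (ltnW jK) (k - 1).
move=> /(_ ltac:(lia)) h1 /(_ ltac:(lia)) h2.
have : C * `|x k| <= 2 * (M * (2 / C) ^+ j).
  rewrite -{1}(gtr0_norm C0) -normrM -xC; apply: le_trans (ler_normD _ _) _; lra.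
have -> : 2 / C * (M * (2 / C) ^+ j) = C^-1 * (2 * (M * (2 / C) ^+ j)) by ring.
by rewrite ler_pdivlMl.
Qed.

Lemma arith_seq (x : int -> R) (k : int) : (forall k, x (k + 1) + x (k - 1) = 2 * x k) ->
  x k = x 0 + k%:~R * (x 1 - x 0).
Proof.
move=> h; suff [] : x k = x 0 + k%:~R * (x 1 - x 0) /\ x (k + 1) = x 0 + (k + 1)%:~R * (x 1 - x 0) by [].
elim/int_rec: k => [|k [h1 h2]|k [h1 h2]].
- by rewrite !add0r mul0r addr0 mul1r; split=> //; ring.
- have := h (k.+1%:Z); rewrite -[k.+1]addn1 PoszD addrK h1 h2 => e; split=> //.
  by move: e; rewrite !rmorphD /=; lra.
- have := h (- k%:Z); rewrite h1 h2 => e.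
  have -> : - k.+1%:Z = - k%:Z - 1 by lia.
  rewrite subrK; split=> //; move: e; rewrite !rmorphD /= !rmorphN /= rmorph1; lra.
Qed.

Variables (d : nat) (A : 'I_d -> nat -> V).
Hypotheses (A_root : forall i n, root (A i n)) (A_inj : forall i, injective (A i))
  (A_same : forall i n m, -1 < B (A i n) (A i m))
  (A_cross : forall i j n m, i != j -> `|B (A i n) (A j m)| < 1)
  (A_prod : forall i j n (rr : nat -> cox_group W) l, i != j ->
    (forall m a, act (rr m) a = refl (A i m) a) ->
    exists N, forall m, (N <= m)%N -> `|B (A j m) (act (gprod rr l) (A i n))| < 1)
  (A_pos : forall (f : 'I_d -> nat) (c : 'I_d -> R), (exists i, c i != 0) ->
    0 < B (\sum_i c i *: A i (f i)) (\sum_i c i *: A i (f i))).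

Definition rot a b x : V := refl a (refl b x).

Lemma rotK a b : root a -> root b -> cancel (rot a b) (rot b a).
Proof. by move=> ra rb x; rewrite /rot reflK ?root_form // reflK ?root_form. Qed.

Lemma gprod_nat (rr : nat -> cox_group W) i n n' (k : nat) x :
  (forall m a, act (rr m) a = refl (A i m) a) ->
  act (gprod rr (flatten (nseq k [:: n; n']))) x = iter k (rot (A i n) (A i n')) x.
Proof.
by move=> rrE; elim: k => [|k IH]; rewrite /= ?act1 // !actM IH !rrE.
Qed.

Definition rotz a b (k : int) x : V :=
  if k is Negz k then iter k.+1 (rot b a) x else iter `|k|%N (rot a b) x.

Lemma rotzS a b k x : root a -> root b -> rotz a b (k + 1) x = rot a b (rotz a b k x).
Proof.
move=> ra rb; case: k => [k|[|k]]; first by rewrite -PoszD addn1.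
  by rewrite /= rotK.
rewrite (_ : Negz k.+1 + 1 = Negz k); last by rewrite !NegzE; lia.
by rewrite [in RHS]/= (rotK rb ra).
Qed.

(** In the plane of [a] and [b] the product of the two reflections has determinant 1 and trace 4 B
    (a, b)^2 - 2. *)
Lemma form_rot_rec a b x y : root a -> root b -> (x = a \/ x = b) ->
  forall k, B y (rotz a b (k + 1) x) + B y (rotz a b (k - 1) x) =
    (4 * B a b ^+ 2 - 2) * B y (rotz a b k x).
Proof.
move=> ra rb xab k; have [p [q pq]] : exists p q : R, rotz a b k x = p *: a + q *: b.
  have rotab (u v : V) (p q : R) : root u -> root v -> exists p' q' : R,
      rot u v (p *: u + q *: v) = p' *: u + q' *: v.
    move=> ru rv; rewrite /rot /refl !formE (root_form ru) (root_form rv) !(formC v u).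
    exists (p - 2 * (p + q * B u v - 2 * (p * B u v + q) * B u v)), (q - 2 * (p * B u v + q)).
    by apply/ffunP => s; rewrite !ffunE /GRing.scale /=; ring.
  have x0 : exists p q : R, x = p *: a + q *: b.
    by case: xab => ->; [exists 1, 0|exists 0, 1]; rewrite scale1r scale0r ?addr0 ?add0r.
  have it n : exists p q : R, iter n (rot a b) x = p *: a + q *: b.
    elim: n => [//|n [p [q /= ->]]]; exact: rotab.
  have it' n : exists p q : R, iter n (rot b a) x = p *: a + q *: b.
    elim: n => [//|n [p [q /= ->]]]; rewrite addrC.
    by have [p' [q' ->]] := rotab b a q p rb ra; exists q', p'; rewrite addrC.
  by case: k => k; [exact: it|exact: it'].
have -> : rotz a b (k - 1) x = rot b a (rotz a b k x).
  by rewrite -{2}(subrK 1 k) rotzS // rotK.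
rewrite rotzS // pq -formDr -formZr; congr (B y _); rewrite /rot /refl !formE.
rewrite (root_form ra) (root_form rb) !(formC b a).
by apply/ffunP => s; rewrite !ffunE /GRing.scale /=; ring.
Qed.

Lemma small_power (q e : R) : 0 < q < 1 -> 0 < e -> exists K : nat, q ^+ K < e.
Proof.
move=> /andP[q0 q1] e0; have : geometric 1 q @ \oo --> (0 : R).
  by apply: cvg_geometric; rewrite gtr0_norm.
move=> /cvgrPdist_lt /(_ e e0) [K _ /(_ K (leqnn K))] /=.
by rewrite sub0r normrN mul1r ger0_norm ?exprn_ge0 ?ltW // => h; exists K.
Qed.

Lemma parallel_orth i j n n' : i != j -> 1 <= B (A i n) (A i n') ->
  exists N, forall m, (N <= m)%N ->
    B (A j m) (A i n) = B (A j m) (A i n') /\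
    (1 < B (A i n) (A i n') -> B (A j m) (A i n) = 0).
Proof.
move=> ij; set a := A i n; set b := A i n'; set c := B a b => c1.
have [ra rb] : root a /\ root b by split; exact: A_root.
have [rr rrE] := choice (fun m => root_refl (A_root i m)).
have [vals vP] := crossing_values R W.
have [e e0 gap] := list_gap (0 :: vals).
have bound x K : exists N, forall m, (N <= m)%N ->
    forall k : int, (`|k| <= K)%N -> B (A j m) (rotz a b k (A i x)) \in vals /\
      `|B (A j m) (rotz a b k (A i x))| < 1.
  have one (k : int) : exists N, forall m, (N <= m)%N ->
      B (A j m) (rotz a b k (A i x)) \in vals /\ `|B (A j m) (rotz a b k (A i x))| < 1.
    have [l lE] : exists l, rotz a b k (A i x) = act (gprod rr l) (A i x).
      case: k => k; [exists (flatten (nseq k [:: n; n']))|exists (flatten (nseq k.+1 [:: n'; n]))];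
        by rewrite (gprod_nat _ _ _ _ rrE).
    have [N NP] := A_prod x l ij rrE; exists N => m /NP h; rewrite lE; split=> //.
    by apply: vP h => //; apply: root_act.
  have [N NP] := choice one; exists (\max_(k < K.+1) maxn (N k) (N (- k%:Z))) => m Nm k kK.
  have lk : (`|k| < K.+1)%N by rewrite ltnS.
  have := leq_trans (@leq_bigmax _ (fun k : 'I_K.+1 => maxn (N k) (N (- k%:Z))) (Ordinal lk)) Nm.
  rewrite geq_max => /andP[m1 m2]; have [k0|k0] := lerP 0 k.
    by rewrite -(gez0_abs k0); exact: NP.
  have -> : k = - (`|k|%N)%:Z by rewrite ltz0_abs ?opprK.
  exact: NP _ _ m2.
(* [K] serves both cases: damping below the gap [e] if c > 1, and steps smaller than [e] if c =
   1. *)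
have [K [K1 K2]] : exists K : nat, (1 < c -> (2 / (4 * c ^+ 2 - 2)) ^+ K < e) /\ 2 / e < K%:R.
  have [c2|c2] := ltrP 1 c; last first.
    exists (Num.bound (2 / e)); split=> //.
    by apply: archi_boundP; rewrite divr_ge0 // ltW.
  have C2 : 2 < 4 * c ^+ 2 - 2 by nra.
  have [|K hK] := @small_power (2 / (4 * c ^+ 2 - 2)) e _ e0.
    by rewrite divr_gt0 ?ltr_pdivrMr ?mul1r //=; lra.
  exists (maxn K (Num.bound (2 / e))); split=> [_|].
    apply: le_lt_trans hK; rewrite -(subnK (leq_maxl K (Num.bound (2 / e)))) exprD.
    rewrite ler_piMl ?exprn_ge0 ?divr_ge0 //; try lra.
    by rewrite exprn_ile1 ?divr_ge0 ?ler_pdivrMr ?mul1r //; lra.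
  apply: lt_le_trans (archi_boundP _) _; first by rewrite divr_ge0 // ltW.
  by rewrite ler_nat leq_maxr.
have K0 : (0 < K)%N.
  by rewrite -(ltr_nat R); apply: lt_trans K2; rewrite divr_gt0.
have [N1 h1] := bound n K; have [N2 h2] := bound n' K.
exists (maxn N1 N2) => m; rewrite geq_max => /andP[/h1 {}h1 /h2 {}h2].
have small x (xab : A i x = a \/ A i x = b) : 1 < c ->
    (forall k : int, (`|k| <= K)%N -> B (A j m) (rotz a b k (A i x)) \in vals /\
      `|B (A j m) (rotz a b k (A i x))| < 1) -> B (A j m) (A i x) = 0.
  move=> c2 h; have C2 : 2 < 4 * c ^+ 2 - 2 by nra.
  have := damped C2 (form_rot_rec (A j m) ra rb xab) (fun k kK => ltW (h k kK).2).
  rewrite mul1r => hx; apply: gap; rewrite ?inE ?eqxx ?(h 0 _).1 ?orbT // subr0.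
  exact: le_lt_trans hx (K1 c2).
have [c2|c2] := ltrP 1 c.
  by rewrite (small n) ?(small n') //; [right|left].
have {c2} c1' : c = 1 by apply/eqP; rewrite eq_le c2.
have [h0 hK] := (h1 0 (leq0n _), h1 K%:Z (leqnn _)); have hS := h1 1 K0.
have rec k : B (A j m) (rotz a b (k + 1) a) + B (A j m) (rotz a b (k - 1) a) =
    2 * B (A j m) (rotz a b k a).
  by rewrite (form_rot_rec (A j m) ra rb (or_introl erefl)) -/c c1'; ring.
have := @arith_seq (fun k => B (A j m) (rotz a b k a)) K%:Z rec.
rewrite -/a in h0 hK hS; set x0 := B (A j m) (rotz a b 0 a) in h0 *.
set x1 := B (A j m) (rotz a b 1 a) in hS *; set xK := B (A j m) _ in hK * => e2.
have e3 : x1 = x0.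
  apply: gap; rewrite ?inE ?h0.1 ?hS.1 ?orbT //.
  have : K%:R * `|x1 - x0| < 2.
    have -> : K%:R * `|x1 - x0| = `|xK - x0|.
      by rewrite e2 addrAC subrr add0r normrM ger0_norm.
    by apply: le_lt_trans (ler_normB _ _) _; have := hK.2; have := h0.2; lra.
  rewrite mulrC -ltr_pdivlMr ?ltr0n // => /lt_le_trans; apply.
  by rewrite ler_pdivrMr ?ltr0n // mulrC -ler_pdivrMr // ltW.
have {}e3 : 2 * (B (A j m) a - B (A j m) b) = 0.
  move: e3; rewrite /x1 /x0 /rotz /= /rot /refl !formE (root_form ra) (formC b a) -/c c1'; lra.
have e4 : B (A j m) a = B (A j m) b by lra.
by split.
Qed.

Lemma infinite_ex (Y : set nat) (l : seq nat) : infinite_set Y -> exists2 m, Y m & m \notin l.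
Proof.
move=> Yi; apply: contrapT => no; apply: Yi; apply: (@sub_finite_set _ _ [set` l]) => // m Ym /=.
by apply: contraT => ml; case: no; exists m.
Qed.

Lemma parallel_ex i (Y : set nat) : infinite_set Y ->
  exists m m', [/\ Y m, Y m', m != m' & 1 <= B (A i m) (A i m')].
Proof.
move=> Yi; apply: contrapT => no.
have [|f fY fn] := @related_seq _ Y (fun m m' => m != m').
  move=> l _; have [m Ym ml] := infinite_ex l Yi; exists m => // b bl.
  by apply: contraNneq ml => <-.
apply: (@no_crossing_seq R W (fun k => A i (f k))) => // p q pq.
rewrite ltr_norml A_same ltNge; apply/negP => h; apply: no.
by exists (f p), (f q); split=> //; exact: fn.
Qed.

Lemma constant_ex i (p : seq 'I_d) (nn : 'I_d -> nat) (Y : set nat) :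
  i \notin p -> infinite_set Y -> exists Z : set nat, [/\ infinite_set Z, Z `<=` Y &
    forall j m m', j \in p -> Z m -> Z m' ->
      B (A i m) (A j (nn j)) = B (A i m') (A j (nn j))].
Proof.
move=> + Yi; elim: p => [|j p IH]; first by exists Y; split.
rewrite inE negb_or => /andP[ij /IH[Z [Zi ZY Zc]]].
have [vals vP] := crossing_values R W.
have [|q _ qi] := @infinite_color nat R Z (fun m => B (A i m) (A j (nn j))) vals Zi.
  by move=> m _; apply: vP => //; exact: A_cross.
exists (Z `&` [set m | B (A i m) (A j (nn j)) = q]); split=> // [m [/ZY]//|].
move=> k m m'; rewrite inE => /orP[/eqP ->|kp] [Zm mq] [Zm' mq']; last exact: Zc.
by rewrite mq mq'.
Qed.

(** The pairs are chosen one family at a time. [parallel_orth] makes later roots see both roots of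
    an earlier pair alike; [constant_ex] makes the two roots of the new pair look alike to the
    earlier ones. *)
Lemma parallel_pairs : exists a b : 'I_d -> V, [/\ forall i, root (a i) /\ root (b i),
  forall i, a i <> b i /\ 1 <= B (a i) (b i),
  forall i j, i != j -> [/\ B (a i) (b j) = B (a i) (a j), B (b i) (b j) = B (a i) (a j) &
    1 < B (a i) (b i) -> B (a i) (a j) = 0] &
  forall c : 'I_d -> R, (exists i, c i != 0) ->
    0 < B (\sum_i c i *: a i) (\sum_i c i *: a i)].
Proof.
(* Either every infinite subfamily contains a pair with B > 1 (flag [true]), or some infinite
   subfamily contains none. *)
have ex i : exists Xh : set nat * bool, infinite_set Xh.1 /\
    if Xh.2 then forall Y, infinite_set Y -> Y `<=` Xh.1 ->
      exists m m', [/\ Y m, Y m' & 1 < B (A i m) (A i m')]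
    else forall m m', Xh.1 m -> Xh.1 m' -> B (A i m) (A i m') <= 1.
  have [h|h] := pselect (forall Y, infinite_set Y ->
      exists m m', [/\ Y m, Y m' & 1 < B (A i m) (A i m')]).
    by exists (setT, true); split=> [|Y /= /h //]; exact: infinite_nat.
  have [Y h2] : exists Y : set nat, ~ (infinite_set Y ->
      exists m m', [/\ Y m, Y m' & 1 < B (A i m) (A i m')]).
    by apply: contrapT => no; apply: h => Y Yi; apply: contrapT => h; apply: no; exists Y => /(_ Yi).
  exists (Y, false); split=> /=; first by apply: contrapT => Yf; apply: h2.
  move=> m m' Ym Ym'; rewrite leNgt; apply/negP => h3; apply: h2 => _; by exists m, m'.
have [Xh XhP] := choice ex; pose X i := (Xh i).1; pose h i := (Xh i).2.
pose sel (p : seq 'I_d) (nn nn' : 'I_d -> nat) :=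
  (forall i, i \in p -> [/\ nn i != nn' i, 1 <= B (A i (nn i)) (A i (nn' i)) &
     h i = (1 < B (A i (nn i)) (A i (nn' i)))]) /\
  (forall i j, i \in p -> j \in p -> i != j ->
    [/\ B (A i (nn i)) (A j (nn' j)) = B (A i (nn i)) (A j (nn j)),
      B (A i (nn' i)) (A j (nn' j)) = B (A i (nn i)) (A j (nn j)) &
      h i || h j -> B (A i (nn i)) (A j (nn j)) = 0]).
have step p i nn nn' : sel p nn nn' -> i \notin p -> (h i -> forall j, j \in p -> h j) ->
    exists mm mm', sel (i :: p) mm mm'.
  move=> [s1 s2] ip hi; have [Xi Xc] := XhP i; rewrite -/(X i) -/(h i) in Xi Xc.
  have [N NP] : exists N, forall j, j \in p -> forall m, (N <= m)%N ->
      B (A i m) (A j (nn j)) = B (A i m) (A j (nn' j)) /\ (h j -> B (A i m) (A j (nn j)) = 0).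
    have : forall j, j \in p -> j \in p by [].
    elim: {-2}p => [|j q IH] qp; first by exists 0%N.
    have [|N NP] := IH; first by move=> k kq; apply: qp; rewrite inE kq orbT.
    have jp : j \in p by apply: qp; rewrite inE eqxx.
    have [_ c1 hj] := s1 _ jp; have ji : j != i by apply: contraNneq ip => <-.
    have [N' N'P] := parallel_orth ji c1; exists (maxn N N') => k.
    rewrite inE => /orP[/eqP ->|kq] m; rewrite geq_max => /andP[m1 m2]; last exact: NP.
    by have [e1 e2] := N'P _ m2; split=> //; rewrite hj.
  have Yi : infinite_set (X i `&` [set m | (N <= m)%N]).
    move=> fY; apply: Xi; have : finite_set (X i `&` [set m | (N <= m)%N] `|` [set` iota 0 N]).
      by rewrite finite_setU.
    apply: sub_finite_set => m Xm; have [Nm|mN] := leqP N m; [by left|right].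
    by rewrite /= mem_iota.
  have [Z [Zi ZY Zc]] := constant_ex nn ip Yi.
  have ZX m : Z m -> X i m by move=> /ZY[].
  have [m [m' [Zm Zm' mm' c1 hc]]] : exists m m', [/\ Z m, Z m', m != m',
      1 <= B (A i m) (A i m') & h i = (1 < B (A i m) (A i m'))].
    move: Xc; case: (h i) => [/(_ Z Zi ZX)[m [m' [Zm Zm' c1]]]|Xc].
      exists m, m'; rewrite c1 ltW //; split=> //; apply: contraTneq c1 => ->.
      by rewrite root_form ?ltxx.
    have [m [m' [Zm Zm' mm' c1]]] := parallel_ex i Zi; exists m, m'; split=> //.
    by apply/esym/negbTE; rewrite -leNgt; apply: Xc; exact: ZX.
  have Nm k : Z k -> (N <= k)%N by move=> /ZY[].
  exists (fun k => if k == i then m else nn k), (fun k => if k == i then m' else nn' k).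
  have ni j : j \in p -> (j == i) = false by move=> jp; apply: contraNF ip => /eqP <-.
  have new j : j \in p -> [/\ B (A i m) (A j (nn' j)) = B (A i m) (A j (nn j)),
      B (A i m') (A j (nn j)) = B (A i m) (A j (nn j)),
      B (A i m') (A j (nn' j)) = B (A i m) (A j (nn j)) &
      h i || h j -> B (A i m) (A j (nn j)) = 0].
    move=> jp; have [e1 e2] := NP _ jp _ (Nm _ Zm); have [e3 e4] := NP _ jp _ (Nm _ Zm').
    have e5 := Zc _ _ _ jp Zm Zm'; split=> //; [by rewrite -e3 -e5|].
    by case/orP => [/hi/(_ _ jp)|]; exact: e2.
  split=> [k|k j]; rewrite ?inE.
    by case/orP => [/eqP ->|kp]; rewrite ?eqxx // ni //; exact: s1.
  case/orP => [/eqP ->|kp] /orP[/eqP ->|jp]; rewrite ?eqxx ?ni // => kj.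
  - by have [? ? ? ?] := new _ jp; split.
  - have [e1 e2 e3 e4] := new _ kp; rewrite !(formC _ (A i _)) e2 e3; split=> // hh.
    by apply: e4; rewrite orbC.
  - exact: s2.
have steps l p nn nn' : sel p nn nn' -> uniq (l ++ p) ->
    (forall i, i \in l -> h i -> forall j, j \in l ++ p -> h j) -> exists mm mm', sel (l ++ p) mm mm'.
  move=> sp; elim: l => [|i l IH] /=; first by exists nn, nn'.
  move=> /andP[ip lp] hl; have [|mm [mm' s]] := IH lp.
    by move=> j jl hj k kl; apply: (hl j) => //; rewrite inE ?jl ?kl orbT.
  apply: (step _ _ _ _ s ip) => hi j jl; apply: (hl i) => //; rewrite inE ?eqxx //.
  by rewrite jl orbT.
(* Families with flag [true] come first: a root chosen after a pair with B > 1 is orthogonal to it,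
   so orthogonality holds as soon as one of two families has this flag. *)
pose l1 := [seq i <- enum 'I_d | h i]; pose l2 := [seq i <- enum 'I_d | ~~ h i].
have [|||nn1 [nn1' s1]] := @steps l1 [::] (fun=> 0%N) (fun=> 0%N).
- by split=> i.
- by rewrite cats0 filter_uniq // enum_uniq.
- by move=> i _ _ j; rewrite cats0 mem_filter => /andP[].
rewrite cats0 in s1; have [||nn [nn' [sa sb]]] := steps l2 l1 nn1 nn1' s1.
- rewrite cat_uniq; apply/and3P; split; try by rewrite filter_uniq ?enum_uniq.
  apply/hasPn => i.
  by rewrite !mem_filter => /andP[-> _].
- by move=> i; rewrite mem_filter => /andP[/negbTE ->].
have all (i : 'I_d) : i \in l2 ++ l1.
  rewrite mem_cat (mem_filter h) (mem_filter (fun i => ~~ h i)) mem_enum.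
  by case: (h i).
exists (fun i => A i (nn i)), (fun i => A i (nn' i)); split=> // [i|i j ij|c].
- have [ne c1 _] := sa _ (all i); split=> // /A_inj e; by rewrite e eqxx in ne.
- have [e1 e2 e3] := sb _ _ (all i) (all j) ij; have [_ _ hi] := sa _ (all i).
  by split=> // c1; apply: e3; rewrite hi c1.
exact: A_pos.
Qed.

End Pairs.

(** * Integer powers of commuting elements *)

Section IntegerPowers.
Variable G : groupType.
Implicit Types g h : G.

Definition zpow g (k : int) : G := if k is Negz n then (g^-1 ^+ n.+1)%g else (g ^+ `|k|%N)%g.

Lemma zpow0 g : zpow g 0 = 1%g. Proof. by []. Qed.

Lemma zpowS g k : zpow g (k + 1) = (g * zpow g k)%g.
Proof.
case: k => [k|[|k]]; first by rewrite -PoszD addn1 /zpow /= expgS.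
  by rewrite /zpow /= mulgV.
rewrite (_ : Negz k.+1 + 1 = Negz k); last by rewrite !NegzE; lia.
by rewrite /zpow [in RHS]expgS mulKVg.
Qed.

Lemma zpowP g k : zpow g (k - 1) = (g^-1 * zpow g k)%g.
Proof. by rewrite -{2}(subrK 1 k) zpowS mulKg. Qed.

Lemma zpow_ind (P : int -> Prop) : P 0 -> (forall k, P k -> P (k + 1)) ->
  (forall k, P k -> P (k - 1)) -> forall k, P k.
Proof.
move=> P0 PS PP; elim/int_rec => [//|n|n] h; first by rewrite -addn1 PoszD; exact: PS.
by rewrite -addn1 PoszD opprD; exact: PP.
Qed.

Lemma zpowD g m n : zpow g (m + n) = (zpow g m * zpow g n)%g.
Proof.
elim/zpow_ind: m => [|m IH|m IH]; first by rewrite add0r mul1g.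
  by rewrite addrAC !zpowS IH mulgA.
by rewrite addrAC !zpowP IH mulgA.
Qed.

Lemma commute_zpow g h k : (g * h = h * g)%g -> (zpow g k * h = h * zpow g k)%g.
Proof.
move=> gh; elim/zpow_ind: k => [|k IH|k IH]; first by rewrite mul1g mulg1.
  by rewrite zpowS -mulgA IH !mulgA gh.
have gh' : (g^-1 * h = h * g^-1)%g.
  by apply: (@mulgI _ g); rewrite mulKVg mulgA gh mulgK.
by rewrite zpowP -mulgA IH !mulgA gh'.
Qed.

Variables (d : nat) (t : 'I_d -> G).
Hypothesis t_comm : forall i j, (t i * t j = t j * t i)%g.

Definition zprod (l : seq 'I_d) (n : 'rV[int]_d) : G :=
  foldr (fun i g => (zpow (t i) (n ord0 i) * g)%g) 1%g l.

Lemma commute_zprod g l n : (forall i, g * t i = t i * g)%g ->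
  (g * zprod l n = zprod l n * g)%g.
Proof.
move=> h; elim: l => [|i l IH]; first by rewrite /= mul1g mulg1.
by rewrite /= mulgA -(commute_zpow _ (esym (h i))) -!mulgA IH.
Qed.

Lemma zprodD l m n : zprod l (m + n) = (zprod l m * zprod l n)%g.
Proof.
elim: l => [|i l IH]; first by rewrite /= mul1g.
rewrite /= mxE zpowD IH !mulgA; congr (_ * _)%g; rewrite -!mulgA; congr (_ * _)%g.
by apply: commute_zprod => j; exact: commute_zpow.
Qed.

(** The product is built one factor at a time, through the directions with nonzero exponent only;
    this restriction is what lets facts about those directions enter the inductions below. *)
Lemma zprod_ind (P : G -> 'rV[int]_d -> Prop) (n : 'rV[int]_d) : P 1%g 0 ->
  (forall i g k, n ord0 i != 0 -> P g k -> P (t i * g)%g (k + delta_mx 0 i)) ->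
  (forall i g k, n ord0 i != 0 -> P g k -> P ((t i)^-1 * g)%g (k - delta_mx 0 i)) ->
  P (zprod (enum 'I_d) n) n.
Proof.
move=> P0 PS PP; suff h l : P (zprod l n) (\sum_(i <- l) n ord0 i *: delta_mx 0 i).
  by have := h (enum 'I_d); rewrite big_enum -row_sum_delta.
elim: l => [|i l IH]; first by rewrite big_nil.
rewrite big_cons addrC /=; move: (zprod l n) (\sum_(j <- l) _) IH => g k IH.
have [->|ni] := eqVneq (n ord0 i) 0; first by rewrite scale0r addr0 mul1g.
elim/zpow_ind: (n ord0 i) => [|m Pm|m Pm]; first by rewrite scale0r addr0 mul1g.
  by rewrite scalerDl scale1r addrA zpowS -mulgA; exact: PS.
by rewrite scalerBl scale1r addrA zpowP -mulgA; exact: PP.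
Qed.

End IntegerPowers.

(** * Commutation and independence of the products of reflections *)

Section FreeAbelian.
Variables (R : realType) (W : coxeterSystem).
Local Notation S := (cox_gens W).
Local Notation V := {ffun S -> R}.
Local Notation B := (@cox_form W R).
Local Notation bas := (@bas R W).
Local Notation act := (@act R W).
Implicit Types (x y z : V) (u v w : cox_group W).

Lemma refl_comm (a b x : V) : B a b = 0 -> refl a (refl b x) = refl b (refl a x).
Proof.
move=> ab; rewrite /refl !formE (formC b a) ab !mulr0 !subr0.
by rewrite -!addrA [X in _ + X]addrC.
Qed.

(** If [p] and [q] were independent in two coordinates, some lattice point would have one of them
    positive and the other negative, which no root has. The constant [M] exceeds the rounding errors
    and the contribution of [a]. *)
Lemma root_lattice (a p q : V) : (forall k l : int, root (a + k%:~R *: p + l%:~R *: q)) ->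
  forall s s', p s * q s' = p s' * q s.
Proof.
move=> rt s t; apply: contrapT => ne.
pose D := p s * q t - p t * q s; have D0 : D != 0 by apply/eqP => h; apply: ne; rewrite /D in h; lra.
pose M := `|a s| + `|a t| + `|p s| + `|q s| + `|p t| + `|q t| + 1.
pose x := (M * q t + M * q s) / D; pose y := (- M * p s - M * p t) / D.
have xs : x * p s + y * q s = M by rewrite /x /y /D; field; rewrite -/D.
have xt : x * p t + y * q t = - M by rewrite /x /y /D; field; rewrite -/D.
pose k := Num.floor x; pose l := Num.floor y.
have fl (z : R) : 0 <= z - (Num.floor z)%:~R <= 1.
  have := floor_itv z; rewrite intrD /= => /andP[h1 h2]; rewrite subr_ge0 h1 /=; lra.
have err (z m : R) : `|(Num.floor z)%:~R * m - z * m| <= `|m|.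
  rewrite -mulrBl normrM ler_piMl // distrC ger0_norm; by case/andP: (fl z).
have := rt k l; set c := _ + _ => /root_sign rc.
have cs : 0 < c s.
  rewrite /c !ffunE /GRing.scale /=; have := err x (p s); have := err y (q s).
  rewrite -/k -/l; rewrite !ler_norml => /andP[h1 _] /andP[h2 _].
  have := ler_norm (- a s); rewrite normrN.
  have := normr_ge0 (a t); have := normr_ge0 (p t); have := normr_ge0 (q t).
  by rewrite /M in xs; lra.
have ct : c t < 0.
  rewrite /c !ffunE /GRing.scale /=; have := err x (p t); have := err y (q t).
  rewrite -/k -/l; rewrite !ler_norml => /andP[_ h1] /andP[_ h2].
  have := ler_norm (a t).
  have := normr_ge0 (a s); have := normr_ge0 (p s); have := normr_ge0 (q s).
  by rewrite /M in xt; lra.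
by case: rc => [/(_ t)|/(_ s)]; [rewrite leNgt ct|rewrite ffunE oppr_ge0 leNgt cs].
Qed.

(** A nonzero [p] with coordinate sum 0 has coordinates of both signs, and so has a + k p for large
    k. *)
Lemma root_ray_rho (a p : V) : p <> 0 -> (forall k : int, root (a + k%:~R *: p)) -> rho p != 0.
Proof.
move=> p0 rt; apply/eqP => rp.
have nz (q : V) : q <> 0 -> rho q = 0 -> exists s, q s < 0.
  move=> q0 rq; apply: contrapT => no; apply: q0; apply/ffunP => s; rewrite ffunE.
  have q1 s' : 0 <= q s' by rewrite leNgt; apply/negP => h; apply: no; exists s'.
  move: rq; rewrite /rho => /eqP; rewrite psumr_eq0 // => /allP/(_ s).
  by rewrite mem_index_enum => /(_ isT) /implyP/(_ isT)/eqP.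
have [s ps] := nz p p0 rp; have [||t pt] := nz (- p).
- by move=> e; apply: p0; rewrite -(opprK p) e oppr0.
- by rewrite rhoN rp oppr0.
rewrite ffunE oppr_lt0 in pt.
pose m := Num.min (- p s) (p t); have m0 : 0 < m by rewrite lt_min pt oppr_gt0 ps.
have [ms mt] : m <= - p s /\ m <= p t by rewrite !ge_min !lexx orbT.
pose k := Num.bound ((`|a s| + `|a t|) / m).
have kb : `|a s| + `|a t| < k%:R * m.
  by rewrite -ltr_pdivrMr // archi_boundP // divr_ge0 ?addr_ge0 // ltW.
have k0 : 0 <= k%:R :> R by [].
have := rt k%:Z => /root_sign [/(_ s)|/(_ t)]; rewrite !ffunE /GRing.scale /= -pmulrn.
  by have := ler_norm (a s); have := normr_ge0 (a t); nra.
by have := ler_norm (- a t); rewrite normrN; have := normr_ge0 (a s); nra.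
Qed.

(** The products of [a] with its rotates start at 1 and increase strictly, since the trace exceeds
    2. *)
Lemma iter_rot_neq (a b : V) N : root a -> root b -> 1 < B a b -> (0 < N)%N ->
  iter N (rot a b) a <> a.
Proof.
move=> ra rb c1; pose x k := B a (iter k (rot a b) a).
have x0 : x 0%N = 1 by rewrite /x root_form.
have x1 : x 1%N = 2 * B a b ^+ 2 - 1.
  by rewrite /x /= /rot /refl !formE (root_form ra) (formC b a); ring.
have xr k : x k.+2 + x k = (4 * B a b ^+ 2 - 2) * x k.+1.
  have := form_rot_rec a ra rb (or_introl erefl) k.+1.
  by rewrite -PoszD addn1 -[k.+1]addn1 PoszD addrK.
have h k : 1 <= x k /\ x k < x k.+1.
  elim: k => [|k [h1 h2]]; first by rewrite x0 x1; split=> //; nra.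
  split; first exact: le_trans h1 (ltW h2).
  have C1 : 1 < B a b ^+ 2 by rewrite expr2 -[1]mulr1 ltr_pM.
  have C2 : 2 < 4 * B a b ^+ 2 - 2.
    by rewrite ltrBrDr (_ : 2 + 2 = 4 * 1 :> R) ?ltr_pM2l // mulr1 -natrD.
  move: (xr k) h1 h2 C2; move: (x k) (x k.+1) (x k.+2) (4 * _ - 2) => p q r C e h1 h2 C2.
  have : 0 < (C - 2) * q by apply: mulr_gt0; lra.
  by lra.
case: N => // N _ e; have := h N; have : x N.+1 = 1 by rewrite /x e root_form.
by move=> -> [h1 h2]; have := le_lt_trans h1 h2; rewrite ltxx.
Qed.

Variables (d : nat) (a b del : 'I_d -> V).
Hypotheses (delE : forall i, del i = a i - b i) (ab_root : forall i, root (a i) /\ root (b i))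
  (ab_ge1 : forall i, a i <> b i /\ 1 <= B (a i) (b i))
  (ab_cross : forall i j, i != j -> [/\ B (a i) (b j) = B (a i) (a j),
    B (b i) (b j) = B (a i) (a j) & 1 < B (a i) (b i) -> B (a i) (a j) = 0])
  (a_pos : forall c : 'I_d -> R, (exists i, c i != 0) ->
    0 < B (\sum_i c i *: a i) (\sum_i c i *: a i)).

Local Notation affine i := (~~ (1 < B (a i) (b i))).

Lemma affineE i : affine i -> B (a i) (b i) = 1.
Proof. by rewrite -leNgt => h; apply/eqP; rewrite eq_le h; case: (ab_ge1 i). Qed.

Lemma del_orth i j : affine i -> B (del i) (a j) = 0 /\ B (del i) (b j) = 0.
Proof.
move=> ai; rewrite delE !formE; have [ra rb] := ab_root i.
have [<-|ij] := eqVneq i j.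
  by rewrite (formC (b i) (a i)) (affineE ai) (root_form ra) (root_form rb) subrr.
have [e1 e2 _] := ab_cross ij; have ji : j != i by rewrite eq_sym.
have [e3 e4 _] := ab_cross ji.
by rewrite e1 e2 subrr (formC (b i)) e3 (formC (a j)) subrr.
Qed.

Lemma del_del i j : affine i -> B (del i) (del j) = 0.
Proof. by move=> ai; have [e1 e2] := del_orth j ai; rewrite (delE j) formDr formNr e1 e2 subrr. Qed.

Lemma rot_affine i (v : V) : affine i ->
  rot (a i) (b i) v = v + (2 * B (b i) v) *: del i - (2 * B (del i) v) *: a i /\
  rot (b i) (a i) v = v - (2 * B (a i) v + 2 * B (del i) v) *: del i + (2 * B (del i) v) *: a i.
Proof.
move=> ai; have e := affineE ai; rewrite /rot /refl delE !formE e (formC (b i) (a i)) e.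
by split; apply/ffunP => s; rewrite !ffunE /GRing.scale /=; ring.
Qed.

Lemma rotations : exists t : 'I_d -> cox_group W,
  forall i x, act (t i) x = rot (a i) (b i) x.
Proof.
have ex i : exists u, forall x, act u x = rot (a i) (b i) x.
  have [ra rb] := ab_root i; have [u uE] := root_refl ra; have [w wE] := root_refl rb.
  by exists (u * w)%g => x; rewrite actM uE wE.
by have [t tE] := choice ex; exists t.
Qed.

Lemma root_ray w (x y : V) : root x ->
  (forall k : int, act w (x + k%:~R *: y) = x + (k + 1)%:~R *: y) ->
  forall m : int, root (x + m%:~R *: y).
Proof.
move=> rx h; elim/zpow_ind => [|m IH|m IH]; first by rewrite scale0r addr0.
  by rewrite -h; apply: root_act.
rewrite -(actK w (x + (m - 1)%:~R *: y)); apply: root_act.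
by rewrite h subrK.
Qed.

(** The rotation t_j translates [a i] by a nonzero multiple of [del j], and t_i translates it by a
    multiple of [del i]: this is a two-parameter lattice of roots, degenerate by [root_lattice]. *)
Lemma del_parallel i j (v : V) : affine i -> affine j -> i != j -> B (a i) (a j) != 0 ->
  B (del j) v *: del i = B (del i) v *: del j.
Proof.
move=> ai aj ij b0; have [t tE] := rotations; pose p := (2 * B (a i) (a j)) *: del j.
have [ij1 ij2] := del_orth i aj; have [ii1 ii2] := del_orth i ai.
have ji : j != i by rewrite eq_sym.
have bji : B (b j) (a i) = B (a i) (a j) by have [e _ _] := ab_cross ij; rewrite formC e.
have rt (k l : int) : root (a i + k%:~R *: p + l%:~R *: (2 *: del i)).
  apply: (root_ray (w := t i)) => [|m].
    apply: (root_ray (w := t j)) => [|m]; first by case: (ab_root i).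
    rewrite tE; have [-> _] := rot_affine (a i + m%:~R *: p) aj.
    have -> : B (b j) (a i + m%:~R *: p) = B (a i) (a j).
      by rewrite /p !formE bji (formC (b j)) (del_orth j aj).2 !mulr0 addr0.
    have -> : B (del j) (a i + m%:~R *: p) = 0.
      by rewrite /p !formE (del_orth i aj).1 del_del // !mulr0 addr0.
    rewrite mulr0 scale0r subr0 -addrA -/p; congr (_ + _).
    by rewrite intrD scalerDl scale1r.
  rewrite tE; have [-> _] := rot_affine (a i + k%:~R *: p + m%:~R *: (2 *: del i)) ai.
  have -> : B (b i) (a i + k%:~R *: p + m%:~R *: (2 *: del i)) = 1.
    by rewrite /p !formE (formC (b i)) (affineE ai) !(formC (b i)) (del_orth i aj).2
      (del_orth i ai).2 !mulr0 !addr0.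
  have -> : B (del i) (a i + k%:~R *: p + m%:~R *: (2 *: del i)) = 0.
    by rewrite /p !formE (del_orth i ai).1 !del_del // !mulr0 !addr0.
  rewrite !mulr0 scale0r subr0 mulr1 -!addrA; congr (_ + (_ + _)).
  by rewrite intrD [RHS]scalerDl scale1r.
have par := root_lattice rt; apply/ffunP => s; rewrite !ffunE /GRing.scale /=.
rewrite !(form_sum _ v) !mulr_suml; apply: eq_bigr => s' _.
have := par s' s; rewrite /p !ffunE /GRing.scale /= => e.
have {}e : del j s' * del i s = del j s * del i s'.
  apply: (@mulfI _ (2 * B (a i) (a j) * 2)); first by rewrite !mulf_neq0 ?pnatr_eq0.
  by move: e; lra.
by rewrite mulrAC e; ring.
Qed.

(** If B (a i, a j) = 0, the two reflections of one pair commute with those of the other. Otherwise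
    both pairs are affine, and [del_parallel] equates the two mixed terms. *)
Lemma rotations_comm t : (forall i x, act (t i) x = rot (a i) (b i) x) ->
  forall i j, (t i * t j = t j * t i)%g.
Proof.
move=> tE i j; have [->//|ij] := eqVneq i j.
apply: (@act_faithful R) => v; rewrite !actM !tE.
have ji : j != i by rewrite eq_sym.
have [e1 e2 _] := ab_cross ij; have [e3 e4 _] := ab_cross ji.
have [b0|b0] := eqVneq (B (a i) (a j)) 0.
  rewrite /rot (refl_comm _ (_ : B (b i) (a j) = 0)); last by rewrite formC e3 formC b0.
  rewrite (refl_comm _ (_ : B (a i) (a j) = 0)) //; congr (refl _ _).
  rewrite (refl_comm _ (_ : B (b i) (b j) = 0)); last by rewrite e2.
  by rewrite (refl_comm _ (_ : B (a i) (b j) = 0)) // e1.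
have ai : affine i by apply/negP => c1; have [_ _ /(_ c1) e] := ab_cross ij; rewrite e eqxx in b0.
have aj : affine j.
  by apply/negP => c1; have [_ _ /(_ c1) e] := ab_cross ji; rewrite formC e eqxx in b0.
have par := del_parallel v ai aj ij b0.
rewrite (rot_affine (rot (a j) (b j) v) ai).1 (rot_affine (rot (a i) (b i) v) aj).1.
rewrite (rot_affine v ai).1 (rot_affine v aj).1 !formE.
rewrite !del_del // (del_orth j ai).1 (del_orth i aj).1 !(formC (b _) (del _)).
rewrite (del_orth i aj).2 (del_orth j ai).2 !mulr0 !addr0 !oppr0 !addr0.
rewrite (formC (b i) (a j)) e3 (formC (b j) (a i)) e1 (formC (a j) (a i)).
move: par; set p := B (del j) v; set q := B (del i) v => /ffunP par.
apply/ffunP => s; have := par s; rewrite !ffunE /GRing.scale /= => e.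
have {}e : p * del i s * B (a i) (a j) = q * del j s * B (a i) (a j) by rewrite e.
by lra.
Qed.

Lemma sum_update (P : pred 'I_d) (F : 'I_d -> V) (f : 'I_d -> R) i (z : R) : P i ->
  \sum_(j | P j) (f j + (j == i)%:R * z) *: F j = \sum_(j | P j) f j *: F j + z *: F i.
Proof.
move=> Pi; under eq_bigr do rewrite scalerDl.
rewrite big_split /=; congr (_ + _); rewrite (bigD1 i) //= eqxx mul1r big1 ?addr0 // => j.
by move=> /andP[_ /negbTE ->]; rewrite mul0r scale0r.
Qed.

Lemma sum_step (P : pred 'I_d) (F : 'I_d -> V) (f : 'I_d -> R) (k : 'rV[int]_d) j : P j ->
  (\sum_(l | P l) (((k + delta_mx 0 j) ord0 l)%:~R * f l) *: F l =
    \sum_(l | P l) ((k ord0 l)%:~R * f l) *: F l + f j *: F j) /\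
  (\sum_(l | P l) (((k - delta_mx 0 j) ord0 l)%:~R * f l) *: F l =
    \sum_(l | P l) ((k ord0 l)%:~R * f l) *: F l - f j *: F j).
Proof.
move=> Pj; rewrite -scaleNr -!sum_update //; split; apply: eq_bigr => l _; congr (_ *: _);
  rewrite !mxE eqxx /= ?intrB ?intrD ?mulrBl ?mulrDl; congr (_ + _);
  by have [->|_] := eqVneq l j; rewrite ?mul1r ?mul0r ?oppr0.
Qed.

Lemma act_expg g N (x : V) : act (g ^+ N)%g x = iter N (act g) x.
Proof. by elim: N => [|N IH]; rewrite ?act1 // expgS actM IH. Qed.

Lemma free_abelian : exists tau : 'rV[int]_d -> cox_group W,
  (forall m n, tau (m + n) = (tau m * tau n)%g) /\ (forall n, tau n = 1%g -> n = 0).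
Proof.
have [t tE] := rotations; have tc := rotations_comm tE.
exists (zprod t (enum 'I_d)); split=> [m n|n n1]; first exact: zprodD.
have tVE i x : act (t i)^-1 x = rot (b i) (a i) x.
  by have [ra rb] := ab_root i; rewrite -{1}(rotK rb ra x) -tE actK.
have dmx (k : 'rV[int]_d) i j : (k + delta_mx 0 j) ord0 i = k ord0 i + (i == j)%:R.
  by rewrite !mxE.
have dmxB (k : 'rV[int]_d) i j : (k - delta_mx 0 j) ord0 i = k ord0 i - (i == j)%:R.
  by rewrite !mxE.
(* A pair with B > 1 cannot occur: the other rotations fix [a i], while powers of its own move
   [a i]. *)
have aff i : n ord0 i != 0 -> affine i.
  move=> ni; apply/negP => c1.
  have fixj j : j != i -> act (t j) (a i) = a i /\ act (t j)^-1 (a i) = a i.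
    move=> ji; have ij : i != j by rewrite eq_sym.
    have [e1 _ /(_ c1) e2] := ab_cross ij; rewrite e2 in e1.
    rewrite tVE tE /rot /refl; have := e1; have := e2; rewrite formC => e3; rewrite formC => e4.
    by rewrite e3 e4 !mulr0 !scale0r !subr0 e3 e4 !mulr0 !scale0r !subr0.
  have : act (zprod t (enum 'I_d) n) (a i) = act (zpow (t i) (n ord0 i)) (a i).
    apply: (zprod_ind (P := fun g k => act g (a i) = act (zpow (t i) (k ord0 i)) (a i))).
    - by rewrite mxE zpow0.
    - move=> j g k _ IH; rewrite actM IH dmx; have [->|ij] := eqVneq i j.
        by rewrite zpowS actM.
      rewrite addr0 -actM -(commute_zpow _ (tc i j)) actM; congr (act _ _).
      by apply: (fixj j _).1; rewrite eq_sym.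
    - move=> j g k _ IH; rewrite actM IH dmxB; have [->|ij] := eqVneq i j.
        by rewrite zpowP actM.
      have cj : ((t i) * (t j)^-1 = (t j)^-1 * t i)%g.
        by apply: (@mulgI _ (t j)); rewrite mulKVg mulgA -tc mulgK.
      rewrite subr0 -actM -(commute_zpow _ cj) actM; congr (act _ _).
      by apply: (fixj j _).2; rewrite eq_sym.
  rewrite n1 act1 => e; have {}e : act (zpow (t i) (`|n ord0 i|%N)%:Z) (a i) = a i.
    have [n0|n0] := lerP 0 (n ord0 i); first by rewrite gez0_abs.
    rewrite ltz0_abs // {1}e -actM -zpowD addNr; exact: act1.
  have [ra rb] := ab_root i; move: e; rewrite /zpow /= act_expg.
  rewrite (eq_iter (tE i)); apply: iter_rot_neq => //.
  by rewrite lt0n absz_eq0.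
(* The product moves v by - 2 X plus a combination of the [del j], which are orthogonal to X. As the
   product is trivial, B (X, X) = 0, and positivity makes all coefficients of X vanish. *)
have rad i (v : V) : n ord0 i != 0 -> B (del i) v = 0.
  pose c j := (n ord0 j)%:~R * B (del j) v.
  pose X := \sum_(j | affine j) c j *: a j.
  have [e eE] : exists e : 'I_d -> R, act (zprod t (enum 'I_d) n) v =
      v - 2 *: X + \sum_(j | affine j) e j *: del j.
    apply: (zprod_ind (P := fun g k => exists e : 'I_d -> R, act g v = v -
      2 *: (\sum_(j | affine j) ((k ord0 j)%:~R * B (del j) v) *: a j) +
      \sum_(j | affine j) e j *: del j)).
    - exists (fun=> 0); rewrite act1 !big1 ?scaler0 ?subr0 ?addr0 // => j _; rewrite ?mxE ?mul0r scale0r //.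
    - move=> j g k /aff aj [e IH]; rewrite actM IH tE; set y := _ + _.
      have dy : B (del j) y = B (del j) v.
        rewrite /y !formE !form_sumr !big1 => [|l la|l la]; rewrite ?mulr0 ?oppr0 ?addr0 //.
          by rewrite formZr del_del // mulr0.
        by rewrite formZr (del_orth l aj).1 mulr0.
      exists (fun l => e l + (l == j)%:R * (2 * B (b j) y)); rewrite (rot_affine y aj).1 dy.
      rewrite sum_update // (sum_step _ _ _ aj).1 scalerDr scalerA /y opprD -!addrA; congr (_ + (_ + _)).
      by rewrite addrA [LHS]addrC.
    - move=> j g k /aff aj [e IH]; rewrite actM IH tVE; set y := _ + _.
      have dy : B (del j) y = B (del j) v.
        rewrite /y !formE !form_sumr !big1 => [|l la|l la]; rewrite ?mulr0 ?oppr0 ?addr0 //.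
          by rewrite formZr del_del // mulr0.
        by rewrite formZr (del_orth l aj).1 mulr0.
      exists (fun l => e l + (l == j)%:R * (- (2 * B (a j) y + 2 * B (del j) v))).
      rewrite (rot_affine y aj).2 dy.
      rewrite sum_update // (sum_step _ _ _ aj).2 scalerBr scalerA /y opprB scaleNr -!addrA.
      by congr (_ + _); rewrite [RHS]addrC -!addrA.
  move: eE; rewrite n1 act1 -addrA => /esym/eqP; rewrite -subr_eq0 addrAC subrr add0r => /eqP eE ni.
  have XX : B X X = 0.
    have : B X (- (2 *: X) + \sum_(j | affine j) e j *: del j) = 0 by rewrite eE form0r.
    have Y0 : B X (\sum_(j | affine j) e j *: del j) = 0.
      rewrite form_sumr big1 // => l la; rewrite formZr /X form_suml big1 ?mulr0 // => j _.
      by rewrite formZl formC (del_orth j la).1 mulr0.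
    rewrite formDr formNr formZr Y0 addr0; move: (B X X) => q; lra.
  have ai := aff _ ni; apply: contrapT => /eqP nz.
  have := @a_pos (fun j => if affine j then c j else 0).
  have -> : \sum_j (if affine j then c j else 0) *: a j = X.
    by rewrite /X [RHS]big_mkcond; apply: eq_bigr => j _; case: ifP; rewrite ?scale0r.
  rewrite XX ltxx => h; have : false by apply: h; exists i; rewrite ai mulf_neq0 // intr_eq0.
  by [].
have trans (v : V) : act (zprod t (enum 'I_d) n) v =
    v + \sum_(j | n ord0 j != 0) ((n ord0 j)%:~R * (2 * B (a j) v)) *: del j.
  apply: (zprod_ind (P := fun g k => act g v =
    v + \sum_(j | n ord0 j != 0) ((k ord0 j)%:~R * (2 * B (a j) v)) *: del j)).
  - by rewrite act1 big1 ?addr0 // => j _; rewrite mxE mul0r scale0r.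
  - move=> j g k nj IH; rewrite actM IH tE; set y := _ + _; have aj := aff _ nj.
    have ay : B (a j) y = B (a j) v.
      rewrite /y !formE form_sumr big1 ?addr0 // => l nl.
      by rewrite formZr (formC (a j)) (rad l _ nl) mulr0.
    have by' : B (b j) y = B (a j) v.
      by have := rad j y nj; rewrite delE formDl formNl ay; lra.
    rewrite (rot_affine y aj).1 (rad j y nj) by' mulr0 scale0r subr0 /y -addrA; congr (_ + _).
    by rewrite (sum_step del (fun l => 2 * B (a l) v) k nj).1.
  - move=> j g k nj IH; rewrite actM IH tVE; set y := _ + _; have aj := aff _ nj.
    have ay : B (a j) y = B (a j) v.
      rewrite /y !formE form_sumr big1 ?addr0 // => l nl.
      by rewrite formZr (formC (a j)) (rad l _ nl) mulr0.
    rewrite (rot_affine y aj).2 (rad j y nj) ay mulr0 scale0r !addr0 /y -addrA; congr (_ + _).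
    by rewrite (sum_step del (fun l => 2 * B (a l) v) k nj).2.
(* For this [v], applying [rho] to [trans] gives 2 B (v, v) = 0; positivity then contradicts that
   [rho (del i)] is nonzero. *)
pose v := \sum_(j | n ord0 j != 0) ((n ord0 j)%:~R * rho (del j)) *: a j.
have vv : B v v = 0.
  have := trans v; rewrite n1 act1 => /esym/eqP; rewrite -subr_eq0 addrAC subrr add0r => /eqP.
  move=> /(congr1 (fun x => rho x)); rewrite rho_sum rho0.
  have -> : \sum_(j | n ord0 j != 0) rho (((n ord0 j)%:~R * (2 * B (a j) v)) *: del j) = 2 * B v v.
    rewrite {2}/v form_suml mulr_sumr; apply: eq_bigr => j _; rewrite rhoZ formZl; ring.
  by lra.
apply/rowP => i; rewrite mxE; apply: contrapT => /eqP ni; have ai := aff _ ni.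
have ri : rho (del i) != 0.
  have d0 : 2 *: del i <> 0.
    move=> /eqP; rewrite scaler_eq0 pnatr_eq0 /= delE subr_eq0 => /eqP.
    by case: (ab_ge1 i).
  have := root_ray_rho d0 (root_ray (w := t i) (ab_root i).1 _); rewrite rhoZ.
  move=> h; have {h} : 2 * rho (del i) != 0.
    apply: h => k; rewrite tE (rot_affine _ ai).1.
    have -> : B (b i) (a i + k%:~R *: (2 *: del i)) = 1.
      by rewrite !formE (formC (b i)) (affineE ai) (formC (b i)) (del_orth i ai).2 !mulr0 addr0.
    have -> : B (del i) (a i + k%:~R *: (2 *: del i)) = 0.
      by rewrite !formE (del_orth i ai).1 del_del // !mulr0 addr0.
    rewrite !mulr0 scale0r subr0 mulr1 -!addrA; congr (_ + _).
    by rewrite intrD [RHS]scalerDl scale1r.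
  by rewrite mulf_eq0 negb_or => /andP[].
have := @a_pos (fun j => if n ord0 j != 0 then (n ord0 j)%:~R * rho (del j) else 0).
have -> : \sum_j (if n ord0 j != 0 then (n ord0 j)%:~R * rho (del j) else 0) *: a j = v.
  by rewrite /v [RHS]big_mkcond; apply: eq_bigr => j _; case: ifP; rewrite ?scale0r.
rewrite vv ltxx => h; have : false by apply: h; exists i; rewrite ni mulf_neq0 // intr_eq0.
by [].
Qed.

End FreeAbelian.

(** * A generic axis *)

Section FreeAxis.
Variables (R : realType) (W : coxeterSystem).
Local Notation S := (cox_gens W).
Local Notation V := {ffun S -> R}.
Local Notation bas := (@bas R W).
Local Notation len := (@cox_length W).
Local Notation act := (@act R W).
Implicit Types (c : V) (x y w : cox_group W).

Variables (d : nat) (tau : 'rV[int]_d -> cox_group W).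
Hypothesis tauD : forall m n, tau (m + n) = (tau m * tau n)%g.
Implicit Types (m n : 'rV[int]_d) (k : int).

Lemma tau0 : tau 0 = 1%g.
Proof. by apply: (@mulgI _ (tau 0)); rewrite -tauD addr0 mulg1. Qed.
Lemma tauN n : tau (- n) = (tau n)^-1%g.
Proof. by apply: (@mulgI _ (tau n)); rewrite -tauD subrr tau0 mulgV. Qed.

Definition fixes n c := act (tau n) c = c.
Definition free m c := forall k : int, k != 0 -> ~ fixes (k *: m) c.

Lemma fixesD m n c : fixes m c -> fixes n c -> fixes (m + n) c.
Proof. by rewrite /fixes tauD actM => hm ->. Qed.
Lemma fixesN n c : fixes n c -> fixes (- n) c.
Proof. by rewrite /fixes tauN => h; rewrite -{1}h actK. Qed.
Lemma fixesZ k n c : fixes n c -> fixes (k *: n) c.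
Proof.
move=> h; elim/zpow_ind: k => [|k IH|k IH]; first by rewrite /fixes scale0r tau0 act1.
  by rewrite scalerDl scale1r; apply: fixesD.
by rewrite scalerBl scale1r; apply: fixesD (fixesN _).
Qed.

Lemma free_scale k m c : k != 0 -> free m c -> free (k *: m) c.
Proof. by move=> k0 h l l0; rewrite scalerA; apply: h; rewrite mulf_neq0. Qed.

(** If no vector acts freely on [c], each basis vector has a nonzero multiple fixing it, and the
    product of these multipliers serves for all vectors. *)
Lemma fixed_or_free c :
  (exists2 N : nat, (0 < N)%N & forall n, fixes (N%:Z *: n) c) \/ exists v, free v c.
Proof.
have [|nf] := pselect (exists v, free v c); [by right|left].
have ex (i : 'I_d) : exists k : int, k != 0 /\ fixes (k *: delta_mx 0 i) c.
  apply: contrapT => h; apply: nf; exists (delta_mx 0 i) => k k0 f; apply: h; by exists k.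
have [kk kP] := choice ex; exists (\prod_i `|kk i|%N)%N.
  by apply: prodn_gt0 => i; rewrite absz_gt0; case: (kP i).
move=> n; rewrite (row_sum_delta n) scaler_sumr.
apply: (big_ind (fun v => fixes v c)) => [||i _]; [by rewrite /fixes tau0 act1|by move=> ? ?; apply: fixesD|].
rewrite (bigD1 i) //= PoszM; move: (\prod_(j | j != i) _)%N => q; case: (kP i) => _ fi.
have -> : ((`|kk i|%N)%:Z * q%:Z) *: (n 0 i *: (delta_mx 0 i : 'rV[int]_d)) =
    (q%:Z * n 0 i) *: ((`|kk i|%N)%:Z *: delta_mx 0 i).
  by rewrite !scalerA; congr (_ *: _); ring.
apply: fixesZ.
have [k0|k0] := lerP 0 (kk i); first by rewrite gez0_abs.
by rewrite ltz0_abs // scaleNr; apply: fixesN.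
Qed.

(** Candidates are v + j m with [v] free on the new root. On it every j works, since a multiple of m
    fixes it; for an old root at most one j fails, because two failures would make a multiple of m
    fix it. *)
Lemma free_ex (l : seq V) : (forall c, c \in l -> exists v, free v c) ->
  exists m, forall c, c \in l -> free m c.
Proof.
elim: l => [|g l IH] h; first by exists 0.
have [|m mP] := IH; first by move=> c cl; apply: h; rewrite inE cl orbT.
have [v vg] := h g (mem_head _ _).
have [mg|/existsNP[k0 /not_implyP[k00 /contrapT fk0]]] := pselect (free m g).
  by exists m => c; rewrite inE => /orP[/eqP ->|/mP].
have [bad badP] : exists bad : seq nat, forall j, j \notin bad ->
    forall c, c \in l -> free (v + j%:Z *: m) c.
  elim: {IH h} l mP => [|c l IH] mP; first by exists [::].
  have [|bad badP] := IH; first by move=> c' cl; apply: mP; rewrite inE cl orbT.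
  have mc := mP c (mem_head _ _).
  have [fr|/existsNP[j0 /existsNP[p0 /not_implyP[p00 /contrapT fp0]]]] :=
    pselect (forall j : nat, free (v + j%:Z *: m) c).
    by exists bad => j jb c'; rewrite inE => /orP[/eqP -> |]; [exact: fr|exact: badP].
  exists (j0 :: bad) => j; rewrite inE negb_or => /andP[jj0 jb] c'.
  rewrite inE => /orP[/eqP ->|]; last exact: badP.
  move=> p p1 fp; apply: (mc (p * p0 * (j%:Z - j0%:Z))).
    by rewrite !mulf_neq0 // subr_eq0 eqz_nat.
  have -> : (p * p0 * (j%:Z - j0%:Z)) *: m =
      p0 *: (p *: (v + j%:Z *: m)) + - (p *: (p0 *: (v + j0%:Z *: m))).
    by apply/rowP => i; rewrite !mxE; ring.
  by apply: fixesD; [exact: fixesZ|apply/fixesN/fixesZ].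
have [j _ jb] := @infinite_ex setT bad infinite_nat.
exists (v + j%:Z *: m) => c; rewrite inE => /orP[/eqP ->|cl]; last exact: badP jb _ cl.
move=> k k1 fk; apply: (vg (k0 * k)); first by rewrite mulf_neq0.
have -> : (k0 * k) *: v = k0 *: (k *: (v + j%:Z *: m)) + - ((k * j%:Z) *: (k0 *: m)).
  by apply/rowP => i; rewrite !mxE; ring.
by apply: fixesD; [exact: fixesZ|apply/fixesN/fixesZ].
Qed.

Lemma side_tau c n y : side c (tau n * y)%g = side (act (tau (- n)) c) y.
Proof. by rewrite side_act tauN invgK. Qed.

Lemma free_bound m c (L : seq V) : free m c ->
  exists K : nat, forall k, act (tau (- (k *: m))) c \in L -> (`|k| < K)%N.
Proof.
move=> fc; elim: L => [|g L [K KP]]; first by exists 0%N.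
have [[k0 k0P]|no] := pselect (exists k, act (tau (- (k *: m))) c = g); last first.
  by exists K => k; rewrite inE => /orP[/eqP h|/KP //]; case: no; exists k.
exists (maxn K `|k0|.+1) => k; rewrite inE leq_max => /orP[/eqP h|/KP ->//].
suff -> : k = k0 by rewrite leqnn orbT.
apply/eqP; rewrite -subr_eq0; apply: contraT => kk; case: (fc _ kk).
rewrite /fixes scalerBl tauD actM -k0P in h *.
by rewrite -h -actM -tauD subrr tau0 act1.
Qed.

Lemma bool_change (g : nat -> bool) p : g 0%N != g p -> exists2 i, (i < p)%N & g i != g i.+1.
Proof.
elim: p => [|p IH]; first by rewrite eqxx.
have [<-|ne] := eqVneq (g p) (g p.+1); last by exists p.
by move=> /IH[i ip h]; exists i => //; apply: ltnW.
Qed.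

(* The signs of the two ends of the line through [y] in direction [m]. *)
Definition lims m c (sp sm : bool) := forall y, exists K : nat, forall k : nat, (K <= k)%N ->
  side c (tau (k%:Z *: m) * y)%g = sp /\ side c (tau (- (k%:Z *: m)) * y)%g = sm.

(** Finitely many translates of [c] separate consecutive chambers of the line, and freeness lets
    each of them occur only once; so the side is eventually constant at both ends. *)
Lemma lims_ex m c : root c -> free m c -> exists sp sm, lims m c sp sm.
Proof.
move=> rc fc; have [L [_ LP]] := sep_list R 1%g (tau m).
have [K KP] := free_bound L fc.
exists (side c (tau (K%:Z *: m))), (side c (tau (- (K%:Z *: m)))) => y.
have [L' [_ L'P]] := sep_list R 1%g y; have [K' K'P] := free_bound L' fc.
have toy k : (K' <= `|k|)%N -> side c (tau (k *: m) * y)%g = side c (tau (k *: m)).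
  move=> kK; rewrite -[in RHS](mulg1 (tau _)) !side_tau; apply/eqP; apply: contraT => ne.
  have := K'P k; rewrite (L'P _ (root_act _ rc)) 1?eq_sym // => /(_ isT).
  by rewrite ltnNge kK.
have tr k : (K <= `|k|)%N -> side c (tau ((k + 1) *: m)) = side c (tau (k *: m)).
  move=> kK; rewrite scalerDl scale1r tauD -[in RHS](mulg1 (tau _)) !side_tau.
  apply/eqP; apply: contraT => ne; have := KP k.
  by rewrite (LP _ (root_act _ rc)) 1?eq_sym // => /(_ isT); rewrite ltnNge kK.
exists (maxn K K') => k; rewrite geq_max => /andP[kK kK'].
rewrite toy // -scaleNr toy ?abszN //; split.
  elim: k kK {kK'} => [|k IH]; first by rewrite leqn0 => /eqP ->.
  rewrite leq_eqVlt => /orP[/eqP -> //|kK]; rewrite -[k.+1]addn1 PoszD tr //; exact: IH.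
rewrite -scaleNr; elim: k kK {kK'} => [|k IH]; first by rewrite leqn0 => /eqP ->.
rewrite leq_eqVlt => /orP[/eqP -> //|kK]; rewrite -(IH kK) -[in RHS](subrK 1 (- k%:Z)).
by rewrite -[k.+1]addn1 PoszD opprD tr //; lia.
Qed.

Lemma lims_tau m c sp sm n : lims m c sp sm -> lims m (act (tau n) c) sp sm.
Proof.
move=> h y; have [K KP] := h (tau (- n) * y)%g; exists K => k /KP.
by rewrite !side_act -!tauN !mulgA -!tauD ![- n + _]addrC.
Qed.

Lemma limsN m c sp sm : root c -> lims m c sp sm -> lims m (- c) (~~ sp) (~~ sm).
Proof. by move=> rc h y; have [K KP] := h y; exists K => k /KP[e1 e2]; rewrite !sideN // e1 e2. Qed.

Lemma free_tau m c n : free m c -> free m (act (tau n) c).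
Proof.
move=> h k k0 e; apply: (h k k0).
have : act (tau n) (act (tau (k *: m)) c) = act (tau n) c by rewrite -actM -tauD addrC tauD actM.
by move=> /(can_inj (actK (tau n))).
Qed.

Lemma freeN m c : free m c -> free m (- c).
Proof.
by move=> h k k0; rewrite /fixes actN => e; apply: (h k k0); apply: oppr_inj.
Qed.

(** Going forward from 1, the side of [c] changes at some time i, so c = tau (i m) g with g among
    the finitely many roots separating 1 from tau m. The backward limit of g bounds i. *)
Lemma wrong_side m : exists L : seq V, forall c s, root c -> free m c -> lims m c s s ->
  side c 1%g != s -> c \in L.
Proof.
have [L0 [_ L0P]] := sep_list R 1%g (tau m).
have [L LP] : exists L : seq V, forall g, g \in L0 -> forall s, lims m g s s ->
    forall k : nat, side g (tau (- (k%:Z *: m))) != s -> act (tau (k%:Z *: m)) g \in L.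
  elim: L0 {L0P} => [|g L0 [L IH]]; first by exists [::].
  have [[s hs]|no] := pselect (exists s, lims m g s s); last first.
    exists L => g'; rewrite inE => /orP[/eqP ->|gL]; last exact: IH.
    by move=> s hs; case: no; exists s.
  have [K KP] := hs 1%g.
  exists ([seq act (tau (k%:Z *: m)) g | k : nat <- iota 0 K] ++ L) => g'.
  rewrite inE => /orP[/eqP ->|gL] s' hs' k ne; rewrite mem_cat; last by rewrite (IH _ gL s') ?orbT.
  have [K' K'P] := hs' 1%g; have ss : s' = s.
    have [|<- _] := KP (maxn K K'); first exact: leq_maxl.
    by have [|<- _] := K'P (maxn K K'); first exact: leq_maxr.
  apply/orP; left; apply/mapP; exists k => //; rewrite mem_iota add0n /= ltnNge.
  by apply/negP => /KP[_]; rewrite mulg1 => e; rewrite e ss eqxx in ne.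
exists L => c s rc fc hs ne; have [K KP] := hs 1%g; have [hK _] := KP K (leqnn K).
rewrite mulg1 in hK; have [|i iK hi] := @bool_change (fun i => side c (tau (i%:Z *: m))) K.
  by rewrite scale0r tau0 hK.
pose g := act (tau (- (i%:Z *: m))) c.
have gE : c = act (tau (i%:Z *: m)) g by rewrite /g -actM -tauD subrr tau0 act1.
rewrite gE; apply: (LP g _ s); last 1 first.
- by rewrite -[tau _](mulg1) side_tau opprK -gE.
- apply: L0P; first exact: root_act.
  move: hi; rewrite -[i.+1]addn1 PoszD scalerDl scale1r tauD.
  by rewrite -{1}(mulg1 (tau _)) !side_tau.
exact: lims_tau.
Qed.

Lemma sided_base m : exists x, forall c s, root c ->
  (forall n, side c (tau n) = s) \/ (free m c /\ lims m c s s) ->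
  forall n, side c (tau n * x)%g = s.
Proof.
have [Wr WrP] := wrong_side m; pose C := \sum_(c <- Wr) `|rho c|.
have C0 : 0 <= C by apply: sumr_ge0.
pose M := (Num.bound ((1 + C) * (size Wr)%:R)).
have MP : (1 + C) * (size Wr)%:R < M%:R.
  by apply: archi_boundP; rewrite mulr_ge0 // addr_ge0.
pose tj (j : nat) := tau (- (j%:Z *: m)).
(* For a root to be kept on its positive side, each of the M terms is at least 1, except for at most
   [size Wr] terms, which are at least - C; the choice of M makes the sum positive. *)
pose xi (v : V) := \sum_(j < M) rho (act (tj j) v).
have xiD (v w : V) (k : R) : xi (v + k *: w) = xi v + k * xi w.
  rewrite /xi mulr_sumr -big_split; apply: eq_bigr => j _.
  by rewrite actD actZ rhoD rhoZ.
have xiN v : xi (- v) = - xi v.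
  by rewrite /xi -sumrN; apply: eq_bigr => j _; rewrite actN rhoN.
have [l lP] : exists l : seq V, forall c, root c -> nneg c -> xi c < 0 -> c \in l.
  have [l lP] : exists l : seq V, forall c, root c -> forall j, (j < M)%N ->
      side c 1%g != side c (tj j)^-1%g -> c \in l.
    elim: M {MP xi xiD xiN} => [|M [l IH]]; first by exists [::].
    have [l' [_ l'P]] := sep_list R 1%g (tj M)^-1%g.
    exists (l' ++ l) => c rc j; rewrite mem_cat ltnS leq_eqVlt => /orP[/eqP ->|jM] h.
      by rewrite l'P.
    by rewrite (IH _ rc j) ?orbT.
  exists l => c rc c0 xc; apply: contraT => cl; move: xc; rewrite ltNge => /negP[].
  apply: sumr_ge0 => j _; apply: ltW.
  have s1 : side c 1%g by apply: nneg_side => //; rewrite invg1 act1.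
  have : side c 1%g = side c (tj j)^-1%g.
    by apply/eqP; apply: contraNT cl => h; exact: (lP c rc j).
  by rewrite s1 /side invgK.
have [x xP] := dominate xiD lP; exists x.
have xi_sum v : xi (act x v) = \sum_s v s * xi (act x (bas s)).
  rewrite {1}(bas_sum v) /xi; under eq_bigr do rewrite !act_sum rho_sum.
  rewrite exchange_big; apply: eq_bigr => s _; rewrite mulr_sumr; apply: eq_bigr => j _.
  by rewrite !actZ rhoZ.
have pos c : root c -> 0 < xi c -> side c x.
  move=> rc c0; apply: contraT => /(sideNP rc) h.
  have := xi_sum (- act x^-1 c); rewrite actN actVK xiN => e.
  have : 0 <= - xi c by rewrite e sumr_ge0 // => s _; rewrite mulr_ge0.
  by rewrite oppr_ge0 leNgt c0.
have M0 : 0 < M%:R :> R by apply: le_lt_trans MP; rewrite mulr_ge0 // addr_ge0.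
have key c : root c -> (forall n, side c (tau n)) \/ (free m c /\ lims m c true true) -> 0 < xi c.
  move=> rc []h.
    apply: lt_le_trans M0 _; rewrite -[M in M%:R]card_ord -sumr_const; apply: ler_sum => j _.
    by have := side_ge1 rc (h (j%:Z *: m)); rewrite -tauN.
  have [fc hl] := h; pose f (j : nat) := act (tj j) c.
  have f_inj : injective f.
    move=> i j e; apply/eqP; rewrite -eqz_nat -subr_eq0; apply: contraT => ij; case: (fc _ ij).
    by rewrite /fixes scalerBl tauD actM -[X in act _ X]e -actM -tauD subrr tau0 act1.
  have tj1 (j : nat) : 1 - (1 + C) * (f j \in Wr)%:R <= rho (f j).
    have rf : root (f j) by apply: root_act.
    have [s1|s1] := boolP (side (f j) 1%g).
      have := side_ge1 rf s1; rewrite invg1 act1 => /(le_trans _); apply.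
      by rewrite gerBl mulr_ge0 ?addr_ge0.
    have fW : f j \in Wr.
      apply: (WrP _ true) => //; [exact: free_tau|exact: lims_tau|by rewrite (negbTE s1)].
    rewrite fW mulr1 opprD addrA subrr add0r.
    have : - C <= - `|rho (f j)| by rewrite lerN2 /C (big_rem _ fW) /= lerDl sumr_ge0.
    by move=> /le_trans; apply; have := ler_norm (- rho (f j)); rewrite normrN; lra.
  have cnt : (\sum_(0 <= j < M) (f j \in Wr) <= size Wr)%N.
    rewrite (eq_bigr (fun j => if f j \in Wr then 1%N else 0%N)); last by move=> j _; case: (_ \in _).
    rewrite -big_mkcond sum1_count -size_filter -(size_map f); apply: uniq_leq_size.
      by rewrite map_inj_uniq // filter_uniq // iota_uniq.
    by move=> v /mapP[j]; rewrite mem_filter => /andP[? _] ->.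
  apply: (@lt_le_trans _ _ (\sum_(j < M) (1 - (1 + C) * (f j \in Wr)%:R))); last first.
    by apply: ler_sum => j _; exact: tj1.
  rewrite sumrB sumr_const card_ord subr_gt0 -mulr_sumr; apply: le_lt_trans MP.
  by rewrite ler_wpM2l ?addr_ge0 // -natr_sum ler_nat -(big_mkord xpredT (fun j => (f j \in Wr) : nat)).
have one c s : root c -> (forall n, side c (tau n) = s) \/ (free m c /\ lims m c s s) -> side c x = s.
  case: s => rc h; first by apply: pos => //; apply: key.
  have : side (- c) x.
    apply: pos (rootN rc) _; apply: key (rootN rc) _.
    case: h => [h|[fc hl]]; [left=> n; by rewrite sideN // h|right].
    by split; [exact: freeN|exact: (limsN rc hl)].
  by rewrite sideN // => /negbTE.
move=> c s rc h n; rewrite side_tau; apply: one; first exact: root_act.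
case: h => [h|[fc hl]]; [left=> n'|right; split; [exact: free_tau|exact: lims_tau]].
by rewrite -[tau n'](mulg1) side_act -tauN opprK mulgA -tauD mulg1.
Qed.

Lemma lims_uniq m c sp sm sp' sm' : lims m c sp sm -> lims m c sp' sm' -> sp = sp' /\ sm = sm'.
Proof.
move=> /(_ 1%g)[K KP] /(_ 1%g)[K' K'P].
have [<- <-] := KP (maxn K K') (leq_maxl _ _).
by have [<- <-] := K'P (maxn K K') (leq_maxr _ _).
Qed.

Lemma lims_uniform m (L : seq V) y : exists D : nat, forall c, c \in L ->
  forall sp sm, lims m c sp sm -> forall k : nat, (D <= k)%N ->
  side c (tau (k%:Z *: m) * y)%g = sp /\ side c (tau (- (k%:Z *: m)) * y)%g = sm.
Proof.
elim: L => [|g L [D DP]]; first by exists 0%N.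
have [[sp [sm h]]|no] := pselect (exists sp sm, lims m g sp sm); last first.
  exists D => c; rewrite inE => /orP[/eqP ->|]; last exact: DP.
  by move=> sp sm h; case: no; exists sp, sm.
have [D' D'P] := h y; exists (maxn D D') => c; rewrite inE => /orP[/eqP -> sp' sm' h'|cL sp' sm' h'] k.
  by rewrite geq_max => /andP[_ /D'P]; have [-> ->] := lims_uniq h h'.
by rewrite geq_max => /andP[kD _]; exact: (DP _ cL).
Qed.

(** If the side of [c] is not constant on the orbit, a step in some coordinate direction crosses its
    wall; translating this step back to 1 leaves finitely many roots. *)
Lemma translates_ex : exists E0 : seq V, forall c, root c ->
  (forall n, side c (tau n) = side c 1%g) \/ exists n g, g \in E0 /\ c = act (tau n) g.
Proof.
have ex (i : 'I_d) : exists l : seq V, forall c, root c ->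
    side c 1%g != side c (tau (delta_mx 0 i)) -> c \in l.
  by have [l [_ lP]] := sep_list R 1%g (tau (delta_mx 0 i)); exists l.
have [L LP] := choice ex; exists (flatten [seq L i | i <- enum 'I_d]) => c rc.
have [[n [i ne]]|no] := pselect (exists n i, side c (tau (n + delta_mx 0 i)) != side c (tau n)).
  right; exists n, (act (tau (- n)) c); split; last by rewrite -actM -tauD subrr tau0 act1.
  apply/flattenP; exists (L i); first by apply: map_f; rewrite mem_enum.
  apply: LP; first exact: root_act.
  by rewrite -side_tau mulg1 eq_sym -[tau (delta_mx 0 i)]mulg1 -side_tau mulg1 -tauD.
left=> n; have step n' i : side c (tau (n' + delta_mx 0 i)) = side c (tau n').
  by apply/eqP; apply: contraT => h; case: no; exists n', i.
have := @zprod_ind (cox_group W) d (fun=> 1%g) (fun _ (k : 'rV[int]_d) => side c (tau k) = side c 1%g) n.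
apply; [by rewrite tau0|by move=> i _ k _ <-|move=> i _ k _ <-].
by rewrite -[in RHS](subrK (delta_mx 0 i) k) step.
Qed.

Lemma trichotomy : exists (N : nat) m', (0 < N)%N /\ forall c, root c ->
  [\/ forall n, side c (tau n) = side c 1%g, forall n, fixes (N%:Z *: n) c |
      free (N%:Z *: m') c].
Proof.
have [E0 E0P] := translates_ex.
have [N N0 NP] : exists2 N : nat, (0 < N)%N & forall c, c \in E0 ->
    (exists v, free v c) \/ forall n, fixes (N%:Z *: n) c.
  elim: E0 {E0P} => [|g E0 [N N0 IH]]; first by exists 1%N.
  have [[N' N'0 h]|h] := fixed_or_free g; last first.
    by exists N => // c; rewrite inE => /orP[/eqP ->|/IH //]; left.
  exists (N' * N)%N; first by rewrite muln_gt0 N0 N'0.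
  move=> c; rewrite inE => /orP[/eqP ->|/IH[fc|fc]]; [right=> n|by left|right=> n].
    by rewrite PoszM -scalerA; exact: h.
  by rewrite PoszM mulrC -scalerA; exact: fc.
have [|m' m'P] := @free_ex [seq c <- E0 | `[< exists v, free v c >]].
  by move=> c; rewrite mem_filter => /andP[/asboolP].
exists N, m'; split=> // c rc; have [h|[n [g [gE ->]]]] := E0P c rc; first by constructor 1.
have [fg|fg] := NP g gE.
  constructor 3; apply/free_tau/free_scale; first by rewrite -lt0n.
  by apply: m'P; rewrite mem_filter gE andbT; apply/asboolP.
constructor 2 => n'; rewrite /fixes -actM -tauD addrC tauD actM; congr (act _ _).
exact: fg.
Qed.

Theorem free_axis : (forall n, tau n = 1%g -> n = 0) ->
  exists (t : 'rV[int]_d -> cox_group W) (m0 : 'rV[int]_d),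
  [/\ forall m n, t (m + n) = (t m * t n)%g, forall n, t n = 1%g -> n = 0,
    forall k : nat, len (t (k%:Z *: m0)) = (k * len (t m0))%N &
    forall n, exists k : nat, len (t ((2 * k)%N%:Z *: m0)) =
      (len (t (k%:Z *: m0 + n)%R) + len (t (k%:Z *: m0 - n)%R))%N].
Proof.
move=> tau_inj; have [N [m' [N0 tri]]] := trichotomy; pose m := N%:Z *: m'.
have [x xP] := sided_base m.
have dich c : root c -> (forall n, side c (tau (N%:Z *: n) * x)%g = side c x) \/
    exists sp sm, lims m c sp sm /\ sp != sm.
  move=> rc; have [h|h|fc] := tri c rc.
  - left=> n; have hx := xP c _ rc (or_introl h); rewrite hx.
    by have := hx 0; rewrite tau0 mul1g.
  - left=> n; rewrite side_tau -scalerN; congr (side _ x); exact: h.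
  have [sp [sm hl]] := lims_ex rc fc; have [e|ne] := eqVneq sp sm; last by right; exists sp, sm.
  left=> n; rewrite -e in hl; have hx := xP c sp rc (or_intror (conj fc hl)); rewrite hx.
  by have := hx 0; rewrite tau0 mul1g.
have [L [_ LP]] := sep_list R x (tau m * x)%g; have [D DP] := lims_uniform m L x.
pose P c (p : nat) := side c (tau (p%:Z *: m) * x)%g.
have P0 c : P c 0%N = side c x by rewrite /P scale0r tau0 mul1g.
have PN (p : nat) : p%:Z *: m = N%:Z *: (p%:Z *: m') by rewrite /m !scalerA mulrC.
have shift c (i j : nat) : side (act (tau (- (i%:Z *: m))) c) (tau (j%:Z *: m) * x)%g = P c (i + j)%N.
  by rewrite -side_tau mulgA -tauD -scalerDl.
(* A crossing before p gives the side [sp] at time q, and a crossing after p gives the side [sm] at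
   time 0. As these differ, a wall crossed between 0 and p is not crossed back by time q. *)
have mono c (p q : nat) : root c -> (D < p)%N -> (p + D < q)%N -> P c 0%N != P c p -> P c p = P c q.
  move=> rc Dp pq ne; apply: contraTeq isT => ne2.
  have [h|[sp [sm [hl spm]]]] := dich c rc.
    by move: ne; rewrite P0 /P PN h eqxx.
  have sepL i : P c i != P c i.+1 -> act (tau (- (i%:Z *: m))) c \in L.
    move=> h; apply: LP; first exact: root_act.
    rewrite -!side_tau mulgA -tauD (_ : i%:Z *: m + m = i.+1%:Z *: m) //.
    by rewrite -[i.+1]addn1 PoszD scalerDl scale1r.
  have [i ip /sepL iL] := bool_change ne.
  have [|j jq] := @bool_change (fun l => P c (p + l)%N) (q - p); first by rewrite addn0 subnKC //; lia.
  rewrite addnS => /sepL jL.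
  have e1 : P c q = sp.
    have [|<- _] := DP _ iL _ _ (lims_tau _ hl) (q - i)%N; first by lia.
    by rewrite shift subnKC //; lia.
  have e2 : P c 0%N = sm.
    have [|_ <-] := DP _ jL _ _ (lims_tau _ hl) (p + j)%N; first by lia.
    by rewrite -side_tau mulgA -tauD subrr tau0 mul1g P0.
  by move: ne ne2 spm; rewrite e2 e1; case: (P c p); case: sp {e1 hl}; case: sm {e2}.
pose t n := (x^-1 * tau (N%:Z *: n) * x)%g.
have tD n n' : t (n + n') = (t n * t n')%g by rewrite /t scalerDr tauD !mulgA mulgK.
have tside c n : side c (t n) = side (act x c) (tau (N%:Z *: n) * x)%g by rewrite side_act /t mulgA.
have side1 c : side c 1%g = side (act x c) x by rewrite side_act mulVg.
(* Steps of D + 1 keep consecutive times far enough apart for [mono]. *)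
pose K := D.+1; exists t, (K%:Z *: m').
have tk c (k : nat) : side c (t (k%:Z *: (K%:Z *: m'))) = P (act x c) (k * K)%N.
  by rewrite tside /P PN PoszM -scalerA.
split=> // [n /(congr1 (fun g => x * g * x^-1)%g)|k|n].
- rewrite /t !mulgA mulgK mulgV mul1g mulg1 mulgV => /tau_inj /rowP e.
  apply/rowP => i; have := e i; rewrite !mxE => /eqP; rewrite mulf_eq0 => /orP[|/eqP //].
  by rewrite eqz_nat; case: N N0 {tri m xP dich L LP DP P P0 PN shift mono t tD tside tk e}.
- elim: k => [|k IH].
    by rewrite scale0r mul0n; have -> : t 0 = 1%g; rewrite ?len1 // /t scaler0 tau0 mulg1 mulVg.
  rewrite -[k.+1]addn1 PoszD scalerDl scale1r tD (@len_add R W) ?IH ?mulnDl ?mul1n // => c rc.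
  rewrite -tD -{4}(scale1r (K%:Z *: m')) -scalerDl -PoszD !tk side1 -P0 => ne.
  case: k {IH} ne => [|k] ne; first by rewrite mul0n eqxx in ne.
  by apply: mono => //; [exact: root_act|rewrite /K; nia..].
have [Ln [_ LnP]] := sep_list R x (tau (N%:Z *: n) * x)%g; have [D' D'P] := lims_uniform m Ln x.
exists D'.+1; set k := D'.+1; set m0 := K%:Z *: m'.
have -> : (2 * k)%N%:Z *: m0 = (k%:Z *: m0 + n) + (k%:Z *: m0 - n).
  by rewrite addrACA subrr addr0 -scalerDl mul2n -addnn PoszD.
rewrite tD (@len_add R W) // => c rc; rewrite -tD addrACA subrr addr0 -scalerDl -PoszD tk.
set c' := act x c; have rc' : root c' by apply: root_act.
have tkn : side c (t (k%:Z *: m0 + n)) = side c' (tau ((k * K)%N%:Z *: m) * (tau (N%:Z *: n) * x))%g.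
  by rewrite tside scalerDr tauD mulgA PN PoszM -scalerA.
rewrite tkn side1 -/c' -P0 mulnDl => ne; apply: contraTeq isT => ne2.
have e2 : P c' 0%N = P c' (k * K + k * K)%N.
  by move: ne ne2; case: (P c' 0%N); case: (side _ _); case: (P c' _).
have e1 : P c' 0%N = P c' (k * K)%N.
  apply: contraTeq isT => ne1; have := mono _ (k * K)%N (k * K + k * K)%N rc' _ _ ne1.
  by rewrite -e2 => h; move: ne1; rewrite h ?eqxx // /K /k; nia.
(* This wall passes between the line and its translate by n at time k K. By the choice of D', its
   limits are reached at times 0 and 2 k K, where the sides would agree. *)
have gL : act (tau (- ((k * K)%N%:Z *: m))) c' \in Ln.
  apply: LnP; first exact: root_act.
  by rewrite -side_tau -[X in side _ X != _]/(tau _ * x)%g -/(P c' _) -e1 -side_tau.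
have [h|[sp [sm [hl spm]]]] := dich c' rc'.
  by move: ne; rewrite mulgA -tauD PN -scalerDr h P0 eqxx.
have [|h1 h2] := D'P _ gL _ _ (lims_tau _ hl) (k * K)%N; first by rewrite /K /k; nia.
rewrite shift -e2 in h1; rewrite -side_tau mulgA -tauD subrr tau0 mul1g -P0 in h2.
by rewrite -h1 -h2 eqxx in spm.
Qed.

End FreeAxis.

(** * Frames in the building *)

Section Buildings.
Variables (W : coxeterSystem) (X : building W).
Local Notation gen := (@cox_gen W).
Local Notation len := (@cox_length W).
Implicit Types (a b c e : X) (u v w : cox_group W).

Lemma len_first_ex w : w != 1%g -> exists s v, w = (gen s * v)%g /\ len w = (len v).+1.
Proof.
move=> /len_first[s sw]; exists s, (gen s * w)%g; rewrite mulgA cgenK mul1g; split=> //.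
by have [h|//] := len_genM s w; rewrite h ltnNge leqnSn in sw.
Qed.

Lemma wdistxx c : wdist c c = 1%g. Proof. by apply/wdist1. Qed.

Lemma gen_neq1 s : gen s <> 1%g.
Proof. by move=> e; have [] := len_genM s 1%g; rewrite mulg1 e len1. Qed.

Lemma len_gen1 s : len (gen s) = 1%N.
Proof. by have [] := len_genM s 1%g; rewrite mulg1 len1. Qed.

Lemma wdist_gen_sym a b s : wdist a b = gen s -> wdist b a = gen s.
Proof.
move=> ab; have := @wdist_adj _ _ b a a s ab; rewrite wdistxx => -[e|e].
  by have /wdist1 ba := esym e; move: ab; rewrite ba wdistxx => /esym/gen_neq1.
by apply: (@mulgI _ (gen s)); rewrite -e cgenK.
Qed.

Lemma wdist_mul a b c : len (wdist a b * wdist b c)%g = (len (wdist a b) + len (wdist b c))%N ->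
  wdist a c = (wdist a b * wdist b c)%g.
Proof.
have [n] := ubnP (len (wdist a b)); elim: n a => // n IH a ln.
have [e|ne] := eqVneq (wdist a b) 1%g.
  by move=> _; rewrite e mul1g; move/wdist1: e => ->.
have [s [v [abE abl]]] := len_first_ex ne; rewrite abE -mulgA => lsum.
have [a' a's a'b] := wdist_ex a b s; rewrite abE mulgA cgenK mul1g in a'b.
have l1 := lenM v (wdist b c); have l2 := lenM (gen s) (v * wdist b c)%g.
rewrite -abE abl in lsum; rewrite len_gen1 lsum in l2.
have lv : len (v * wdist b c)%g = (len v + len (wdist b c))%N by lia.
have a'c : wdist a' c = (v * wdist b c)%g by rewrite (IH a') a'b // -ltnS -abl.
rewrite (@wdist_adj_length _ _ a' a c s) ?a'c //; first exact: wdist_gen_sym.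
by rewrite lsum lv addSn.
Qed.

Lemma wdist_sym a b : wdist b a = (wdist a b)^-1%g.
Proof.
have [n] := ubnP (len (wdist a b)); elim: n a => // n IH a ln.
have [e|ne] := eqVneq (wdist a b) 1%g.
  by rewrite e invg1; move/wdist1: e => ->; exact: wdistxx.
have [s [v [abE abl]]] := len_first_ex ne.
have [a' a's a'b] := wdist_ex a b s; rewrite abE mulgA cgenK mul1g in a'b.
have ba' : wdist b a' = v^-1%g by rewrite (IH a') a'b // -ltnS -abl.
rewrite (wdist_mul (b := a')) ba' a's ?abE ?invMg ?cgenV //.
have -> : (v^-1 * gen s)%g = (wdist a b)^-1%g by rewrite abE invMg cgenV.
by rewrite !lenV abl len_gen1 addn1.
Qed.

Lemma between_ex a b u v : wdist a b = (u * v)%g -> len (u * v)%g = (len u + len v)%N ->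
  exists c, wdist a c = u /\ wdist c b = v.
Proof.
have [n] := ubnP (len u); elim: n u a => // n IH u a ln abE lsum.
have [e|ne] := eqVneq u 1%g; first by exists a; rewrite abE e mul1g wdistxx.
have [s [u' [uE ul]]] := len_first_ex ne.
have [a' a's a'b] := wdist_ex a b s; rewrite abE uE !mulgA cgenK mul1g in a'b.
have l1 := lenM u' v; have l2 := lenM (gen s) (u' * v)%g.
rewrite mulgA -uE lsum ul len_gen1 in l2.
have [||c [a'c cb]] := IH u' a' _ a'b; [by rewrite -ltnS -ul|by lia|].
exists c; split=> //; have aa' := wdist_gen_sym a's.
by rewrite (wdist_mul (b := a')) aa' a'c -?uE // len_gen1 ul.
Qed.

Lemma between_uniq a b c c' : wdist a c = wdist a c' -> wdist c b = wdist c' b ->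
  len (wdist a c * wdist c b)%g = (len (wdist a c) + len (wdist c b))%N -> c = c'.
Proof.
have [n] := ubnP (len (wdist a c)); elim: n a => // n IH a ln eac ecb lsum.
have [e|ne] := eqVneq (wdist a c) 1%g.
  by have /wdist1 <- := e; have /wdist1 <- : wdist a c' = 1%g by rewrite -eac.
have [s [u' [uE ul]]] := len_first_ex ne.
have [a1 a1s a1c] := wdist_ex a c s; have [a2 a2s a2c] := wdist_ex a c' s.
rewrite -eac in a2c; rewrite uE mulgA cgenK mul1g in a1c a2c.
have l1 := lenM u' (wdist c b); have l2 := lenM (gen s) (u' * wdist c b)%g.
rewrite mulgA -uE lsum ul len_gen1 in l2.
have lu : len (u' * wdist c b)%g = (len u' + len (wdist c b))%N by lia.
have a1b : wdist a1 b = (u' * wdist c b)%g by rewrite (wdist_mul (b := c)) a1c.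
have a2b : wdist a2 b = (u' * wdist c b)%g by rewrite (wdist_mul (b := c')) a2c -ecb.
suff a12 : a1 = a2.
  by apply: (IH a1); rewrite ?a1c // ?a12 ?a2c // -ltnS -ul.
have aa2 := wdist_gen_sym a2s; have := @wdist_adj _ _ a a1 a2 s a1s; rewrite aa2 cgenK.
case=> [a12|/wdist1//]; have := @wdist_adj_length _ _ a2 a1 b s a12.
rewrite a2b mulgA -uE lsum ul addSn -lu => /(_ erefl); rewrite a1b uE -mulgA => e.
by have := congr1 len e; rewrite mulgA -uE lsum ul lu; lia.
Qed.

Lemma wdist_to c w : exists a, wdist c a = w.
Proof.
have [n] := ubnP (len w); elim: n w c => // n IH w c ln.
have [->|/len_first_ex[s [v [wE wl]]]] := eqVneq w 1%g; first by exists c; exact: wdistxx.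
have [c' c's _] := wdist_ex c c s; have [|a av] := IH v c'; first by rewrite -ltnS -wl.
by exists a; rewrite (wdist_mul (b := c')) (wdist_gen_sym c's) av -?wE // len_gen1 wl.
Qed.

Lemma sphere_finite : locally_finite X -> forall c w, finite_set [set a | wdist c a = w].
Proof.
move=> lf c w; have [n] := ubnP (len w); elim: n w c => // n IH w c ln.
have [->|/len_first_ex[s [v [wE wl]]]] := eqVneq w 1%g.
  by apply: (@sub_finite_set _ _ [set c]) => // a /wdist1 ->.
apply: (@sub_finite_set _ _ (\bigcup_(c' in [set c' | wdist c c' = gen s]) [set a | wdist c' a = v])).
  move=> a /= ca; have [||c' [cc' c'a]] := @between_ex c a (gen s) v; [by rewrite ca|by rewrite -wE wl len_gen1|].
  by exists c'.
by apply: bigcup_finite => [|c' _]; [exact: lf|apply: IH; rewrite -ltnS -wl].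
Qed.

End Buildings.

(** * Limits of automorphisms *)

Section Limits.
Variables (W : coxeterSystem) (X : building W).
Local Notation aut := (building_aut X).
Implicit Types (a b c e : X) (f g h : aut).

Lemma autM f g c : (f * g)%g c = f (g c). Proof. by []. Qed.
Lemma autK f c : (f^-1)%g (f c) = c. Proof. by have [h _] := aut_invP f; exact: h. Qed.
Lemma autVK f c : f ((f^-1)%g c) = c. Proof. by have [_ h] := aut_invP f; exact: h. Qed.

Lemma aut_cvg (U : set_system aut) (v : aut) : Filter U ->
  (forall c, U [set f | f c = v c]) -> U --> v.
Proof.
move=> FU h; have cv : (@aut_ptws W X) @ U --> (aut_ptws v : {ptws X -> discrete_topology X}).
  apply/cvg_sup => c A /= [_ [[B Bop <-] Bfs sBfA]].
  by apply: filterS (h c) => f /= fc; apply: sBfA; rewrite /= /aut_ptws fc.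
move=> A /= [_ [[B Bop <-] Bfs sBfA]].
have /cv FB : nbhs (aut_ptws v : {ptws X -> discrete_topology X}) B by rewrite nbhsE; exists B.
exact: (@filterS _ U FU _ _ sBfA FB).
Qed.

Hypothesis lf : locally_finite X.

Lemma ultra_finite (T : Type) (I : choiceType) (U : set_system T) (A : set I) (f : T -> I) :
  UltraFilter U -> finite_set A -> U (f @^-1` A) -> exists2 i, A i & U (f @^-1` [set i]).
Proof.
move=> UU /finite_seqP[l ->]; elim: l => [|i l IH] h.
  by have [x []] := @filter_ex _ U _ _ h.
have [hi|hi] := in_ultra_setVsetC (f @^-1` [set i]) UU; first by exists i; rewrite //= mem_head.
have [|j jl hj] := IH; last by exists j => //=; rewrite inE jl orbT.
apply: filterS2 hi h => x /= xi; rewrite inE => /orP[/eqP|//]; by move=> e.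
Qed.

Lemma type_preservingV f : type_preserving f -> type_preserving (f^-1)%g.
Proof. by move=> tf a b; rewrite -{2}(autVK f a) -{2}(autVK f b) tf. Qed.

(** Local finiteness confines both g a and g^-1 a to finite sets, so pointwise limits exist. The
    limits of the inverses are what makes the limit map bijective. *)
Lemma limit_aut (U : set_system aut) (G : set aut) c (A : set X) :
  UltraFilter U -> closed G -> (forall g, G g -> type_preserving g) -> U G ->
  finite_set A -> U [set g | A (g c)] ->
  exists v, [/\ G v, U --> v & forall a, U [set g | g a = v a]].
Proof.
move=> UU Gc Gt UG Af UA.
have lim1 a : exists b, U [set g | g a = b].
  have [||b _ bP] := @ultra_finite aut X U (\bigcup_(b in A) [set e | wdist b e = wdist c a]) (fun g => g a) UU.
  - by apply: bigcup_finite => // b _; exact: sphere_finite.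
  - by apply: filterS2 UA UG => g Ag /Gt tg; exists (g c); rewrite //= tg.
  by exists b.
have lim2 a : exists b, U [set g : aut | aut_inv g a = b].
  have [||b _ bP] := @ultra_finite aut X U
    (\bigcup_(b in A) [set e | wdist c e = wdist b a]) (fun g => aut_inv g a) UU.
  - by apply: bigcup_finite => // b _; exact: sphere_finite.
  - apply: filterS2 UA UG => g Ag /Gt/type_preservingV tg; exists (g c) => //=.
    by rewrite -[in RHS](tg (g c)) [aut_inv g (g c)]autK.
  by exists b.
have [v vP] := choice lim1; have [v' v'P] := choice lim2.
have vK : cancel v v'.
  move=> a; have [g [/= g1 g2]] := @filter_ex _ U _ _ (filterI (vP a) (v'P (v a))).
  by rewrite -g2 -g1 autK.
have v'K : cancel v' v.
  move=> a; have [g [/= g1 g2]] := @filter_ex _ U _ _ (filterI (v'P a) (vP (v' a))).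
  by rewrite -g2 -g1 autVK.
have vT a b : wdist (v a) (v b) = wdist a b.
  have [g [[/= g1 g2] /Gt tg]] := @filter_ex _ U _ _ (filterI (filterI (vP a) (vP b)) UG).
  by rewrite -g1 -g2 tg.
have vA : is_automorphism v.
  split; first by exists v'.
  by exists id, 1%g; split=> // [|s]; [exists id|rewrite perm1].
have cv : U --> BuildingAut vA by apply: aut_cvg.
exists (BuildingAut vA); split=> //.
by apply: (@closed_cvg _ _ U _ id G Gc UG).
Qed.

Lemma limit_seq (G : set aut) (v_ : nat -> aut) c (A : set X) : closed G ->
  (forall g, G g -> type_preserving g) -> (forall l, G (v_ l)) -> finite_set A ->
  (forall l, A (v_ l c)) ->
  exists2 v, G v & forall (D : seq X) N, exists2 l, (N <= l)%N & forall a, a \in D -> v_ l a = v a.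
Proof.
move=> Gc Gt Gv Af Av.
have PF : ProperFilter (v_ @ \oo) by apply: fmap_proper_filter.
have [U [UU FU]] := ultraFilterLemma PF.
have UG : U G by apply: FU; exists 0%N => // l _; exact: Gv.
have UA : U [set g | A (g c)] by apply: FU; exists 0%N => // l _; exact: Av.
have [v [v1 _ v2]] := limit_aut UU Gc Gt UG Af UA.
exists v => // D N.
have UD : U [set g | forall a, a \in D -> g a = v a].
  elim: D => [|a D IH]; first by apply: filterS filterT.
  apply: filterS2 (v2 a) IH => g /= ga gD b; rewrite inE => /orP[/eqP ->//|]; exact: gD.
have UN : U [set g | exists2 l, (N <= l)%N & g = v_ l].
  by apply: FU; exists N => // l /= Nl; exists l.
have [g [gD [l Nl gl]]] := @filter_ex _ U _ _ (filterI UD UN).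
by exists l => // a /gD; rewrite gl.
Qed.

End Limits.

(** * The copy of Z^d spanned by an axis *)

Section Axis.
Variables (W : coxeterSystem) (X : building W) (d : nat).
Variables (t : 'rV[int]_d -> cox_group W) (m : 'rV[int]_d).
Local Notation len := (@cox_length W).
Local Notation aut := (building_aut X).
Implicit Types (n : 'rV[int]_d) (k : nat) (f g : aut).

Hypothesis tD : forall n n', t (n + n') = (t n * t n')%g.
Hypothesis m_len : forall k, len (t (k%:Z *: m)) = (k * len (t m))%N.

(* [t n] lies on a geodesic from [t (- k m)] to [t (k m)]. *)
Definition straight k n :=
  len (t ((2 * k)%N%:Z *: m)) = (len (t (k%:Z *: m + n)%R) + len (t (k%:Z *: m - n)%R))%N.

(** Subadditivity bounds each length on the left by the sum on the right, while the lengths along m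
    are exactly additive; hence all these inequalities are equalities. *)
Lemma straightD k k' n n' : straight k n -> straight k' n' ->
  [/\ straight (k + k') (n + n'),
      len (t ((k + k')%N%:Z *: m + (n + n'))) =
        (len (t (k%:Z *: m + n)%R) + len (t (k'%:Z *: m + n')%R))%N &
      len (t ((k + k')%N%:Z *: m - (n + n'))) =
        (len (t (k%:Z *: m - n)%R) + len (t (k'%:Z *: m - n')%R))%N].
Proof.
rewrite /straight !m_len => h h'.
have e1 : (k + k')%N%:Z *: m + (n + n') = (k%:Z *: m + n) + (k'%:Z *: m + n').
  by rewrite PoszD scalerDl addrACA.
have e2 : (k + k')%N%:Z *: m - (n + n') = (k%:Z *: m - n) + (k'%:Z *: m - n').
  by rewrite PoszD scalerDl opprD addrACA.
have l1 := lenM (t (k%:Z *: m + n)) (t (k'%:Z *: m + n')).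
have l2 := lenM (t (k%:Z *: m - n)) (t (k'%:Z *: m - n')).
rewrite -tD -e1 in l1; rewrite -tD -e2 in l2.
have := lenM (t ((k + k')%N%:Z *: m + (n + n'))) (t ((k + k')%N%:Z *: m - (n + n'))).
rewrite -tD addrACA subrr addr0 -scalerDl -PoszD m_len => l3.
have : ((2 * (k + k')) * len (t m) = (2 * k) * len (t m) + (2 * k') * len (t m))%N by ring.
have : ((k + k' + (k + k')) * len (t m) = (2 * k) * len (t m) + (2 * k') * len (t m))%N by ring.
by split; lia.
Qed.

Lemma straight0 k : straight k 0.
Proof. by rewrite /straight subr0 addr0 !m_len; ring. Qed.

Lemma straightN k n : straight k n -> straight k (- n).
Proof. by rewrite /straight opprK addnC. Qed.

Lemma straight_ge k k' n : (k <= k')%N -> straight k n -> straight k' n.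
Proof.
by move=> /subnKC <- /straightD/(_ (straight0 (k' - k)))[]; rewrite addr0.
Qed.

Hypothesis t_inj : forall n, t n = 1%g -> n = 0.
Hypothesis straight_ex : forall n, exists k, straight k n.

(** Distances are prescribed only along displacements that occur on geodesics in direction m; there
    lengths add up, so that chambers are determined by their positions. *)
Definition framed (a : 'rV[int]_d -> X) := forall n k n', straight k n' ->
  wdist (a n) (a (n + (k%:Z *: m + n'))) = t (k%:Z *: m + n').

Definition line (c : int -> X) := forall j k, wdist (c j) (c (j + k%:Z)) = t (k%:Z *: m).

Lemma framed_shift a n : framed a -> framed (fun n' => a (n + n')).
Proof. by move=> aF n1 k n' h; rewrite addrA aF. Qed.

Lemma framed_aut a f : type_preserving f -> framed a -> framed (f \o a).
Proof. by move=> ft aF n k n' h; rewrite /= ft aF. Qed.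

Lemma framed_sum a n k n' : framed a -> straight k n ->
  wdist (a (n' - k%:Z *: m)) (a (n' + n)) = t (k%:Z *: m + n) /\
  wdist (a (n' + n)) (a (n' + k%:Z *: m)) = t (k%:Z *: m - n).
Proof.
move=> aF h; split; first by have := aF (n' - k%:Z *: m) _ _ h; rewrite addrA subrK.
have := aF (n' + n) _ _ (straightN h); by rewrite -addrA [n + _]addrCA subrr addr0.
Qed.

Lemma framed_ext a a' : framed a -> framed a' -> (forall j : int, a (j *: m) = a' (j *: m)) ->
  a =1 a'.
Proof.
move=> aF a'F e n; have [k kP] := straight_ex n.
have [h1 h2] := framed_sum 0 aF kP; have [h1' h2'] := framed_sum 0 a'F kP.
rewrite !add0r in h1 h2 h1' h2'.
rewrite -scaleNr e in h1; rewrite e in h2; rewrite -scaleNr in h1'.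
apply: (between_uniq (a := a' (- k%:Z *: m)) (b := a' (k%:Z *: m))); rewrite ?h1 ?h2 //.
by rewrite -tD addrACA subrr addr0 -scalerDl -PoszD addnn -mul2n.
Qed.

Lemma framed_inj a : framed a -> injective a.
Proof.
move=> aF n n' e; have [k kP] := straight_ex (n' - n).
have h1 := aF n k _ kP; have h2 := aF n' k _ (straight0 k).
rewrite (_ : n + (k%:Z *: m + (n' - n)) = n' + (k%:Z *: m + 0)) in h1; last first.
  by rewrite addr0 addrCA [n + _]addrC subrK addrC.
move: h1; rewrite e h2 !tD => /mulgI h; apply/esym/subr0_eq/t_inj.
by rewrite tD -h; apply: (@mulgI _ (t 0)); rewrite -tD addr0 mulg1.
Qed.

Section Line.
Variable c : int -> X.
Hypothesis cL : line c.

(** [e] has position n relative to the axis. Asking it for all large k allows two such chambers to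
    be compared between the same two points of the axis. *)
Let fr n e := exists k0, forall k, (k0 <= k)%N -> [/\ straight k n,
  wdist (c (- k%:Z)) e = t (k%:Z *: m + n) & wdist e (c k%:Z) = t (k%:Z *: m - n)].

Local Lemma fr_start n k e : straight k n -> wdist (c (- k%:Z)) e = t (k%:Z *: m + n) ->
  wdist e (c k%:Z) = t (k%:Z *: m - n) -> fr n e.
Proof.
move=> kP h1 h2; exists k => k' /subnKC <-; set i := (k' - k)%N.
have [g l1 l2] := straightD kP (straight0 i); rewrite !addr0 in g l1 l2; split=> //.
  have h : wdist (c (- (k + i)%N%:Z)) (c (- k%:Z)) = t (i%:Z *: m).
    by rewrite -(cL (- (k + i)%N%:Z)) PoszD opprD subrK.
  have e1 : (t (i%:Z *: m) * t (k%:Z *: m + n))%g = t ((k + i)%N%:Z *: m + n).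
    by rewrite -tD addrA -scalerDl -PoszD addnC.
  by rewrite (wdist_mul (b := c (- k%:Z))) h h1 e1 // l1 addnC.
have e1 : (t (k%:Z *: m - n) * t (i%:Z *: m))%g = t ((k + i)%N%:Z *: m - n).
  by rewrite -tD addrAC -scalerDl -PoszD.
by rewrite (wdist_mul (b := c k%:Z)) h2 ?PoszD cL ?e1 // l2 subr0.
Qed.

Local Lemma fr_ex n : exists e, fr n e.
Proof.
have [k kP] := straight_ex n.
have E : (t (k%:Z *: m + n) * t (k%:Z *: m - n))%g = t ((2 * k)%N%:Z *: m).
  by rewrite -tD addrACA subrr addr0 -scalerDl -PoszD addnn -mul2n.
have [||e [h1 h2]] := @between_ex W X (c (- k%:Z)) (c k%:Z) (t (k%:Z *: m + n)) (t (k%:Z *: m - n)).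
- by rewrite E -(cL (- k%:Z)); congr (wdist _ (c _)); lia.
- by rewrite E kP.
by exists e; apply: fr_start kP h1 h2.
Qed.

Local Lemma fr_uniq n e e' : fr n e -> fr n e' -> e = e'.
Proof.
move=> [k1 h1] [k2 h2]; pose k := maxn k1 k2.
have [kP e1 e2] := h1 k (leq_maxl _ _); have [_ e1' e2'] := h2 k (leq_maxr _ _).
apply: (between_uniq (a := c (- k%:Z)) (b := c k%:Z)); rewrite ?e1 ?e2 //.
by rewrite -tD addrACA subrr addr0 -scalerDl -PoszD addnn -mul2n.
Qed.

Lemma framed_ex : exists2 a, framed a & forall j : int, a (j *: m) = c j.
Proof.
have [a aP] := choice fr_ex; exists a; last first.
  move=> j; apply: (fr_uniq (aP _)); have [k0 k0P] := straight_ex (j *: m).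
  pose k := (k0 + `|j|)%N; apply: (@fr_start _ k).
  - by apply: straight_ge k0P; exact: leq_addr.
  - have [p pE] : exists p : nat, k%:Z + j = p%:Z by exists `|(k%:Z + j)%R|%N; rewrite /k; lia.
    by rewrite -scalerDl pE -(cL (- k%:Z)) -pE addKr.
  have [p pE] : exists p : nat, k%:Z - j = p%:Z by exists `|(k%:Z - j)%R|%N; rewrite /k; lia.
  by rewrite -scalerBl pE -(cL j) -pE addrC subrK.
move=> n k n' kP; pose n2 := n + (k%:Z *: m + n').
have [k1 h1] := aP n; have [k2 h2] := aP n2.
have [k3 g3] := straight_ex (- (n + n')); pose q := (k1 + k2 + k3)%N.
have {}g3 : straight q (- (n + n')) by apply: straight_ge g3; exact: leq_addl.
have q1 : (k1 <= k + q)%N by rewrite /q; lia.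
have [g4 d4 d4'] := h1 _ q1.
have [_ l1 _] := straightD kP g3; have [_ l2 _] := straightD g4 kP.
have eA : (t (k%:Z *: m + n') * t (q%:Z *: m - (n + n')))%g = t ((k + q)%N%:Z *: m - n).
  by rewrite -tD PoszD scalerDl; congr t; apply/rowP => x; rewrite !mxE; ring.
(* The chamber at the required displacement from [a n], taken on a geodesic to a far point of the
   axis; it turns out to have position [n2], hence to be [a n2]. *)
have [||e [e1 e2]] := @between_ex W X (a n) (c (k + q)%N%:Z) (t (k%:Z *: m + n')) (t (q%:Z *: m - (n + n'))).
- by rewrite eA d4'.
- rewrite eA -l1; congr (len (t _)); rewrite PoszD scalerDl.
  by apply/rowP => x; rewrite !mxE; ring.
suff -> : a n2 = e by [].
apply: (fr_uniq (aP n2)).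
have eB : (t ((k + q)%N%:Z *: m + n) * t (k%:Z *: m + n'))%g = t ((k + q)%N%:Z *: m + n2).
  by rewrite -tD; congr t; apply/rowP => x; rewrite !mxE; ring.
have q2 : (k2 <= k + q)%N by rewrite /q; lia.
have [g5 _ _] := h2 _ q2.
apply: (fr_start g5).
  rewrite (wdist_mul (b := a n)) d4 e1 eB // -l2; congr (len (t _)).
  by rewrite PoszD; apply/rowP => x; rewrite !mxE PoszD; ring.
by rewrite e2; congr t; apply/rowP => x; rewrite !mxE PoszD; ring.
Qed.

End Line.

End Axis.

Lemma subset_stable (T : eqType) (Q : nat -> T -> Prop) (l : seq T) :
  (forall k e, Q k.+1 e -> Q k e) ->
  exists n0, forall e, e \in l -> Q n0 e -> forall k, Q k e.
Proof.
move=> QS; have Qle i j e : (i <= j)%N -> Q j e -> Q i e.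
  by move/subnK <-; elim: (j - i)%N => // k IH; rewrite addSn => /QS.
elim: l => [|e l [n0 IH]]; first by exists 0%N.
have [h|/existsNP[k hk]] := pselect (forall k, Q k e).
  by exists n0 => e'; rewrite inE => /orP[/eqP ->//|/IH].
exists (maxn n0 k) => e'; rewrite inE => /orP[/eqP -> Qe|el Qe].
  by case: hk; apply: Qle Qe; exact: leq_maxr.
by apply: IH => //; apply: Qle Qe; exact: leq_maxl.
Qed.

(** * Elements of the group acting along an axis *)

Section Automorphisms.
Variables (W : coxeterSystem) (X : building W).
Hypothesis lf : locally_finite X.
Local Notation len := (@cox_length W).
Local Notation aut := (building_aut X).
Variable G : set aut.
Hypothesis Gsub : is_subgroup G.
Hypothesis Gc : closed G.
Hypothesis Gt : forall g, G g -> type_preserving g.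
Implicit Types (f g h v : aut) (j : int) (k : nat) (c : X).

Local Lemma group1G : G 1%g. Proof. by case: Gsub. Qed.
Local Lemma groupVG g : G g -> G g^-1%g.
Proof. by case: Gsub => G1 GM Gg; rewrite -[(g^-1)%g]mul1g; exact: GM. Qed.
Local Lemma groupMG f g : G f -> G g -> G (f * g)%g.
Proof. by move=> Gf /groupVG Gg; case: Gsub => _ GM; rewrite -[g]invgK; exact: GM. Qed.
Local Lemma zpowG g j : G g -> G (zpow g j).
Proof.
move=> Gg; elim/zpow_ind: j => [|j IH|j IH]; first exact: group1G.
  by rewrite zpowS; exact: groupMG.
by rewrite zpowP; apply: groupMG => //; exact: groupVG.
Qed.

Local Lemma zpow_conj f g h j c : (forall e, h (f e) = g (h e)) -> h (zpow f j c) = zpow g j (h c).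
Proof.
move=> e; elim/zpow_ind: j => [//|j IH|j IH]; first by rewrite !zpowS !autM e IH.
rewrite !zpowP !autM; apply: (@can_inj _ _ _ ((g^-1)%g : aut)); first exact: autK.
by rewrite -e !autVK.
Qed.

Section Isolation.
Variables (d : nat) (t : 'rV[int]_d -> cox_group W) (m : 'rV[int]_d).
Hypothesis tD : forall n n', t (n + n') = (t n * t n')%g.
Hypothesis m_len : forall k, len (t (k%:Z *: m)) = (k * len (t m))%N.

Lemma axis_line g c : G g -> wdist c (g c) = t m -> line t m (fun j => zpow g j c).
Proof.
move=> Gg cg j k; rewrite zpowD autM (Gt (zpowG j Gg)).
elim: k => [|k IH]; first by rewrite zpow0 wdistxx scale0r; apply: (@mulgI _ (t 0)); rewrite -tD addr0 mulg1.
have e : (t (k%:Z *: m) * t m)%g = t (k.+1%:Z *: m).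
  by rewrite -tD -[k.+1]addn1 PoszD scalerDl scale1r.
have h : wdist (zpow g k%:Z c) (zpow g k.+1%:Z c) = t m.
  by rewrite -[k.+1]addn1 PoszD zpowD autM (Gt (zpowG _ Gg)).
by rewrite (wdist_mul (b := zpow g k%:Z c)) IH h e // !m_len mulSn addnC.
Qed.

(* Pulled back to [c], the orbits of the next chamber of the axis under the
   stabilizers of longer and longer segments decrease in a finite sphere, hence are
   eventually constant; from there on an element of [G] matching the two axes on a
   segment can be corrected to match them one step further. *)
Lemma axis_isolated g c : G g -> wdist c (g c) = t m ->
  exists N : nat, forall g', G g' ->
    (forall k, (k <= N)%N -> zpow g' k%:Z c = zpow g k%:Z c) ->
    exists2 v, G v & forall j, v (zpow g j c) = zpow g' j c.
Proof.
move=> Gg cg; have gS f k e : zpow f k.+1%:Z e = f (zpow f k%:Z e).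
  by rewrite -addn1 PoszD zpowS.
have gSr f k e : zpow f k.+1%:Z e = zpow f k%:Z (f e).
  by rewrite -addn1 PoszD zpowD.
pose P n p := G p /\ forall k, (k <= n)%N -> p (zpow g k%:Z c) = zpow g k%:Z c.
pose Q n e := exists2 p, P n p & zpow g n%:Z e = p (zpow g n.+1%:Z c).
have QS n e : Q n.+1 e -> Q n e.
  case=> p [Gp pc] pe; exists (g^-1 * p * g)%g; last by rewrite !autM -gS -pe gS autK.
  split; first by apply: groupMG => //; apply: groupMG => //; exact: groupVG.
  by move=> k kn; rewrite !autM -gS pc // gS autK.
have /finite_seqP[l lE] := sphere_finite lf c (t m).
have Ql n e : Q n e -> e \in l.
  case=> p [Gp pc] pe; suff : [set` l] e by []; rewrite -lE /=.
  rewrite -(Gt (zpowG n Gg)) pe -(pc n) // (Gt Gp) gS; have := axis_line Gg cg n 1.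
  by rewrite scale1r -PoszD addn1 gS.
have [n0 n0P] := subset_stable l QS.
exists n0.+1 => g' Gg' g'c.
have step n : exists2 v, G v & forall k, (k <= n0.+1 + n)%N -> v (zpow g k%:Z c) = zpow g' k%:Z c.
  elim: n => [|n [v Gv vc]].
    by exists 1%g; [exact: group1G|move=> k; rewrite addn0 => kn; rewrite g'c].
  pose n1 := (n0 + n)%N; rewrite addSn -/n1 in vc.
  (* The error of [v] at the first chamber where it may fail, pulled back one step along g.
     Stability of [Q] replaces it by a [p] fixing one chamber more, so that v p is correct one step
     further. *)
  pose p1 := (g^-1 * v^-1 * g' * v)%g.
  have Gp1 : G p1.
    by apply: groupMG => //; apply: groupMG => //; apply: groupMG; exact: groupVG.
  have p1c k : (k <= n1)%N -> p1 (zpow g k%:Z c) = zpow g k%:Z c.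
    by move=> kn; rewrite !autM vc -?gS -?vc ?autK ?gS ?autK // ltnW.
  pose e := (zpow g n1%:Z)^-1%g (p1 (zpow g n1.+1%:Z c)).
  have Qe : Q n1 e by exists p1 => //; rewrite /e autVK.
  have [||p [Gp pc] pe] := n0P e _ _ n1.+1; first exact: Ql Qe.
    have Qle k : Q (n0 + k)%N e -> Q n0 e.
      by elim: k => [|k IH]; rewrite ?addn0 // addnS => /QS.
    exact: Qle Qe.
  exists (v * p)%g; first exact: groupMG.
  move=> k; rewrite addSn addnS -/n1 leq_eqVlt => /orP[/eqP ->|kn]; last by rewrite autM pc // vc.
  by rewrite autM -pe gS /e autVK !autM autVK autVK vc // -gS.
have ex n : exists v, G v /\ forall k, (k <= n)%N -> v (zpow g k%:Z c) = zpow g' k%:Z c.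
  by have [v Gv vP] := step n; exists v; split=> // k kn; apply: vP; lia.
have {ex}[w wP] := choice ex.
(* Recentering: [w (2 * n)] matches the half-axes on [0, 2 n], so [u n] matches the axes on
   [-n, n]. *)
pose u n := (zpow g' (- n%:Z) * w (2 * n)%N * zpow g n%:Z)%g.
have uP n j : (`|j| <= n)%N -> u n (zpow g j c) = zpow g' j c.
  move=> jn; rewrite /u !autM -(autM (zpow g n%:Z) (zpow g j)) -zpowD.
  have [p pE] : exists p : nat, n%:Z + j = p%:Z by exists `|(n%:Z + j)%R|%N; lia.
  have [_ h] := wP (2 * n)%N; rewrite pE h; last by lia.
  by rewrite -autM -zpowD -pE addKr.
have [|||v Gv vP] := @limit_seq W X lf G u c [set c] Gc Gt.
- by move=> n; apply: groupMG; [apply: groupMG; [exact: zpowG|by case: (wP (2 * n)%N)]|exact: zpowG].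
- exact: finite_set1.
- by move=> n; have := uP n 0 isT; rewrite !zpow0.
exists v => // j; have [n jn h] := vP [:: zpow g j c] `|j|%N.
by rewrite -h ?mem_head // uP.
Qed.

Hypothesis t_inj : forall n, t n = 1%g -> n = 0.
Hypothesis straight_ex : forall n, exists k, straight t m k n.

Variable cs : seq X.
Hypothesis csP : forall c, exists2 g, G g & g c \in cs.

Lemma frequent (T : choiceType) (l : seq T) (f : nat -> T) : (forall n, f n \in l) ->
  exists2 q, q \in l & forall n, exists2 k, (n <= k)%N & f k = q.
Proof.
move=> fl; have [||q ql qi] := @infinite_color nat T setT f l; first exact: infinite_nat.
  by move=> n _; exact: fl.
exists q => // n; have [k [_ /= kq] kn] := infinite_ex (iota 0 n) qi.
by exists k => //; move: kn; rewrite mem_iota add0n /= -leqNgt.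
Qed.

Lemma translation_ex g (a : 'rV[int]_d -> X) (b : nat -> 'rV[int]_d) : G g -> framed t m a ->
  (forall n, g (a n) = a (n + m)) ->
  exists l l' y, [/\ (l < l')%N, G y & forall n, y (a n) = a (n + (b l' - b l))].
Proof.
move=> Gg aF ga.
have ex l : exists f, G f /\ f (a (b l)) \in cs.
  by have [f Gf fP] := csP (a (b l)); exists f.
have {ex}[x xP] := choice ex.
have [c _ cP] := frequent (fun l => proj2 (xP l)).
have ex n : exists k, (n <= k)%N /\ x k (a (b k)) = c by have [k] := cP n; exists k.
have {ex}[phi phiP] := choice ex.
(* These conjugates of g all translate the same chamber [c] by t m, so they accumulate at some [g0]
   in G, which [axis_isolated] compares with two of them. *)
pose h n := (x (phi n) * g * (x (phi n))^-1)%g.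
have Gx n : G (x n) by case: (xP n).
have Gh n : G (h n) by apply: groupMG; [exact: groupMG|exact: groupVG].
have xc n : (x (phi n))^-1%g c = a (b (phi n)).
  by have [_ <-] := phiP n; rewrite autK.
have am n : wdist (a n) (a (n + m)) = t m.
  have := aF n 1%N 0; rewrite scale1r addr0; apply.
  by rewrite /straight subr0 addr0 !m_len; ring.
have hc n : wdist c (h n c) = t m.
  by rewrite !autM xc ga -(proj2 (phiP n)) Gt.
have [||g0 Gg0 g0P] := @limit_seq W X lf G h c [set e | wdist c e = t m] Gc Gt Gh.
- exact: sphere_finite.
- exact: hc.
have c0 : wdist c (g0 c) = t m.
  by have [n _ hn] := g0P [:: c] 0%N; rewrite -hn ?mem_head.
have [N NP] := axis_isolated Gg0 c0.
have agree n0 : exists2 n, (n0 <= n)%N & exists2 v, G v & forall j, v (zpow g0 j c) = zpow (h n) j c.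
  have [n nn hn] := g0P [seq zpow g0 k%:Z c | k <- iota 0 N.+1] n0; exists n => //.
  apply: NP => //; elim=> [//|k IH] kN.
  rewrite -addn1 PoszD !zpowS [LHS]autM [RHS]autM IH; last exact: ltnW.
  by apply: hn; apply/mapP; exists k => //; rewrite mem_iota; lia.
have [n1 _ [v1 Gv1 v1P]] := agree 0%N.
have [n2 n12 [v2 Gv2 v2P]] := agree (phi n1).+1.
pose y := ((x (phi n2))^-1 * v2 * v1^-1 * x (phi n1))%g.
have Gy : G y.
  by apply: groupMG => //; apply: groupMG; [apply: groupMG => //|]; exact: groupVG.
exists (phi n1), (phi n2), y; split=> //; first by apply: leq_trans n12 _; case: (phiP n2).
have gj n j : zpow g j (a n) = a (n + j *: m).
  elim/zpow_ind: j => [|j IH|j IH]; first by rewrite scale0r addr0.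
    by rewrite zpowS autM IH ga scalerDl scale1r addrA.
  by rewrite zpowP autM IH -[in RHS](autK g (a _)) ga scalerBl scale1r addrA subrK.
have yj j : y (a (b (phi n1) + j *: m)) = a (b (phi n2) + j *: m).
  have hx n e : x (phi n) (g e) = h n (x (phi n) e) by rewrite !autM autK.
  rewrite -!gj !autM (zpow_conj j _ (hx n1)) (proj2 (phiP n1)) -v1P autK v2P.
  rewrite -(proj2 (phiP n2)) -(zpow_conj j _ (hx n2)) autK //.
have h1 := framed_ext tD straight_ex (framed_aut (Gt Gy) (framed_shift (b (phi n1)) aF)) (framed_shift (b (phi n2)) aF) yj.
by move=> n; have := h1 (n - b (phi n1)); rewrite /= addrC subrK addrCA.
Qed.

Theorem compact_by_Zd_axis g c : G g -> wdist c (g c) = t m ->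
  exists H : set aut, H `<=` G /\ compact_by_Zd d H.
Proof.
move=> Gg cg; have [a aF ac] := framed_ex tD m_len straight_ex (axis_line Gg cg).
have ga n : g (a n) = a (n + m).
  have h := framed_ext tD straight_ex (framed_aut (Gt Gg) aF) (framed_shift m aF).
  rewrite -[LHS]/((g \o a) n) h 1?addrC // => j /=.
  by rewrite ac -autM -zpowS -ac scalerDl scale1r addrC.
have ex i : exists p : nat * aut, [/\ (0 < p.1)%N, G p.2 &
    forall n, p.2 (a n) = a (n + p.1%:Z *: delta_mx 0 i)].
  have [l [l' [y [ll Gy yP]]]] := translation_ex (fun l => l%:Z *: delta_mx 0 i) Gg aF ga.
  exists ((l' - l)%N, y); split=> //=; first by rewrite subn_gt0.
  by move=> n; rewrite yP -scalerBl -subzn // ltnW.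
have {ex}[M MP] := choice ex.
pose D (z : 'rV[int]_d) : 'rV[int]_d := \row_i (z ord0 i * (M i).1%:Z).
have D0 : D 0 = 0 by apply/rowP => i; rewrite !mxE mul0r.
have DD z z' : D (z + z') = D z + D z' by apply/rowP => i; rewrite !mxE mulrDl.
have DN z : D (- z) = - D z by apply/rowP => i; rewrite !mxE mulNr.
have Dinj z z' : D z = D z' -> z = z'.
  move=> e; apply/rowP => i; have := congr1 (fun v : 'rV[int]_d => v ord0 i) e.
  rewrite !mxE; apply: mulIf; have [h _ _] := MP i.
  by rewrite (_ : 0 = 0%N%:Z) // eqz_nat -lt0n.
pose tr (h : aut) z := forall n, h (a n) = a (n + D z).
have tr_uniq h z z' : tr h z -> tr h z' -> z = z'.
  move=> h1 h2; apply: Dinj; apply: (@addrI _ 0).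
  by apply: (framed_inj tD m_len t_inj straight_ex aF); rewrite -h1 h2.
have tr1 : tr 1%g 0 by move=> n; rewrite D0 addr0.
have trM h h' z z' : tr h z -> tr h' z' -> tr (h * h')%g (z + z').
  by move=> h1 h2 n; rewrite autM h2 h1 DD -addrA [D z' + _]addrC.
have trV h z : tr h z -> tr (h^-1)%g (- z).
  by move=> h1 n; rewrite DN -[in RHS](autK h (a _)) h1 subrK.
pose H : set aut := [set h | G h /\ exists z, tr h z].
pose K : set aut := [set h | G h /\ tr h 0].
have Hsub : is_subgroup H.
  split; first by split; [exact: group1G|exists 0].
  move=> x y [Gx [z xz]] [Gy [z' yz]]; split; last by exists (z + - z'); apply: trM => //; exact: trV.
  by apply: groupMG => //; exact: groupVG.
have Ksub : is_subgroup K.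
  split; first by split; [exact: group1G|].
  move=> x y [Gx xz] [Gy yz]; split; last by rewrite -(addr0 0) -{2}oppr0; apply: trM => //; exact: trV.
  by apply: groupMG => //; exact: groupVG.
pose phi (h : aut) : 'rV[int]_d := xget 0 [set z | tr h z].
have phiP h z : tr h z -> phi h = z.
  by move=> hz; apply: (tr_uniq h) => //; rewrite /phi; case: xgetP => // /(_ z).
have phiH h : H h -> tr h (phi h) by case=> _ [z hz]; rewrite (phiP h z).
exists H; split; first by move=> h [].
split=> //; exists K; split=> //.
- by move=> h [Gh h0]; split=> //; exists 0.
- move=> h k [Gh [z hz]] [Gk k0]; split.
    by apply: groupMG; [exact: groupMG|exact: groupVG].
  by rewrite -(subrr z) -{1}(addr0 z); apply: (trM); [exact: trM|exact: trV].
- rewrite compact_ultra => U UU UK.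
  have UG : U G by apply: filterS UK => h [].
  have UA : U [set h | [set a 0] (h (a 0))].
    by apply: filterS UK => h [_ h0]; rewrite /= h0 D0 addr0.
  have [v [Gv Uv vP]] := limit_aut lf UU Gc Gt UG (finite_set1 (a 0)) UA.
  exists v; split=> //; split=> // n.
  by have [h [/= <- [_ h0]]] := @filter_ex _ U _ _ (filterI (vP (a n)) UK).
exists phi; split.
- by move=> x y Hx Hy; apply: phiP; apply: trM; exact: phiH.
- move=> z; suff [x [Gx xz]] : exists x, G x /\ tr x z.
    by exists x; [split=> //; exists z|exact: phiP].
  rewrite [z]matrix_sum_delta big_ord1.
  apply: (big_ind (fun z => exists x, G x /\ tr x z)).
  + by exists 1%g; split=> //; exact: group1G.
  + move=> u u' [x [Gx xu]] [x' [Gx' xu']]; exists (x * x')%g.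
    by split; [exact: groupMG|exact: trM].
  move=> i _; have [_ Gy yP] := MP i.
  have y1 : tr (M i).2 (delta_mx 0 i).
    move=> n; rewrite yP; congr (a (_ + _)); apply/rowP => j.
    by rewrite !mxE eqxx /=; case: eqP => [->|]; rewrite ?mulr1 ?mul1r ?mulr0 ?mul0r.
  exists (zpow (M i).2 (z 0 i)); split; first exact: zpowG.
  elim/zpow_ind: (z 0 i) => [|k IH|k IH]; first by rewrite scale0r.
    by rewrite zpowS scalerDl scale1r addrC; exact: trM.
  by rewrite zpowP scalerBl scale1r addrC; apply: trM => //; exact: trV.
move=> x y Hx Hy; have tx := phiH x Hx; have ty := phiH y Hy; split.
  move=> e; split; first by apply: groupMG; [apply: groupVG; case: Hx|case: Hy].
  by rewrite -(addNr (phi x)) {2}e; apply: trM => //; exact: trV.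
case=> _ h; have := tr_uniq _ _ _ h (trM _ _ _ _ (trV _ _ tx) ty).
by move=> e; apply/eqP; rewrite -subr_eq0 -opprB -[_ - _]addrC -e oppr0.
Qed.

End Isolation.

Theorem compact_by_Zd_ex (d : nat) (t : 'rV[int]_d -> cox_group W) (m : 'rV[int]_d) (cs : seq X) :
  (forall n n', t (n + n') = (t n * t n')%g) -> (forall n, t n = 1%g -> n = 0) ->
  (forall k, len (t (k%:Z *: m)) = (k * len (t m))%N) ->
  (forall n, exists k, straight t m k n) ->
  (forall c, exists2 g, G g & g c \in cs) ->
  exists H : set aut, H `<=` G /\ compact_by_Zd d H.
Proof.
move=> tD t_inj m_len st csP.
have t0 : t 0 = 1%g by apply: (@mulgI _ (t 0)); rewrite -tD addr0 mulg1.
have ex c : exists e, wdist c e = t m by exact: wdist_to.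
have {ex}[nx nxP] := choice ex; have [c0] := chamber_inhabited X.
pose c n := iter n nx c0.
have cD i k : wdist (c i) (c (i + k)%N) = t (k%:Z *: m).
  elim: k => [|k IH]; first by rewrite addn0 wdistxx scale0r t0.
  have e : (t (k%:Z *: m)%R * t m)%g = t (k.+1%:Z *: m).
    by rewrite -tD -[k.+1]addn1 PoszD scalerDl scale1r.
  have h : wdist (c (i + k)%N) (c (i + k.+1)%N) = t m by rewrite addnS nxP.
  by rewrite (wdist_mul (b := c (i + k)%N)) IH h e // !m_len mulSn addnC.
have ex n : exists f, G f /\ f (c n) \in cs by have [f Gf fP] := csP (c n); exists f.
have {ex}[x xP] := choice ex.
have [q _ qP] := frequent (fun l => proj2 (xP l)).
(* Two chambers of a ray in direction m are sent to the same representative; the resulting [g]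
   translates by N m, and m is replaced by this multiple. *)
have [i _ xi] := qP 0%N; have [j ij xj] := qP i.+1.
pose N := (j - i)%N; have N0 : (0 < N)%N by rewrite /N subn_gt0.
have [Gxi _] := xP i; have [Gxj _] := xP j.
pose g := ((x j)^-1 * x i)%g.
have Gg : G g by apply: groupMG => //; exact: groupVG.
have gc : wdist (c i) (g (c i)) = t (N%:Z *: m).
  by rewrite autM xi -xj autK -(cD i) /N subnKC // ltnW.
have Nlen k : len (t (k%:Z *: (N%:Z *: m))) = (k * len (t (N%:Z *: m)))%N.
  by rewrite scalerA -PoszM !m_len mulnA.
apply: (compact_by_Zd_axis tD Nlen t_inj _ csP Gg gc) => n.
have [k kP] := st n; exists k; rewrite /straight !scalerA -!PoszM -mulnA.
by apply: (straight_ge tD m_len _ kP); exact: leq_pmulr.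
Qed.

End Automorphisms.

(** * The Davis realization of the building *)

Section Flags.
Variables (R : realType) (W : coxeterSystem).
Local Notation S := (cox_gens W).
Local Notation V := {ffun S -> R}.
Local Notation B := (@cox_form W R).
Local Notation bas := (@bas R W).
Local Notation vertex := (@cell_vertex W R).
Implicit Types (x y z : V) (s t : S) (J K L : {set S}) (f g : {set S} -> R).

Lemma vertex_supp K : spherical K -> supp_in K (vertex K).
Proof. by move=> Ks; have [] := solveP (fun=> 1 : R) Ks. Qed.

Lemma vertex_form K s : spherical K -> s \in K -> B (bas s) (vertex K) = 1.
Proof. by move=> Ks; have [_] := solveP (fun=> 1 : R) Ks; exact. Qed.

Lemma vertex_nneg K : spherical K -> nneg (vertex K).
Proof.
move=> Ks; apply: (nneg_inverse Ks) => s sK; first by rewrite vertex_supp.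
by rewrite vertex_form // ler01.
Qed.

Lemma vertex_gt0 K s : spherical K -> s \in K -> 0 < vertex K s.
Proof.
move=> Ks sK; rewrite lt_neqAle vertex_nneg // andbT eq_sym.
have : s \in supp (vertex K) by apply: form_gt0_supp; [exact: vertex_nneg|rewrite vertex_form // ltr01].
by rewrite inE.
Qed.

Lemma vertex_form_off K s : spherical K -> s \notin K -> B (bas s) (vertex K) <= 0.
Proof. by move=> Ks sK; apply: form_off_le0; [exact: vertex_nneg|exact: vertex_supp]. Qed.

Lemma vertex0 : vertex (finset.set0) = 0.
Proof. by apply/ffunP => s; rewrite ffunE (vertex_supp (@spherical0 W)) // finset.in_set0. Qed.

Definition flag_weight f := [/\ forall K, 0 <= f K, forall K, f K != 0 -> spherical K &
  forall K L, f K != 0 -> f L != 0 -> (K \subset L) || (L \subset K)].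

Definition bary f : V := \sum_K f K *: vertex K.

Lemma bary_coord f s : bary f s = \sum_K f K * vertex K s.
Proof. by rewrite /bary sum_ffunE; apply: eq_bigr => K _; rewrite ffunE. Qed.

Lemma bary_form f s : B (bas s) (bary f) = \sum_K f K * B (bas s) (vertex K).
Proof. by rewrite /bary form_sumr; apply: eq_bigr => K _; rewrite formZr. Qed.

Lemma bary_nneg f : flag_weight f -> nneg (bary f).
Proof.
move=> [f0 fs _] s; rewrite bary_coord sumr_ge0 // => K _.
have [->|/fs Ks] := eqVneq (f K) 0; first by rewrite mul0r.
by rewrite mulr_ge0 // vertex_nneg.
Qed.

Lemma flag_max f K0 : flag_weight f -> f K0 != 0 ->
  exists2 K, f K != 0 & forall L, f L != 0 -> L \subset K.
Proof.
move=> [_ _ fc] K0P; case: (@arg_maxnP _ K0 (fun K => f K != 0) (fun K : {set S} => #|K|) K0P) => K KP Kmax.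
exists K => // L LP; have /orP[KL|//] := fc K L KP LP.
by rewrite (eqP (_ : K == L)) // eqEcard KL; exact: Kmax.
Qed.

Lemma flag_min f K0 : flag_weight f -> f K0 != 0 ->
  exists2 K, f K != 0 & forall L, f L != 0 -> K \subset L.
Proof.
move=> [_ _ fc] K0P; case: (@arg_minnP _ K0 (fun K => f K != 0) (fun K : {set S} => #|K|) K0P) => K KP Kmin.
exists K => // L LP; have /orP[//|LK] := fc K L KP LP.
by rewrite (eqP (_ : L == K)) // eqEcard LK; exact: Kmin.
Qed.

Lemma bary_supp f K : flag_weight f -> f K != 0 -> (forall L, f L != 0 -> L \subset K) ->
  supp (bary f) = K.
Proof.
move=> fw fK Kmax; have [f0 fs _] := fw; apply/finset.setP => s; rewrite inE bary_coord.
have [sK|sK] := boolP (s \in K).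
  rewrite psumr_neq0; last first.
    move=> L _; have [->|/fs Ls] := eqVneq (f L) 0; first by rewrite mul0r.
    by rewrite mulr_ge0 // vertex_nneg.
  apply/hasP; exists K; first by rewrite mem_index_enum.
  by apply: mulr_gt0; [rewrite lt_neqAle eq_sym fK f0|exact: vertex_gt0 (fs _ fK) sK].
apply/negbTE; rewrite negbK; apply/eqP; apply: big1 => L _.
have [->|fL] := eqVneq (f L) 0; first by rewrite mul0r.
have sL : s \notin L by apply: contra sK; exact: (fintype.subsetP (Kmax _ fL)).
by rewrite (vertex_supp (fs _ fL)) ?mulr0.
Qed.

Lemma bary_inQ f : flag_weight f -> \sum_K f K = 1 -> inQ (bary f) /\
  forall K, f K != 0 -> (forall L, f L != 0 -> K \subset L) -> wall_type (bary f) = K.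
Proof.
move=> fw f1; have [f0 fs fc] := fw.
have le1 s L : f L * B (bas s) (vertex L) <= f L.
  have [->|/fs Ls] := eqVneq (f L) 0; first by rewrite mul0r.
  rewrite ler_piMr //; have [sL|sL] := boolP (s \in L); first by rewrite vertex_form.
  by apply: le_trans (vertex_form_off Ls sL) ler01.
have [K0 K0P] : exists K, f K != 0.
  apply: contrapT => no; have : \sum_K f K = 0.
    by apply: big1 => K _; apply/eqP; apply: contrapT => /negP h; apply: no; exists K.
  by rewrite f1; apply/eqP; rewrite oner_neq0.
split.
  split; first exact: bary_nneg.
    by have [K KP Kmax] := flag_max fw K0P; rewrite (bary_supp fw KP Kmax); exact: fs.
  by move=> s; rewrite bary_form -f1; apply: ler_sum => L _.
move=> K KP Kmin; apply/finset.setP => s; rewrite inE bary_form.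
have [sK|sK] := boolP (s \in K).
  rewrite -f1; apply/eqP; apply: eq_bigr => L _.
  have [->|fL] := eqVneq (f L) 0; first by rewrite mul0r.
  by rewrite (vertex_form (fs _ fL)) ?mulr1 //; apply: (fintype.subsetP (Kmin _ fL)).
apply/negbTE; rewrite neq_lt; apply/orP; left; rewrite -f1.
rewrite (bigD1 K) //= [ltRHS](bigD1 K) //=; apply: ltr_leD; last exact: ler_sum.
apply: (@le_lt_trans _ _ 0); last by rewrite lt_neqAle eq_sym KP f0.
by apply: mulr_ge0_le0 => //; apply: vertex_form_off => //; exact: fs.
Qed.

(** The largest type carried is the support of the point. Subtracting the smaller of its two
    coefficients lowers the number of types carried. The empty type is exempt because its vertex is
    0. *)
Lemma bary_uniq f g : flag_weight f -> flag_weight g -> bary f = bary g ->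
  forall K, K != finset.set0 -> f K = g K.
Proof.
pose c h := #|[set K : {set S} | (K != finset.set0) && (h K != 0 :> R)]%SET|.
have [n] := ubnP (c f + c g)%N; elim: n f g => // n IH f g cn fw gw e.
pose J := supp (bary f).
have top h : flag_weight h -> supp (bary h) = J -> J != finset.set0 -> h J != 0.
  move=> hw hJ J0; have [[K hK]|no] := pselect (exists K, h K != 0).
    by have [M hM Mmax] := flag_max hw hK; rewrite -hJ (bary_supp hw hM Mmax).
  case/negP: J0; rewrite -hJ; apply/eqP/finset.setP => s; rewrite !inE bary_coord.
  rewrite big1 ?eqxx // => K _; have [->|hK] := eqVneq (h K) 0; first by rewrite mul0r.
  by case: no; exists K.
have bot h K : flag_weight h -> supp (bary h) = finset.set0 -> K != finset.set0 -> h K = 0.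
  move=> hw h0 K0; apply/eqP; apply: contraNT K0 => hK.
  by have [M hM Mmax] := flag_max hw hK; rewrite -finset.subset0 -h0 (bary_supp hw hM Mmax) Mmax.
have [J0|J0] := eqVneq J finset.set0; first by move=> K K0; rewrite !bot // -?e.
wlog fg : f g cn fw gw e @J top bot J0 / f J <= g J.
  move=> h; have /orP[|gf] := le_total (f J) (g J); first exact: h.
  by move=> K K0; apply/esym/h => //; rewrite -?e // addnC.
have fJ := top f fw erefl J0.
pose sub h K : R := if K == J then h J - f J else h K.
have subE h : bary (sub h) = bary h - f J *: vertex J.
  rewrite /bary (bigD1 J) //= [in RHS](bigD1 J) //= /sub eqxx scalerBl addrAC; congr (_ + _ - _).
  by apply: eq_bigr => K /negbTE ->.
have sub0 h K : f J <= h J -> 0 <= h K -> 0 <= sub h K.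
  by rewrite /sub; case: eqP => // _; rewrite subr_ge0.
have subn h K : h J != 0 -> sub h K != 0 -> h K != 0.
  by move=> hJ; rewrite /sub; have [->|] := eqVneq K J.
have sub_weight h : flag_weight h -> f J <= h J -> h J != 0 -> flag_weight (sub h).
  case=> h0 hs hc fh hJ; split=> [K|K /(subn h _ hJ)|K L /(subn h _ hJ) hK /(subn h _ hJ)]; last exact: hc.
    exact: sub0.
  exact: hs.
have gJ : g J != 0 by apply: top => //; rewrite -e.
have cle h : h J != 0 -> (c (sub h) <= c h)%N.
  move=> hJ; apply: subset_leq_card; apply/fintype.subsetP => K; rewrite !inE => /andP[-> /=].
  exact: subn.
have clt : (c (sub f) < c f)%N.
  apply: proper_card; apply/fintype.properP; split.
    by apply/fintype.subsetP => K; rewrite !inE => /andP[-> /=]; exact: subn.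
  by exists J; rewrite !inE J0 ?fJ //= /sub eqxx subrr eqxx.
have IHs : forall K, K != finset.set0 -> sub f K = sub g K.
  apply: IH; [|exact: sub_weight|exact: sub_weight|by rewrite !subE e].
  by rewrite -ltnS; apply: leq_trans cn; rewrite ltnS -addSn leq_add // cle.
move=> K K0; have := IHs K K0; rewrite /sub; case: eqP => // -> /eqP.
by rewrite subrr eq_sym subr_eq0 => /eqP.
Qed.

Implicit Types (o l : seq S).

Fixpoint suffixes o : seq {set S} :=
  if o is _ :: o' then [set t in o]%SET :: suffixes o' else [::].

(* The coordinates of [z] with respect to the vertices [x_K], [K] ranging over the
   suffixes of [o]. *)
Fixpoint flag_coord o z K : R :=
  if o is s :: o' then
    let: J := [set t in o]%SET in let: m := z s / vertex J s in
    (if K == J then m else 0) + flag_coord o' (z - m *: vertex J) K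
  else 0.

Lemma flag_coord_out o z K : K \notin suffixes o -> flag_coord o z K = 0.
Proof.
elim: o z => //= s o IH z; rewrite inE negb_or => /andP[/negbTE -> h].
by rewrite IH // addr0.
Qed.

Lemma suffixes_sub o K : K \in suffixes o -> K \subset [set t in o]%SET.
Proof.
elim: o => //= s o IH; rewrite inE => /orP[/eqP -> //|/IH h].
apply: (fintype.subset_trans h); apply/fintype.subsetP => t; rewrite !inE => ->.
by rewrite orbT.
Qed.

Lemma suffixes_chain o K L : K \in suffixes o -> L \in suffixes o -> (K \subset L) || (L \subset K).
Proof.
elim: o => // s o IH; rewrite /= !inE => /orP[/eqP ->|Ko] /orP[/eqP ->|Lo]; last exact: IH.
- by rewrite fintype.subxx.
- by rewrite (@suffixes_sub (s :: o)) ?orbT //= inE Lo orbT.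
- by rewrite (@suffixes_sub (s :: o)) //= inE Ko orbT.
Qed.

Lemma suffixes_last s o K : K \in suffixes (s :: o) -> last s o \in K.
Proof.
elim: o s => [|t o IH] s; first by rewrite inE => /eqP ->; rewrite !inE.
rewrite /= inE => /orP[/eqP ->|]; last exact: IH.
by rewrite inE (mem_last s (t :: o)).
Qed.

Lemma flag_coord_lin o (a b : R) x y K :
  flag_coord o (a *: x + b *: y) K = a * flag_coord o x K + b * flag_coord o y K.
Proof.
elim: o x y => [|s o IH] x y; first by rewrite /= !mulr0 addr0.
rewrite /=; set J := [set t in s :: o]%SET; set p := vertex J.
rewrite (_ : a *: x + b *: y - _ *: p = a *: (x - (x s / p s) *: p) + b *: (y - (y s / p s) *: p)).
  by rewrite IH; case: (K == J); rewrite ?add0r // !ffunE /GRing.scale /=; ring.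
by apply/ffunP => t; rewrite !ffunE /GRing.scale /=; ring.
Qed.

Lemma supp_in_step s o z : spherical [set t in s :: o]%SET -> supp_in [set t in s :: o]%SET z ->
  supp_in [set t in o]%SET
    (z - (z s / vertex [set t in s :: o]%SET s) *: vertex [set t in s :: o]%SET).
Proof.
set J := [set t in s :: o]%SET => Js zJ t to; rewrite !ffunE /GRing.scale /=.
have [tJ|tJ] := boolP (t \in J); last by rewrite (zJ t tJ) (vertex_supp Js tJ) mulr0 subrr.
have -> : t = s by move: tJ to; rewrite !inE => /orP[/eqP //|->].
by rewrite divfK ?subrr // gt_eqF // vertex_gt0 // inE mem_head.
Qed.

Lemma flag_coord_bary o z : spherical [set t in o]%SET -> supp_in [set t in o]%SET z ->
  bary (flag_coord o z) = z.
Proof.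
elim: o z => [|s o IH] z Js zJ.
  apply/ffunP => t; rewrite zJ ?inE // bary_coord big1 // => K _.
  by rewrite mul0r.
have h := supp_in_step Js zJ; have Js' : spherical [set t in o]%SET.
  by apply: spherical_sub Js; apply/fintype.subsetP => t; rewrite !inE => ->; rewrite orbT.
have := IH _ Js' h; move: Js zJ {h}; rewrite /bary /=.
set J := [set t in s :: o]%SET; set m := z s / _ => Js zJ e.
under eq_bigr => K _ do rewrite scalerDl.
rewrite big_split /= e (bigD1 J) //= eqxx big1 ?addr0 1?addrC ?subrK // => K /negbTE ->.
by rewrite scale0r.
Qed.

(** The last letter lies in every suffix, so each vertex has product 1 with it. On the chamber the
    sum is therefore at most 1. *)
Lemma flag_coord_sum s o z : spherical [set t in s :: o]%SET -> supp_in [set t in s :: o]%SET z ->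
  \sum_K flag_coord (s :: o) z K = B (bas (last s o)) z.
Proof.
move=> Js zJ; rewrite -{2}(flag_coord_bary Js zJ) bary_form; apply: eq_bigr => K _.
have [Ko|Ko] := boolP (K \in suffixes (s :: o)); last by rewrite flag_coord_out // mul0r.
rewrite vertex_form ?mulr1 //; last exact: suffixes_last.
exact: spherical_sub (suffixes_sub Ko) Js.
Qed.

(** The letter with the smallest ratio z s / x_J s comes first: subtracting that multiple of x_J
    leaves a nonnegative vector on the other letters. *)
Lemma flag_ex l z : uniq l -> spherical [set t in l]%SET -> supp_in [set t in l]%SET z -> nneg z ->
  exists2 o, perm_eq o l & forall K, 0 <= flag_coord o z K.
Proof.
have [n] := ubnP (size l); elim: n l z => // n IH l z ln lu.
have [->|[s0 s0l]] : l = [::] \/ exists s, s \in l.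
- by case: (l) => [|s l']; [left|right; exists s; rewrite ?mem_head].
- by exists [::].
set J := [set t in l]%SET => Js zJ z0.
have [s sl smin] := seq_max (fun s => - (z s / vertex J s)) s0l.
pose m := z s / vertex J s.
have lE : perm_eq (s :: rem s l) l by rewrite perm_sym perm_to_rem.
have JE l' : perm_eq (s :: l') l -> [set t in s :: l']%SET = J.
  by move=> h; apply/finset.setP => t; rewrite !inE -(perm_mem h) inE.
have Js1 : spherical [set t in s :: rem s l]%SET by rewrite JE.
have zJ1 : supp_in [set t in s :: rem s l]%SET z by rewrite JE.
have h := supp_in_step Js1 zJ1; rewrite JE // -/m in h.
have [|||||o oP o0] := IH (rem s l) (z - m *: vertex J).
- by rewrite size_rem // -ltnS prednK //; case: (l) sl.
- exact: rem_uniq.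
- by apply: spherical_sub Js; apply/fintype.subsetP => t; rewrite !inE => /mem_rem.
- exact: h.
- move=> t; rewrite !ffunE /GRing.scale /= subr_ge0.
  have [tl|tl] := boolP (t \in l); last by rewrite vertex_supp ?mulr0 // inE.
  have p0 : 0 < vertex J t by rewrite vertex_gt0 // inE.
  by rewrite -ler_pdivlMr // -lerN2; exact: smin.
have oE : perm_eq (s :: o) l by apply: perm_trans lE; rewrite perm_cons.
exists (s :: o) => // K; rewrite /= JE // -/m addr_ge0 //.
by case: eqP => // _; rewrite /m divr_ge0 // vertex_nneg.
Qed.

(** The missing weight goes to the empty type, whose vertex is 0, so the position is unaffected. *)
Definition flag_point o z K : R :=
  flag_coord o z K + (if K == finset.set0 then 1 - \sum_L flag_coord o z L else 0).

Lemma flag_pointP o z : spherical [set t in o]%SET -> supp_in [set t in o]%SET z -> inQ z ->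
  (forall K, 0 <= flag_coord o z K) ->
  [/\ flag_weight (flag_point o z), \sum_K flag_point o z K = 1, bary (flag_point o z) = z &
    forall K, flag_point o z K != 0 -> (K \in suffixes o) || (K == finset.set0)].
Proof.
move=> Js zJ [z0 _ z1] c0.
have out K : flag_point o z K != 0 -> (K \in suffixes o) || (K == finset.set0).
  rewrite /flag_point; have [_|_] := eqVneq K finset.set0; first by rewrite orbT.
  by rewrite addr0 orbF; apply: contraNT => /flag_coord_out ->.
have s1 : \sum_K flag_coord o z K <= 1.
  case: (o) Js zJ => [|s o'] Js zJ; first by rewrite big1 ?ler01.
  by rewrite flag_coord_sum.
have rest : \sum_(K : {set S}) (if K == finset.set0 then 1 - \sum_L flag_coord o z L else 0) =
    1 - \sum_L flag_coord o z L.
  by move: (1 - _) => q; rewrite (bigD1 finset.set0) //= eqxx big1 ?addr0 // => K /negbTE ->.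
split=> //.
- split=> [K|K /out/orP[Ko|/eqP ->]|K L /out Ko /out Lo].
  + by rewrite addr_ge0 //; case: eqP => // _; rewrite subr_ge0.
  + exact: spherical_sub (suffixes_sub Ko) Js.
  + exact: spherical0.
  case/orP: Ko => [Ko|/eqP ->]; last by rewrite finset.sub0set.
  by case/orP: Lo => [Lo|/eqP ->]; [exact: suffixes_chain Ko Lo|rewrite finset.sub0set orbT].
- by rewrite big_split /= rest addrC subrK.
rewrite -[RHS](flag_coord_bary Js zJ) /bary; apply: eq_bigr => K _.
rewrite /flag_point scalerDl; case: eqP => [->|]; last by rewrite scale0r addr0.
by rewrite vertex0 !scaler0 addr0.
Qed.

End Flags.

(** * Residues and their types *)

Section ResidueTheory.
Variables (R : realType) (W : coxeterSystem) (X : building W).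
Local Notation S := (cox_gens W).
Local Notation gen := (@cox_gen W).
Implicit Types (a b c e : X) (K L : {set S}).

Lemma wdist_par K b e c : parabolic K (wdist b e) ->
  exists2 v, parabolic K v & wdist b c = (v * wdist e c)%g.
Proof.
case=> r; elim: r b => [|s r IH] b /=; first by move=> _ /esym/wdist1 ->; exists 1%g; rewrite ?mul1g //; exact: par1.
move=> /andP[sK rK] rE; have [b' b's b'e] := wdist_ex b e s.
have {IH}[|v vK vE] := IH b' rK; first by rewrite b'e -rE /= mulgA cgenK mul1g.
have := wdist_adj c (wdist_gen_sym b's); rewrite vE => -[] ->; first by exists v.
by exists (gen s * v)%g; [apply: parM => //; exact: par_gen|rewrite mulgA].
Qed.

Lemma residue_refl K a : residue K a a. Proof. by rewrite /residue /= wdistxx; exact: par1. Qed.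

Lemma residue_eq K a b : residue K a b -> residue K a = residue K b.
Proof.
suff h a' b' : residue K a' b' -> residue K b' `<=` residue K a'.
  move=> ab; apply/seteqP; split; apply: h => //.
  by rewrite /residue /= wdist_sym; exact: parV.
move=> ab c bc; rewrite /residue /=; have [v vK ->] := wdist_par c ab.
exact: parM.
Qed.

Lemma residue_typeK K a : residue_type (residue K a) = K.
Proof.
apply/finset.setP => s; rewrite inE; apply/asboolP/idP => [[c [e [ac ae ce]]]|sK].
  by apply: (@par_gen_mem R); rewrite -ce; move: ae; rewrite (residue_eq ac).
have [e es _] := wdist_ex a a s; exists a, e; rewrite (wdist_gen_sym es); split=> //.
  exact: residue_refl.
by rewrite /residue /= (wdist_gen_sym es); exact: par_gen.
Qed.

Lemma residue_inj a : injective (fun K => residue K a).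
Proof. by move=> K L e; rewrite -(@residue_typeK K a) e residue_typeK. Qed.

Lemma residue_sub K L a : residue K a `<=` residue L a -> K \subset L.
Proof.
move=> KL; apply/fintype.subsetP => s sK; have [e es _] := wdist_ex a a s.
have ae := wdist_gen_sym es; have : residue L a e by apply: KL; rewrite /residue /= ae; exact: par_gen.
by rewrite /residue /= ae => /(@par_gen_mem R).
Qed.

Lemma residue_subr K L a : K \subset L -> residue K a `<=` residue L a.
Proof. by move=> KL e; exact: par_sub. Qed.

Lemma spherical_residueP A a : spherical_residue A -> A a ->
  exists2 K, spherical K & A = residue K a.
Proof. by move=> [K [c [Ks ->]]] /residue_eq e; exists K. Qed.

Lemma chain_min (l : seq (set X)) : (forall A B, A \in l -> B \in l -> A `<=` B \/ B `<=` A) ->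
  (forall A, A \in l -> A !=set0) -> l <> [::] -> exists a, forall A, A \in l -> A a.
Proof.
move=> lc ln l0; suff [A Al Amin] : exists2 A, A \in l & forall B, B \in l -> A `<=` B.
  by have [a Aa] := ln A Al; exists a => B /Amin; exact.
elim: l lc l0 {ln} => // A l IH lc _.
have [->|l0] := pselect (l = [::]).
  by exists A; rewrite ?mem_head // => B; rewrite inE => /eqP ->.
have [||B Bl Bmin] := IH; [by move=> A1 A2 h1 h2; apply: lc; rewrite inE ?h1 ?h2 orbT|by []|].
have [|||AB] := lc A B; [exact: mem_head|by rewrite inE Bl orbT| |].
  move=> AB; exists A; first exact: mem_head.
  by move=> C; rewrite inE => /orP[/eqP ->//|/Bmin]; exact: subset_trans.
by exists B; [rewrite inE Bl orbT|move=> C; rewrite inE => /orP[/eqP -> //|/Bmin]].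
Qed.

End ResidueTheory.

(** * Points of the Davis realization in the coordinates of a chamber *)

Section Points.
Variables (R : realType) (W : coxeterSystem) (X : building W).
Local Notation S := (cox_gens W).
Local Notation V := {ffun S -> R}.
Local Notation vertex := (@cell_vertex W R).
Implicit Types (a b c e : X) (K L : {set S}) (p q : davis R X) (f : {set S} -> R) (z : V).

(* The chamber [a] belongs to all the residues carrying [p]. *)
Definition davis_in p a := forall A, p A != 0 -> A a.

Lemma davis_fsum a (F : set X -> R) : (forall A, F A != 0 -> spherical_residue A /\ A a) ->
  \sum_(A \in [set: set X]) F A = \sum_K F (residue K a).
Proof.
move=> FP; rewrite (@fsbigE _ _ _ _ _ [seq residue K a | K <- enum {: {set S}}]) //.
- rewrite big_map big_enum_cond /=; apply: eq_bigl => K.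
  by rewrite mem_set.
- by rewrite map_inj_uniq ?enum_uniq //; exact: (residue_inj R).
move=> A _ Al; apply/eqP; apply: contraNT Al => /FP[As Aa].
by have [K Ks ->] := spherical_residueP As Aa; apply: map_f; rewrite mem_enum.
Qed.

Lemma davis_weight p a : davis_in p a ->
  [/\ flag_weight (fun K => p (residue K a)), \sum_K p (residue K a) = 1 &
    davis_pos p = bary (fun K => p (residue K a))].
Proof.
move=> pa; have [p0 pf ps pc p1] := davis_coordP p.
have sup A : p A != 0 -> spherical_residue A /\ A a by move=> h; split; [exact: ps|exact: pa].
split.
- split=> [K|K|K L hK hL]; first exact: p0.
    move=> /ps[J [c [Js e]]]; have [|J' J's e'] := @spherical_residueP _ _ (residue K a) a _ (residue_refl K a).
      by exists J, c.
    by rewrite (@residue_inj R _ _ a K J' e').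
  by apply/orP; case: (pc _ _ hK hL) => h; [left|right]; exact: (residue_sub R h).
- by rewrite -p1 (davis_fsum sup).
apply/ffunP => s; rewrite ffunE bary_coord (@davis_fsum a).
  by apply: eq_bigr => K _; rewrite (residue_typeK R).
by move=> A h; apply: sup; apply: contraNneq h => ->; rewrite mul0r.
Qed.

Lemma davis_in_ex2 p q : same_simplex p q -> exists2 a, davis_in p a & davis_in q a.
Proof.
move=> pq; have [_ pf ps _ p1] := davis_coordP p; have [_ qf qs _ _] := davis_coordP q.
have /finite_seqP[l lE] : finite_set ([set A | p A != 0] `|` [set A | q A != 0]).
  by rewrite finite_setU.
have lP A : A \in l <-> (p A != 0 \/ q A != 0).
  split=> h; first by have : [set` l] A by []; rewrite -lE.
  by have : ([set A | p A != 0] `|` [set A | q A != 0]) A by []; rewrite lE.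
have [||l0|a aP] := @chain_min W X l.
- by move=> A B /lP hA /lP hB; exact: pq.
- by move=> A /lP[/ps|/qs] [J [c [_ ->]]]; exists c; exact: residue_refl.
- have p0 A : p A = 0.
    by apply/eqP; apply: contrapT => /negP h; have /lP : p A != 0 \/ q A != 0 by [left|]; rewrite l0.
  by move: p1; rewrite fsbig1 // => /esym/eqP; rewrite oner_eq0.
exists a => A h; apply: aP; apply/lP; first by left.
by right.
Qed.

Lemma same_simplexxx p : same_simplex p p.
Proof. by have [_ _ _ pc _] := davis_coordP p; move=> A B hA hB; apply: pc; [case: hA|case: hB]. Qed.

Lemma davis_in_ex p : exists a, davis_in p a.
Proof. by have [a pa _] := davis_in_ex2 (@same_simplexxx p); exists a. Qed.

Lemma davis_posQ p : inQ (davis_pos p).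
Proof.
have [a pa] := davis_in_ex p; have [fw f1 ->] := davis_weight pa.
by have [] := bary_inQ fw f1.
Qed.

(** The residues carrying [p] form a chain, and by [bary_inQ] the type of the smallest one is the
    wall type of the position. *)
Lemma davis_in_par p a b : davis_in p a ->
  (davis_in p b <-> parabolic (wall_type (davis_pos p)) (wdist a b)).
Proof.
move=> pa; have [fw f1 ->] := davis_weight pa; have [_ wt] := bary_inQ fw f1.
have [K0 K0P] : exists K, p (residue K a) != 0.
  apply: contrapT => no; have : \sum_K p (residue K a) = 0.
    by apply: big1 => K _; apply/eqP; apply: contrapT => /negP h; apply: no; exists K.
  by rewrite f1; apply/eqP; rewrite oner_neq0.
have [K KP Kmin] := flag_min fw K0P; rewrite (wt K KP Kmin).
split=> [pb|ab A pA]; first exact: (pb (residue K a)).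
have [_ _ ps _ _] := davis_coordP p; have [L _ AE] := spherical_residueP (ps A pA) (pa A pA).
by move: pA; rewrite AE => /Kmin KL; exact: residue_subr KL b ab.
Qed.

Lemma davis_ex a f : flag_weight f -> \sum_K f K = 1 ->
  exists2 p, davis_in p a & forall K, p (residue K a) = f K.
Proof.
move=> fw f1; have [f0 fs fc] := fw.
pose F (A : set X) : R := \sum_K if `[< A = residue K a >] then f K else 0.
have FK K : F (residue K a) = f K.
  rewrite /F (bigD1 K) //= big1 ?addr0 => [|L LK]; first by rewrite asboolT.
  by rewrite asboolF // => /(residue_inj R) e; rewrite e eqxx in LK.
have FN A : F A != 0 -> exists2 K, f K != 0 & A = residue K a.
  move=> h; apply: contrapT => no; move/negP: h; apply; apply/eqP/big1 => K _.
  case: asboolP => // AE; apply/eqP; apply: contrapT => /negP h; apply: no.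
  by exists K.
have Fp : is_davis_point F.
  split.
  - by move=> A; apply: sumr_ge0 => K _; case: ifP.
  - apply: (@sub_finite_set _ _ [set` [seq residue K a | K <- enum {: {set S}}]]); last exact: finite_seq.
    by move=> A /FN[K _ ->] /=; apply: map_f; rewrite mem_enum.
  - by move=> A /FN[K /fs Ks ->]; exists K, a.
  - move=> A B /FN[K hK ->] /FN[L hL ->]; have /orP[h|h] := fc K L hK hL; [left|right]; exact: residue_subr.
  have h A : F A != 0 -> spherical_residue A /\ A a.
    move=> /FN[K hK ->]; split; last exact: residue_refl.
    by exists K, a; split=> //; exact: fs.
  by rewrite (davis_fsum h) -f1; apply: eq_bigr => K _.
by exists (DavisPoint Fp) => // A /FN[K _ ->]; exact: residue_refl.
Qed.

Lemma davis_eq p q : davis_coord p =1 davis_coord q -> p = q.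
Proof.
case: p q => p pP [q qP] /= /funext e; subst q; congr DavisPoint; exact: Prop_irrelevance.
Qed.

Lemma davis_uniq p q a : davis_in p a -> davis_in q a -> davis_pos p = davis_pos q -> p = q.
Proof.
move=> pa qa; have [pw p1 ->] := davis_weight pa; have [qw q1 ->] := davis_weight qa => e.
have h := bary_uniq pw qw e.
have pq K : p (residue K a) = q (residue K a).
  have [->|K0] := eqVneq K finset.set0; last exact: h.
  move: p1; rewrite -q1 (bigD1 finset.set0) //= [RHS](bigD1 finset.set0) //=.
  by rewrite (eq_bigr (fun K => q (residue K a))) => [/addIr|L /h].
apply: davis_eq => A; have [_ _ ps _ _] := davis_coordP p; have [_ _ qs _ _] := davis_coordP q.
have [K [->|h']] : exists K, A = residue K a \/ (p A = 0 /\ q A = 0); [|exact: pq|by case: h' => -> ->].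
have [hp|hp] := eqVneq (p A) 0; last first.
  by have [K _ ->] := spherical_residueP (ps A hp) (pa A hp); exists K; left.
have [hq|hq] := eqVneq (q A) 0; last first.
  by have [K _ ->] := spherical_residueP (qs A hq) (qa A hq); exists K; left.
by exists finset.set0; right.
Qed.

End Points.

(** * Retraction of paths to the Coxeter group and lifting back *)

Section Retraction.
Variables (R : realType) (W : coxeterSystem) (X : building W).
Local Notation S := (cox_gens W).
Local Notation V := {ffun S -> R}.
Implicit Types (a b c e : X) (K L : {set S}) (p q : davis R X) (x y z : V) (l : R) (w : cox_group W).

(* [davis_dist p q <= l] *)
Definition dle p q l := forall e : R, 0 < e -> davis_ball p (l + e) q.

Lemma dle_trans p q r (l l' : R) : dle p q l -> dle q r l' -> dle p r (l + l').
Proof.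
move=> h h' e e0; have e2 : 0 < e / 2 by rewrite divr_gt0.
have -> : l + l' + e = (l + e / 2) + (l' + e / 2) by field.
exact: davis_ball_triangle (h _ e2) (h' _ e2).
Qed.

Lemma dle_refl p : dle p p 0.
Proof. by move=> e e0; rewrite add0r; exact: davis_ball_center. Qed.

Lemma dle_simplex p q : same_simplex p q -> dle p q (nrm (davis_pos p - davis_pos q)).
Proof.
move=> pq e e0; apply/davis_ballP; exists 1%N, (fun i => if i == 0%N then p else q); split.
  by split=> // i; rewrite ltnS leqn0 => /eqP ->.
by rewrite /string_length big_nat1 /= ltrDl.
Qed.

Lemma dle_dist p q (r l : R) : davis_dist p q = r%:E -> dle p q l -> r <= l.
Proof.
move=> pq h; apply/ler_addgt0Pr => e e0; have := h e e0.
by rewrite /davis_ball /= pq lte_fin; exact: ltW.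
Qed.

Lemma same_simplex_spherical p q : same_simplex p q ->
  spherical (supp (davis_pos p) :|: supp (davis_pos q))%SET.
Proof.
move=> pq; have [a pa qa] := davis_in_ex2 pq.
have top (r : davis R X) : davis_in r a -> exists K, [/\ r (residue K a) != 0, spherical K & supp (davis_pos r) = K].
  move=> ra; have [rw r1 ->] := davis_weight ra.
  have [K0 K0P] : exists K, r (residue K a) != 0.
    apply: contrapT => no; have : \sum_K r (residue K a) = 0.
      by apply: big1 => K _; apply/eqP; apply: contrapT => /negP h; apply: no; exists K.
    by rewrite r1; apply/eqP; rewrite oner_neq0.
  have [K KP Kmax] := flag_max rw K0P; exists K; rewrite (bary_supp rw KP Kmax).
  by split=> //; case: rw => _ + _; apply.
have [K [KP Ks ->]] := top p pa; have [L [LP Ls ->]] := top q qa.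
have := pq (residue K a) (residue L a) (or_introl KP) (or_intror LP).
case=> /(residue_sub R) h; first by rewrite (finset.setUidPr h).
by rewrite (finset.setUidPl h).
Qed.

Lemma wdist_par_r K a b c : parabolic K (wdist a b) ->
  exists2 v, parabolic K v & wdist c b = (wdist c a * v)%g.
Proof.
move=> /parV; rewrite -wdist_sym => /(@wdist_par _ _ K b a c)[v vK e].
exists v^-1%g; first exact: parV.
by rewrite wdist_sym e invMg -wdist_sym.
Qed.

(** Consecutive points of a string share a chamber, in which the step is a straight move. Passing to
    another chamber of the same point is a turn, because the chambers of a point form a residue of
    its wall type. *)
Lemma string_reach c n p q ch a b : davis_string p q n ch -> davis_in p a -> davis_in q b ->
  reach (wdist c a) (davis_pos p) (wdist c b) (davis_pos q) (string_length n ch).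
Proof.
have turn w x e b' q' l : reach w x (wdist c e) (davis_pos q') l -> davis_in q' e -> davis_in q' b' ->
    reach w x (wdist c b') (davis_pos q') l.
  move=> h qe qb; have /(davis_in_par b' qe) eb := qb.
  by have [v vK ->] := wdist_par_r c eb; exact: reach_turn.
elim: n q b => [|n IH] q b [ch0 chn chs] pa qb.
  rewrite /string_length big_nil; rewrite -chn ch0 in qb *.
  by apply: turn pa qb; apply: reach_refl; exact: davis_posQ.
have s := chs n (ltnSn n); have [e e1 e2] := davis_in_ex2 s.
have h : davis_string p (ch n) n ch by split=> // i lt; apply: chs; exact: ltnW.
rewrite /string_length big_nat_recr //= -/(string_length n ch).
have := IH _ e h pa e1; rewrite chn in s e2 * => hr.
apply: turn e2 qb; apply: reach_move hr _ _; first exact: davis_posQ.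
exact: same_simplex_spherical.
Qed.

Lemma davis_flag_ex a o z : spherical [set t in o]%SET -> supp_in [set t in o]%SET z -> inQ z ->
  (forall K, 0 <= flag_coord o z K) ->
  exists p, [/\ davis_in p a, davis_pos p = z & forall A, p A != 0 ->
    exists2 K, A = residue K a & (K \in suffixes o) || (K == finset.set0)].
Proof.
move=> os zo qz z0; have [fw f1 fz fo] := flag_pointP os zo qz z0.
have [p pa pE] := davis_ex a fw f1; exists p; split=> //.
  have [_ _ ->] := davis_weight pa; rewrite -[RHS]fz.
  by rewrite /bary; apply: eq_bigr => K _; rewrite pE.
move=> A pA; have [_ _ ps _ _] := davis_coordP p.
have [K _ AE] := spherical_residueP (ps A pA) (pa A pA); exists K => //.
by apply: fo; rewrite -pE -AE.
Qed.

Lemma flag_enum L z : spherical L -> supp_in L z -> nneg z -> exists2 o, o \in permutations (enum L) &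
  [/\ spherical [set t in o]%SET, forall x, supp_in L x -> supp_in [set t in o]%SET x &
    forall K, 0 <= flag_coord o z K].
Proof.
move=> Ls zL z0; have e (l : seq S) : perm_eq l (enum L) -> [set t in l]%SET = L.
  by move=> h; apply/finset.setP => t; rewrite inE (perm_mem h) mem_enum.
have [||||o oP o0] := @flag_ex R W (enum L) z; rewrite ?enum_uniq ?e //.
by exists o; rewrite ?mem_permutations // e.
Qed.

Lemma davis_point_ex a z : inQ z -> exists2 p, davis_in p a & davis_pos p = z.
Proof.
move=> qz; have [z0 Ls _] := qz; have zL : supp_in (supp z) z by exact: supp_in_supp.
have [ro _ [os oL oz]] := flag_enum Ls zL z0.
by have [p [pa pz _]] := davis_flag_ex a os (oL _ zL) qz oz; exists p.
Qed.

(* Between two parameters where no coordinate changes sign, the segment stays in the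
   simplex of the flag containing its midpoint. *)
Lemma dle_segment p q a : davis_in p a -> davis_in q a ->
  spherical (supp (davis_pos p) :|: supp (davis_pos q))%SET ->
  dle p q (nrm (davis_pos p - davis_pos q)).
Proof.
move=> pa qa; set x := davis_pos p; set y := davis_pos q; set L := (supp x :|: supp y)%SET => Ls.
have xL : supp_in L x by apply: supp_in_supp; exact: finset.subsetUl.
have yL : supp_in L y by apply: supp_in_supp; exact: finset.subsetUr.
have segQ t : 0 <= t <= 1 -> inQ (seg x y t).
  by move=> t01; apply: inQ_seg => //; exact: davis_posQ.
pose P s t := forall p' q', davis_in p' a -> davis_in q' a -> davis_pos p' = seg x y s ->
  davis_pos q' = seg x y t -> dle p' q' ((t - s) * nrm (x - y)).
pose fs := [seq (flag_coord o x K, flag_coord o y K - flag_coord o x K) |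
  o <- permutations (enum L), K <- enum {: {set S}}].
suff h : P 0 1.
  by have := h p q pa qa; rewrite seg0 seg1 subr0 mul1r; apply.
apply: (subdivide (l := fs)); rewrite ?lexx ?ler01 //.
  move=> s r t /andP[s0 sr] /andP[rt t1] Psr Prt p' q' p'a q'a p's q't.
  have [|r' r'a r'r] := @davis_point_ex a (seg x y r); first by apply: segQ; rewrite (le_trans s0) //= (le_trans rt).
  have -> : (t - s) * nrm (x - y) = (r - s) * nrm (x - y) + (t - r) * nrm (x - y) by ring.
  exact: dle_trans (Psr _ _ p'a r'a p's r'r) (Prt _ _ r'a q'a r'r q't).
move=> s t s0 st t1 sgn p' q' p'a q'a p's q't.
have s01 : 0 <= s <= 1 by rewrite s0 (le_trans st).
have t01 : 0 <= t <= 1 by rewrite t1 (le_trans s0).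
pose m := (s + t) / 2; have m01 : 0 <= m <= 1 by rewrite /m; apply/andP; split; lra.
have mL := seg_supp m xL yL; have [m0 _ _] := segQ m m01.
have [ro oP [os oL om]] := flag_enum Ls mL m0.
have lin r K : flag_coord ro (seg x y r) K = flag_coord ro x K + (flag_coord ro y K - flag_coord ro x K) * r.
  by rewrite seg_conv flag_coord_lin; ring.
have pos K : 0 <= flag_coord ro (seg x y s) K /\ 0 <= flag_coord ro (seg x y t) K.
  have := om K; have := sgn (flag_coord ro x K, flag_coord ro y K - flag_coord ro x K).
  rewrite !lin /= => /(_ _); have -> : (flag_coord ro x K, flag_coord ro y K - flag_coord ro x K) \in fs.
    by apply/allpairsP; exists (ro, K); rewrite mem_enum.
  move=> /(_ isT); rewrite /m; move: (flag_coord ro x K) (_ - _) => u v uv h.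
  have e : u + v * ((s + t) / 2) = ((u + v * s) + (u + v * t)) / 2 by field.
  rewrite e in h; move: (u + v * s) (u + v * t) uv h => g k uv h.
  have {}h : 0 <= g + k by lra.
  by split; rewrite leNgt; apply/negP => h'; nra.
have [p2 [p2a p2s p2o]] := davis_flag_ex a os (oL _ (seg_supp s xL yL)) (segQ s s01) (fun K => proj1 (pos K)).
have [q2 [q2a q2t q2o]] := davis_flag_ex a os (oL _ (seg_supp t xL yL)) (segQ t t01) (fun K => proj2 (pos K)).
have e1 : p' = p2 by apply: (davis_uniq p'a p2a); rewrite p's p2s.
have e2 : q' = q2 by apply: (davis_uniq q'a q2a); rewrite q't q2t.
have -> : (t - s) * nrm (x - y) = nrm (davis_pos p' - davis_pos q').
  by rewrite p's q't segB nrmZ ger0_norm ?subr_ge0.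
apply: dle_simplex; rewrite e1 e2 => A B hA hB.
have fo C : p2 C != 0 \/ q2 C != 0 -> exists2 K, C = residue K a & (K \in suffixes ro) || (K == finset.set0).
  by case=> [/p2o|/q2o].
have [K -> Ko] := fo A hA; have [J -> Jo] := fo B hB.
have /orP[h|h] : (K \subset J) || (J \subset K); [|left; exact: residue_subr|right; exact: residue_subr].
case/orP: Ko => [Ko|/eqP ->]; last by rewrite finset.sub0set.
by case/orP: Jo => [Jo|/eqP ->]; [exact: suffixes_chain Ko Jo|rewrite finset.sub0set orbT].
Qed.

Lemma wdist_turn K c b v : parabolic K v ->
  exists2 b', residue K b b' & wdist c b' = (wdist c b * v)%g.
Proof.
case=> r rK <-; elim: r b rK => [|s r IH] b /=; first by exists b; rewrite ?mulg1 //; exact: residue_refl.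
move=> /andP[sK rK]; have [b1 b1b b1c] := wdist_ex b c s.
have [b' b1b' cb'] := IH b1 rK; exists b'.
  rewrite (@residue_eq _ _ K b b1) // /residue /= (wdist_gen_sym b1b); exact: par_gen.
by rewrite cb' [wdist c b1]wdist_sym b1c invMg -wdist_sym cgenV mulgA.
Qed.

(** Turns lift to galleries inside the residue of the current point, and moves lift inside the
    current chamber by [dle_segment]. *)
Lemma reach_lift w z w' z' l : reach w z w' z' l -> forall c a p, wdist c a = w -> davis_in p a ->
  davis_pos p = z -> exists b q, [/\ wdist c b = w', davis_in q b, davis_pos q = z' & dle p q l].
Proof.
elim=> [{}w {}z qz c a p ca pa pz|{}w {}z {}w' {}z' v {}l h IH vz c a p ca pa pz|
  {}w {}z {}w' {}z' z'' {}l h IH qz s c a p ca pa pz].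
- by exists a, p; split=> //; exact: dle_refl.
- have [b [q [cb qb qz pq]]] := IH c a p ca pa pz; rewrite -qz in vz.
  have [b' bb' cb'] := wdist_turn c b vz; exists b', q; split=> //; first by rewrite cb' cb.
  exact/(davis_in_par b' qb).
have [b [q [cb qb qz' pq]]] := IH c a p ca pa pz.
have [q' q'b q'z] := davis_point_ex b qz; exists b, q'; split=> //.
by apply: dle_trans pq _; rewrite -qz' -q'z; apply: dle_segment qb q'b _; rewrite qz' q'z.
Qed.

End Retraction.

(** * From the flat to the free abelian group, and finiteness of orbits *)

Section Assembly.
Variables (R : realType) (W : coxeterSystem) (X : building W).
Local Notation S := (cox_gens W).
Local Notation V := {ffun S -> R}.
Local Notation aut := (building_aut X).
Implicit Types (a b c e : X) (p q : davis R X).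

Lemma flat_free_abelian (d : nat) (f : 'rV[R]_d -> davis R X) :
  (forall x y, davis_dist (f x) (f y) = (euclidean_dist x y)%:E) ->
  exists tau : 'rV[int]_d -> cox_group W,
    (forall m n, tau (m + n) = (tau m * tau n)%g) /\ (forall n, tau n = 1%g -> n = 0).
Proof.
move=> fE; pose wt p : {set S} := wall_type (davis_pos p).
(* The base point lies on as few walls as possible. Nearby points lie on no other walls, hence on
   exactly the same ones, and so belong to the same chamber [c]. *)
have [x0 xmin] : exists x0, forall x, (#|wt (f x0)| <= #|wt (f x)|)%N.
  have ex : exists n, `[< exists x, #|wt (f x)| = n >] by exists #|wt (f 0)|; apply/asboolP; exists 0.
  case: (ex_minnP ex) => n /asboolP[x0 <-] nmin; exists x0 => x.
  by apply: nmin; apply/asboolP; exists x.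
pose h x := f (x0 + x).
have hE x y : davis_dist (h x) (h y) = (en (x - y))%:E.
  by rewrite fE euclidean_distE opprD addrACA subrr add0r.
have [c cP] := davis_in_ex (h 0).
have ex x : exists a, davis_in (h x) a /\ (x = 0 -> a = c).
  have [->|x0'] := eqVneq x 0; first by exists c.
  by have [a aP] := davis_in_ex (h x); exists a; split=> // /eqP; rewrite (negbTE x0').
have {ex}[a aP] := choice ex.
pose wx x := wdist c (a x); pose zx x := davis_pos (h x).
have zxQ x : inQ (zx x) by exact: davis_posQ.
have wx0 : wx 0 = 1%g by rewrite /wx (proj2 (aP 0) erefl) wdistxx.
have reach_flat x y r : en (x - y) < r -> exists2 l, l < r & reach (wx x) (zx x) (wx y) (zx y) l.
  move=> xy; have /davis_ballP[n [ch [chs chl]]] : davis_ball (h x) r (h y).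
    by rewrite /davis_ball /= hE lte_fin.
  exists (string_length n ch) => //.
  exact: string_reach chs (proj1 (aP x)) (proj1 (aP y)).
have [r0 [r00 r01 near0]] := near_self (zxQ 0).
have wts x : spherical (wt (h x)).
  by have [z0 Ls _] := zxQ x; apply: spherical_sub Ls; exact: wall_type_supp.
have ballc x : en x < r0 -> davis_in (h x) c.
  move=> xr; have /reach_flat[l lr hr] : en (0 - x) < r0 by rewrite sub0r enN.
  have [|nl pl] := near_reach (wts 0) r01 hr near0; first by rewrite add0r.
  rewrite add0r in nl; have sub : wt (h x) \subset wt (h 0) by exact: near_wall lr nl.
  have wE : wt (h x) = wt (h 0).
    by apply/eqP; rewrite eqEcard sub /h addr0; exact: xmin.
  rewrite wx0 invg1 mul1g in pl; apply/(davis_in_par c (proj1 (aP x))).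
  by rewrite -/(wt (h x)) wE wdist_sym; exact: parV.
(* The reversed path, turned so as to end in the chamber 1, lifts to a path from [h y]. Its last
   chamber is at distance 1 in W from [c], so it is [c], and the path ends at [h x] itself. *)
have reach_ball x y l : en x < r0 -> reach (wx x) (zx x) (wx y) (zx y) l -> en (x - y) <= l.
  move=> /ballc xc hr; have /(davis_in_par c (proj1 (aP x))) wv := xc.
  rewrite wdist_sym in wv.
  have := reach_turn (reach_sym hr) wv; rewrite -/(wx x) mulgV => hr'.
  have [b [q [cb qb qz yq]]] := reach_lift hr' (erefl (wx y)) (proj1 (aP y)) erefl.
  have /wdist1 bc : wdist c b = 1%g by [].
  rewrite -bc in qb; have qE : q = h x by exact: davis_uniq qb xc qz.
  by rewrite qE in yq; apply: (dle_dist (p := h y) (q := h x)); rewrite // hE enB.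
have [A [A1 A2 A3 A4 [A5 A6]]] := flat_families r00 zxQ wx0 reach_flat reach_ball.
have [u [v [uv1 uv2 uv3 uv4]]] := parallel_pairs A1 A2 A3 A4 A5 A6.
exact: (free_abelian (fun i => erefl (u i - v i)) uv1 uv2 uv3 uv4).
Qed.

Lemma davis_vertex_ex a : exists p : davis R X, p [set a] = 1.
Proof.
pose f (K : {set S}) : R := (K == finset.set0)%:R.
have fN K : f K != 0 -> K = finset.set0 by rewrite /f; have [//|] := eqVneq K finset.set0; rewrite eqxx.
have fw : flag_weight f.
  split=> [K|K /fN ->|K L /fN -> _]; [exact: ler0n|exact: spherical0|by rewrite finset.sub0set].
have f1 : \sum_K f K = 1.
  by rewrite (bigD1 finset.set0) //= /f eqxx big1 ?addr0 // => K /negbTE ->.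
have [p pa pE] := davis_ex a fw f1; exists p.
rewrite (_ : [set a] = residue finset.set0 a); first by rewrite pE /f eqxx.
by apply/seteqP; split=> e /=; [move=> ->; exact: residue_refl|move=> /par_set0/wdist1 ->].
Qed.

Lemma davis_vertexP p a : p [set a] = 1 -> davis_in p a /\ davis_pos p = 0.
Proof.
move=> pa1; have [b pb] := davis_in_ex p.
have ba : b = a by apply: (pb [set a]); rewrite pa1 oner_neq0.
rewrite ba in pb; split=> //; have [[f0 _ _] f1 ->] := davis_weight pb.
have r0 : residue finset.set0 a = [set a].
  by apply/seteqP; split=> e /=; [move=> /par_set0/wdist1 ->|move=> ->; exact: residue_refl].
have rest : \sum_(K | K != finset.set0) p (residue K a) = 0.
  by move: f1; rewrite (bigD1 finset.set0) //= r0 pa1 -[RHS]addr0 => /addrI.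
rewrite /bary (bigD1 finset.set0) //= vertex0 scaler0 add0r big1 // => K K0.
have := psumr_eq0P (fun K _ => f0 K) rest; move=> /(_ K K0) ->.
by rewrite scale0r.
Qed.

(** At the centre of a chamber [J] is empty and kap = 1, so a path shorter than 1 starting there
    makes no nontrivial turn. *)
Lemma davis_vertex_far p q a b : p [set a] = 1 -> q [set b] = 1 -> davis_ball p 1 q -> a = b.
Proof.
move=> /davis_vertexP[pa p0] /davis_vertexP[qb q0] /davis_ballP[n [ch [chs chl]]].
have := string_reach a chs pa qb; rewrite p0 q0 wdistxx => hr.
have near0 : near (finset.set0 : {set S}) 1 0 (0 : V).
  split=> [|s _]; last by rewrite form0r subrr addr0.
  have -> : xi (finset.set0 : {set S}) (0 : V) = 0.
    by apply/ffunP => s; rewrite ffunE (xi_supp (@spherical0 W)) // finset.in_set0.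
  by rewrite nrm0.
have [|_ ab] := near_reach (@spherical0 W) (lexx (1 : R)) hr near0; first by rewrite add0r.
by apply/wdist1; have := par_set0 ab; rewrite invg1 mul1g.
Qed.

(** The centres of distinct chambers are at distance at least 1, so a compact set contains finitely
    many of them. *)
Lemma cocompact_finite (G : set aut) : is_subgroup G -> cocompact R G ->
  exists cs : seq X, forall c, exists2 g, G g & g c \in cs.
Proof.
move=> [G1 GM] [K Kc KG]; pose C0 := [set e | exists2 p, K p & p [set e] = 1].
suff /finite_seqP[cs csE] : finite_set C0.
  exists cs => c; have [q qc] := davis_vertex_ex c; have [g [p [Gg Kp pq]]] := KG q.
  exists (g^-1)%g; first by rewrite -[(g^-1)%g]mul1g; exact: GM.
  suff : [set` cs] (((g^-1)%g : aut) c) by []; rewrite -csE; exists p => //.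
  rewrite -qc pq; congr (p _); apply/seteqP; split=> e /=; first by move=> ->; exact: autVK.
  by move=> <-; rewrite autK.
apply: contrapT => Ci.
have [|e einj eP] := @injective_seq X C0.
  move=> l; apply: contrapT => no; apply: Ci.
  apply: (@sub_finite_set _ _ [set` l]) => // m Ym /=.
  by apply: contraT => ml; case: no; exists m.
have ex n : exists p, K p /\ p [set e n] = 1 by have [p] := eP n; exists p.
have [p pP] := choice ex.
have PF : ProperFilter (p @ \oo) by apply: fmap_proper_filter.
have [|y [Ky ycl]] := Kc (p @ \oo) PF; first by exists 0%N => // n _; case: (pP n).
have near_y N : exists2 n, (N <= n)%N & davis_ball y (1 / 2) (p n).
  have [||q [[n Nn <-] yn]] := ycl [set p n | n in [set n | (N <= n)%N]] (davis_ball y (1 / 2)).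
  - by exists N => // n Nn; exists n.
  - by apply: nbhsx_ballx; rewrite divr_gt0.
  by exists n.
have [n _ yn] := near_y 0%N; have [n' nn' yn'] := near_y n.+1.
have : davis_ball (p n) 1 (p n').
  rewrite [1](splitr 1); exact: davis_ball_triangle (davis_ball_sym yn) yn'.
move=> /(davis_vertex_far (proj2 (pP n)) (proj2 (pP n')))/einj e'.
by rewrite e' ltnn in nn'.
Qed.

End Assembly.

Theorem theorem1p4 (R : realType) (W : coxeterSystem)
    (W_infinite : infinite_set [set: cox_group W])
    (Delta : building W) (Delta_lf : locally_finite Delta)
    (G : set (building_aut Delta)) (G_subgroup : is_subgroup G)
    (G_closed : closed G)
    (G_type_preserving : forall g, G g -> type_preserving g)
    (G_cocompact : cocompact R G)
    (d : nat) (F : set (davis R Delta)) (F_maximal : maximal_flat d F) :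
  exists H : set (building_aut Delta), H `<=` G /\ compact_by_Zd d H.
Proof.
have [[_ _ _ [f [_ fE]]] _] := F_maximal.
have [tau [tauD tau_inj]] := flat_free_abelian fE.
have [t [m [tD t_inj m_len m_good]]] := free_axis R tauD tau_inj.
have [cs csP] := cocompact_finite G_subgroup G_cocompact.
exact: (compact_by_Zd_ex Delta_lf G_subgroup G_closed G_type_preserving tD t_inj m_len m_good csP).
Qed.
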